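(* Let $f\colon\mathbb{C}\to\mathbb{C}$ be a transcendental entire function and let $U$ be an invariant Fatou component of $f$ such that $\infty$ is accessible from $U$. Assume that $U$ is strongly postsingularly separated (SPS). Then the following hold. (a) Periodic points in $\partial U$ are accessible from $U$. (b) If a connected component $C$ of $\partial U$ contains a periodic point, then every other point in $C$ is escaping. (c) If, additionally, $U$ is recurrent, then periodic points in $\partial U$ are dense in $\partial U$, and escaping points in $\partial U$ are dense in $\partial U$.
   Context: $\partial U$ is the boundary of $U$ in $\mathbb{C}$. A Fatou component $U$ is invariant if $f(U)\subset U$; for transcendental entire $f$ it is then simply connected. A point $v\in\partial U\cup\{\infty\}$ (boundary in $\widehat{\mathbb{C}}$) is accessible from $U$ if there is a curve $\gamma\colon[0,1)\to U$ with $\gamma(t)\to v$ as $t\to1^-$. A point $z$ is escaping if $f^n(z)\to\infty$ as $n\to\infty$. $SV(f)$ is the set of singular values of $f$ (points of $\mathbb{C}$ around which not every branch of $f^{-1}$ is locally well-defined), and $P(f)=\overline{\bigcup_{s\in SV(f)}\bigcup_{n\ge0}f^n(s)}$ is the postsingular set. $U$ is strongly postsingularly separated (SPS) if there exist a simply connected domain $\Omega\subset\mathbb{C}$ and a domain $V$ such that $\overline V\subset U$, $\overline U\subset\Omega$ (closures in $\mathbb{C}$) and $P(f)\cap\Omega\subset V$. Recurrent Fatou component: let $\varphi\colon\mathbb{D}\to U$ be a Riemann map; $g=\varphi^{-1}\circ f\circ\varphi$ is an inner function, i.e. for Lebesgue-almost every $e^{i\theta}$ the radial limit $g^*(e^{i\theta})=\lim_{r\to1^-}g(re^{i\theta})$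 exists and lies in $\partial\mathbb{D}$. $U$ is recurrent if for every Borel set $A\subset\partial\mathbb{D}$ and Lebesgue-almost every $x\in A$ there is a sequence $n_k\to\infty$ with $(g^* )^{n_k}(x)\in A$. *)

(* Defs.v *)
From HB Require Import structures.
From mathcomp Require Import all_boot all_order all_algebra complex.
From mathcomp Require Import all_classical all_reals all_analysis.

Set Implicit Arguments.
Unset Strict Implicit.
Unset Printing Implicit Defensive.

Import Order.TTheory GRing.Theory Num.Theory.
Import numFieldNormedType.Exports.

Local Open Scope classical_set_scope.
Local Open Scope complex_scope.
Local Open Scope ring_scope.

(* [R[i]] gets the topology of its modulus and is a normed space over itself,
   so that [derivable f z 1] is complex differentiability at [z]. *)
#[export, non_forgetful_inheritance]
HB.instance Definition _ (R : realType) := GRing.ComAlgebra.copy R[i] (R[i])^o.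
#[export, non_forgetful_inheritance]
HB.instance Definition _ (R : realType) := Vector.copy R[i] (R[i])^o.
#[export, non_forgetful_inheritance]
HB.instance Definition _ (R : realType) := NormedModule.copy R[i] (R[i])^o.

Notation sphere R := (one_point_compactification R[i]).

Definition boundary (T : topologicalType) (A : set T) : set T :=
  closure A `\` interior A.

Definition domain (T : topologicalType) (D : set T) :=
  [/\ open D, connected D & D !=set0].

Section Plane.
Context {R : realType}.
Implicit Types (f g phi : R[i] -> R[i]) (U D A : set R[i]) (z p v : R[i]).

(* Simple connectedness: every loop in [D] contracts to its base point in [D]. *)
Definition simply_connected_domain D :=
  domain D /\
  forall gamma : R -> R[i],
    {within `[0, 1], continuous gamma} ->
    (forall t, 0 <= t <= 1 -> D (gamma t)) ->
    gamma 0 = gamma 1 ->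
  exists H : R * R -> R[i],
    [/\ {within `[0, 1] `*` `[0, 1], continuous H},
        forall s t, 0 <= s <= 1 -> 0 <= t <= 1 -> D (H (s, t)),
        forall t, 0 <= t <= 1 -> H (0, t) = gamma t /\ H (1, t) = gamma 0 &
        forall s, 0 <= s <= 1 -> H (s, 0) = gamma 0 /\ H (s, 1) = gamma 0].

Definition holomorphic_on D f := forall z, D z -> derivable f z 1.

Definition transcendental_entire f :=
  holomorphic_on setT f /\ ~ exists q : {poly R[i]}, forall z, f z = q.[z].

(* Montel normality of the iterates on [D]: locally uniform convergence is
   uniform convergence on the compact subsets of [D]; limits are either finite
   (hence holomorphic) or identically infinite. *)
Definition iterates_normal_on f D :=
  forall n : nat -> nat, exists2 s : nat -> nat,
    {homo s : i j / (i < j)%N} &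
    (exists g, {family compactly_in D,
                 (fun k => iter (n (s k)) f) @ \oo --> g}) \/
    (forall K, compact K -> K `<=` D -> forall M : R,
       \forall k \near \oo, forall z, K z -> M%:C < `|iter (n (s k)) f z|).

Definition fatou_set f : set R[i] :=
  [set z | exists D, [/\ domain D, D z & iterates_normal_on f D]].

Definition fatou_component f U :=
  exists2 z, fatou_set f z & U = connected_component (fatou_set f) z.

(* The boundary is taken in the sphere; [None] is the point at infinity. *)
Definition accessible U (v : sphere R) :=
  boundary (Some @` U : set (sphere R)) v /\
  exists gamma : R -> R[i],
    [/\ {within `[0, 1[, continuous gamma},
        forall t, 0 <= t < 1 -> U (gamma t) &
        (Some (gamma t) : sphere R) @[t --> 1^'-] --> v].

Definition escaping f z :=
  (Some (iter n f z) : sphere R) @[n --> \oo] --> (None : sphere R).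

Definition periodic_point f p := exists2 n, (0 < n)%N & iter n f p = p.

(* [v] is regular when one disc around it carries all the branches of the
   inverse: every [w] mapped into the disc is a value of a holomorphic right
   inverse of [f] defined on the whole disc.  The radius does not depend on
   [w], so asymptotic values are singular even when they are omitted. *)
Definition regular_value f v :=
  exists2 r : R, 0 < r &
    forall w, ball v r%:C (f w) ->
    exists g, [/\ holomorphic_on (ball v r%:C) g,
                  forall u, ball v r%:C u -> f (g u) = u &
                  g (f w) = w].

Definition singular_values f : set R[i] := ~` regular_value f.

Definition postsingular_set f : set R[i] :=
  closure [set iter n f s | n in [set: nat] & s in singular_values f].

Definition SPS f U :=
  exists Omega V,
    [/\ simply_connected_domain Omega, domain V, closure V `<=` U,
        closure U `<=` Omega & postsingular_set f `&` Omega `<=` V].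

Definition unit_disc : set R[i] := ball 0 1.

Definition unit_circle : set R[i] := [set z | `|z| = 1].

Definition cis (t : R) : R[i] := cos t +i* sin t.

Definition riemann_map U phi :=
  [/\ holomorphic_on unit_disc phi, set_inj unit_disc phi &
      phi @` unit_disc = U].

Definition inner_function f phi : R[i] -> R[i] :=
  pinv unit_disc phi \o f \o phi.

(* Total: an arbitrary value is taken where the radial limit does not exist. *)
Definition radial_limit g z : R[i] := lim (g (r%:C * z) @[r --> 1^'-]).

(* Lebesgue measure on the circle is the image under [cis] of Lebesgue measure
   on [0, 2 pi[.  Two Riemann maps onto [U] differ by an automorphism of the
   disc, so the choice of [phi] is immaterial. *)
Definition recurrent f U :=
  exists2 phi, riemann_map U phi &
    let g := radial_limit (inner_function f phi) in
    forall A, <<s @open R[i] >> A -> A `<=` unit_circle ->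
    {ae lebesgue_measure, forall t : R,
       0 <= t < 2 * pi -> A (cis t) ->
       exists2 n : nat -> nat, n k @[k --> \oo] --> \oo &
         forall k, A (iter (n k) g (cis t))}.

End Plane.

(* Main.v *)
From HB Require Import structures.
From mathcomp Require Import all_boot all_order all_algebra complex.
From mathcomp Require Import all_classical all_reals all_analysis.
From mathcomp Require Import measurable_realfun.
From mathcomp Require Import ring lra.
Require Import Defs.
Set Implicit Arguments.
Unset Strict Implicit.
Unset Printing Implicit Defensive.
Import Order.TTheory GRing.Theory Num.Theory.
Import numFieldNormedType.Exports.
Local Open Scope classical_set_scope.
Local Open Scope complex_scope.
Local Open Scope ring_scope.

(** The norm of [R[i]] takes its values in [R[i]]; this is the same modulus with real values, so
    that estimates are statements about real numbers. *)
Notation md := (@Normc.normc _).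

(* Let [E] be a closed connected unbounded subset of [U] that contains the
   postsingular points of [Omega], and let [T = Omega \ E]: an open
   neighbourhood of the boundary of [U] free of postsingular points.  On a
   compact part of a component [D] of [T], [z - e] has a square root for every
   [e] outside [D]; this replaces simple connectivity and suffices to continue
   the inverse branches of all iterates over [D].  Moreover [U n D] is
   connected, so a branch taking one point of [U n D] into [U] takes all of
   [U n D] into [U].  As [f] is not injective, discs on which all iterates are
   univalent lie in the Fatou set; hence inverse branches of higher and higher
   iterates whose values approach a boundary point shrink to it.

   (a) The branches fixing a periodic point [p] carry a curve of [U n D] joining
   a point to its preimage to a curve that lands at [p].
   (b) If a point of the component of [p] comes back to a disc infinitely often,
   the branches at [p] bring it arbitrarily close to [p], so it is [p].
   (c) Let [g] be the inner function.  For bounded [F], Littlewood subordination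
   compares [F o g^n] near the circle with [F] along the orbit of the boundary
   map; with [F] built from a square root of [phi - q], recurrence yields [z] in
   [U] with [z] and [f^n z] close to [q] and [n] large.  The branch of [f^-n]
   taking [f^n z] to [z] contracts a disc at [q], and its fixed point is a
   periodic boundary point.  Finally the boundary of the unbounded, simply
   connected [U] has no compact open part near [p], so there are other points of
   the component of [p] close to [p], and they escape by (b). *)

(** That loops contract in the components of [T] is never established; what is used is a parity. A
    point [e] of [E] can slide along [E] towards infinity, and for [e] outside [Omega] a logarithm
    of [z - e] exists on [Omega]; either way [z - e] has a root on compact parts of [T]. Continuing
    a branch cell by cell over a square grid can fail only when a new cell closes a ring around a
    missing cell. Such a ring would wind once around a missing point, and an odd winding number
    forbids a root. Distortion estimates are kept crude: any bound of [F z - w] by a multiple of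
    [F a - w], for an omitted value [w], will do. Together with the pair of points that [f]
    identifies it also yields normality, so no theorem on families omitting several values is
    invoked. Boundary values are handled through countably many radii. Square means of a bounded
    function over circles increase with the radius, so differences along fast radii are summable and
    converge almost everywhere at a geometric rate. This rate is what lets the argument pass from
    [g] to its iterates. *)

Section Modulus.
Context {R : realType}.
Local Notation C := R[i].
Implicit Types (z w : C) (r e : R).

Lemma md0 : md (0 : C) = 0. Proof. exact: Normc.normc0. Qed.
Lemma md1 : md (1 : C) = 1. Proof. exact: Normc.normc1. Qed.
Lemma mdM z w : md (z * w) = md z * md w. Proof. exact: Normc.normcM. Qed.
Lemma mdV z : md z^-1 = (md z)^-1. Proof. exact: Normc.normcV. Qed.
Lemma md_div z w : md (z / w) = md z / md w. Proof. by rewrite mdM mdV. Qed.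
Lemma mdN z : md (- z) = md z. Proof. exact: normcN. Qed.
Lemma mdD z w : md (z + w) <= md z + md w. Proof. exact: le_normcD. Qed.
Lemma md_ge0 z : 0 <= md z. Proof. by case: z => a b; rewrite sqrtr_ge0. Qed.
Lemma md_eq0 z : (md z == 0) = (z == 0).
Proof. by apply/eqP/eqP => [/Normc.eq0_normc//|->]; rewrite md0. Qed.
Lemma md_gt0 z : (0 < md z) = (z != 0).
Proof. by rewrite lt_def md_ge0 andbT md_eq0. Qed.
Lemma md_distC z w : md (z - w) = md (w - z).
Proof. by rewrite -opprB mdN. Qed.
Lemma mdX z n : md (z ^+ n) = md z ^+ n.
Proof. by elim: n => [|n IH]; rewrite ?expr0 ?md1// !exprS mdM IH. Qed.
Lemma mdB z w : md (z - w) <= md z + md w.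
Proof. by rewrite -[md w]mdN; exact: mdD. Qed.
Lemma md_tri z w u : md (z - w) <= md (z - u) + md (u - w).
Proof. by have := mdD (z - u) (u - w); rewrite addrA subrK. Qed.
Lemma md_subl z w : md z - md w <= md (z - w).
Proof. by have := mdD (z - w) w; rewrite subrK; lra. Qed.
Lemma md_addl z w : md z - md w <= md (z + w).
Proof. by have := md_subl z (- w); rewrite opprK mdN. Qed.
Lemma mdr (x : R) : md x%:C = `|x|.
Proof. by rewrite /= expr0n/= addr0 sqrtr_sqr. Qed.
Lemma md_normE z : `|z| = (md z)%:C. Proof. by []. Qed.
Lemma md_sqr z : md z ^+ 2 = complex.Re z ^+ 2 + complex.Im z ^+ 2.
Proof. by case: z => a b /=; rewrite sqr_sqrtr// addr_ge0// sqr_ge0. Qed.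
Lemma md_Re z : `|complex.Re z| <= md z.
Proof.
rewrite -(@ler_pXn2r _ 2) ?nnegrE ?md_ge0// md_sqr -normrX ger0_norm ?sqr_ge0//.
by rewrite lerDl sqr_ge0.
Qed.
Lemma md_Im z : `|complex.Im z| <= md z.
Proof.
rewrite -(@ler_pXn2r _ 2) ?nnegrE ?md_ge0// md_sqr -normrX ger0_norm ?sqr_ge0//.
by rewrite lerDr sqr_ge0.
Qed.
Lemma Re_le_md z : complex.Re z <= md z.
Proof. exact: le_trans (ler_norm _) (md_Re z). Qed.
Lemma md_i : md ('i%C : C) = 1. Proof. by rewrite /= expr0n/= add0r expr1n sqrtr1. Qed.
Lemma md_le_ReIm z : md z <= `|complex.Re z| + `|complex.Im z|.
Proof.
rewrite {1}[z]complexE; apply: le_trans (mdD _ _) _.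
by rewrite mdM md_i mul1r !mdr.
Qed.
Lemma mdMn z n : md (z *+ n) = md z *+ n. Proof. exact: normcMn. Qed.
Lemma md_nat n : md (n%:R : C) = n%:R. Proof. by rewrite mdMn md1. Qed.
Lemma realC_gt0 (x : C) : 0 < x -> exists2 r : R, 0 < r & x = r%:C.
Proof.
by case: x => a b; rewrite ltcE/= => /andP[/eqP -> h]; exists a.
Qed.

(** * Discs and the topology of the plane *)

Definition disc (a : C) r : set C := [set z | md (z - a) < r].
Definition cdisc (a : C) r : set C := [set z | md (z - a) <= r].

Lemma ballE (a : C) r : ball a r%:C = disc a r.
Proof.
apply/seteqP; split => z; rewrite -ball_normE/= /ball_/= md_normE ltcR;
  by rewrite /disc/= md_distC.
Qed.

Lemma nbhs_md z (A : set C) :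
  nbhs z A <-> exists2 r, 0 < r & disc z r `<=` A.
Proof.
split => [/nbhs_ballP[e /= /realC_gt0[r r0 ->]]|[r r0 h]].
  by rewrite ballE => h; exists r.
by apply/nbhs_ballP; exists r%:C => /=; rewrite ?ltcR// ballE.
Qed.

Lemma nbhs_disc z r : 0 < r -> nbhs z (disc z r).
Proof. by move=> r0; apply/nbhs_md; exists r. Qed.

Lemma disc_center a r : 0 < r -> disc a r a.
Proof. by rewrite /disc/= subrr md0. Qed.

Lemma subset_disc a b r e : md (a - b) + r <= e -> disc a r `<=` disc b e.
Proof. move=> h z /=; rewrite /disc/= => hz; have := md_tri z b a; lra. Qed.

Lemma disc_sub_cdisc a r : disc a r `<=` cdisc a r.
Proof. by move=> z /ltW. Qed.

Lemma cdisc_sub_disc a r e : r < e -> cdisc a r `<=` disc a e.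
Proof. by move=> h z /le_lt_trans; apply. Qed.

Lemma open_disc a r : open (disc a r).
Proof.
rewrite openE => z; rewrite /disc/= => hz; rewrite /interior.
apply/nbhs_md; exists (r - md (z - a)); first by lra.
by apply: subset_disc; lra.
Qed.

Lemma open_md (A : set C) :
  open A <-> forall z, A z -> exists2 r, 0 < r & disc z r `<=` A.
Proof.
by rewrite openE; split => h z /h; rewrite /interior => /nbhs_md.
Qed.

Lemma cvg_md T (F : set_system T) (FF : Filter F) (f : T -> C) l :
  f x @[x --> F] --> l <-> forall e, 0 < e -> \forall x \near F, md (f x - l) < e.
Proof.
split => [h e e0|h].
  by have := h _ (nbhs_disc l e0).
move=> A /nbhs_md[r r0 rA].
by rewrite /nbhs/=; near=> x; apply: rA; rewrite /disc/=; near: x; exact: h.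
Unshelve. all: by end_near. Qed.

Lemma contP (f : C -> C) z : {for z, continuous f} <->
  forall e, 0 < e -> exists2 t, 0 < t & forall w, md (w - z) < t -> md (f w - f z) < e.
Proof.
split => [/(@cvg_md _ (nbhs z) _ _ _) h e /h /nbhs_md[t t0 ht]|h]; first by exists t.
apply/(@cvg_md _ (nbhs z) _ _ _) => e /h[t t0 ht]; apply/nbhs_md; by exists t.
Qed.

Lemma contRP (f : C -> R) z : {for z, continuous f} <->
  forall e, 0 < e -> exists2 t, 0 < t & forall w, md (w - z) < t -> `|f w - f z| < e.
Proof.
split => [/(@cvgrPdist_lt _ _ _ (nbhs z) _) h e /h /nbhs_md[t t0 ht]|h].
  by exists t => // w /ht /=; rewrite distrC.
apply/(@cvgrPdist_lt _ _ _ (nbhs z) _) => e /h[t t0 ht]; apply/nbhs_md; exists t => // w /ht.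
by rewrite distrC.
Qed.

Lemma contTP (T : topologicalType) (f : T -> C) (x : T) : {for x, continuous f} <->
  forall e, 0 < e -> \forall y \near x, md (f y - f x) < e.
Proof. exact: cvg_md. Qed.

Lemma continuous_Re : continuous (@complex.Re R).
Proof.
move=> z; apply/contRP => e e0; exists e => // w wz.
by rewrite -raddfB; exact: le_lt_trans (md_Re _) wz.
Qed.

Lemma continuous_Im : continuous (@complex.Im R).
Proof.
move=> z; apply/contRP => e e0; exists e => // w wz.
by rewrite -raddfB; exact: le_lt_trans (md_Im _) wz.
Qed.

Lemma continuous_md : continuous (md : C -> R).
Proof.
move=> z; apply/contRP => e e0; exists e => // w.
have := md_subl z w; have := md_subl w z; rewrite (md_distC z w) ltr_norml; lra.
Qed.

Lemma cvg_ReIm T (F : set_system T) (FF : Filter F) (f : T -> C) l :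
  complex.Re (f x) @[x --> F] --> complex.Re l ->
  complex.Im (f x) @[x --> F] --> complex.Im l -> f x @[x --> F] --> l.
Proof.
move=> hr hi; apply/cvg_md => e e0.
have e2 : 0 < e / 2 by lra.
move/cvgrPdist_lt : hr => /(_ _ e2) hr.
move/cvgrPdist_lt : hi => /(_ _ e2) hi.
near=> x; apply: le_lt_trans (md_le_ReIm _) _.
have h1 : `|complex.Re l - complex.Re (f x)| < e / 2 by near: x.
have h2 : `|complex.Im l - complex.Im (f x)| < e / 2 by near: x.
by rewrite !raddfB/= distrC (distrC (complex.Im _)); lra.
Unshelve. all: by end_near. Qed.

Lemma continuous_realC : continuous (fun x : R => x%:C).
Proof.
move=> x; apply/cvg_md => e e0; near=> y.
rewrite -rmorphB mdr distrC; near: y.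
by have /cvgrPdist_lt := @cvg_id _ (nbhs x); exact.
Unshelve. all: by end_near. Qed.

Lemma continuous_mkC : continuous (fun p : R * R => p.1 +i* p.2).
Proof.
by move=> p; apply: cvg_ReIm => /=; [exact: cvg_fst|exact: cvg_snd].
Qed.

Lemma closed_cdisc a r : closed (cdisc a r).
Proof.
rewrite /cdisc; have -> : [set z | md (z - a) <= r] =
    (fun z => md (z - a)) @^-1` [set x | x <= r] by [].
apply: closed_comp; last exact: closed_le.
move=> z _; apply: (@continuous_comp _ _ _ (fun z => z - a) md z); last exact: continuous_md.
apply/contP => e e0; exists e => // w.
by have -> : w - a - (z - a) = w - z by ring.
Qed.

Lemma compact_cdisc a r : compact (cdisc a r).
Proof.
pose S := `[complex.Re a - r, complex.Re a + r]%classic `*`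
          `[complex.Im a - r, complex.Im a + r]%classic.
apply: (@subclosed_compact _ _ ((fun p : R * R => p.1 +i* p.2) @` S)).
- exact: closed_cdisc.
- apply: continuous_compact.
    by apply: continuous_subspaceT => p; exact: continuous_mkC.
  by apply: compact_setX; exact: segment_compact.
- move=> z; rewrite /cdisc/= => hz; exists (complex.Re z, complex.Im z) => /=.
    have := le_trans (md_Re _) hz; have := le_trans (md_Im _) hz.
    rewrite !raddfB/= !ler_norml => /andP[? ?] /andP[? ?].
    by split; rewrite /= in_itv/=; lra.
  by case: z {hz}.
Qed.

Lemma compact_md (K : set C) r : closed K -> (forall z, K z -> md z <= r) -> compact K.
Proof.
move=> cK h; apply: (@subclosed_compact _ K (cdisc 0 r)) => //; first exact: compact_cdisc.
move=> z Kz.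
by rewrite /cdisc/= subr0; exact: h.
Qed.

Lemma compact_bound (K : set C) : compact K -> exists2 M, 0 < M & forall z, K z -> md z <= M.
Proof.
move=> cK; have [K0|K0] := pselect (K !=set0); last first.
  by exists 1 => // z Kz; exfalso; apply: K0; exists z.
have [z0 _ h] := compact_EVT_max K0 cK (continuous_subspaceT (fun z => @continuous_md z)).
exists (md z0 + 1) => [|z Kz]; first by have := md_ge0 z0; lra.
by have := h z; rewrite inE => /(_ Kz); lra.
Qed.

Lemma closure_md (A : set C) z :
  closure A z <-> forall r, 0 < r -> exists2 w, A w & md (w - z) < r.
Proof.
split => [h r r0|h B /nbhs_md[r r0 rB]].
  by have [w [Aw Bw]] := h _ (nbhs_disc z r0); exists w.
by have [w Aw zw] := h r r0; exists w; split => //; exact: rB.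
Qed.

(** Complex differentiability with derivative [d], as a little-o without division: sums, products
    and compositions then need no separate case [w = z]. [derivable_hd] links it to
    [derivable f z 1]. *)
Definition hd (f : C -> C) z d := forall e, 0 < e -> exists2 t, 0 < t &
  forall w, md (w - z) < t -> md (f w - f z - d * (w - z)) <= e * md (w - z).

Lemma derivable_hd f z : derivable f z 1 <-> exists d, hd f z d.
Proof.
split => [|[d h]].
  rewrite /derivable => /cvg_ex[/= d /cvg_md h]; exists d => e e0.
  have /nbhs_md[t t0 ht] := h _ e0; exists t => // w wz.
  have [->|nz] := eqVneq w z; first by rewrite !subrr mulr0 subrr md0 mulr0.
  have wz0 : w - z != 0 by rewrite subr_eq0.
  have := ht (w - z); rewrite /disc/= subr0 => /(_ wz wz0).
  rewrite /= -[(w - z) *: 1]/((w - z) * 1) mulr1 subrK.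
  rewrite -[_ *: _]/((w - z)^-1 * (f w - f z)) => /ltW.
  have -> : (w - z)^-1 * (f w - f z) - d = (f w - f z - d * (w - z)) / (w - z).
    by field.
  by rewrite md_div ler_pdivrMr ?md_gt0.
apply/cvg_ex; exists d; apply/cvg_md => e e0.
have [|t t0 ht] := h (e / 2); first by lra.
apply/nbhs_md; exists t => // u; rewrite /disc/= subr0 => ut u0.
rewrite -[u *: 1]/(u * 1) mulr1 -[_ *: _]/(u^-1 * (f (u + z) - f z)).
have -> : u^-1 * (f (u + z) - f z) - d = (f (u + z) - f z - d * u) / u by field.
rewrite md_div ltr_pdivrMr ?md_gt0//.
have := ht (u + z); rewrite addrK => /(_ ut) /le_lt_trans; apply.
by rewrite ltr_pM2r ?md_gt0//; lra.
Qed.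

Lemma hd_cst c z : hd (fun=> c) z 0.
Proof. by move=> e e0; exists 1 => // w _; rewrite subrr mul0r subrr md0 mulr_ge0 ?md_ge0// ltW. Qed.

Lemma hd_id z : hd id z 1.
Proof. by move=> e e0; exists 1 => // w _; rewrite mul1r subrr md0 mulr_ge0 ?md_ge0// ltW. Qed.

Lemma hdD f g z a b : hd f z a -> hd g z b -> hd (fun w => f w + g w) z (a + b).
Proof.
move=> hf hg e e0; have e2 : 0 < e / 2 by lra.
have [t t0 ht] := hf _ e2; have [s s0 hs] := hg _ e2.
exists (Order.min t s) => [|w]; first by rewrite lt_min t0.
rewrite lt_min => /andP[/ht h1 /hs h2].
have -> : f w + g w - (f z + g z) - (a + b) * (w - z) =
  (f w - f z - a * (w - z)) + (g w - g z - b * (w - z)) by ring.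
by apply: le_trans (mdD _ _) _; lra.
Qed.

Lemma hd_lip f z d : hd f z d -> exists2 t, 0 < t &
  forall w, md (w - z) < t -> md (f w - f z) <= (md d + 1) * md (w - z).
Proof.
move=> /(_ 1 ltr01)[t t0 h]; exists t => // w /h hw.
have -> : f w - f z = (f w - f z - d * (w - z)) + d * (w - z) by ring.
by apply: le_trans (mdD _ _) _; rewrite mdM; lra.
Qed.

Lemma hd_continuous f z d : hd f z d -> {for z, continuous f}.
Proof.
move=> /hd_lip[t t0 h]; apply/contP => e e0.
have d0 : 0 < md d + 1 by have := md_ge0 d; lra.
exists (Order.min t (e / (md d + 1))) => [|w]; first by rewrite lt_min t0 divr_gt0.
rewrite lt_min => /andP[/h h1]; rewrite ltr_pdivlMr// mulrC.
exact: le_lt_trans.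
Qed.

Lemma hd_uniq f z a b : hd f z a -> hd f z b -> a = b.
Proof.
move=> hf hg; apply/eqP; rewrite -subr_eq0 -md_eq0; apply/negPn/negP => n0.
have p0 : 0 < md (a - b) by rewrite lt_def n0 md_ge0.
have e4 : 0 < md (a - b) / 4 by lra.
have [t t0 ht] := hf _ e4; have [s s0 hs] := hg _ e4.
pose m := Order.min t s; pose u := (m / 2)%:C : C.
have m0 : 0 < m by rewrite lt_min t0.
have mt : m <= t by rewrite ge_min lexx.
have ms : m <= s by rewrite ge_min lexx orbT.
have mu : md u = m / 2 by rewrite mdr gtr0_norm// divr_gt0.
have hz : z + u - z = u by ring.
have := ht (z + u); have := hs (z + u); rewrite hz mu.
move=> /(_ ltac:(lra)) h1 /(_ ltac:(lra)) h2.
have : md ((a - b) * u) <= md (a - b) / 4 * (m / 2) + md (a - b) / 4 * (m / 2).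
  have -> : (a - b) * u = (f (z + u) - f z - b * u) - (f (z + u) - f z - a * u) by ring.
  by apply: le_trans (mdB _ _) _; lra.
by rewrite mdM mu; nra.
Qed.

Lemma hdN f z a : hd f z a -> hd (fun w => - f w) z (- a).
Proof.
move=> h e /h[t t0 ht]; exists t => // w /ht; rewrite -mdN.
by have -> : - (f w - f z - a * (w - z)) = - f w - - f z - - a * (w - z) by ring.
Qed.

Lemma hdB f g z a b : hd f z a -> hd g z b -> hd (fun w => f w - g w) z (a - b).
Proof. by move=> hf /hdN; exact: hdD. Qed.

Lemma hdM f g z a b : hd f z a -> hd g z b ->
  hd (fun w => f w * g w) z (a * g z + f z * b).
Proof.
move=> hf hg e e0.
pose A := 3 * (md a + 1); pose F := 3 * (md (f z) + 1); pose G := 3 * (md (g z) + 1).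
have A0 : 0 < A by rewrite /A; have := md_ge0 a; lra.
have F0 : 0 < F by rewrite /F; have := md_ge0 (f z); lra.
have G0 : 0 < G by rewrite /G; have := md_ge0 (g z); lra.
have [t t0 ht] := hf _ (divr_gt0 e0 G0); have [s s0 hs] := hg _ (divr_gt0 e0 F0).
have m0 : 0 < Order.min 1 (e / A) by rewrite lt_min ltr01 divr_gt0.
have /contP/(_ _ m0)[r r0 hr] := hd_continuous hg.
exists (Order.min t (Order.min s r)) => [|w]; first by rewrite !lt_min t0 s0.
rewrite !lt_min => /and3P[/ht h1 /hs h2 /hr]; rewrite lt_min => /andP[h3 h4].
have -> : f w * g w - f z * g z - (a * g z + f z * b) * (w - z) =
  (f w - f z - a * (w - z)) * g w + f z * (g w - g z - b * (w - z)) +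
  a * (w - z) * (g w - g z) by ring.
apply: le_trans (mdD _ _) _; apply: le_trans (lerD (mdD _ _) (lexx _)) _.
rewrite !mdM; set h := md (w - z) in h1 h2 *.
have h0 : 0 <= h by exact: md_ge0.
have gw : md (g w) <= G / 3 by have := md_subl (g w) (g z); rewrite /G; lra.
have k1 : md (f w - f z - a * (w - z)) * md (g w) <= e / G * h * (G / 3).
  by apply: ler_pM; rewrite ?md_ge0.
have k2 : md (f z) * md (g w - g z - b * (w - z)) <= F / 3 * (e / F * h).
  by apply: ler_pM; rewrite ?md_ge0 // /F; lra.
have k3 : md a * h * md (g w - g z) <= A / 3 * h * (e / A).
  apply: ler_pM; rewrite ?mulr_ge0 ?md_ge0//; last exact: ltW.
  by rewrite ler_wpM2r // /A; lra.
have -> : e * h = e / G * h * (G / 3) + F / 3 * (e / F * h) + A / 3 * h * (e / A).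
  by field; rewrite !gt_eqF.
by rewrite !lerD.
Qed.

Lemma hdZ c f z a : hd f z a -> hd (fun w => c * f w) z (c * a).
Proof.
by move=> /(hdM (hd_cst c z)); rewrite mul0r add0r.
Qed.

Lemma hd_comp g f z a b : hd f z a -> hd g (f z) b -> hd (fun w => g (f w)) z (b * a).
Proof.
move=> hf hg e e0.
pose A := 2 * (md a + 1); pose B := 2 * (md b + 1).
have A0 : 0 < A by rewrite /A; have := md_ge0 a; lra.
have B0 : 0 < B by rewrite /B; have := md_ge0 b; lra.
have [t t0 ht] := hf _ (divr_gt0 e0 B0); have [s s0 hs] := hg _ (divr_gt0 e0 A0).
have [r r0 hr] := hd_lip hf.
have /contP/(_ _ s0)[q q0 hq] := hd_continuous hf.
exists (Order.min t (Order.min q r)) => [|w]; first by rewrite !lt_min t0 q0.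
rewrite !lt_min => /and3P[/ht h1 /hq/hs h2 /hr h3].
have -> : g (f w) - g (f z) - b * a * (w - z) =
  (g (f w) - g (f z) - b * (f w - f z)) + b * (f w - f z - a * (w - z)) by ring.
apply: le_trans (mdD _ _) _; rewrite mdM; set h := md (w - z) in h1 h3 *.
have h0 : 0 <= h by exact: md_ge0.
have k1 : md b * md (f w - f z - a * (w - z)) <= B / 2 * (e / B * h).
  by apply: ler_pM; rewrite ?md_ge0 // /B; lra.
have k2 : e / A * md (f w - f z) <= e / A * (A / 2 * h).
  by rewrite ler_wpM2l// ?(ltW (divr_gt0 e0 A0))// /A; lra.
have -> : e * h = e / A * (A / 2 * h) + B / 2 * (e / B * h).
  by field; rewrite !gt_eqF.
by apply: lerD => //; exact: le_trans h2 k2.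
Qed.

Lemma hd_inv z : z != 0 -> hd (fun w => w^-1) z (- z ^- 2).
Proof.
move=> z0 e e0; have p : 0 < md z by rewrite md_gt0.
have p3 : 0 < e * md z ^+ 3 / 2 by rewrite divr_gt0// mulr_gt0// exprn_gt0.
exists (Order.min (md z / 2) (e * md z ^+ 3 / 2)) => [|w].
  by rewrite lt_min p3 divr_gt0.
rewrite lt_min => /andP[h1 h2].
have wz : md z / 2 < md w by have := md_subl z w; rewrite md_distC; lra.
have w0 : w != 0 by rewrite -md_gt0; lra.
have -> : w^-1 - z^-1 - - z ^- 2 * (w - z) = (w - z) * (w - z) / (z ^+ 2 * w).
  by field; rewrite w0 z0.
have mw : 0 < md w by rewrite md_gt0.
rewrite md_div (mdM (w - z)) (mdM (z ^+ 2)) mdX ler_pdivrMr ?mulr_gt0 ?exprn_gt0//.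
rewrite mulrAC ler_wpM2r ?md_ge0//; apply: le_trans (ltW h2) _.
have -> : e * md z ^+ 3 / 2 = e * (md z ^+ 2 * (md z / 2)) by field.
by rewrite ler_wpM2l ?(ltW e0)// ler_wpM2l ?exprn_ge0 ?md_ge0 ?(ltW wz).
Qed.

Lemma hdV f z a : f z != 0 -> hd f z a -> hd (fun w => (f w)^-1) z (- a / f z ^+ 2).
Proof.
move=> f0 hf; have := hd_comp hf (hd_inv f0).
by have -> : - f z ^- 2 * a = - a / f z ^+ 2 by field.
Qed.

Lemma hd_div f g z a b : g z != 0 -> hd f z a -> hd g z b ->
  hd (fun w => f w / g w) z ((a * g z - f z * b) / g z ^+ 2).
Proof.
move=> g0 hf /(hdV g0) /(hdM hf).
by have -> : a / g z + f z * (- b / g z ^+ 2) = (a * g z - f z * b) / g z ^+ 2 by field.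
Qed.

Lemma hd_eq f g z d r : 0 < r -> {in disc z r, f =1 g} -> hd f z d -> hd g z d.
Proof.
move=> r0 fg h e /h[t t0 ht]; exists (Order.min r t) => [|w]; first by rewrite lt_min r0.
rewrite lt_min => /andP[wr /ht].
by rewrite !fg ?inE//; exact: disc_center.
Qed.

Lemma hdX f z a n : hd f z a -> hd (fun w => f w ^+ n) z (n%:R * f z ^+ n.-1 * a).
Proof.
move=> h; elim: n => [|n IH].
  by rewrite !mul0r; exact: (hd_cst 1 z).
have := hdM h IH; rewrite (_ : a * _ + _ = n.+1%:R * f z ^+ n * a); last first.
  by rewrite -natr1; case: n {IH} => [|n] /=; rewrite ?expr0 ?exprS; ring.
apply: (hd_eq ltr01) => w _ /=; by rewrite exprS.
Qed.

Definition hol (D : set C) f := forall z, D z -> exists d, hd f z d.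
Definition dv f z : C := xget 0 [set d | hd f z d].

Lemma dvP D f z : hol D f -> D z -> hd f z (dv f z).
Proof. by move=> h /h [d hdd]; rewrite /dv; case: xgetP => [//|/(_ d)]. Qed.

Lemma hd_dv f z d : hd f z d -> dv f z = d.
Proof.
move=> h; rewrite /dv; case: xgetP => [y _ /= hy|/(_ d)//]; exact: hd_uniq hy h.
Qed.

Lemma hol_sub D E f : E `<=` D -> hol D f -> hol E f.
Proof. by move=> s h z /s /h. Qed.

Lemma holomorphic_hol D f : holomorphic_on D f <-> hol D f.
Proof. by split => h z /h /derivable_hd. Qed.

Lemma hol_cont D f z : hol D f -> D z -> {for z, continuous f}.
Proof. by move=> h /h [d] /hd_continuous. Qed.

Lemma hol_comp D E f g : hol D f -> hol E g -> (forall z, D z -> E (f z)) ->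
  hol D (fun z => g (f z)).
Proof.
move=> hf hg DE z Dz; have [a ha] := hf z Dz; have [b hb] := hg _ (DE _ Dz).
by exists (b * a); exact: hd_comp.
Qed.

Lemma hol_iter f n : hol setT f -> hol setT (iter n f).
Proof.
move=> h; elim: n => [|n IH]; first by move=> z _; exists 1; exact: hd_id.
by apply: (hol_comp IH h).
Qed.

End Modulus.

(** * Cauchy theory *)

Section ComplexIntegral.
Context {R : realType}.
Local Notation C := R[i].
Local Notation mu := (@lebesgue_measure R).
Implicit Types (f g : R -> C) (a b : R).

Definition ci f a b : C :=
  (\int[mu]_(x in `[a, b]) complex.Re (f x)) +i* (\int[mu]_(x in `[a, b]) complex.Im (f x)).

Lemma ri_int (u : R -> R) a b : {within `[a, b], continuous u} ->
  mu.-integrable `[a, b] (EFin \o u).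
Proof.
by move=> cu; apply: continuous_compact_integrable => //; exact: segment_compact.
Qed.

Lemma within_comp (u : R -> C) (v : C -> R) (A : set R) : {within A, continuous u} ->
  continuous v -> {within A, continuous (fun x => v (u x))}.
Proof. by move=> cu cv x; exact: continuous_comp (cu x) (cv _). Qed.

Lemma within_compC (u : R -> C) (v : C -> C) (A : set R) : {within A, continuous u} ->
  continuous v -> {within A, continuous (fun x => v (u x))}.
Proof. by move=> cu cv x; exact: continuous_comp (cu x) (cv _). Qed.

Lemma continuous_mulC (c : C) : continuous (fun z : C => c * z).
Proof. by move=> z; have := hd_continuous (hdZ c (hd_id z)). Qed.

Lemma within_scaleR (k : R) (u : R -> R) (A : set R) : {within A, continuous u} ->
  {within A, continuous (fun x => k * u x)}.
Proof. by move=> cu x; apply: cvgM; [exact: cvg_cst|exact: cu]. Qed.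

Lemma ri_Re f a b : {within `[a, b], continuous f} ->
  mu.-integrable `[a, b] (EFin \o (fun x => complex.Re (f x))).
Proof. by move=> cf; apply/ri_int/within_comp => //; exact: continuous_Re. Qed.

Lemma ri_Im f a b : {within `[a, b], continuous f} ->
  mu.-integrable `[a, b] (EFin \o (fun x => complex.Im (f x))).
Proof. by move=> cf; apply/ri_int/within_comp => //; exact: continuous_Im. Qed.

Lemma ri_md f a b : {within `[a, b], continuous f} ->
  mu.-integrable `[a, b] (EFin \o (fun x => md (f x))).
Proof. by move=> cf; apply/ri_int/within_comp => //; exact: continuous_md. Qed.

Lemma ri_cst (c : R) a b : a <= b -> \int[mu]_(x in `[a, b]) c = c * (b - a).
Proof.
move=> ab; rewrite Rintegral_cst//= lebesgue_measure_itv/= lte_fin.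
by case: ltP => [_|ba]; rewrite ?EFinN ?(le_anti (introT andP (conj ab ba))) ?subrr.
Qed.

Lemma eq_ci f g a b : (forall x, a <= x <= b -> f x = g x) -> ci f a b = ci g a b.
Proof.
by move=> fg; rewrite /ci; congr Complex; apply: eq_Rintegral => x;
  rewrite inE/= in_itv/= => /fg ->.
Qed.

Lemma ciB f g a b : {within `[a, b], continuous f} -> {within `[a, b], continuous g} ->
  ci (fun x => f x - g x) a b = ci f a b - ci g a b.
Proof.
move=> cf cg; rewrite /ci.
under [X in X +i* _]eq_Rintegral do rewrite raddfB.
under [X in _ +i* X]eq_Rintegral do rewrite raddfB.
by rewrite !RintegralB//; [exact: ri_Im|exact: ri_Im|exact: ri_Re|exact: ri_Re].
Qed.

Lemma ciZ (c : C) f a b : {within `[a, b], continuous f} ->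
  ci (fun x => c * f x) a b = c * ci f a b.
Proof.
move=> cf; case: c => p q; have hR := ri_Re cf; have hI := ri_Im cf.
have m : measurable `[a, b] by [].
have cR : {within `[a, b], continuous (fun x => complex.Re (f x))}.
  by apply: within_comp => //; exact: continuous_Re.
have cI : {within `[a, b], continuous (fun x => complex.Im (f x))}.
  by apply: within_comp => //; exact: continuous_Im.
have hZR k := ri_int (within_scaleR (k := k) cR).
have hZI k := ri_int (within_scaleR (k := k) cI).
rewrite /ci.
transitivity ((\int[mu]_(x in `[a, b]) (p * complex.Re (f x) - q * complex.Im (f x))) +i*
              (\int[mu]_(x in `[a, b]) (p * complex.Im (f x) + q * complex.Re (f x)))).
  by congr Complex; apply: eq_Rintegral => x _; case: (f x).
rewrite RintegralB ?RintegralD//.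
by rewrite !RintegralZl.
Qed.

Lemma ci_md f a b : {within `[a, b], continuous f} ->
  md (ci f a b) <= \int[mu]_(x in `[a, b]) md (f x).
Proof.
move=> cf; set I := ci f a b.
have [I0|I0] := eqVneq I 0; first by rewrite I0 md0 Rintegral_ge0// => x _; exact: md_ge0.
(* Unit factor rotating the integral onto the positive real axis, so that its modulus becomes the
   integral of a real part. *)
pose u := conjc I / (md I)%:C.
have mI : md I != 0 by rewrite md_eq0.
have uI : u * I = (md I)%:C.
  have h : I * conjc I = (md I)%:C ^+ 2 by rewrite -md_normE sqr_normc.
  have mC : (md I)%:C != 0 :> C by rewrite -md_eq0 mdr normr_eq0.
  by rewrite /u mulrAC (mulrC (conjc I)) h expr2 mulfK.
have mu1 : md u = 1.
  have : md (u * I) = md I by rewrite uI mdr ger0_norm// md_ge0.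
  by rewrite mdM => /(canRL (mulfK mI)) ->; rewrite divff.
have -> : md I = complex.Re (ci (fun x => u * f x) a b) by rewrite ciZ// uI.
have cuf : {within `[a, b], continuous (fun x => u * f x)}.
  by apply: within_compC => //; exact: continuous_mulC.
apply: le_Rintegral; [by []|exact: ri_Re|exact: ri_md|] => x _.
by apply: le_trans (Re_le_md _) _; rewrite mdM mu1 mul1r.
Qed.

Lemma ci_bound f a b (M : R) : a <= b -> {within `[a, b], continuous f} ->
  (forall x, a <= x <= b -> md (f x) <= M) -> md (ci f a b) <= M * (b - a).
Proof.
move=> ab cf h; apply: le_trans (ci_md cf) _; rewrite -ri_cst//.
apply: le_Rintegral; [by []|exact: ri_md|by apply: ri_int; exact: cst_continuous|].
by move=> x; rewrite /= in_itv/=; exact: h.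
Qed.

Lemma ri_split (u : R -> R) a b c : a <= b -> b <= c -> {within `[a, c], continuous u} ->
  \int[mu]_(x in `[a, c]) u x = \int[mu]_(x in `[a, b]) u x + \int[mu]_(x in `[b, c]) u x.
Proof.
move=> ab bc cu; have hi := ri_int cu.
have := @Rintegral_itvB R u (BLeft a) (BRight c) b hi.
rewrite !bnd_simp => /(_ ab bc) h.
rewrite -(@Rintegral_itv_obnd_cbnd R b (BRight c)) -?h; first by rewrite addrC subrK.
apply: integrableS hi => //.
by move=> x /=; rewrite !in_itv/= => /andP[h1 ->]; rewrite (le_trans ab (ltW h1)).
Qed.

Lemma ci_split f a b c : a <= b -> b <= c -> {within `[a, c], continuous f} ->
  ci f a c = ci f a b + ci f b c.
Proof.
move=> ab bc cf; rewrite /ci.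
rewrite (ri_split ab bc); last by apply: within_comp => //; exact: continuous_Re.
by rewrite (ri_split ab bc)//; apply: within_comp => //; exact: continuous_Im.
Qed.

Lemma within_contI f (A : set R) : (forall x, A x -> {for x, continuous f}) ->
  {within A, continuous f}.
Proof. by move=> h; apply: continuous_in_subspaceT => x; rewrite inE => /h. Qed.

Lemma ri_id a b : a <= b -> \int[mu]_(x in `[a, b]) x = (b ^+ 2 - a ^+ 2) / 2.
Proof.
rewrite le_eqVlt => /predU1P[->|ab].
  by rewrite set_itv1 Rintegral_set1 subrr mul0r.
pose F : R -> R := ((id : R -> R) * (id : R -> R)) * cst (2^-1 : R).
have dF (x : R) : is_derive x 1 F x.
  rewrite /F; apply: is_derive_eq.
  rewrite scaler0 add0r -[x%:A]/(x * 1) mulr1 -[_ *: _]/(2^-1 * (x + x)).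
  by field.
rewrite /Rintegral (@continuous_FTC2 _ id F)//=.
- by change (b * b * 2^-1 - a * a * 2^-1 = (b ^+ 2 - a ^+ 2) / 2); field.
- by apply: continuous_subspaceT => x; exact: cvg_id.
- have cF : continuous F by move=> x; apply: differentiable_continuous; exact/derivable1_diffP/ex_derive.
  split.
  + by move=> x _; exact: ex_derive.
  + by apply: cvg_at_right_filter; exact: cF.
  + by apply: cvg_at_left_filter; exact: cF.
- by move=> x _; rewrite derive1E derive_val.
Qed.

Lemma ci_affine (p q : C) a b : a <= b ->
  ci (fun x => p + q * x%:C) a b = p * (b - a)%:C + q * ((b ^+ 2 - a ^+ 2) / 2)%:C.
Proof.
move=> ab; case: p => p1 p2; case: q => q1 q2; rewrite /ci.
have m : measurable `[a, b] by [].
have cid : {within `[a, b], continuous (fun x : R => x)}.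
  by apply: continuous_subspaceT => x; exact: cvg_id.
have hid := ri_int cid.
have hc (k : R) : mu.-integrable `[a, b] (EFin \o (fun=> k)).
  by apply: ri_int; exact: cst_continuous.
have hZ k := ri_int (within_scaleR (k := k) cid).
transitivity ((\int[mu]_(x in `[a, b]) (p1 + q1 * x)) +i* (\int[mu]_(x in `[a, b]) (p2 + q2 * x))).
  congr Complex; apply: eq_Rintegral => x _ /=; ring.
rewrite !RintegralD// !ri_cst// !RintegralZl// ri_id//.
by apply/eqP; rewrite eq_complex/=; apply/andP; split; apply/eqP; ring.
Qed.

End ComplexIntegral.

(** * Goursat's lemma on rectangles *)

Section Goursat.
Context {R : realType}.
Local Notation C := R[i].
Implicit Types (K h : C -> C) (x y r : R).

Lemma mid_l (a b : R) : a <= b -> a <= (a + b) / 2. Proof. by lra. Qed.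
Lemma mid_r (a b : R) : a <= b -> (a + b) / 2 <= b. Proof. by lra. Qed.
Lemma mid_lB (a b : R) : (a + b) / 2 - a = (b - a) / 2. Proof. by field. Qed.
Lemma mid_rB (a b : R) : b - (a + b) / 2 = (b - a) / 2. Proof. by field. Qed.

Lemma quarter_le (q a b c d : R) :
  a <= q / 4 -> b <= q / 4 -> c <= q / 4 -> d <= q / 4 -> a <= q - d - c - b.
Proof. by lra. Qed.

(* Compactness in the form used for Goursat and for lifting on rectangles. *)
Lemma rect_bisect (P : R -> R -> R -> R -> Prop) x1 x2 y1 y2 : x1 <= x2 -> y1 <= y2 ->
  (forall a b c d, x1 <= a -> a <= b -> b <= x2 -> y1 <= c -> c <= d -> d <= y2 ->
     P a ((a + b) / 2) c ((c + d) / 2) -> P ((a + b) / 2) b c ((c + d) / 2) ->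
     P a ((a + b) / 2) ((c + d) / 2) d -> P ((a + b) / 2) b ((c + d) / 2) d -> P a b c d) ->
  (forall x y, x1 <= x <= x2 -> y1 <= y <= y2 -> exists2 e, 0 < e &
     forall a b c d, x1 <= a -> a <= x -> x <= b -> b <= x2 ->
       y1 <= c -> c <= y -> y <= d -> d <= y2 -> b - a < e -> d - c < e -> P a b c d) ->
  P x1 x2 y1 y2.
Proof.
move=> x12 y12 hq hl; apply: contrapT => nP.
pose rect := (R * R * (R * R))%type.
pose Q (r : rect) := P r.1.1 r.1.2 r.2.1 r.2.2.
pose In (r : rect) := [/\ x1 <= r.1.1, r.1.1 <= r.1.2, r.1.2 <= x2 &
                          [/\ y1 <= r.2.1, r.2.1 <= r.2.2 & r.2.2 <= y2]].
pose sub (r s : rect) := [/\ r.1.1 <= s.1.1, s.1.2 <= r.1.2, r.2.1 <= s.2.1 & s.2.2 <= r.2.2]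
  /\ (s.1.2 - s.1.1 = (r.1.2 - r.1.1) / 2 /\ s.2.2 - s.2.1 = (r.2.2 - r.2.1) / 2).
have step (r : rect) : exists s, In r -> ~ Q r -> [/\ In s, ~ Q s & sub r s].
  have [[Ir nQ]|h] := pselect (In r /\ ~ Q r); last by exists r => h1 h2; case: h.
  case: r Ir nQ => [[a b] [c d]] Ir nQ; rewrite /In/sub/Q/= in Ir nQ *.
  case: Ir => ? ? ? [? ? ?].
  apply: contrapT => ne.
  have [ml mr nl nr] : [/\ a <= (a + b) / 2, (a + b) / 2 <= b, c <= (c + d) / 2 & (c + d) / 2 <= d].
    by split; [exact: mid_l|exact: mid_r|exact: mid_l|exact: mid_r].
  have [mx my] : x1 <= (a + b) / 2 /\ (a + b) / 2 <= x2.
    by split; [exact: le_trans ml|exact: le_trans mr _].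
  have [nx ny] : y1 <= (c + d) / 2 /\ (c + d) / 2 <= y2.
    by split; [exact: le_trans nl|exact: le_trans nr _].
  have t1 : P a ((a + b) / 2) c ((c + d) / 2).
    apply: contrapT => n1; apply: ne; exists ((a, (a + b) / 2), (c, (c + d) / 2)) => _ _ /=.
    by rewrite !mid_lB; split.
  have t2 : P ((a + b) / 2) b c ((c + d) / 2).
    apply: contrapT => n1; apply: ne; exists (((a + b) / 2, b), (c, (c + d) / 2)) => _ _ /=.
    by rewrite mid_lB mid_rB; split.
  have t3 : P a ((a + b) / 2) ((c + d) / 2) d.
    apply: contrapT => n1; apply: ne; exists ((a, (a + b) / 2), ((c + d) / 2, d)) => _ _ /=.
    by rewrite mid_lB mid_rB; split.
  apply: ne; exists (((a + b) / 2, b), ((c + d) / 2, d)) => _ nn /=.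
  by rewrite !mid_rB; split => // t4; apply: nQ; apply: hq.
have [f hf] := choice step.
(* Nested rectangles on which [P] fails, halved each time; the suprema of their lower corners give
   the common point at which the local hypothesis applies. *)
pose s n := iter n f ((x1, x2), (y1, y2)).
have s0 n : In (s n) /\ ~ Q (s n).
  elim: n => [|n [I1 I2]]; first by split => //; split => //=; split.
  by have [] := hf _ I1 I2.
have sS n : sub (s n) (s n.+1) by have [I1 I2] := s0 n; have [] := hf _ I1 I2.
have mono n m : (n <= m)%N -> [/\ (s n).1.1 <= (s m).1.1, (s m).1.2 <= (s n).1.2,
                                  (s n).2.1 <= (s m).2.1 & (s m).2.2 <= (s n).2.2].
  move=> /subnK <-; elim: (m - n)%N => [|k [? ? ? ?]]; first by rewrite add0n; split.
  have [[? ? ? ?] _] := sS (k + n)%N; rewrite addSn.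
  by split; [exact: le_trans (_ : _ <= (s (k + n)%N).1.1) _|exact: le_trans (_ : _ <= (s (k + n)%N).1.2) _|
    exact: le_trans (_ : _ <= (s (k + n)%N).2.1) _|exact: le_trans (_ : _ <= (s (k + n)%N).2.2) _].
have size n : (s n).1.2 - (s n).1.1 = (x2 - x1) / 2 ^+ n /\
              (s n).2.2 - (s n).2.1 = (y2 - y1) / 2 ^+ n.
  elim: n => [|n [I1 I2]]; first by rewrite expr0 !divr1.
  have [_ [-> ->]] := sS n; rewrite I1 I2 exprS invfM.
  by split; rewrite mulrA mulrAC.
pose A := [set (s n).1.1 | n in [set: nat]]; pose B := [set (s n).2.1 | n in [set: nat]].
have crossA n m : (s n).1.1 <= (s m).1.2.
  have [[_ h1 _ _] _] := s0 (maxn n m).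
  have [h2 _ _ _] := mono n (maxn n m) (leq_maxl _ _).
  by have [_ h3 _ _] := mono m (maxn n m) (leq_maxr _ _); lra.
have crossB n m : (s n).2.1 <= (s m).2.2.
  have [[_ _ _ [_ h1 _]] _] := s0 (maxn n m).
  have [_ _ h2 _] := mono n (maxn n m) (leq_maxl _ _).
  by have [_ _ _ h3] := mono m (maxn n m) (leq_maxr _ _); lra.
have supA : has_sup A by split; [exists x1; exists 0%N|exists x2 => _ [n _ <-]; exact: (crossA n 0%N)].
have supB : has_sup B by split; [exists y1; exists 0%N|exists y2 => _ [n _ <-]; exact: (crossB n 0%N)].
pose x := sup A; pose y := sup B.
have xl n : (s n).1.1 <= x by apply: (sup_upper_bound supA); exists n.
have xr n : x <= (s n).1.2 by apply: sup_le_ub; [case: supA|move=> _ [m _ <-]].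
have yl n : (s n).2.1 <= y by apply: (sup_upper_bound supB); exists n.
have yr n : y <= (s n).2.2 by apply: sup_le_ub; [case: supB|move=> _ [m _ <-]].
have [|| e e0 he] := hl x y.
- by have := xl 0%N; have := xr 0%N; rewrite /s/= => -> ->.
- by have := yl 0%N; have := yr 0%N; rewrite /s/= => -> ->.
have [n hn] : exists n : nat, (x2 - x1) + (y2 - y1) < e * 2 ^+ n.
  have [n hn] : exists n : nat, ((x2 - x1) + (y2 - y1)) / e < n%:R.
    exists (Num.truncn (((x2 - x1) + (y2 - y1)) / e)).+1.
    by apply: Num.Theory.truncnS_gt.
  exists n; move: hn; rewrite ltr_pdivrMr// mulrC => /lt_le_trans; apply.
  rewrite ler_wpM2l ?(ltW e0)// -natrX ler_nat; exact: ltnW (ltn_expl _ _).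
have [[h1 h2 h3 [h4 h5 h6]] nQ] := s0 n; apply: nQ; have [z1 z2] := size n.
have p2 : 0 < (2 : R) ^+ n by rewrite exprn_gt0.
move: x12 y12 hn p2; clear -z1 z2 he h1 h2 h3 h4 h5 h6 xl xr yl yr => x12 y12 hn p2.
have w1 : (s n).1.2 - (s n).1.1 < e by rewrite z1 ltr_pdivrMr//; clear -x12 y12 hn; lra.
have w2 : (s n).2.2 - (s n).2.1 < e by rewrite z2 ltr_pdivrMr//; clear -x12 y12 hn; lra.
exact: he.
Qed.

Definition pt x y : C := x +i* y.

Lemma pt_affine x y : pt x y = x%:C + 'i%C * y%:C.
Proof. by rewrite /pt {1}(complexE (x +i* y)). Qed.

(** The integral of [K z dz] along the boundary of the rectangle, counterclockwise. *)
Definition rint K x1 x2 y1 y2 : C :=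
  ci (fun x => K (pt x y1)) x1 x2 - ci (fun x => K (pt x y2)) x1 x2
  + 'i%C * (ci (fun y => K (pt x2 y)) y1 y2 - ci (fun y => K (pt x1 y)) y1 y2).

Lemma continuous_pth y : continuous (fun x => pt x y).
Proof. by move=> x; apply: cvg_ReIm; [exact: cvg_id|exact: cvg_cst]. Qed.

Lemma continuous_ptv x : continuous (fun y => pt x y).
Proof. by move=> y; apply: cvg_ReIm; [exact: cvg_cst|exact: cvg_id]. Qed.

Definition rect_cont K x1 x2 y1 y2 := forall x y, x1 <= x <= x2 -> y1 <= y <= y2 ->
  {for pt x y, continuous K}.

Lemma rcont_h K x1 x2 y1 y2 y : rect_cont K x1 x2 y1 y2 -> y1 <= y <= y2 ->
  {within `[x1, x2], continuous (fun x => K (pt x y))}.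
Proof.
move=> h yy; apply: within_contI => x /=; rewrite in_itv/= => xx.
by apply: (@continuous_comp _ _ _ (fun x => pt x y) K); [exact: continuous_pth|exact: h].
Qed.

Lemma rcont_v K x1 x2 y1 y2 x : rect_cont K x1 x2 y1 y2 -> x1 <= x <= x2 ->
  {within `[y1, y2], continuous (fun y => K (pt x y))}.
Proof.
move=> h xx; apply: within_contI => y /=; rewrite in_itv/= => yy.
by apply: (@continuous_comp _ _ _ (fun y => pt x y) K); [exact: continuous_ptv|exact: h].
Qed.

Lemma rcont_sub K x1 x2 y1 y2 a b c d : rect_cont K x1 x2 y1 y2 -> x1 <= a -> b <= x2 ->
  y1 <= c -> d <= y2 -> rect_cont K a b c d.
Proof.
by move=> h ? ? ? ? x y /andP[? ?] /andP[? ?]; apply: h; apply/andP; split; lra.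
Qed.

Lemma rint_quarter K a b c d m n : a <= m -> m <= b -> c <= n -> n <= d -> rect_cont K a b c d ->
  rint K a b c d = rint K a m c n + rint K m b c n + rint K a m n d + rint K m b n d.
Proof.
move=> am mb cn nd h; rewrite /rint.
have c1 : {within `[a, b], continuous (fun x => K (pt x c))} by apply: rcont_h h _; lra.
have c2 : {within `[a, b], continuous (fun x => K (pt x d))} by apply: rcont_h h _; lra.
have c3 : {within `[c, d], continuous (fun x => K (pt a x))} by apply: rcont_v h _; lra.
have c4 : {within `[c, d], continuous (fun x => K (pt b x))} by apply: rcont_v h _; lra.
rewrite (ci_split am mb c1) (ci_split am mb c2) (ci_split cn nd c3) (ci_split cn nd c4).
ring.
Qed.

(** Direct integration: horizontal and vertical pairs of sides contribute opposite multiples of the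
    area. This removes the first-order part of the function in Goursat's lemma. *)
Lemma rint_affine (p q : C) a b c d : a <= b -> c <= d ->
  rint (fun z => p + q * z) a b c d = 0.
Proof.
move=> ab cd; rewrite /rint.
have hh y : ci (fun x => p + q * pt x y) a b =
    (p + q * 'i%C * y%:C) * (b - a)%:C + q * ((b ^+ 2 - a ^+ 2) / 2)%:C.
  by rewrite -ci_affine//; apply: eq_ci => x _; rewrite pt_affine; ring.
have vv x : ci (fun y => p + q * pt x y) c d =
    (p + q * x%:C) * (d - c)%:C + q * 'i%C * ((d ^+ 2 - c ^+ 2) / 2)%:C.
  by rewrite -ci_affine//; apply: eq_ci => y _; rewrite pt_affine; ring.
rewrite !hh !vv !rmorphB/=.
have -> : 'i%C * ((p + q * b%:C) * (d%:C - c%:C) + q * 'i%C * ((d ^+ 2 - c ^+ 2) / 2)%:C -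
   ((p + q * a%:C) * (d%:C - c%:C) + q * 'i%C * ((d ^+ 2 - c ^+ 2) / 2)%:C)) =
   'i%C * q * (b%:C - a%:C) * (d%:C - c%:C) by ring.
ring.
Qed.

Lemma rint_bound K a b c d (M : R) : a <= b -> c <= d -> rect_cont K a b c d ->
  (forall x y, a <= x <= b -> c <= y <= d -> md (K (pt x y)) <= M) ->
  md (rint K a b c d) <= 2 * M * ((b - a) + (d - c)).
Proof.
move=> ab cd h hM; rewrite /rint.
have h1 : md (ci (fun x => K (pt x c)) a b) <= M * (b - a).
  by apply: ci_bound => //; [apply: rcont_h h _; lra|move=> x xx; apply: hM => //; lra].
have h2 : md (ci (fun x => K (pt x d)) a b) <= M * (b - a).
  by apply: ci_bound => //; [apply: rcont_h h _; lra|move=> x xx; apply: hM => //; lra].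
have h3 : md (ci (fun x => K (pt a x)) c d) <= M * (d - c).
  by apply: ci_bound => //; [apply: rcont_v h _; lra|move=> x xx; apply: hM => //; lra].
have h4 : md (ci (fun x => K (pt b x)) c d) <= M * (d - c).
  by apply: ci_bound => //; [apply: rcont_v h _; lra|move=> x xx; apply: hM => //; lra].
apply: le_trans (mdD _ _) _; rewrite mdM md_i mul1r.
apply: le_trans (lerD (mdB _ _) (mdB _ _)) _; lra.
Qed.

Lemma rintB K H a b c d : a <= b -> c <= d -> rect_cont K a b c d -> rect_cont H a b c d ->
  rint (fun z => K z - H z) a b c d = rint K a b c d - rint H a b c d.
Proof.
move=> ab cd hK hH; rewrite /rint.
have ca : a <= a <= b by rewrite lexx.
have cb : a <= b <= b by rewrite lexx ab.
have cc : c <= c <= d by rewrite lexx.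
have cd' : c <= d <= d by rewrite lexx cd.
rewrite (ciB (rcont_h hK cc) (rcont_h hH cc)) (ciB (rcont_h hK cd') (rcont_h hH cd')).
rewrite (ciB (rcont_v hK ca) (rcont_v hH ca)) (ciB (rcont_v hK cb) (rcont_v hH cb)).
ring.
Qed.

(** The bound by [e] times the squared half-perimeter passes from the four quarters to the
    rectangle, and it holds on small rectangles: subtract the affine approximation, whose boundary
    integral vanishes, and estimate the remainder. *)
Lemma goursat K x1 x2 y1 y2 : x1 <= x2 -> y1 <= y2 ->
  (forall x y, x1 <= x <= x2 -> y1 <= y <= y2 -> exists d, hd K (pt x y) d) ->
  rint K x1 x2 y1 y2 = 0.
Proof.
move=> x12 y12 hK.
have cK : rect_cont K x1 x2 y1 y2.
  by move=> x y xx yy; have [d /hd_continuous] := hK x y xx yy.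
suff h e : 0 < e -> md (rint K x1 x2 y1 y2) <= e * ((x2 - x1) + (y2 - y1)) ^+ 2.
  apply/eqP; rewrite -md_eq0 eq_le md_ge0 andbT; apply/ler_addgt0Pl => e e0; rewrite addr0.
  set s := (x2 - x1) + (y2 - y1) in h *; have s0 : 0 <= s by rewrite /s; lra.
  have p : 0 < s ^+ 2 + 1 by have := sqr_ge0 s; lra.
  apply: le_trans (h _ (divr_gt0 e0 p)) _.
  by rewrite mulrAC ler_pdivrMr// ler_wpM2l ?(ltW e0)//; lra.
move=> e0.
apply: (@rect_bisect (fun a b c d => md (rint K a b c d) <= e * ((b - a) + (d - c)) ^+ 2)) => //.
  move=> a b c d ? ? ? ? ? ? h1 h2 h3 h4.
  have cK' : rect_cont K a b c d by apply: rcont_sub cK _ _ _ _.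
  rewrite (rint_quarter (mid_l _) (mid_r _) (mid_l _) (mid_r _) cK')//.
  move: h1 h2 h3 h4; rewrite !mid_lB !mid_rB.
  set q := e * ((b - a) + (d - c)) ^+ 2.
  have -> : e * ((b - a) / 2 + (d - c) / 2) ^+ 2 = q / 4 by rewrite /q; field.
  move=> h1 h2 h3 h4; do 3 (apply: le_trans (mdD _ _) _; rewrite -lerBrDr).
  exact: quarter_le.
move=> x y xx yy; have [D hD] := hK x y xx yy.
have e2 : 0 < e / 2 by lra.
have [t t0 ht] := hD _ e2; exists (t / 2) => [|a b c d ? xa xb ? ? yc yd ? bat dct]; first by rewrite divr_gt0.
pose L z := (K (pt x y) - D * pt x y) + D * z.
have cK' : rect_cont K a b c d by apply: rcont_sub cK _ _ _ _.
have cL : rect_cont L a b c d.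
  move=> u v _ _; have : hd L (pt u v) (0 + D * 1) by apply: hdD (hd_cst _ _) (hdZ _ (hd_id _)).
  exact: hd_continuous.
have ab : a <= b by exact: le_trans xb.
have cd : c <= d by exact: le_trans yd.
rewrite -[rint K a b c d]subr0 -(rint_affine (K (pt x y) - D * pt x y) D ab cd) -/L.
rewrite -(rintB ab cd cK' cL).
set s := b - a + (d - c).
have -> : e * s ^+ 2 = 2 * (e / 2 * s) * s by field.
apply: (@rint_bound (fun z => K z - L z) a b c d (e / 2 * s) ab cd) => [u v uu vv|u v uu vv].
  by apply: (@continuousB _ _ _ K L); [exact: cK'|exact: cL].
have -> : K (pt u v) - L (pt u v) = K (pt u v) - K (pt x y) - D * (pt u v - pt x y).
  by rewrite /L; ring.
have hs : md (pt u v - pt x y) <= s.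
  apply: le_trans (md_le_ReIm _) _; rewrite /= /s.
  move: uu vv xa xb yc yd; clear => /andP[? ?] /andP[? ?] ? ? ? ?.
  by apply: lerD; rewrite ler_norml; apply/andP; split; lra.
apply: le_trans (ht _ _) _.
  by apply: le_lt_trans hs _; rewrite /s; clear -bat dct; lra.
by rewrite ler_wpM2l// ltW.
Qed.

End Goursat.

(** * The complex exponential *)

Section Exponential.
Context {R : realType}.
Local Notation C := R[i].
Implicit Types (z w : C) (t r x y : R).

Definition cexp z : C := (expR (complex.Re z))%:C * cis (complex.Im z).

Lemma cisD x y : cis (x + y) = cis x * cis y :> C.
Proof. by rewrite /cis cosD sinD; apply/eqP; rewrite eq_complex/= !eqxx/= addrC mulrC. Qed.

Lemma md_cis x : md (cis x : C) = 1.
Proof. by rewrite /cis/= cos2Dsin2 sqrtr1. Qed.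

Lemma cis0 : cis 0 = 1 :> C. Proof. by rewrite /cis cos0 sin0. Qed.

Lemma cis_neq0 x : cis x != 0 :> C.
Proof. by rewrite -md_eq0 md_cis oner_eq0. Qed.

Lemma cis_pi : cis pi = - 1 :> C.
Proof. by apply/eqP; rewrite /cis cospi sinpi eq_complex/= oppr0 !eqxx. Qed.

Lemma cis2pi : cis (2 * pi) = 1 :> C.
Proof. by rewrite mulr_natl /cis cos2pi sin2pi. Qed.

Lemma cisD2pi x : cis (x + 2 * pi) = cis x :> C.
Proof. by rewrite cisD cis2pi mulr1. Qed.

Lemma continuous_cis : continuous (fun x => cis x : C).
Proof. by move=> x; apply: cvg_ReIm; [exact: continuous_cos|exact: continuous_sin]. Qed.

Lemma cexpD z w : cexp (z + w) = cexp z * cexp w.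
Proof. by rewrite /cexp !raddfD/= expRD rmorphM cisD; ring. Qed.

Lemma cexp0 : cexp 0 = 1. Proof. by rewrite /cexp/= expR0 cis0 mulr1. Qed.

Lemma md_cexp z : md (cexp z) = expR (complex.Re z).
Proof. by rewrite mdM md_cis mulr1 mdr ger0_norm// expR_ge0. Qed.

Lemma cexp_neq0 z : cexp z != 0.
Proof. by rewrite -md_eq0 md_cexp gt_eqF// expR_gt0. Qed.

Lemma rd_hd (f : R -> R) x d : is_derive x 1 f d -> forall e, 0 < e -> exists2 t, 0 < t &
  forall h, `|h| < t -> `|f (x + h) - f x - d * h| <= e * `|h|.
Proof.
move=> [df <-] e e0.
move: df; rewrite /derivable => /cvg_ex[/= l hl].
have -> : 'D_1 f x = l by apply: cvg_lim => //; exact: hl.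
move: hl => /cvgrPdist_le/(_ e e0)/nbhs_ballP[t /= t0 ht].
exists t => // h ht'.
have [->|h0] := eqVneq h 0; first by rewrite addr0 subrr mulr0 subrr normr0 mulr0.
have := ht h; rewrite /ball/= sub0r normrN => /(_ ht' h0).
rewrite -[h *: 1]/(h * 1) mulr1 -[_ *: _]/(h^-1 * (f (h + x) - f x)) => hh.
have -> : f (x + h) - f x - l * h = - ((l - h^-1 * (f (h + x) - f x)) * h).
  by rewrite (addrC x); field.
by rewrite normrN normrM ler_wpM2r.
Qed.

(** The derivative at [0], assembled from those of the real exponential, sine and cosine; the
    functional equation carries it to every point. *)
Lemma cexp_at0 e : 0 < e -> exists2 t, 0 < t & forall u, md u < t ->
  md (cexp u - 1 - u) <= e * md u.
Proof.
move=> e0; have e1 : 0 < e / 10 by lra.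
have [t1 t10 h1] := rd_hd (is_derive_expR (0 : R)) e1.
have [t2 t20 h2] := rd_hd (is_derive_sin (0 : R)) e1.
have [t3 t30 h3] := rd_hd (is_derive_cos (0 : R)) e1.
pose t := Order.min (Order.min t1 t2) (Order.min t3 (Order.min 1 (e / 2))).
exists t => [|u]; first by rewrite !lt_min t10 t20 t30 ltr01/=; lra.
rewrite !lt_min => /andP[/andP[u1 u2] /and3P[u3 u4 u5]].
set a := complex.Re u; set b := complex.Im u.
have au : `|a| <= md u by exact: md_Re.
have bu : `|b| <= md u by exact: md_Im.
have := h1 a (le_lt_trans au u1); rewrite add0r expR0 mul1r => k1.
have := h2 b (le_lt_trans bu u2); rewrite add0r sin0 cos0 subr0 mul1r => k2.
have := h3 b (le_lt_trans bu u3); rewrite add0r sin0 cos0 oppr0 mul0r subr0 => k3.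
have -> : cexp u - 1 - u = (expR a - 1 - a)%:C * cis b + (1 + a)%:C * (cis b - 1 - 'i%C * b%:C)
    + ('i%C * (a * b)%:C).
  rewrite {2}(complexE u) -/a -/b /cexp -/a -/b !rmorphB !rmorphD !rmorphM !rmorph1/=; ring.
have m3 : md (cis b - 1 - 'i%C * b%:C : C) <= e / 5 * md u.
  apply: le_trans (md_le_ReIm _) _; rewrite /= !(mulr0, mul0r, mul1r, subr0, oppr0, add0r, addr0, sub0r).
  have : e / 10 * `|b| <= e / 10 * md u by rewrite ler_wpM2l// ltW.
  have := k2; have := k3; lra.
have m1 : md (1 + a)%:C <= 2.
  rewrite mdr; apply: le_trans (ler_normD _ _) _; rewrite normr1.
  have := le_lt_trans au u4; lra.
apply: le_trans (mdD _ _) _; apply: le_trans (lerD (mdD _ _) (lexx _)) _.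
rewrite !mdM md_cis mulr1 md_i mul1r !mdr normrM.
have n1 : md (1 + a)%:C * md (cis b - 1 - 'i%C * b%:C : C) <= 2 * (e / 5 * md u).
  by apply: ler_pM => //; exact: md_ge0.
have n2 : `|a| * `|b| <= e / 2 * md u.
  by apply: ler_pM => //; apply: le_trans au (ltW u5).
have n3 : e / 10 * `|a| <= e / 10 * md u by rewrite ler_wpM2l// ltW.
rewrite mdr in n1; lra.
Qed.

Lemma hd_cexp z : hd cexp z (cexp z).
Proof.
move=> e e0; have p : 0 < md (cexp z) by rewrite md_gt0 cexp_neq0.
have [t t0 ht] := cexp_at0 (divr_gt0 e0 p); exists t => // w wz.
have -> : cexp w - cexp z - cexp z * (w - z) = cexp z * (cexp (w - z) - 1 - (w - z)).
  have -> : cexp w = cexp z * cexp (w - z) by rewrite -cexpD addrC subrK.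
  ring.
rewrite mdM; have := ht _ wz; rewrite mulrAC ler_pdivlMr// mulrC => h.
by rewrite (le_trans h).
Qed.

End Exponential.

(** * Means over circles and the Cauchy estimate *)

Section CircleMean.
Context {R : realType}.
Local Notation C := R[i].
Implicit Types (h f : C -> C) (z w a : C) (t r M : R).

Lemma pi2_gt0 : 0 < 2 * pi :> R. Proof. by have := pi_gt0 R; lra. Qed.

Definition circ r t : C := r%:C * cis t.

Lemma md_circ r t : 0 <= r -> md (circ r t) = r.
Proof. by move=> r0; rewrite mdM md_cis mulr1 mdr ger0_norm. Qed.

Lemma continuous_circ r : continuous (circ r).
Proof.
move=> t; exact: (continuous_comp (@continuous_cis R t) (@continuous_mulC R r%:C _)).
Qed.

Definition ccont h r := forall z, md z = r -> {for z, continuous h}.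

Lemma circ_cont h r : 0 <= r -> ccont h r -> forall t, {for t, continuous (fun t => h (circ r t))}.
Proof.
move=> r0 ch t; apply: (@continuous_comp _ _ _ (circ r) h); first exact: continuous_circ.
by apply: ch; exact: md_circ.
Qed.

Lemma circ_within h r (A : set R) : 0 <= r -> ccont h r ->
  {within A, continuous (fun t => h (circ r t))}.
Proof. by move=> r0 ch; apply: within_contI => t _; exact: circ_cont. Qed.

Definition avg h r : C := ci (fun t => h (circ r t)) 0 (2 * pi) / (2 * pi)%:C.

Lemma pi2C_neq0 : (2 * pi)%:C != 0 :> C.
Proof. by rewrite -md_eq0 mdr normr_eq0 gt_eqF// pi2_gt0. Qed.

Lemma eq_avg h f r : 0 <= r -> (forall z, md z = r -> h z = f z) -> avg h r = avg f r.
Proof. by move=> r0 hf; congr (_ / _); apply: eq_ci => t _; apply: hf; exact: md_circ. Qed.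

Lemma avgB h f r : 0 <= r -> ccont h r -> ccont f r ->
  avg (fun z => h z - f z) r = avg h r - avg f r.
Proof.
by move=> r0 ch cf; rewrite /avg ciB ?mulrBl//; apply: circ_within.
Qed.

Lemma avgZ c h r : 0 <= r -> ccont h r -> avg (fun z => c * h z) r = c * avg h r.
Proof.
by move=> r0 ch; rewrite /avg ciZ ?mulrA//; apply: circ_within.
Qed.

Lemma avg_cst c r : avg (fun=> c) r = c.
Proof.
rewrite /avg; have := @ci_affine R c 0 0 (2 * pi) (ltW pi2_gt0).
rewrite mul0r addr0 subr0 => h.
rewrite (_ : ci _ _ _ = ci (fun x => c + 0 * x%:C) 0 (2 * pi)); last first.
  by apply: eq_ci => x _; rewrite mul0r addr0.
by rewrite h mulfK// pi2C_neq0.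
Qed.

Lemma avg_bound h r M : 0 <= r -> ccont h r -> (forall z, md z = r -> md (h z) <= M) ->
  md (avg h r) <= M.
Proof.
move=> r0 ch hM; rewrite /avg md_div mdr gtr0_norm ?pi2_gt0// ler_pdivrMr ?pi2_gt0//.
apply: le_trans (ci_bound (ltW pi2_gt0) _ _) _; first exact: circ_within ch.
  by move=> t _; apply: hM; exact: md_circ.
by rewrite subr0.
Qed.

Lemma avg_Re h r M : 0 <= r -> ccont h r -> (forall z, md z = r -> complex.Re (h z) <= M) ->
  complex.Re (avg h r) <= M.
Proof.
move=> r0 ch hM; rewrite /avg.
have -> : (ci (fun t => h (circ r t)) 0 (2 * pi) / (2 * pi)%:C) =
  (2 * pi)^-1%:C * ci (fun t => h (circ r t)) 0 (2 * pi) by rewrite fmorphV mulrC.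
have -> c z : complex.Re (c%:C * z) = c * complex.Re z by case: z => x y /=; rewrite mul0r subr0.
rewrite mulrC ler_pdivrMr ?pi2_gt0//= -[X in _ <= _ * X]subr0 -ri_cst ?(ltW pi2_gt0)//.
have cc : {within `[0, 2 * pi], continuous (fun t => h (circ r t))} by exact: circ_within.
apply: le_Rintegral; [by []|exact: ri_Re|by apply: ri_int; exact: cst_continuous|].
by move=> t _; apply: hM; exact: md_circ.
Qed.

(** Goursat for [h \o cexp] on the rectangle between [ln r1] and [ln r2], of height [2 * pi]: the
    horizontal sides cancel by periodicity, the vertical sides are the two means. *)
Lemma avg_annulus h r1 r2 : (forall z, r1 <= md z <= r2 -> exists d, hd h z d) ->
  0 < r1 -> r1 <= r2 -> avg h r1 = avg h r2.
Proof.
move=> hh r10 r12; have r20 : 0 < r2 by exact: lt_le_trans r12.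
have e1 : expR (ln r1) = r1 by rewrite lnK// posrE.
have e2 : expR (ln r2) = r2 by rewrite lnK// posrE.
have l12 : ln r1 <= ln r2 by rewrite ler_ln ?posrE.
have cp x y : cexp (pt x y) = circ (expR x) y by [].
have := @goursat R (fun z => h (cexp z)) (ln r1) (ln r2) 0 (2 * pi) l12 (ltW pi2_gt0).
have H x y : ln r1 <= x <= ln r2 -> 0 <= y <= 2 * pi ->
    exists d, hd (fun z => h (cexp z)) (pt x y) d.
  move=> /andP[x1 x2] _; have [|d hdd] := hh (cexp (pt x y)).
    by rewrite cp md_circ ?expR_ge0// -{1}e1 -{1}e2 !ler_expR x1.
  by exists (d * cexp (pt x y)); apply: hd_comp hdd; exact: hd_cexp.
move=> /(_ H); rewrite /rint.
have -> : ci (fun x => h (cexp (pt x (2 * pi)))) (ln r1) (ln r2) =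
          ci (fun x => h (cexp (pt x 0))) (ln r1) (ln r2).
  by apply: eq_ci => x _; rewrite !cp /circ -[2 * pi]add0r cisD2pi.
rewrite subrr add0r => /eqP; rewrite mulf_eq0 -md_eq0 md_i oner_eq0/= subr_eq0 => /eqP.
rewrite /avg; under eq_ci do rewrite cp e2.
by under [in RHS]eq_ci do rewrite cp e1; move=> ->.
Qed.

Lemma avg_const h r1 r2 s : (forall z, 0 < md z < s -> exists d, hd h z d) ->
  0 < r1 -> r1 <= r2 -> r2 < s -> avg h r1 = avg h r2.
Proof.
move=> hh r10 r12 r2s; apply: avg_annulus => // z /andP[z1 z2]; apply: hh.
by rewrite (lt_le_trans r10 z1) (le_lt_trans z2 r2s).
Qed.

Lemma hd_ccont h s r : (forall z, 0 < md z < s -> exists d, hd h z d) -> 0 < r -> r < s ->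
  ccont h r.
Proof. by move=> hh r0 rs z zr; have [|d /hd_continuous] := hh z; rewrite ?zr ?r0. Qed.

(** The means do not depend on the radius and tend to [h 0]. Differentiability is asked off the
    centre only, so that difference quotients qualify. *)
Lemma mvp h s r : (forall z, 0 < md z < s -> exists d, hd h z d) -> {for 0, continuous h} ->
  0 < r -> r < s -> avg h r = h 0.
Proof.
move=> hh c0 r0 rs; apply/eqP; rewrite -subr_eq0 -md_eq0 eq_le md_ge0 andbT.
apply/ler_addgt0Pl => e e0; rewrite addr0.
have /contP/(_ _ e0)[t t0 ht] := c0.
have [q [q0 qr qt]] : exists q : R, [/\ 0 < q, q <= r & q < t].
  exists (Order.min (t / 2) r); split; first by rewrite lt_min r0 andbT; lra.
    by rewrite ge_min lexx orbT.
  by apply: (@le_lt_trans _ _ (t / 2)); [rewrite ge_min lexx|lra].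
rewrite -(avg_const hh q0 qr rs) -[X in _ - X](avg_cst (h 0) q).
have ch : ccont h q by exact: hd_ccont hh q0 (le_lt_trans qr rs).
have cc : ccont (fun=> h 0) q by move=> z _; exact: cst_continuous.
rewrite -(avgB (ltW q0) ch cc).
apply: (@avg_bound (fun z => h z - h 0) q e (ltW q0)).
- move=> z zq; apply: (@continuousB _ _ _ h (fun=> h 0)); last exact: cst_continuous.
  exact: ch.
- by move=> z zq; apply/ltW/ht; rewrite subr0 zq.
Qed.

Lemma hd_shift f a z d : hd f (a + z) d -> hd (fun z => f (a + z)) z d.
Proof.
move=> h; have := hd_comp (hdD (hd_cst a z) (hd_id z)) h.
by rewrite add0r mulr1.
Qed.

Lemma hd_quot_cont f a d : hd f a d ->
  {for 0, continuous (fun z => if z == 0 then d else (f (a + z) - f a) / z)}.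
Proof.
move=> h; apply/contP => e e0; have e2 : 0 < e / 2 by lra.
have [t t0 ht] := h _ e2; exists t => // w; rewrite subr0 eqxx => wt.
have [w0|w0] := eqVneq w 0; first by rewrite subrr md0.
have -> : (f (a + w) - f a) / w - d = (f (a + w) - f a - d * w) / w by field.
rewrite md_div ltr_pdivrMr ?md_gt0//.
have := ht (a + w); rewrite (addrC a w) addrK => /(_ wt) /le_lt_trans; apply.
by rewrite ltr_pM2r ?md_gt0//; lra.
Qed.

(** Mean value property of the difference quotient, whose value at the centre is the derivative; on
    the circle of radius [r] it is at most [2 * M / r], and [r] tends to [s]. *)
Lemma cauchy_dv f a s M : 0 < s -> hol (disc a s) f ->
  (forall z, disc a s z -> md (f z) <= M) -> md (dv f a) <= 2 * M / s.
Proof.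
move=> s0 hf hM.
pose k z := if z == 0 then dv f a else (f (a + z) - f a) / z.
have ha := dvP hf (disc_center a s0).
have hk z : 0 < md z < s -> exists d, hd k z d.
  move=> /andP[z0 zs]; have [|d hdd] := hf (a + z); first by rewrite /disc/= addrAC subrr add0r.
  have zn : z != 0 by rewrite -md_gt0.
  exists (((d - 0) * z - (f (a + z) - f a) * 1) / z ^+ 2).
  apply: (@hd_eq _ (fun z => (f (a + z) - f a) / z) k z _ (md z) z0); last first.
    by apply: (@hd_div _ (fun z => f (a + z) - f a) id) => //;
      [apply: hdB (hd_shift hdd) (hd_cst _ _)|exact: hd_id].
  move=> w; rewrite inE /disc/= => wz; rewrite /k; case: eqP => // w0.
  by move: wz; rewrite w0 sub0r mdN ltxx.
have ck : {for 0, continuous k} by exact: hd_quot_cont.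
have kb r : 0 < r -> r < s -> md (dv f a) <= 2 * M / r.
  move=> r0 rs; have -> : dv f a = k 0 by rewrite /k eqxx.
  rewrite -(mvp hk ck r0 rs); apply: avg_bound; first exact: ltW.
    exact: hd_ccont hk r0 rs.
  move=> z zr; rewrite /k -md_eq0 zr gt_eqF// md_div zr ler_wpM2r ?invr_ge0 ?(ltW r0)//.
  have /hM h1 : disc a s (a + z) by rewrite /disc/= addrAC subrr add0r zr.
  have := hM a (disc_center a s0); have := mdB (f (a + z)) (f a); lra.
have M0 : 0 <= M by apply: le_trans (hM a (disc_center a s0)); exact: md_ge0.
rewrite ler_pdivlMr//; apply/ler_addgt0Pl => e e0.
have [D0|D0] := eqVneq (md (dv f a)) 0; first by rewrite D0 mul0r; lra.
have Dp : 0 < md (dv f a) by rewrite lt_def D0 md_ge0.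
pose r := Order.max (s / 2) (s - e / md (dv f a)).
have r0 : 0 < r by rewrite lt_max; apply/orP; left; lra.
have rs : r < s by rewrite gt_max; apply/andP; split; [lra|rewrite ltrBlDr ltrDl divr_gt0].
have := kb r r0 rs; rewrite ler_pdivlMr// => h1.
have : s - e / md (dv f a) <= r by rewrite le_max lexx orbT.
rewrite lerBlDr => /(ler_wpM2l (ltW Dp)) h2.
apply: le_trans h2 _; rewrite mulrDr (mulrC _ (e / _)) divfK// addrC lerD2l//.
Qed.

(** Bisection of the segment with slope [L + e]: the estimate adds up over two halves and holds near
    each point by differentiability. The rectangle of [rect_bisect] degenerates to a segment
    here. *)
Lemma mvi f z w (L : R) :
  (forall t, 0 <= t <= 1 -> exists2 d, hd f (w + t%:C * (z - w)) d & md d <= L) ->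
  md (f z - f w) <= L * md (z - w).
Proof.
move=> h; set v := z - w in h *.
have [v0|v0] := eqVneq v 0.
  by move/eqP: v0; rewrite subr_eq0 => /eqP ->; rewrite subrr md0 mulr_ge0 ?md_ge0//;
    have [|d _] := h 0; [rewrite lexx ler01|move=> dL; apply: le_trans dL; exact: md_ge0].
have vp : 0 < md v by rewrite md_gt0.
apply/ler_addgt0Pl => e0 e00; set e := e0 / md v.
have ep : 0 < e by rewrite divr_gt0.
suff : md (f (w + 1%:C * v) - f (w + 0%:C * v)) <= (L + e) * (1 - 0) * md v.
  rewrite mul1r mul0r addr0 /v (addrC w) subrK -/v subr0 mulr1 mulrDl divfK ?gt_eqF//.
  by rewrite [e0 + _]addrC.
pose P (a b _ _ : R) := md (f (w + b%:C * v) - f (w + a%:C * v)) <= (L + e) * (b - a) * md v.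
suff : P 0 1 0 0 by [].
refine (@rect_bisect R P 0 1 0 0 ler01 (lexx 0) _ _); rewrite /P.
  move=> a b c d _ _ _ _ _ _ h1 h2 _ _; apply: le_trans (md_tri _ _ (f (w + ((a + b) / 2)%:C * v))) _.
  apply: le_trans (lerD h2 h1) _; rewrite -mulrDl -mulrDr.
  by have -> : b - (a + b) / 2 + ((a + b) / 2 - a) = b - a by ring.
move=> x y /h[D hD DL] _.
have [t t0 ht] := hD _ ep; exists (t / md v) => [|a b c d _ ax xb _ _ _ _ _ bat _].
  by rewrite divr_gt0.
rewrite ltr_pdivlMr// in bat.
have one u : `|u - x| <= b - a ->
    md (f (w + u%:C * v) - f (w + x%:C * v)) <= (L + e) * `|u - x| * md v.
  move=> ux.
  have E : w + u%:C * v - (w + x%:C * v) = (u - x)%:C * v by rewrite rmorphB; ring.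
  have lt : md (w + u%:C * v - (w + x%:C * v)) < t.
    by rewrite E mdM mdr; apply: le_lt_trans bat; rewrite ler_wpM2r ?md_ge0.
  have := ht _ lt; rewrite E mdM mdr => k1.
  set A := f (w + u%:C * v) in k1 *; set B := f (w + x%:C * v) in k1 *.
  have -> : A - B = (A - B - D * ((u - x)%:C * v)) + D * ((u - x)%:C * v) by ring.
  apply: le_trans (mdD _ _) _; rewrite !mdM mdr.
  have : md D * (`|u - x| * md v) <= L * (`|u - x| * md v).
    by rewrite ler_wpM2r// mulr_ge0 ?md_ge0.
  by move: k1; rewrite !mulrDl !mulrA => k1 k2; rewrite addrC; exact: lerD.
apply: le_trans (md_tri _ _ (f (w + x%:C * v))) _.
have b1 : `|b - x| = b - x by rewrite ger0_norm// subr_ge0.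
have a1 : `|a - x| = x - a by rewrite distrC ger0_norm// subr_ge0.
have := one b; rewrite b1 => /(_ (_ : _ <= _)) H1.
have := one a; rewrite a1 => /(_ (_ : _ <= _)) H2.
rewrite (md_distC (f (w + x%:C * v))).
have {}H1 := H1 ltac:(by rewrite lerB). have {}H2 := H2 ltac:(by rewrite lerB).
apply: le_trans (lerD H1 H2) _; rewrite -mulrDl -mulrDr.
by have -> : b - x + (x - a) = b - a by ring.
Qed.

End CircleMean.

(** * Second derivatives, maximum principle, open mapping *)

Section Holomorphic.
Context {R : realType}.
Local Notation C := R[i].
Implicit Types (h f : C -> C) (z w a : C) (t r M : R) (D : set C).

Lemma div_small (x e : R) : 0 <= x -> 0 < e ->
  exists N : nat, forall n, (N <= n)%N -> x / n.+1%:R < e.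
Proof.
move=> x0 e0; exists (Num.truncn (x / e)) => n Nn.
rewrite ltr_pdivrMr// mulrC -ltr_pdivrMr//.
apply: lt_le_trans (Num.Theory.truncnS_gt _) _.
by rewrite ler_nat ltnS.
Qed.

Lemma compact_seq (K : set C) (u : nat -> C) : compact K -> (forall n, K (u n)) ->
  exists2 c, K c & forall e, 0 < e -> forall N, exists2 n, (N <= n)%N & md (u n - c) < e.
Proof.
move=> cK uK.
have FK : \forall n \near \oo, K (u n) by exact: nearW.
have [c [Kc hc]] := cK (u n @[n --> \oo]) _ FK.
exists c => // e e0 N.
have [|w [[n [Nn <-]] /=]] := hc (u @` [set n | (N <= n)%N]) (disc c e) _ (nbhs_disc c e0).
  by exists N => // n /= Nn; exists n.
by rewrite /disc/=; exists n.
Qed.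

(** Extraction of subsequences: each index is chosen beyond its predecessor. *)
Lemma lip_choice (P : nat -> nat -> Prop) : (forall k N, exists2 n, (N <= n)%N & P k n) ->
  exists2 s : nat -> nat, {homo s : i j / (i < j)%N} & forall k, P k (s k).
Proof.
move=> h.
have h' (p : nat * nat) : exists n, (p.2 <= n)%N /\ P p.1 n.
  by have [n Nn Pn] := h p.1 p.2; exists n.
have [f hf] := choice h'.
pose s := fix s k := if k is k'.+1 then f (k'.+1, (s k').+1) else f (0%N, 0%N).
exists s; last by case=> [|k]; [exact: (hf (0%N, 0%N)).2|exact: (hf (k.+1, (s k).+1)).2].
have sS k : (s k < s k.+1)%N by exact: (hf (k.+1, (s k).+1)).1.
exact: homo_ltn ltn_trans sS.
Qed.

Lemma compact_subseq (K : set C) (u : nat -> C) : compact K -> (forall n, K (u n)) ->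
  exists2 c, K c & exists2 s : nat -> nat, {homo s : i j / (i < j)%N} &
    forall k, md (u (s k) - c) < k.+1%:R^-1.
Proof.
move=> cK uK; have [c Kc hc] := compact_seq cK uK; exists c => //.
have [|s s1 s2] := @lip_choice (fun k n => md (u n - c) < k.+1%:R^-1).
  by move=> k N; apply: hc; rewrite invr_gt0.
by exists s.
Qed.

Lemma seg_disc a r w z t : disc a r w -> disc a r z -> 0 <= t <= 1 ->
  disc a r (w + t%:C * (z - w)).
Proof.
rewrite /disc/= => wr zr /andP[t0 t1].
have -> : w + t%:C * (z - w) - a = (1 - t)%:C * (w - a) + t%:C * (z - a).
  by rewrite rmorphB rmorph1; ring.
apply: le_lt_trans (mdD _ _) _; rewrite !mdM !mdr !ger0_norm ?subr_ge0//.
have [->|tp] := eqVneq t 0; first by rewrite subr0 mul1r mul0r addr0.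
have k1 : (1 - t) * md (w - a) <= (1 - t) * r by rewrite ler_wpM2l ?subr_ge0// ltW.
have k2 : t * md (z - a) < t * r by rewrite ltr_pM2l// lt_def tp.
have -> : r = (1 - t) * r + t * r by ring.
exact: ler_ltD.
Qed.

Lemma mvi_disc a r f w z (L : R) : hol (disc a r) f ->
  (forall u, disc a r u -> md (dv f u) <= L) -> disc a r w -> disc a r z ->
  md (f z - f w) <= L * md (z - w).
Proof.
move=> hf hL wr zr; apply: mvi => t t01.
have hu := seg_disc wr zr t01.
by exists (dv f (w + t%:C * (z - w))); [exact: dvP hf hu|exact: hL].
Qed.

Lemma hol_bounded_near D f a : open D -> hol D f -> D a ->
  exists2 r, 0 < r & disc a r `<=` D /\ forall z, disc a r z -> md (f z) <= md (f a) + 1.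
Proof.
move=> /open_md oD hf Da; have [r r0 rD] := oD a Da.
have /contP/(_ _ ltr01)[t t0 ht] := hol_cont hf Da.
exists (Order.min r t); first by rewrite lt_min r0.
split=> z; rewrite /disc/= lt_min => /andP[z1 z2]; first exact: rD.
by have := ht z z2; have := md_subl (f z) (f a); lra.
Qed.

Lemma dv_bound a s f M : 0 < s -> hol (disc a s) f ->
  (forall z, disc a s z -> md (f z) <= M) -> forall z, disc a (s / 2) z -> md (dv f z) <= 4 * M / s.
Proof.
move=> s0 hf hM z zs.
have sub : disc z (s / 2) `<=` disc a s by apply: subset_disc; move: zs; rewrite /disc/=; lra.
have -> : 4 * M / s = 2 * M / (s / 2) by field; rewrite gt_eqF.
apply: cauchy_dv; [lra|exact: hol_sub sub hf|by move=> w /sub; exact: hM].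
Qed.

(** The tools are the Cauchy estimate and the mean value inequality. The estimate for [psi u], which
    is of order [md u], makes [dv f] Lipschitz ([Lip]); hence [psi u z / u] is within order [md u]
    of [dv f z]. The estimate for [psi u z / u - psi v z / v] then shows that the difference
    quotients [q] of [dv f] at [a] form a Cauchy family. *)
Lemma hol_dv D f : open D -> hol D f -> hol D (dv f).
Proof.
move=> oD hf a Da.
have [s s0 [sD hM]] := hol_bounded_near oD hf Da; set M := _ + 1 in hM.
have M0 : 0 <= M by rewrite /M; have := md_ge0 (f a); lra.
have hfs : hol (disc a s) f by exact: hol_sub sD hf.
pose L1 := 4 * M / s; pose L2 := 2 * L1 / (s / 8).
have L1p : 0 <= L1 by rewrite /L1 divr_ge0 ?mulr_ge0 ?(ltW s0).
have s8 : 0 < s / 8 by lra.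
have s16' : 0 < s / 16 by lra.
have L2p : 0 <= L2 by exact: divr_ge0 (mulr_ge0 (ler0n _ 2) L1p) (ltW s8).
have B1 := dv_bound s0 hfs hM.
pose psi u z := f (z + u) - f z.
have hps u z : md u < s / 4 -> disc a (s / 4) z -> hd (psi u) z (dv f (z + u) - dv f z).
  move=> us zs; apply: hdB; last first.
    by apply: dvP hfs _; move: zs; rewrite /disc/=; lra.
  have zu : disc a s (z + u).
    move: zs; rewrite /disc/= (_ : z + u - a = (z - a) + u); last by ring.
    by have := mdD (z - a) u; lra.
  have := hd_comp (hdD (hd_id z) (hd_cst u z)) (dvP hfs zu); rewrite addr0 mulr1; exact.
have Bps u z : md u < s / 4 -> disc a (s / 4) z -> md (psi u z) <= L1 * md u.
  move=> us zs; have := @mvi_disc a (s / 2) f z (z + u) L1.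
  rewrite addrAC subrr add0r; apply => //.
  - by apply: hol_sub hfs; apply: subset_disc; rewrite subrr md0; lra.
  - by move: zs; rewrite /disc/=; lra.
  - move: zs; rewrite /disc/= (_ : z + u - a = (z - a) + u); last by ring.
    by have := mdD (z - a) u; lra.
have Lip u z : md u < s / 4 -> disc a (s / 8) z -> md (dv f (z + u) - dv f z) <= L2 * md u.
  move=> us zs.
  have zs4 : disc a (s / 4) z by move: zs; rewrite /disc/=; lra.
  rewrite -(hd_dv (hps u z us zs4)).
  have -> : L2 * md u = 2 * (L1 * md u) / (s / 8) by rewrite /L2; field; rewrite gt_eqF.
  have sub : disc z (s / 8) `<=` disc a (s / 4) by apply: subset_disc; move: zs; rewrite /disc/=; lra.
  apply: cauchy_dv => [|w /sub ws|w /sub ws]; [lra| |exact: Bps].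
  by exists (dv f (w + u) - dv f w); exact: hps.
have small u z : u != 0 -> md u < s / 16 -> disc a (s / 16) z ->
    md (psi u z / u - dv f z) <= L2 * md u.
  move=> u0 us zs.
  have up : 0 < md u by rewrite md_gt0.
  pose g v := f (z + v) - dv f z * v.
  have hg v : md v <= md u -> hd g v (dv f (z + v) - dv f z).
    move=> vu; apply: hdB; last by have := hdZ (dv f z) (hd_id v); rewrite mulr1.
    apply: hd_shift; apply: dvP hfs _.
    move: zs; rewrite /disc/= (_ : z + v - a = (z - a) + v); last by ring.
    by have := mdD (z - a) v; lra.
  have -> : psi u z / u - dv f z = (g u - g 0) / u.
    by rewrite /psi /g addr0 mulr0 subr0; field.
  rewrite md_div ler_pdivrMr//.
  have := @mvi R g u 0 (L2 * md u); rewrite subr0; apply => t /andP[t0 t1].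
  rewrite add0r.
  have tu : md (t%:C * u) <= md u by rewrite mdM mdr ger0_norm// ler_piMl// md_ge0.
  exists (dv f (z + t%:C * u) - dv f z); first exact: hg.
  apply: le_trans (Lip _ _ _ _) _; [lra| |by rewrite ler_wpM2l].
  by move: zs; rewrite /disc/=; lra.
pose q u := (dv f (a + u) - dv f a) / u.
pose L3 := 2 * L2 / (s / 16).
have L3p : 0 <= L3 by exact: divr_ge0 (mulr_ge0 (ler0n _ 2) L2p) (ltW s16').
have hq u z : u != 0 -> md u < s / 16 -> disc a (s / 16) z ->
    hd (fun z => psi u z / u) z ((dv f (z + u) - dv f z) / u).
  move=> u0 us zs; have := hdZ (u^-1) (hps u z ltac:(lra) ltac:(move: zs; rewrite /disc/=; lra)).
  rewrite mulrC => /(@hd_eq _ _ (fun z => psi u z / u) _ _ 1 ltr01); apply.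
  by move=> w _; rewrite mulrC.
have qq u v : u != 0 -> md u < s / 16 -> v != 0 -> md v < s / 16 ->
    md (q u - q v) <= L3 * (md u + md v).
  move=> u0 us v0 vs; have s16 : 0 < s / 16 by lra.
  have ha := disc_center a s16.
  rewrite /q -(hd_dv (hdB (hq u a u0 us ha) (hq v a v0 vs ha))).
  have -> : L3 * (md u + md v) = 2 * (L2 * (md u + md v)) / (s / 16).
    by rewrite /L3; field; rewrite gt_eqF.
  apply: cauchy_dv => // [w ws|w ws].
    by eexists; apply: hdB; apply: hq.
  have -> : psi u w / u - psi v w / v =
     (psi u w / u - dv f w) - (psi v w / v - dv f w) by ring.
  apply: le_trans (mdB _ _) _; rewrite mulrDr.
  by apply: lerD; apply: small.
(* Increments tending to [0]; a cluster point [c] of their quotients is the second derivative. *)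
pose un (n : nat) : C := (s / 32 / n.+1%:R)%:C.
have un0 n : 0 < s / 32 / n.+1%:R by rewrite divr_gt0//; lra.
have unE n : md (un n) = s / 32 / n.+1%:R by rewrite mdr gtr0_norm.
have unn n : un n != 0 by rewrite -md_gt0 unE.
have uns n : md (un n) <= s / 32.
  by rewrite unE ler_pdivrMr// ler_peMr// ?ler1n//; lra.
have qb n : cdisc (q (un 0%N)) (L3 * s) (q (un n)).
  rewrite /cdisc/=; apply: le_trans (qq _ _ _ _ _ _) _ => //; try by have := uns n; have := uns 0%N; lra.
  by rewrite ler_wpM2l//; have := uns n; have := uns 0%N; lra.
have [c _ hc] := compact_seq (@compact_cdisc R _ _) qb.
have qc u : u != 0 -> md u < s / 16 -> md (q u - c) <= L3 * md u.
  move=> u0 us; apply/ler_addgt0Pl => e e0.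
  have [N hN] : exists N : nat, L3 * (s / 32 / N.+1%:R) < e / 2.
    have e2 : 0 < e / 2 by lra.
    have L0 : 0 <= L3 * (s / 32) by apply: mulr_ge0 L3p _; lra.
    have [N hN] := div_small L0 e2.
    by exists N; rewrite mulrA; exact: hN.
  have [n Nn hn] := hc (e / 2) ltac:(lra) N.
  have h1 := qq u (un n) u0 us (unn n) ltac:(by have := uns n; lra).
  have h2 : L3 * md (un n) <= L3 * (s / 32 / N.+1%:R).
    rewrite ler_wpM2l// unE ler_wpM2l//; first by lra.
    by rewrite lef_pV2 ?posrE// ler_nat ltnS.
  apply: le_trans (md_tri _ _ (q (un n))) _.
  apply: le_trans (lerD h1 (ltW hn)) _; rewrite mulrDr [e + _]addrC -addrA lerD2l.
  by have := le_lt_trans h2 hN; lra.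
exists c => e e0; have L3e : 0 < e / (L3 + 1) by rewrite divr_gt0//; lra.
exists (Order.min (s / 16) (e / (L3 + 1))); first by rewrite lt_min L3e andbT; lra.
move=> w; rewrite lt_min => /andP[w1 w2].
have [->|wa] := eqVneq w a; first by rewrite !subrr mulr0 subrr md0 mulr0.
have wa0 : w - a != 0 by rewrite subr_eq0.
have := qc _ wa0 w1; rewrite /q (addrC a) subrK => h1.
have -> : dv f w - dv f a - c * (w - a) = ((dv f w - dv f a) / (w - a) - c) * (w - a) by field.
rewrite mdM ler_wpM2r ?md_ge0//; apply: le_trans h1 _.
have : (L3 + 1) * md (w - a) <= (L3 + 1) * (e / (L3 + 1)) by rewrite ler_wpM2l ?(ltW w2)//; lra.
rewrite (mulrC _ (e / _)) divfK ?gt_eqF//; last by lra.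
by have := md_ge0 (w - a); lra.
Qed.

Definition quot f a z := if z == a then dv f a else (f z - f a) / (z - a).

Lemma quotE f a z : f z = f a + (z - a) * quot f a z.
Proof.
rewrite /quot; case: eqP => [->|/eqP za]; first by rewrite subrr mul0r addr0.
by field; rewrite subr_eq0.
Qed.

(** At [a] the derivative is half the second derivative [c] of [f]: the Taylor remainder [g] has
    derivative at most [e * md (w - a)] on the segment from [a] to [w], and the mean value
    inequality integrates this. *)
Lemma hol_quot D f a : open D -> hol D f -> D a -> hol D (quot f a).
Proof.
move=> oD hf Da z Dz; have [->{z Dz}|za] := eqVneq z a; last first.
  have [d hdd] := hf z Dz.
  exists (((d - 0) * (z - a) - (f z - f a) * (1 - 0)) / (z - a) ^+ 2).
  have za0 : z - a != 0 by rewrite subr_eq0.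
  have p : 0 < md (z - a) by rewrite md_gt0.
  apply: (hd_eq p); last first.
    apply: (@hd_div _ (fun z => f z - f a) (fun z => z - a)) => //.
      by apply: hdB hdd (hd_cst _ _).
    by apply: hdB (hd_id _) (hd_cst _ _).
  move=> w; rewrite inE /disc/= => wz; rewrite /quot; case: eqP => // wa.
  by move: wz; rewrite wa md_distC ltxx.
have [c hc] := hol_dv oD hf Da; exists (c / 2) => e e0.
have [t t0 ht] := hc e e0.
move/open_md : oD => /(_ a Da)[r r0 rD].
exists (Order.min t r) => [|w]; first by rewrite lt_min t0.
rewrite lt_min => /andP[wt wr].
have [->|wa] := eqVneq w a; first by rewrite !subrr mulr0 subrr md0 mulr0.
have wa0 : w - a != 0 by rewrite subr_eq0.
pose g z := f z - f a - dv f a * (z - a) - c / 2 * (z - a) ^+ 2.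
have hg z : D z -> hd g z (dv f z - dv f a - c * (z - a)).
  move=> Dz; have h0 := hdB (hd_id z) (hd_cst a z).
  have := hdB (hdB (hdB (dvP hf Dz) (hd_cst (f a) z)) (hdZ (dv f a) h0)) (hdZ (c / 2) (hdX 2 h0)).
  rewrite /g /= !subr0 mulr1 expr1.
  by have -> : dv f z - dv f a - c / 2 * (2 * (z - a) * 1) = dv f z - dv f a - c * (z - a) by field.
have ga : g a = 0 by rewrite /g !subrr mulr0 expr0n/= mulr0 !subr0.
rewrite /quot eqxx (negbTE wa).
have -> : (f w - f a) / (w - a) - dv f a - c / 2 * (w - a) = (g w - g a) / (w - a).
  by rewrite ga subr0 /g; field.
rewrite md_div ler_pdivrMr ?md_gt0//.
apply: mvi => u /andP[u0 u1].
set z := a + u%:C * (w - a).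
have zE : z - a = u%:C * (w - a) by rewrite /z addrAC subrr add0r.
have zm : md (z - a) <= md (w - a) by rewrite zE mdM mdr ger0_norm// ler_piMl// md_ge0.
exists (dv f z - dv f a - c * (z - a)).
  by apply: hg; apply: rD; exact: le_lt_trans zm wr.
apply: le_trans (ht z _) _; first exact: le_lt_trans zm wt.
by rewrite ler_wpM2l// ltW.
Qed.

Lemma holD D f h : hol D f -> hol D h -> hol D (fun z => f z + h z).
Proof. by move=> hf hh z Dz; have [a ?] := hf z Dz; have [b ?] := hh z Dz; exists (a + b); exact: hdD. Qed.
Lemma holB D f h : hol D f -> hol D h -> hol D (fun z => f z - h z).
Proof. by move=> hf hh z Dz; have [a ?] := hf z Dz; have [b ?] := hh z Dz; exists (a - b); exact: hdB. Qed.
Lemma holM D f h : hol D f -> hol D h -> hol D (fun z => f z * h z).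
Proof. by move=> hf hh z Dz; have [a ha] := hf z Dz; have [b hb] := hh z Dz; eexists; exact: hdM ha hb. Qed.
Lemma holV D f : hol D f -> (forall z, D z -> f z != 0) -> hol D (fun z => (f z)^-1).
Proof. by move=> hf f0 z Dz; have [a ha] := hf z Dz; eexists; exact: hdV (f0 z Dz) ha. Qed.
Lemma holX D f n : hol D f -> hol D (fun z => f z ^+ n).
Proof. by move=> hf z Dz; have [a ha] := hf z Dz; eexists; exact: hdX ha. Qed.
Lemma hol_cst D (c : C) : hol D (fun=> c). Proof. by move=> z _; exists 0; exact: hd_cst. Qed.
Lemma hol_id D : hol D (id : C -> C). Proof. by move=> z _; exists 1; exact: hd_id. Qed.

(** After [e * md (z - a) ^+ 2] is added to the squared modulus, a maximum cannot be interior: over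
    a small circle around it the mean of the sum strictly exceeds the central value. *)
Lemma max_principle a r f M : 0 < r -> (forall z, disc a r z -> exists d, hd f z d) ->
  (forall z, cdisc a r z -> {for z, continuous f}) ->
  (forall z, md (z - a) = r -> md (f z) <= M) -> forall z, cdisc a r z -> md (f z) <= M.
Proof.
move=> r0 hf cf hM z0 z0r.
have M0 : 0 <= M.
  by apply: le_trans (hM (a + r%:C) _); rewrite ?md_ge0// addrAC subrr add0r mdr gtr0_norm.
have [//|nM] := leP (md (f z0)) M; exfalso.
(* On the circle of radius [r] the added term is half the excess of [md (f z0) ^+ 2] over [M ^+ 2],
   so the maximum of [u] is not attained there. *)
pose e := (md (f z0) ^+ 2 - M ^+ 2) / (2 * r ^+ 2).
have r2 : 0 < r ^+ 2 by rewrite exprn_gt0.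
have e0 : 0 < e.
  by rewrite divr_gt0// ?mulr_gt0// subr_gt0 ltr_pXn2r// nnegrE ?md_ge0.
pose u z := md (f z) ^+ 2 + e * md (z - a) ^+ 2.
have cu : {within cdisc a r, continuous u}.
  apply: continuous_in_subspaceT => z; rewrite inE => zr.
  have c1 : {for z, continuous (fun z => md (f z))}.
    by apply: (@continuous_comp _ _ _ f md); [exact: cf|exact: continuous_md].
  have c2 : {for z, continuous (fun z => md (z - a))}.
    apply: (@continuous_comp _ _ _ (fun z => z - a) md); last exact: continuous_md.
    exact: hd_continuous (hdB (hd_id z) (hd_cst a z)).
  have sq (v : C -> R) : {for z, continuous v} -> {for z, continuous (fun z => v z ^+ 2)}.
    move=> cv; apply: (@continuous_comp _ _ _ v (fun x : R => x ^+ 2) z cv).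
    exact: exprn_continuous.
  apply: (@continuousD _ _ _ (fun z => md (f z) ^+ 2) (fun z => e * md (z - a) ^+ 2)).
    exact: sq c1.
  apply: (@continuousM _ _ (fun=> e) (fun z => md (z - a) ^+ 2)); last exact: sq c2.
  exact: cst_continuous.
have [|z1] := compact_EVT_max _ (@compact_cdisc R a r) cu; first by exists z0.
rewrite inE => z1r max1.
have u01 : u z0 <= u z1 by apply: max1; rewrite inE.
have z1i : md (z1 - a) < r.
  rewrite lt_neqAle; apply/andP; split => //; apply/eqP => z1e.
  have h1 := hM z1 z1e.
  have h2 : md (f z1) ^+ 2 <= M ^+ 2 by rewrite ler_pXn2r// nnegrE ?md_ge0.
  have h3 : e * md (z1 - a) ^+ 2 = (md (f z0) ^+ 2 - M ^+ 2) / 2.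
    by rewrite z1e /e; field; rewrite gt_eqF.
  have h4 : M ^+ 2 < md (f z0) ^+ 2 by rewrite ltr_pXn2r// nnegrE ?md_ge0.
  move: u01; rewrite /u h3.
  have : 0 <= e * md (z0 - a) ^+ 2 by rewrite mulr_ge0 ?sqr_ge0// ltW.
  by move: h2 h4; set A := md (f z0) ^+ 2; set B := md (f z1) ^+ 2; set D := _ * _; set E := M ^+ 2; lra.
pose s := r - md (z1 - a).
have s0 : 0 < s by rewrite subr_gt0.
have sub : disc z1 s `<=` disc a r by apply: subset_disc; rewrite /s; lra.
have [k mk kf] : exists2 k : C, md k = 1 & k * f z1 ^+ 2 = (md (f z1) ^+ 2)%:C.
  have [->|f0] := eqVneq (f z1) 0.
    by exists 1; rewrite ?md1// mul1r md0 !expr0n.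
  have m0 : md (f z1) != 0 by rewrite md_eq0.
  have mC : (md (f z1))%:C != 0 :> C by rewrite -md_eq0 mdr normr_eq0.
  exists (((md (f z1))%:C / f z1) ^+ 2).
    by rewrite mdX md_div mdr ger0_norm ?md_ge0// divff// expr1n.
  by rewrite rmorphXn/=; field.
(* The factor [k] makes [g 0] the real number [md (f z1) ^+ 2]; the linear term is the cross term of
   [e * md (z1 + z - a) ^+ 2]. By maximality of [u z1] the real part of [g] on the circle of radius
   [q] is at most [md (f z1) ^+ 2 - e * q ^+ 2], below its own mean. *)
pose g z := k * f (z1 + z) ^+ 2 + ((2 * e)%:C * conjc (z1 - a)) * z.
have hg z : md z < s -> exists d, hd g z d.
  move=> zs; have [|d hdd] := hf (z1 + z).
    by apply: sub; rewrite /disc/= addrAC subrr add0r.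
  by eexists; apply: hdD; [apply: hdZ; exact: hdX (hd_shift hdd)|exact: hdZ (hd_id z)].
have cg : {for 0, continuous g} by have [|d /hd_continuous] := hg 0; rewrite ?md0.
have hg' z : 0 < md z < s -> exists d, hd g z d by move=> /andP[_]; exact: hg.
pose q := s / 2.
have q0 : 0 < q by rewrite divr_gt0.
have qs : q < s by rewrite /q; lra.
have := mvp hg' cg q0 qs; rewrite {2}/g addr0 mulr0 addr0 kf => av.
have : complex.Re (avg g q) <= md (f z1) ^+ 2 - e * q ^+ 2.
  apply: avg_Re; [exact: ltW|exact: hd_ccont hg' q0 qs|move=> z zq].
  have zr : cdisc a r (z1 + z).
    by apply/disc_sub_cdisc/sub; rewrite /disc/= addrAC subrr add0r zq.
  have := max1 (z1 + z); rewrite inE => /(_ zr); rewrite /u.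
  have -> : md (z1 + z - a) ^+ 2 = md (z1 - a) ^+ 2 + q ^+ 2 +
      2 * complex.Re (conjc (z1 - a) * z).
    rewrite -zq !md_sqr; case: (z1) (a) (z) => [x1 y1] [x2 y2] [x3 y3] /=; ring.
  have -> : complex.Re (g z) = complex.Re (k * f (z1 + z) ^+ 2) +
      2 * e * complex.Re (conjc (z1 - a) * z).
    rewrite /g raddfD/= -mulrA.
    have -> c w : complex.Re (c%:C * w) = c * complex.Re w by case: w => x y /=; rewrite mul0r subr0.
    by [].
  have : complex.Re (k * f (z1 + z) ^+ 2) <= md (f (z1 + z)) ^+ 2.
    by apply: le_trans (Re_le_md _) _; rewrite mdM mk mul1r mdX.
  set A := complex.Re _; set B := complex.Re _; set D := md (f (z1 + z)) ^+ 2.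
  by rewrite !mulrDr; set E := md (f z1) ^+ 2; set F := md _ ^+ 2; set G := q ^+ 2; lra.
rewrite av /=; have : 0 < e * q ^+ 2 by rewrite mulr_gt0// exprn_gt0.
by set E := md (f z1) ^+ 2; set G := e * _; lra.
Qed.

(** If [w] were omitted, the maximum principle for [(f z - w)^-1] would give [e <= md (f a - w)],
    since on the circle [md (f z - w)] is at least [2 * e - e]. *)
Lemma open_mapping a r f (e : R) : 0 < r -> 0 < e -> (forall z, disc a r z -> exists d, hd f z d) ->
  (forall z, cdisc a r z -> {for z, continuous f}) ->
  (forall z, md (z - a) = r -> 2 * e <= md (f z - f a)) ->
  disc (f a) e `<=` f @` disc a r.
Proof.
move=> r0 e0 hf cf hM w we; apply: contrapT => nw.
have nz z : cdisc a r z -> f z - w != 0.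
  move=> zr; rewrite subr_eq0; apply/eqP => fzw.
  have : md (z - a) < r.
    rewrite lt_neqAle zr andbT; apply/eqP => /hM.
    by rewrite fzw; move: we; rewrite /disc/= ; lra.
  by move=> h; apply: nw; exists z.
have := @max_principle a r (fun z => (f z - w)^-1) (e^-1) r0.
move=> /(_ _ _ _ a)/=; rewrite mdV.
have aw : 0 < md (f a - w).
  by rewrite md_gt0 nz// /cdisc/= subrr md0 ltW.
have H : (md (f a - w))^-1 <= e^-1 -> False.
  by rewrite lef_pV2 ?posrE// md_distC; move: we; rewrite /disc/=; lra.
move=> h; apply: H; apply: h.
- move=> z zr; have [d hdd] := hf z zr; eexists; apply: hdV.
    by apply: nz; exact: disc_sub_cdisc.
  exact: hdB hdd (hd_cst w z).
- move=> z zr; apply: (@continuous_comp _ _ _ (fun z => f z - w) (fun z => z^-1)).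
    apply: (@continuousB _ _ _ f (fun=> w)); [exact: cf|exact: cst_continuous].
  exact: hd_continuous (hd_inv (nz z zr)).
- move=> z zr; have zr' : cdisc a r z by rewrite /cdisc/= zr.
  rewrite mdV lef_pV2 ?posrE ?md_gt0 ?nz//.
  have := hM z zr; have := md_tri (f z) (f a) w; rewrite (md_distC w).
  by move: we; rewrite /disc/= (md_distC w); lra.
- by rewrite /cdisc/= subrr md0 ltW.
Qed.

Lemma hol_zero_dv a s f : 0 < s -> hol (disc a s) f -> (forall z, disc a s z -> dv f z = 0) ->
  forall z, disc a s z -> f z = f a.
Proof.
move=> s0 hf h z zs; apply/eqP; rewrite -subr_eq0 -md_eq0 eq_le md_ge0 andbT.
rewrite -[X in _ <= X](mul0r (md (z - a))).
by apply: (mvi_disc hf) => // [w /h ->|]; rewrite ?md0//; exact: disc_center.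
Qed.

Lemma liouville f M : hol setT f -> (forall z, md (f z) <= M) -> forall z, f z = f 0.
Proof.
move=> hf hM z; apply: (@hol_zero_dv 0 (md z + 1)); first by have := md_ge0 z; lra.
- exact: hol_sub hf.
- move=> w _; apply/eqP; rewrite -md_eq0 eq_le md_ge0 andbT.
  apply/ler_addgt0Pl => e e0; rewrite addr0.
  have M0 : 0 <= M by apply: le_trans (hM 0); exact: md_ge0.
  have p : 0 < (2 * M + 1) / e by rewrite divr_gt0//; lra.
  apply: le_trans (cauchy_dv p (hol_sub (@subsetT _ _) hf) (fun z _ => hM z)) _.
  rewrite invf_div mulrA ler_pdivrMr; last by lra.
  by rewrite mulrC ler_wpM2l ?(ltW e0)//; lra.
- by rewrite /disc/= subr0; lra.
Qed.

End Holomorphic.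

(** * Continuous logarithms and univalent functions *)

Section Logarithm.
Context {R : realType}.
Local Notation C := R[i].
Implicit Types (z w a u : C) (t r : R).

(** Connectedness as an induction principle with neighbourhoods relative to [A], the form used by
    continuation arguments. *)
Lemma conn_clopen (X : topologicalType) (A P : set X) x y : connected A ->
  (forall x, A x -> P x -> \forall y \near x, A y -> P y) ->
  (forall x, A x -> ~ P x -> \forall y \near x, A y -> ~ P y) ->
  A x -> P x -> A y -> P y.
Proof.
move=> cA h1 h2 Ax Px Ay.
pose O1 := interior [set y | A y -> P y].
pose O2 := interior [set y | A y -> ~ P y].
have B1 : A `&` P = A `&` O1.
  apply/seteqP; split => z [Az Pz]; split => //; first exact: h1.
  by apply: (nbhs_singleton Pz).
have B2 : A `&` P = A `&` ~` O2.
  apply/seteqP; split => z [Az Pz]; split => //.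
    by move=> /nbhs_singleton/(_ Az).
  by apply: contrapT => nP; apply: Pz; exact: h2.
have : A `&` P = A.
  apply: cA; first by exists x.
  - by exists O1 => //; exact: open_interior.
  - by exists (~` O2) => //; apply: open_closedC; exact: open_interior.
by move=> e; have : A y by []; rewrite -e => -[].
Qed.

Lemma connected_disc a r : connected (disc a r : set C).
Proof.
have [r0|r0] := ltP 0 r; last first.
  rewrite (_ : disc a r = set0); first exact: connected0.
  by apply/seteqP; split => z //; rewrite /disc/= => /lt_le_trans/(_ r0); rewrite ltNge md_ge0.
rewrite (_ : disc a r = \bigcup_(z in disc a r) ((fun t : R => a + t%:C * (z - a)) @` `[0, 1]%classic)); last first.
  apply/seteqP; split => [z zr|z [w wr [t /=]]].
    exists z => //; exists 1; first by rewrite /= in_itv/= ler01 lexx.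
    by rewrite mul1r addrC subrK.
  rewrite in_itv/= => t01 <-; apply: seg_disc => //; exact: disc_center.
apply: bigcup_connected.
  exists a => z _; exists 0; first by rewrite /= in_itv/= ler01 lexx.
  by rewrite mul0r addr0.
move=> z _; apply: connected_continuous_connected; first exact: segment_connected.
apply: within_contI => t _; apply/contTP => e e0.
have p : 0 < e / (md (z - a) + 1) by rewrite divr_gt0// ltr_wpDl ?md_ge0.
apply/nbhs_ballP; exists (e / (md (z - a) + 1)) => // s.
rewrite /ball/= ltr_pdivlMr ?ltr_wpDl ?md_ge0// => h.
rewrite opprD addrACA subrr add0r -mulrBl -rmorphB mdM mdr distrC.
by apply: le_lt_trans h; rewrite ler_wpM2l// lerDl ler01.
Qed.

Lemma contX_T (X Y : topologicalType) (f : X -> Y) (g : Y -> C) x : {for x, continuous f} ->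
  {for f x, continuous g} -> {for x, continuous (fun y => g (f y))}.
Proof. by move=> cf /contTP cg; apply/contTP => e e0; exact: cf _ (cg e e0). Qed.

Lemma contXR_T (X Y : topologicalType) (f : X -> Y) (g : Y -> R) x : {for x, continuous f} ->
  {for f x, continuous g} -> {for x, continuous (fun y => g (f y))}.
Proof. by move=> cf cg A /cg hA; exact: cf _ hA. Qed.

Lemma contC_T (X : topologicalType) (f : X -> C) (g : C -> C) x : {for x, continuous f} ->
  {for f x, continuous g} -> {for x, continuous (fun y => g (f y))}.
Proof.
move=> /contTP cf /contP cg; apply/contTP => e /cg[t t0 ht].
by apply: filterS (cf t t0) => y /ht.
Qed.

Lemma contCR_T (X : topologicalType) (f : X -> C) (g : C -> R) x : {for x, continuous f} ->
  {for f x, continuous g} -> {for x, continuous (fun y => g (f y))}.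
Proof.
move=> /contTP cf /contRP cg; apply/cvgrPdist_lt => e /cg[t t0 ht].
by apply: filterS (cf t t0) => y /ht; rewrite distrC.
Qed.

Lemma contD_T (X : topologicalType) (f g : X -> C) x : {for x, continuous f} ->
  {for x, continuous g} -> {for x, continuous (fun y => f y + g y)}.
Proof.
move=> /contTP cf /contTP cg; apply/contTP => e e0; have e2 : 0 < e / 2 by lra.
apply: filterS2 (cf _ e2) (cg _ e2) => y h1 h2.
rewrite opprD addrACA; apply: le_lt_trans (mdD _ _) _; lra.
Qed.

Lemma contN_T (X : topologicalType) (f : X -> C) x : {for x, continuous f} ->
  {for x, continuous (fun y => - f y)}.
Proof.
move=> /contTP cf; apply/contTP => e e0.
by apply: filterS (cf _ e0) => y; rewrite -opprD mdN.
Qed.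

Lemma contB_T (X : topologicalType) (f g : X -> C) x : {for x, continuous f} ->
  {for x, continuous g} -> {for x, continuous (fun y => f y - g y)}.
Proof. by move=> cf cg; exact: contD_T cf (contN_T cg). Qed.

Lemma contM_T (X : topologicalType) (f g : X -> C) x : {for x, continuous f} ->
  {for x, continuous g} -> {for x, continuous (fun y => f y * g y)}.
Proof.
move=> /contTP cf /contTP cg; apply/contTP => e e0.
pose M := md (f x) + md (g x) + 1.
have M0 : 0 < M by rewrite /M; have := md_ge0 (f x); have := md_ge0 (g x); lra.
have m0 : 0 < Order.min 1 (e / (2 * M)) by rewrite lt_min ltr01 divr_gt0// mulr_gt0.
apply: filterS2 (cf _ m0) (cg _ m0) => y; rewrite !lt_min => /andP[h1 h2] /andP[_ h4].
have -> : f y * g y - f x * g x = (f y - f x) * g x + f y * (g y - g x) by ring.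
apply: le_lt_trans (mdD _ _) _; rewrite !mdM.
have fy : md (f y) <= M by have := md_subl (f y) (f x); have := md_ge0 (g x); rewrite /M; lra.
have gx : md (g x) <= M by have := md_ge0 (f x); rewrite /M; lra.
have k1 : md (f y - f x) * md (g x) <= md (f y - f x) * M by rewrite ler_wpM2l ?md_ge0.
have k2 : md (f y) * md (g y - g x) <= M * md (g y - g x) by rewrite ler_wpM2r ?md_ge0.
move: h2 h4; rewrite !ltr_pdivlMr ?mulr_gt0//; lra.
Qed.

Lemma contV_T (X : topologicalType) (f : X -> C) x : f x != 0 -> {for x, continuous f} ->
  {for x, continuous (fun y => (f y)^-1)}.
Proof. by move=> f0 cf; apply: contC_T cf (hd_continuous (hd_inv f0)). Qed.

Lemma contRC_T (X : topologicalType) (f : X -> R) x : {for x, continuous f} ->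
  {for x, continuous (fun y => (f y)%:C)}.
Proof. by move=> cf; exact: contX_T cf (@continuous_realC R _). Qed.

Lemma contReIm_T (X : topologicalType) (f : X -> C) x : {for x, continuous (fun y => complex.Re (f y))} ->
  {for x, continuous (fun y => complex.Im (f y))} -> {for x, continuous f}.
Proof. by move=> cr ci; exact: (@cvg_ReIm R X (nbhs x) _ f (f x) cr ci). Qed.

Lemma cont_pair (X Y Z : topologicalType) (f : X -> Y) (g : X -> Z) x : {for x, continuous f} ->
  {for x, continuous g} -> {for x, continuous (fun y => (f y, g y))}.
Proof. by move=> cf cg; exact: (@cvg_pair _ _ _ (nbhs x) (nbhs (f x)) (nbhs (g x)) _ _ _ f g). Qed.

Lemma contfst (X Y : topologicalType) (p : X * Y) : {for p, continuous (fun p : X * Y => p.1)}.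
Proof. by move=> A; exact: cvg_fst. Qed.

Lemma contsnd (X Y : topologicalType) (p : X * Y) : {for p, continuous (fun p : X * Y => p.2)}.
Proof. by move=> A; exact: cvg_snd. Qed.

Lemma contid (X : topologicalType) (x : X) : {for x, continuous (fun y : X => y)}.
Proof. by []. Qed.

Lemma contcst (X Y : topologicalType) (c : Y) (x : X) : {for x, continuous (fun _ : X => c)}.
Proof. exact: cst_continuous. Qed.

(** The principal logarithm, meaningful on the right half-plane only. *)
Definition plog u : C := ln (md u) +i* atan (complex.Im u / complex.Re u).

Lemma cexp_plog u : 0 < complex.Re u -> cexp (plog u) = u.
Proof.
case: u => x y /= x0; set t := y / x.
have m : md (x +i* y) = x * Num.sqrt (1 + t ^+ 2).
  rewrite /=; have -> : x ^+ 2 + y ^+ 2 = x ^+ 2 * (1 + t ^+ 2) by rewrite /t; field; rewrite gt_eqF.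
  by rewrite sqrtrM ?sqr_ge0// sqrtr_sqr gtr0_norm.
have s0 : 0 < Num.sqrt (1 + t ^+ 2) by rewrite sqrtr_gt0; have := sqr_ge0 t; lra.
have mp : 0 < md (x +i* y) by rewrite m mulr_gt0.
have c : cos (atan t) = (Num.sqrt (1 + t ^+ 2))^-1 by exact: cos_atan.
have c0 : cos (atan t) != 0 by rewrite c invr_eq0 gt_eqF.
have s : sin (atan t) = t * cos (atan t).
  by rewrite -{2}(atanK t) /tan divfK.
rewrite /cexp/= lnK ?posrE//.
rewrite /cis s c -/(md (x +i* y)) m.
by apply/eqP; rewrite eq_complex/= /t; apply/andP; split; apply/eqP; field; rewrite ?gt_eqF.
Qed.

Lemma plog1 : plog 1 = 0.
Proof. by rewrite /plog md1 ln1 /= mul0r atan0. Qed.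

Lemma continuous_plog u : 0 < complex.Re u -> {for u, continuous plog}.
Proof.
move=> u0; have m0 : 0 < md u by rewrite md_gt0; apply: contraTneq u0 => ->; rewrite ltxx.
apply: contReIm_T => /=.
  by apply: (@contXR_T _ _ md (@ln R)); [exact: continuous_md|exact: continuous_ln].
apply: (@contXR_T _ _ (fun u : C => complex.Im u / complex.Re u) (@atan R)); last exact: continuous_atan.
apply: (@continuousM _ _ (@complex.Im R) (fun u : C => (complex.Re u)^-1)).
  exact: continuous_Im.
by apply: (@continuousV _ _ (@complex.Re R)); [rewrite gt_eqF|exact: continuous_Re].
Qed.

Lemma Re_near1 u : md (u - 1) < 1 -> 0 < complex.Re u.
Proof.
move=> h; have := le_lt_trans (md_Re (u - 1)) h; rewrite raddfB/= ltr_norml; lra.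
Qed.

(* A homotopy in the punctured plane, parametrized by a compact space, has a
   continuous logarithm. *)
Lemma log_lift (X : topologicalType) (K : set X) (F : R -> X -> C) : compact K ->
  (forall t x, 0 <= t <= 1 -> K x -> {for (t, x), continuous (fun p : R * X => F p.1 p.2)}) ->
  (forall t x, 0 <= t <= 1 -> K x -> F t x != 0) ->
  exists l : X -> C, [/\ forall x, K x -> {for x, continuous l},
    forall x, K x -> cexp (l x) = F 1 x / F 0 x &
    forall x, K x -> (forall t, 0 <= t <= 1 -> F t x = F 0 x) -> l x = 0].
Proof.
move=> cK cF F0.
have cFt t x : 0 <= t <= 1 -> K x -> {for x, continuous (F t)}.
  move=> t01 Kx; apply: (@contX_T _ _ (fun x => (t, x)) (fun p : R * X => F p.1 p.2)); last exact: cF.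
  by apply: cont_pair; [exact: contcst|exact: contid].
pose P (a b _ _ : R) := exists l : X -> C, [/\ forall x, K x -> {for x, continuous l},
    forall x, K x -> cexp (l x) = F b x / F a x &
    forall x, K x -> (forall t, 0 <= t <= 1 -> F t x = F 0 x) -> l x = 0].
suff : P 0 1 0 0 by [].
refine (@rect_bisect R P 0 1 0 0 ler01 (lexx 0) _ _); rewrite /P.
  move=> a b c d a0 ab b1 _ _ _ [l1 [c1 e1 z1]] [l2 [c2 e2 z2]] _ _.
  exists (fun x => l1 x + l2 x); split => x Kx.
  - by apply: contD_T; [exact: c1|exact: c2].
  - rewrite cexpD e1// e2//.
    have m01 : 0 <= (a + b) / 2 <= 1.
      by rewrite (le_trans a0 (mid_l ab)) (le_trans (mid_r ab) b1).
    have n1 := F0 _ _ m01 Kx; have n2 := F0 a x ltac:(by rewrite a0 (le_trans ab)) Kx.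
    by rewrite mulrC mulrA divfK.
  - by move=> h; rewrite z1// z2// addr0.
move=> t y0 t01 _.
(* By compactness this holds for all [x] in [K] at once when [s] is near [t]. Two numbers within
   [1 / 3] of [1] have a quotient within [1] of [1], hence in the right half-plane, where [plog]
   applies. *)
pose Q (s : R) x := 0 <= s <= 1 -> K x -> md (F s x / F t x - 1) < 1 / 3.
have nearQ : \forall s \near t, forall x, K x -> Q s x.
  have := cK; rewrite compact_near_coveringP => /(_ R (nbhs t) Q _); apply.
  move=> x Kx.
  pose G (p : X * R) := F p.2 p.1 / F t p.1.
  have cG : {for (x, t), continuous G}.
    apply: (@contM_T _ (fun p : X * R => F p.2 p.1) (fun p : X * R => (F t p.1)^-1)).
      apply: (@contX_T _ _ (fun p : X * R => (p.2, p.1)) (fun p : R * X => F p.1 p.2)); last exact: cF.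
      by apply: cont_pair; [exact: contsnd|exact: contfst].
    apply: (@contV_T _ (fun p : X * R => F t p.1)); first exact: F0.
    by apply: (@contX_T _ _ (fun p : X * R => p.1) (F t)); [exact: contfst|exact: cFt].
  have /contTP/(_ (1 / 3)) := cG; rewrite /G/= divff ?F0// => /(_ ltac:(lra)).
  apply: filterS => p /= hp; rewrite /Q => _ _; exact: hp.
have [e e0 he] : exists2 e, 0 < e & forall s, `|s - t| < e -> forall x, K x -> Q s x.
  by have /nbhs_ballP[e /= e0 he] := nearQ; exists e => // s st; apply: he; rewrite /ball/= distrC.
exists e => // a b c d a0 at_ tb b1 _ _ _ _ bat _.
have ab01 : 0 <= a <= 1 by rewrite a0 (le_trans at_ (le_trans tb b1)).
have bb01 : 0 <= b <= 1 by rewrite b1 (le_trans a0 (le_trans at_ tb)).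
have ha : `|a - t| < e by rewrite distrC ger0_norm ?subr_ge0//; apply: le_lt_trans bat; rewrite lerB.
have hb : `|b - t| < e by rewrite ger0_norm ?subr_ge0//; apply: le_lt_trans bat; rewrite lerB.
have near1 x : K x -> 0 < complex.Re (F b x / F a x).
  move=> Kx; apply: Re_near1.
  have h1 := he a ha x Kx ab01 Kx; have h2 := he b hb x Kx bb01 Kx.
  have n1 := F0 t x t01 Kx; have n2 := F0 a x ab01 Kx.
  set p := F a x / F t x in h1 *; set q := F b x / F t x in h2 *.
  have p0 : p != 0 by rewrite mulf_neq0// invr_eq0.
  have -> : F b x / F a x - 1 = (q - p) / p.
    by rewrite mulrBl divff// /p /q invf_div mulrA divfK.
  rewrite md_div ltr_pdivrMr ?md_gt0// mul1r.
  have : md (q - p) <= md (q - 1) + md (p - 1) by rewrite (md_distC p); exact: md_tri.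
  have := md_subl 1 p; rewrite md1 md_distC; lra.
exists (fun x => plog (F b x / F a x)); split => x Kx.
- apply: (@contC_T _ (fun x => F b x / F a x)); last exact/continuous_plog/near1.
  apply: contM_T; first exact: cFt.
  by apply: contV_T; [exact: F0|exact: cFt].
- exact/cexp_plog/near1.
- by move=> h; rewrite (h b)// -(h a)// divff ?F0// plog1.
Qed.

Lemma cexp_eq1 (d : C) : cexp d = 1 -> md d < 1 -> d = 0.
Proof.
move=> h dl; have := md_cexp d; rewrite h md1 => /esym e1.
have re0 : complex.Re d = 0 by apply: expR_inj; rewrite e1 expR0.
have : cis (complex.Im d) = 1 :> C by rewrite -h /cexp re0 expR0 mul1r.
move=> [_ s0]; have il : `|complex.Im d| < 1 := le_lt_trans (md_Im d) dl.
have pi1 : 2 <= pi :> R by exact: pi_ge2.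
suff im0 : complex.Im d = 0 by case: (d) re0 im0 => x y /= -> ->.
move: il; rewrite ltr_norml => /andP[i1 i2].
have [ip|im|//] := ltgtP 0 (complex.Im d).
  by have := @sin_gt0_pi R (complex.Im d); rewrite s0 ltxx => /(_ ltac:(lra)).
have := @sin_gt0_pi R (- complex.Im d); rewrite sinN s0 oppr0 ltxx.
by move=> /(_ ltac:(lra)).
Qed.

Lemma log_unique (X : topologicalType) (A : set X) (l1 l2 : X -> C) x y : connected A ->
  (forall x, A x -> {for x, continuous l1}) -> (forall x, A x -> {for x, continuous l2}) ->
  (forall x, A x -> cexp (l1 x) = cexp (l2 x)) -> A x -> l1 x = l2 x -> A y -> l1 y = l2 y.
Proof.
move=> cA c1 c2 h Ax e Ay.
have e1 (z : X) : A z -> cexp (l1 z - l2 z) = 1.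
  by move=> Az; apply: (mulIf (cexp_neq0 (l2 z))); rewrite -cexpD subrK mul1r h.
have cd (z : X) : A z -> {for z, continuous (fun x => l1 x - l2 x)}.
  by move=> Az; apply: contB_T; [exact: c1|exact: c2].
apply: (conn_clopen (P := [set z | l1 z = l2 z]) cA _ _ Ax e Ay) => z Az /=.
  move=> ez; have /contTP/(_ 1 ltr01) := cd z Az; rewrite ez subrr.
  apply: filterS => w; rewrite subr0 => wl Aw; apply/eqP; rewrite -subr_eq0.
  by apply/eqP/cexp_eq1 => //; exact: e1.
move=> nz; have p : 0 < md (l1 z - l2 z) by rewrite md_gt0 subr_eq0; exact/eqP.
have /contTP/(_ _ p) := cd z Az.
by apply: filterS => w wl Aw ew; move: wl; rewrite ew subrr sub0r mdN ltxx.
Qed.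

Lemma cexp_surj z : z != 0 -> exists w, cexp w = z.
Proof.
move=> z0.
have rot (k : C) : (exists v, cexp v = k) -> 0 < complex.Re (z / k) -> exists w, cexp w = z.
  move=> [v vk] h; exists (plog (z / k) + v).
  by rewrite cexpD cexp_plog// vk divfK// -vk cexp_neq0.
have hcis x : exists v, cexp v = cis x :> C.
  by exists (0 +i* x); rewrite /cexp/= expR0 mul1r.
have cp : cis (pi / 2) = 'i%C :> C by rewrite /cis cos_pihalf sin_pihalf.
have [p|n|e] := ltgtP 0 (complex.Re z).
- by apply: (rot 1); rewrite ?divr1//; exists 0; exact: cexp0.
- apply: (rot (-1)); first by rewrite -cis_pi; exact: hcis.
  by rewrite invrN invr1 mulrN1 raddfN/=; lra.
have [p|n|e'] := ltgtP 0 (complex.Im z).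
- apply: (rot 'i%C); first by rewrite -cp; exact: hcis.
  have -> : z / 'i%C = - (z * 'i%C).
    have ii : ('i%C : C) * 'i%C = -1 by rewrite -expr2 sqr_i.
    have i0 : ('i%C : C) != 0 by rewrite -md_eq0 md_i oner_eq0.
    by apply: (mulIf i0); rewrite divfK// mulNr -mulrA ii mulrN1 opprK.
  by rewrite raddfN/= ReiNIm; lra.
- apply: (rot (- 'i%C)).
    by rewrite -mulN1r -cis_pi -cp -cisD; exact: hcis.
  have -> : z / - 'i%C = z * 'i%C.
    have ii : ('i%C : C) * 'i%C = -1 by rewrite -expr2 sqr_i.
    have i0 : (- 'i%C : C) != 0 by rewrite oppr_eq0 -md_eq0 md_i oner_eq0.
    by apply: (mulIf i0); rewrite divfK// mulrN -mulrA ii mulrN1 opprK.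
  by rewrite ReiNIm; lra.
- by move: z0; rewrite -[z]/z; case: (z) e e' => x y /= <- <-; rewrite eqxx.
Qed.

Lemma log_cdisc a r (F : C -> C) : 0 <= r -> (forall z, cdisc a r z -> {for z, continuous F}) ->
  (forall z, cdisc a r z -> F z != 0) ->
  exists l : C -> C, [/\ forall z, cdisc a r z -> {for z, continuous l},
     forall z, cdisc a r z -> cexp (l z) = F z / F a & l a = 0].
Proof.
move=> r0 cF F0.
have sub t z : 0 <= t <= 1 -> cdisc a r z -> cdisc a r (a + t%:C * (z - a)).
  move=> /andP[t0 t1]; rewrite /cdisc/= addrAC subrr add0r mdM mdr ger0_norm// => h.
  by apply: le_trans h; rewrite ler_piMl// md_ge0.
have [|||l [l1 l2 l3]] := @log_lift C (cdisc a r) (fun t z => F (a + t%:C * (z - a))).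
- exact: compact_cdisc.
- move=> t z t01 zr.
  apply: (@contC_T _ (fun p : R * C => a + p.1%:C * (p.2 - a)) F); last exact/cF/sub.
  apply: contD_T; first exact: contcst.
  apply: contM_T; first by apply: contRC_T; exact: contfst.
  by apply: contB_T; [exact: contsnd|exact: contcst].
- by move=> t z t01 zr; apply/F0/sub.
have aa : cdisc a r a by rewrite /cdisc/= subrr md0.
exists l; split => //.
- by move=> z zr; rewrite l2// mul1r mul0r addr0 addrC subrK.
- by apply: l3 => // t t01; rewrite subrr !mulr0.
Qed.

(** Logarithms on smaller closed discs, normalized at [a], agree on overlaps by uniqueness. *)
Lemma log_disc a r (F : C -> C) : 0 < r -> (forall z, disc a r z -> {for z, continuous F}) ->
  (forall z, disc a r z -> F z != 0) ->
  exists l : C -> C, [/\ forall z, disc a r z -> {for z, continuous l} &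
     forall z, disc a r z -> cexp (l z) = F z].
Proof.
move=> r0 cF F0.
have sub s : 0 < s < r -> cdisc a s `<=` disc a r by move=> /andP[_ ?]; exact: cdisc_sub_disc.
have ex s : exists l : C -> C, 0 < s < r -> [/\ forall z, cdisc a s z -> {for z, continuous l},
     forall z, cdisc a s z -> cexp (l z) = F z / F a & l a = 0].
  have [sr|ns] := pselect (0 < s < r); last by exists (fun=> 0) => /ns.
  have [||| l hl] := @log_cdisc a s F.
  - by case/andP: sr => /ltW.
  - by move=> z /(sub _ sr); exact: cF.
  - by move=> z /(sub _ sr); exact: F0.
  by exists l.
have [L hL] := choice ex.
(* Strictly between [md (z - a)] and [r]: [z] is interior to the disc whose logarithm is used at
   [z]. *)
pose rho z := (md (z - a) + r) / 2.
have hr z : disc a r z -> 0 < rho z < r /\ md (z - a) < rho z.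
  rewrite /disc/= /rho; have := md_ge0 (z - a) => h1 h2; split; lra.
have agree s t z : 0 < s < r -> 0 < t < r -> disc a s z -> disc a t z -> L s z = L t z.
  move=> sr tr zs zt.
  have [c1 e1 z1] := hL s sr; have [c2 e2 z2] := hL t tr.
  pose q := Order.min s t.
  have q1 : disc a q `<=` disc a s by apply: subset_disc; rewrite subrr md0 add0r ge_min lexx.
  have q2 : disc a q `<=` disc a t by apply: subset_disc; rewrite subrr md0 add0r ge_min lexx orbT.
  apply: (@log_unique _ (disc a q) (L s) (L t) a z (@connected_disc a q)).
  - by move=> w /q1/disc_sub_cdisc; exact: c1.
  - by move=> w /q2/disc_sub_cdisc; exact: c2.
  - by move=> w wq; rewrite e1 ?e2//; apply: disc_sub_cdisc; [exact: q2|exact: q1].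
  - by apply: disc_center; rewrite lt_min; case/andP: sr => -> _; case/andP: tr => ->.
  - by rewrite z1 z2.
  - by rewrite /disc/= lt_min; apply/andP.
have [c hc] := cexp_surj (F0 a (disc_center a r0)).
exists (fun z => L (rho z) z + c); split => z zr; have [rz zz] := hr z zr.
  apply: (@contD_T _ (fun z => L (rho z) z)); last exact: contcst.
  have [c1 _ _] := hL _ rz.
  have cz : {for z, continuous (L (rho z))} by apply: c1; exact: ltW.
  have /contP hcz := cz; apply/contP => e e0; have [t t0 ht] := hcz e e0.
  have /open_md/(_ z zz)[s s0 hs] := @open_disc R a (rho z).
  exists (Order.min t s) => [|w]; first by rewrite lt_min t0.
  rewrite lt_min => /andP[/ht wt /hs ws].
  have wr : disc a r w by move: ws; rewrite /disc/= => /lt_trans; apply; case/andP: rz.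
  have [rw ww] := hr w wr.
  by rewrite (agree (rho w) (rho z) w rw rz ww ws).
by have [_ e1 _] := hL _ rz; rewrite cexpD hc e1 ?divfK ?F0//; [exact: disc_center|exact: ltW].
Qed.

Lemma sqrt_disc a r (F : C -> C) : 0 < r -> (forall z, disc a r z -> {for z, continuous F}) ->
  (forall z, disc a r z -> F z != 0) ->
  exists s : C -> C, (forall z, disc a r z -> {for z, continuous s}) /\
     (forall z, disc a r z -> s z ^+ 2 = F z).
Proof.
move=> r0 cF F0; have [l [l1 l2]] := log_disc r0 cF F0.
exists (fun z => cexp (2^-1 * l z)); split => z zr.
  apply: (@contC_T _ (fun z => 2^-1 * l z) cexp); last exact: hd_continuous (hd_cexp _).
  by apply: contM_T; [exact: contcst|exact: l1].
rewrite expr2 -cexpD -mulrDl.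
have -> : 2^-1 + 2^-1 = 1 :> C by field.
by rewrite mul1r l2.
Qed.

(** [s w - s z] is the difference of the squares divided by [s w + s z], which stays away from [0]
    by continuity. *)
Lemma hd_sqrt (s : C -> C) z q : {for z, continuous s} -> s z != 0 ->
  hd (fun w => s w ^+ 2) z q -> hd s z (q / (2 * s z)).
Proof.
move=> cs s0 hq e e0.
have p : 0 < md (s z) by rewrite md_gt0.
have e1 : 0 < e * md (s z) / 2 by rewrite divr_gt0 ?mulr_gt0.
have [t t0 ht] := hq _ e1.
have q0 : 0 < md q + 1 by rewrite ltr_wpDl ?md_ge0.
have m1 : 0 < Order.min (md (s z)) (e * md (s z) ^+ 2 / (md q + 1)).
  by rewrite lt_min p/= divr_gt0// mulr_gt0// exprn_gt0.
have /contP/(_ _ m1)[r r0 hr] := cs.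
exists (Order.min t r) => [|w]; first by rewrite lt_min t0.
rewrite lt_min => /andP[/ht h1 /hr]; rewrite lt_min => /andP[h2 h3].
have sw : md (s z) < md (s w + s z).
  have -> : s w + s z = 2 * s z + (s w - s z) by ring.
  have := md_addl (2 * s z) (s w - s z); rewrite mdM md_nat; lra.
have n0 : s w + s z != 0 by rewrite -md_gt0; apply: lt_trans sw.
have -> : s w - s z - q / (2 * s z) * (w - z) =
    ((s w ^+ 2 - s z ^+ 2 - q * (w - z)) + q * (w - z) * (s z - s w) / (2 * s z)) / (s w + s z).
  by field; rewrite s0 n0.
rewrite md_div ler_pdivrMr ?md_gt0//.
apply: le_trans (mdD _ _) _; rewrite md_div !mdM md_nat (md_distC (s z)).
set h := md (w - z) in h1 *; have h0 : 0 <= h by exact: md_ge0.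
have k : md q * h * md (s w - s z) / (2 * md (s z)) <= e * md (s z) / 2 * h.
  rewrite ler_pdivrMr ?mulr_gt0//.
  have -> : e * md (s z) / 2 * h * (2 * md (s z)) = h * (e * md (s z) ^+ 2) by field.
  rewrite -mulrA mulrCA ler_wpM2l//.
  move: h3; rewrite ltr_pdivlMr// mulrDr mulr1 => h3.
  by rewrite mulrC; have := md_ge0 (s w - s z); lra.
have k2 : e * h * md (s z) <= e * h * md (s w + s z).
  by rewrite ler_wpM2l ?(ltW sw)// mulr_ge0// ltW.
apply: le_trans (lerD h1 k) _; apply: le_trans k2.
by rewrite le_eqVlt; apply/orP; left; apply/eqP; field.
Qed.

End Logarithm.

(** * Distortion of univalent functions *)

Section Univalent.
Context {R : realType}.
Local Notation C := R[i].
Implicit Types (F f : C -> C) (z w a u : C) (r e M : R).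

Definition inj (D : set C) F := forall z w, D z -> D w -> F z = F w -> z = w.

Lemma inj_sub (D E : set C) F : E `<=` D -> inj D F -> inj E F.
Proof. by move=> s h z w /s Dz /s Dw; exact: h. Qed.

(** Injectivity makes the minimum of [md (F z - F a)] over the circle of radius [s] positive; half
    of it is a radius for [open_mapping]. *)
Lemma inj_open a r F s : 0 < s -> s < r -> hol (disc a r) F -> inj (disc a r) F ->
  exists2 e, 0 < e & disc (F a) e `<=` F @` disc a s.
Proof.
move=> s0 sr hF iF.
have sub : cdisc a s `<=` disc a r by exact: cdisc_sub_disc.
have ra : disc a r a by apply: disc_center; exact: lt_trans sr.
pose K := [set z | md (z - a) = s].
have KD z : K z -> disc a r z by rewrite /K/= /disc/= => ->.
have cK : compact K.
  apply: (@compact_md R K (md a + s)); last first.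
    by move=> z Kz; have := md_subl z a; rewrite Kz; lra.
  move=> z /closure_md h; apply/eqP; rewrite -subr_eq0 -normr_le0.
  apply/ler_addgt0Pl => e e0; rewrite addr0; have [w Kw wz] := h e e0.
  have := md_subl (z - a) (w - a); have := md_subl (w - a) (z - a); rewrite Kw.
  have -> : w - a - (z - a) = w - z by ring.
  have -> : z - a - (w - a) = z - w by ring.
  by rewrite (md_distC z w) ler_norml; lra.
have K0 : K !=set0 by exists (a + s%:C); rewrite /K/= addrAC subrr add0r mdr gtr0_norm.
have cg0 (z : C) : disc a r z -> {for z, continuous (fun z => md (F z - F a))}.
  move=> zr; apply/contRP => e e0; have /contP/(_ e e0)[t t0 ht] := hol_cont hF zr.
  exists t => // y /ht; apply: le_lt_trans => /=.
  have := md_subl (F z - F a) (F y - F a); have := md_subl (F y - F a) (F z - F a).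
  have -> : F y - F a - (F z - F a) = F y - F z by ring.
  have -> : F z - F a - (F y - F a) = F z - F y by ring.
  by rewrite (md_distC (F z) (F y)) ler_norml; lra.
have cg : {within K, continuous (fun z => md (F z - F a))}.
  by apply: continuous_in_subspaceT => z; rewrite inE => /KD; exact: cg0.
have [z0] := compact_EVT_min K0 cK cg.
rewrite inE => Kz0 hmin.
have p : 0 < md (F z0 - F a).
  rewrite md_gt0 subr_eq0; apply/eqP => /(iF _ _ (KD _ Kz0) ra) e.
  by move: Kz0 s0; rewrite /K/= e subrr md0 => ->; rewrite ltxx.
exists (md (F z0 - F a) / 2); first by rewrite divr_gt0.
apply: open_mapping => //; first by rewrite divr_gt0.
- by move=> z /disc_sub_cdisc/sub; exact: hF.
- by move=> z /sub; exact: hol_cont hF.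
- by move=> z Kz; rewrite mulrC divfK//; apply: hmin; rewrite inE.
Qed.

(** A weak quarter theorem. Let [d] be the distance from [F a] to the complement of the image, [v]
    an omitted value at nearly this distance, and [s] the root of [(F - v) / (F a - v)] with
    [s a = 1]. Where [F] is within [d] of [F a], [s] has positive real part; hence [s] stays at
    distance [1 / 5] from [-1]. Cauchy's estimate for [(s + 1)^-1], bounded by [5], gives the
    constant [80], and the choice of [v] a factor [11 / 10]. *)
Lemma koebe a r F w : 0 < r -> hol (disc a r) F -> inj (disc a r) F -> ~ (F @` disc a r) w ->
  md (dv F a) <= 88 * md (F a - w) / r.
Proof.
move=> r0 hF iF nw.
have ra : disc a r a by exact: disc_center.
pose E := [set md (F a - v) | v in ~` (F @` disc a r)].
have [e0 e00 he0] : exists2 e, 0 < e & disc (F a) e `<=` F @` disc a r.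
  have r2 : 0 < r / 2 by lra.
  have r2r : r / 2 < r by lra.
  have [e e0 he] := inj_open r2 r2r hF iF; exists e => // z /he [y yr <-].
  by exists y => //; move: yr; rewrite /disc/=; lra.
have lbE x : E x -> e0 <= x.
  move=> [v nv <-]; rewrite leNgt; apply/negP => h; apply: nv; apply: he0.
  by rewrite /disc/= md_distC.
have infE : has_inf E by split; [exists (md (F a - w)); exists w|exists e0; exact: lbE].
pose d := inf E.
have d0 : 0 < d by apply: lt_le_trans e00 _; apply: lb_le_inf; [case: infE|exact: lbE].
have dw : d <= md (F a - w) by apply: (ge_inf infE.2); exists w.
have sub : disc (F a) d `<=` F @` disc a r.
  move=> z zd; apply: contrapT => nz.
  have : d <= md (F a - z) by apply: (ge_inf infE.2); exists z.
  by move: zd; rewrite /disc/= md_distC; lra.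
have [v nv vd] : exists2 v, ~ (F @` disc a r) v & md (F a - v) < 11 / 10 * d.
  have [|_ [v nv <-]] := @inf_adherent R E (d / 10) _ infE; first by rewrite divr_gt0.
  by move=> h; exists v => //; move: h; rewrite -/d; lra.
have vd' : d <= md (F a - v) by apply: (ge_inf infE.2); exists v.
pose c := F a - v.
have c0 : c != 0 by rewrite -md_gt0; apply: lt_le_trans vd'.
pose Q z := (F z - v) / c.
have hQ z : disc a r z -> hd Q z (dv F z / c).
  move=> zr; have := hdZ (c^-1) (hdB (dvP hF zr) (hd_cst v z)).
  rewrite subr0 mulrC => /(@hd_eq _ _ Q _ _ 1 ltr01); apply => y _; by rewrite /Q mulrC.
have Q0 z : disc a r z -> Q z != 0.
  move=> zr; rewrite mulf_neq0 ?invr_eq0// subr_eq0; apply/eqP => e; apply: nv.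
  by rewrite -e; exists z.
have [s0 [cs0 es0]] := sqrt_disc r0 (fun z zr => hd_continuous (hQ z zr)) Q0.
have Qa : Q a = 1 by rewrite /Q divff.
have sa : s0 a = 1 \/ s0 a = -1.
  have : s0 a ^+ 2 = 1 ^+ 2 by rewrite es0// Qa expr1n.
  by move=> /eqP; rewrite eqf_sqr => /orP[] /eqP; [left|right].
pose s z := s0 a * s0 z.
have sa1 : s a = 1 by rewrite /s -expr2 es0// Qa.
have es z : disc a r z -> s z ^+ 2 = Q z.
  by move=> zr; rewrite /s exprMn es0// es0// Qa mul1r.
have cs z : disc a r z -> {for z, continuous s}.
  by move=> zr; apply: contM_T; [exact: contcst|exact: cs0].
have sn z : disc a r z -> s z != 0.
  by move=> zr; apply/eqP => e; have := Q0 z zr; rewrite -es// e expr0n eqxx.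
(* the inverse of F is continuous on the disc around F a *)
have exG u : exists z, disc (F a) d u -> disc a r z /\ F z = u.
  have [/sub[z zr <-]|n] := pselect (disc (F a) d u); first by exists z.
  by exists a => /n.
have [G hG] := choice exG.
have cG u : disc (F a) d u -> {for u, continuous G}.
  move=> ud; have [Gr FG] := hG u ud; apply/contP => e e_0.
  pose q := (r - md (G u - a)) / 2.
  have q0 : 0 < q by move: Gr; rewrite /q /disc/=; lra.
  pose p := Order.min (q / 2) e.
  have p0 : 0 < p by rewrite lt_min e_0 andbT; lra.
  have pq : p < q by apply: (@le_lt_trans _ _ (q / 2)); [rewrite ge_min lexx|lra].
  have subq : disc (G u) q `<=` disc a r.
    by apply: subset_disc; move: Gr; rewrite /q /disc/=; lra.
  have [t t0 ht] := inj_open p0 pq (hol_sub subq hF) (inj_sub subq iF).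
  have /open_md/(_ u ud)[t1 t10 ht1] := @open_disc R (F a) d.
  exists (Order.min t t1) => [|y]; first by rewrite lt_min t0.
  rewrite lt_min => /andP[yt yt1]; have [Gy FGy] := hG y (ht1 _ yt1).
  have [|x xp Fx] := ht y; first by rewrite FG.
  have -> : G y = x.
    apply: iF => //; last by rewrite FGy.
    by apply: subq; move: xp; rewrite /disc/=; lra.
  by apply: lt_le_trans xp _; rewrite ge_min lexx orbT.
(* Over the disc around [F a] the quotient [Q] is within [1] of [1], so the real part of [s] cannot
   vanish; it is positive at the centre, and the continuous inverse [G] lets connectedness of the
   disc preserve the sign. *)
have Re_pos z : disc a r z -> disc (F a) d (F z) -> 0 < complex.Re (s z).
  move=> zr zd.
  have ne u : disc (F a) d u -> complex.Re (s (G u)) != 0.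
    move=> ud; have [Gr FG] := hG u ud; apply/eqP => re0.
    have h1 : complex.Re (Q (G u)) <= 0.
      by rewrite -es//; move: re0; case: (s (G u)) => x y /= ->; have := sqr_ge0 y; rewrite mul0r expr2; lra.
    have h2 : 0 < complex.Re (Q (G u)).
      apply: Re_near1; rewrite /Q FG.
      have -> : (u - v) / c - 1 = (u - F a) / c by rewrite /c; field.
      by rewrite md_div ltr_pdivrMr ?md_gt0// mul1r; apply: lt_le_trans vd'.
    by move: h1; rewrite leNgt h2.
  have cRe u : disc (F a) d u -> {for u, continuous (fun u => complex.Re (s (G u)))}.
    move=> ud; apply: contCR_T (@continuous_Re R _); apply: contC_T; first exact: cG.
    by apply: cs; have [] := hG u ud.
  have GF : G (F z) = z by apply: iF => //; have [] := hG _ zd.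
  have GFa : G (F a) = a by have := hG _ (disc_center (F a) d0) => -[h1 h2]; apply: iF.
  rewrite -[X in s X]GF.
  apply: (@conn_clopen _ (disc (F a) d) [set u | 0 < complex.Re (s (G u))] (F a) _ (@connected_disc R _ _)) => //.
  - move=> u ud /= pu; have /contRP/(_ _ pu)[t t0 ht] := cRe u ud.
    by apply/nbhs_md; exists t => // y /ht + _; rewrite ltr_norml => /andP[+ _]; lra.
  - move=> u ud /= pu; have nu : complex.Re (s (G u)) < 0 by rewrite lt_neqAle ne//= leNgt; exact/negP.
    have p : 0 < - complex.Re (s (G u)) by lra.
    have /contRP/(_ _ p)[t t0 ht] := cRe u ud.
    by apply/nbhs_md; exists t => // y /ht + _; rewrite ltr_norml => /andP[_ +]; lra.
  - exact: disc_center.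
  - by rewrite /= GFa sa1.
have far z : disc a r z -> 1 / 5 <= md (s z + 1).
  move=> zr; rewrite leNgt; apply/negP => h.
  have zd : disc (F a) d (F z).
    have -> : F z = F a + (s z + 1) * (s z - 1) * c.
      have -> : (s z + 1) * (s z - 1) = s z ^+ 2 - 1 by ring.
      by rewrite es// /Q mulrBl mul1r divfK// /c; ring.
    rewrite /disc/= addrAC subrr add0r !mdM.
    have h2 : md (s z - 1) <= 11 / 5.
      have -> : s z - 1 = (s z + 1) - 2 by ring.
      by have := mdB (s z + 1) 2; rewrite md_nat; lra.
    have h3 : md (s z + 1) * md (s z - 1) <= 1 / 5 * (11 / 5).
      by apply: ler_pM; rewrite ?md_ge0// ltW.
    apply: (@le_lt_trans _ _ (1 / 5 * (11 / 5) * md c)); first by rewrite ler_wpM2r ?md_ge0.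
    by rewrite /c; lra.
  have := Re_pos z zr zd; have := le_lt_trans (md_Re (s z + 1)) h.
  by rewrite raddfD/= ltr_norml; lra.
have n1 z : disc a r z -> s z + 1 != 0 by move=> zr; rewrite -md_gt0; have := far z zr; lra.
have hs z : disc a r z -> hd s z (dv F z / c / (2 * s z)).
  move=> zr; apply: hd_sqrt; [exact: cs|exact: sn|].
  have /open_md/(_ z zr)[t t0 ht] := @open_disc R a r.
  by apply: hd_eq t0 _ (hQ z zr) => y; rewrite inE => /ht /es ->.
pose h z := (s z + 1)^-1.
have hh z : disc a r z -> hd h z (- (dv F z / c / (2 * s z) + 0) / (s z + 1) ^+ 2).
  by move=> zr; apply: hdV; [exact: n1|exact: hdD (hs z zr) (hd_cst _ _)].
have := @cauchy_dv R h a r 5 r0 (fun z zr => ex_intro _ _ (hh z zr)).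
have b5 z : disc a r z -> md (h z) <= 5.
  move=> zr; rewrite /h mdV invf_ple ?posrE ?md_gt0 ?n1//.
  by rewrite -[5^-1]div1r; exact: far.
move=> /(_ b5).
rewrite (hd_dv (hh a ra)) sa1 addr0 mulr1.
have -> : - (dv F a / c / 2) / (1 + 1) ^+ 2 = - (dv F a / c) / 8 by field.
rewrite md_div mdN md_div md_nat ler_pdivrMr// ler_pdivrMr ?md_gt0// => H.
apply: le_trans H _.
have -> : 2 * 5 / r * 8 * md c = (80 * md c) / r by field; rewrite gt_eqF.
rewrite ler_pM2r ?invr_gt0//; rewrite /c; lra.
Qed.

(* A univalent function on a disc cannot leave the vicinity of an omitted value
   too fast: by [koebe], [F - w] satisfies a linear differential inequality. *)
Lemma growth a r F w z : hol (disc a r) F -> inj (disc a r) F -> ~ (F @` disc a r) w ->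
  disc a (r / 2) z -> md (F z - w) <= 2 ^+ 200 * md (F a - w).
Proof.
move=> hF iF nw zr.
have r0 : 0 < r by move: zr; rewrite /disc/=; have := md_ge0 (z - a); lra.
(* [koebe] on the disc of radius [r / 2] around [y]: [176 = 2 * 88]. *)
have B y : disc a (r / 2) y -> md (dv F y) <= 176 / r * md (F y - w).
  move=> yr.
  have sub : disc y (r / 2) `<=` disc a r by apply: subset_disc; move: yr; rewrite /disc/=; lra.
  have -> : 176 / r * md (F y - w) = 88 * md (F y - w) / (r / 2) by field; rewrite gt_eqF.
  apply: koebe; [lra|exact: hol_sub sub hF|exact: inj_sub sub iF|].
  by move=> [x /sub xr e]; apply: nw; exists x.
have sub2 : disc a (r / 2) `<=` disc a r by apply: subset_disc; rewrite subrr md0; lra.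
(* With [g t0] the maximum of [md (F - w)] on the segment, a step of length [r / 400] changes [F] by
   at most [176 / 400] of [g t0], less than half of it; so [md (F - w)] at most doubles. *)
have one x y : disc a (r / 2) x -> disc a (r / 2) y -> md (y - x) <= r / 400 ->
    md (F y - w) <= 2 * md (F x - w).
  move=> xr yr xy.
  pose g (t : R) := md (F (x + t%:C * (y - x)) - w).
  have sg t : 0 <= t <= 1 -> disc a (r / 2) (x + t%:C * (y - x)) by exact: seg_disc.
  have cg0 (t : R) : 0 <= t <= 1 -> {for t, continuous g}.
    move=> t01; apply: (@contCR_T R R (fun t : R => F (x + t%:C * (y - x)) - w) (@Normc.normc R)); last exact: continuous_md.
    apply: (@contB_T R R (fun t : R => F (x + t%:C * (y - x))) (fun _ => w)); last exact: contcst.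
    apply: (@contC_T R R (fun t : R => x + t%:C * (y - x)) F); last exact: hol_cont hF (sub2 _ (sg t t01)).
    apply: (@contD_T R R (fun _ => x) (fun t : R => t%:C * (y - x))); first exact: contcst.
    by apply: (@contM_T R R (fun t : R => t%:C) (fun _ => y - x)); [exact: continuous_realC|exact: contcst].
  have cg : {within `[0, 1], continuous g}.
    by apply: continuous_in_subspaceT => t; rewrite inE/= in_itv/=; exact: cg0.
  have [t0] := EVT_max ler01 cg; rewrite in_itv/= => t01 hmax.
  have h0 := hmax 0; have h1 := hmax 1.
  rewrite !in_itv/= !lexx ler01/= in h0 h1; have {}h1 := h1 isT.
  have gy : g 1 = md (F y - w) by rewrite /g mul1r; congr (md (F _ - w)); ring.
  rewrite -gy; apply: le_trans h1 _.
  set p := x + t0%:C * (y - x).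
  have : md (F p - F x) <= (176 / r * g t0) * md (p - x).
    apply: mvi => t /andP[tt0 tt1].
    have E : x + t%:C * (p - x) = x + (t * t0)%:C * (y - x) by rewrite /p rmorphM; ring.
    have tt : 0 <= t * t0 <= 1.
      case/andP: t01 => ? ?; rewrite mulr_ge0//=; apply: le_trans (_ : 1 * 1 <= 1); last by rewrite mulr1.
      exact: ler_pM.
    exists (dv F (x + t%:C * (p - x))); first by rewrite E; apply: dvP hF _; exact/sub2/sg.
    rewrite E; apply: le_trans (B _ (sg _ tt)) _.
    rewrite ler_wpM2l ?divr_ge0 ?(ltW r0)//.
    by apply: hmax; rewrite in_itv.
  have px : md (p - x) <= r / 400.
    rewrite /p addrAC subrr add0r mdM mdr; case/andP: t01 => ? ?; rewrite ger0_norm//.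
    by apply: le_trans xy; rewrite ler_piMl// md_ge0.
  have gp : 0 <= g t0 by exact: md_ge0.
  have k : 176 / r * g t0 * md (p - x) <= 176 / r * g t0 * (r / 400).
    by apply: ler_wpM2l px; exact: mulr_ge0 (divr_ge0 (ler0n _ _) (ltW r0)) gp.
  have k2 : 176 / r * g t0 * (r / 400) = g t0 * (176 / 400) by field; rewrite gt_eqF.
  have k3 : g t0 <= md (F p - F x) + md (F x - w).
    by rewrite /g -/p; exact: md_tri.
  rewrite k2 in k => h; lra.
(* [200] steps of length below [r / 400] reach any point of the disc of radius [r / 2]. *)
have step n : (n <= 200)%N -> md (F (a + (n%:R / 200)%:C * (z - a)) - w) <= 2 ^+ n * md (F a - w).
  elim: n => [_|n IH n200]; first by rewrite mul0r mul0r addr0 expr0 mul1r.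
  have in01 k : (k <= 200)%N -> 0 <= (k%:R / 200 : R) <= 1.
    by move=> k2; rewrite (divr_ge0 (ler0n _ _) (ler0n _ _)) ler_pdivrMr// mul1r (ler_nat _ k 200).
  have ra : disc a (r / 2) a by apply: disc_center; lra.
  apply: le_trans (one _ _ (seg_disc ra zr (in01 n (ltnW n200))) (seg_disc ra zr (in01 _ n200)) _) _; last first.
    by rewrite exprS -mulrA ler_wpM2l// IH// ltnW.
  have -> : a + (n.+1%:R / 200)%:C * (z - a) - (a + (n%:R / 200)%:C * (z - a)) =
      (1 / 200)%:C * (z - a).
    by rewrite -natr1 mulrDl rmorphD; ring.
  rewrite mdM mdr ger0_norm; last by lra.
  by move: zr; rewrite /disc/=; lra.
have := step 200%N (leqnn _).
have -> // : a + (200 / 200)%:C * (z - a) = z.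
by rewrite divff ?pnatr_eq0// mul1r; ring.
Qed.

(** An ultrafilter on the indices gives pointwise limits everywhere at once; a common Lipschitz
    constant makes the convergence uniform on the smaller disc, and a subsequence is picked from
    members of the ultrafilter. *)
Lemma montel a r M (F : nat -> C -> C) : 0 < r -> (forall n, hol (disc a r) (F n)) ->
  (forall n z, disc a r z -> md (F n z) <= M) ->
  exists s g, {homo s : i j / (i < j)%N} /\
    forall e, 0 < e -> exists N, forall k, (N <= k)%N -> forall z, cdisc a (r / 4) z ->
      md (F (s k) z - g z) < e.
Proof.
move=> r0 hF hM.
have M0 : 0 <= M by apply: le_trans (hM 0%N a (disc_center a r0)); exact: md_ge0.
have [U [UU UF]] := ultraFilterLemma (eventually_filter : ProperFilter \oo).
have PU : ProperFilter U by exact: ultra_proper.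
have ex z : exists l, disc a r z -> forall e, 0 < e -> \forall n \near U, md (F n z - l) < e.
  have [zr|n] := pselect (disc a r z); last by exists 0 => /n.
  have := @compact_cdisc R 0 M; rewrite compact_ultra => /(_ (F^~ z @ U)).
  have UU' : UltraFilter (F^~ z @ U).
    split; first exact: fmap_proper_filter.
    move=> G PG sG; apply/seteqP; split => // A GA.
    by apply: contrapT => nA; have [|h] := @in_ultra_setVsetC _ U ((F^~ z) @^-1` A) UU;
      [exact: nA|have := @filter_ex _ G _ _ (filterI GA (sG (~` A) h)) => -[y []]].
  case=> //; first by apply: nearW => n; rewrite /cdisc/= subr0; exact: hM.
  move=> l [_ /= hl]; exists l => _ e e0.
  by have /cvg_md/(_ e e0) := hl.
have [g hg] := choice ex.
pose L := 4 * M / r.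
have L0 : 0 <= L by rewrite divr_ge0 ?mulr_ge0// ltW.
have sub2 : disc a (r / 2) `<=` disc a r by apply: subset_disc; rewrite subrr md0; lra.
have lip n z w : disc a (r / 2) z -> disc a (r / 2) w -> md (F n z - F n w) <= L * md (z - w).
  move=> zr wr; apply: (mvi_disc (hol_sub sub2 (hF n))) => //.
  exact: dv_bound r0 (hF n) (hM n).
have lipg z w : disc a (r / 2) z -> disc a (r / 2) w -> md (g z - g w) <= L * md (z - w).
  move=> zr wr; apply/ler_addgt0Pl => e e0; have e2 : 0 < e / 2 by lra.
  have [n [h1 h2]] := filter_ex (filterI (hg z (sub2 _ zr) _ e2) (hg w (sub2 _ wr) _ e2)).
  apply: le_trans (md_tri _ _ (F n z)) _.
  rewrite md_distC; apply: le_trans (lerD (lexx _) (md_tri _ _ (F n w))) _.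
  have := lip n z w zr wr; lra.
have sub4 : cdisc a (r / 4) `<=` disc a (r / 2) by apply: cdisc_sub_disc; lra.
have unif e : 0 < e -> \forall n \near U, forall z, cdisc a (r / 4) z -> md (F n z - g z) < e.
  move=> e0; have := @compact_cdisc R a (r / 4); rewrite compact_near_coveringP.
  move=> /(_ nat U (fun n z => cdisc a (r / 4) z -> md (F n z - g z) < e) _) h.
  suff : \forall n \near U, cdisc a (r / 4) `<=` (fun z => cdisc a (r / 4) z -> md (F n z - g z) < e).
    by apply: filterS => n h' z zr; exact: h'.
  apply: h => x xr; have e3 : 0 < e / 3 by lra.
  have t0 : 0 < e / (3 * (L + 1)) by rewrite divr_gt0// mulr_gt0//; lra.
  exists (disc x (e / (3 * (L + 1))), [set n | md (F n x - g x) < e / 3]).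
    by split; [exact: nbhs_disc|exact: hg (sub2 _ (sub4 _ xr)) _ e3].
  move=> [z n] /= [zx nx] zr.
  have xz := lip n z x (sub4 _ zr) (sub4 _ xr).
  have gz := lipg x z (sub4 _ xr) (sub4 _ zr).
  have Lz : L * md (z - x) < e / 3.
    move: zx; rewrite /disc/= ltr_pdivlMr ?mulr_gt0//; last by lra.
    by have := md_ge0 (z - x); nra.
  apply: le_lt_trans (md_tri _ _ (F n x)) _.
  apply: le_lt_trans (lerD (lexx _) (md_tri _ _ (g x))) _.
  by move: gz; rewrite (md_distC x z); lra.
have [|s s1 s2] := @lip_choice (fun k n => forall z, cdisc a (r / 4) z -> md (F n z - g z) < k.+1%:R^-1).
  move=> k N; have hk : 0 < (k.+1%:R^-1 : R) by rewrite invr_gt0.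
  have hN : U [set n | (N <= n)%N] by apply: UF; exists N.
  by have [n [h1 h2]] := filter_ex (filterI (unif _ hk) hN); exists n.
exists s, g; split => // e e0.
have [N hN] := div_small (ler01 : (0 : R) <= 1) e0.
exists N => k Nk z zr; apply: lt_trans (s2 k z zr) _.
by have := hN k Nk; rewrite mul1r.
Qed.

End Univalent.

(** * Shrinking of inverse branches *)

Section Dyn.
Context {R : realType}.
Local Notation C := R[i].
Implicit Types (F f : C -> C) (z w a u : C) (r e M : R).

Lemma fam_cvgE (F : nat -> C -> C) g (D : set C) :
  ({family compactly_in D, F @ \oo --> g}) <->
  (forall K, compact K -> K `<=` D -> forall e, 0 < e ->
     exists N, forall k, (N <= k)%N -> forall z, K z -> md (F k z - g z) < e).
Proof.
split=> [/fam_cvgP h K cK KD e e0|h].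
  have [|N _ hN] := h K (conj KD cK) [set h | forall y, K y -> md (h y - g y) < e].
    apply/(uniform_nbhs (g : {uniform` K -> C})); exists [set xy | md (xy.2 - xy.1) < e].
    split => //; rewrite -entourage_ballE; exists e%:C; first by rewrite /= ltcR.
    by move=> [x y] /=; rewrite -[ball _ _ _]/(ball x e%:C y) ballE.
  by exists N.
apply/fam_cvgP => K [KD cK] P.
move=> /(uniform_nbhs (g : {uniform` K -> C})) [E [+ subP]].
rewrite -entourage_ballE => -[e /= e0 he].
have [r r0 er] : exists2 r : R, 0 < r & e = r%:C.
  by case: e e0 {he} => x y; rewrite ltcE/= => /andP[/eqP -> x0]; exists x.
have [N hN] := h K cK KD r r0.
exists N => // k /hN hk; apply: subP => y Ky; apply: he => /=.
by rewrite er ballE; exact: hk.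
Qed.

(** An injective entire function is affine. Its divided difference [k] at [a] has no zero, and [h],
    the inverse of [k], grows at most linearly, since [f] stays [e] away from [f a] off the unit
    disc at [a]. So the divided difference [q] of [h] is bounded, hence constant by Liouville. *)
Lemma noninj f : transcendental_entire f -> exists a b, a != b /\ f a = f b.
Proof.
move=> [/holomorphic_hol hf nt]; apply: contrapT => ninj; apply: nt.
have inj z w : f z = f w -> z = w.
  by move=> e; apply: contrapT => n; apply: ninj; exists z, w; split => //; exact/eqP.
have [a da] : exists a, dv f a != 0.
  apply: contrapT => h; have e : f 1 = f 0.
    apply: (@hol_zero_dv R 0 2) => //; first exact: hol_sub hf.
      by move=> z _; apply/eqP/negPn/negP => dz; apply: h; exists z.
    by have : md (1 - 0 : C) < 2 by rewrite subr0 md1; lra.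
  by have /eqP := inj _ _ e; rewrite oner_eq0.
pose k := quot f a.
have hk : hol setT k by apply: hol_quot => //; exact: openT.
have k0 z : k z != 0.
  rewrite /k /quot; case: (eqVneq z a) => [_|za]; first exact: da.
  apply: mulf_neq0; rewrite ?invr_eq0 subr_eq0; last exact: za.
  by apply/eqP => /inj e; move: za; rewrite e eqxx.
pose h z := (k z)^-1.
have hh : hol setT h by apply: holV.
pose q := quot h a.
have hq : hol setT q by apply: hol_quot => //; exact: openT.
have [e e0 he] : exists2 e, 0 < e & disc (f a) e `<=` f @` disc a 1.
  have l : (1 : R) < 2 by lra.
  apply: (@inj_open R a 2 f 1 ltr01 l); first exact: hol_sub hf.
  by move=> z w _ _; exact: inj.
have bdd F : hol setT F -> exists2 M, 0 < M & forall z, md (z - a) <= 1 -> md (F z) <= M.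
  move=> hF; have [|M M0 hM] := @compact_bound R (F @` cdisc a 1).
    apply: continuous_compact; last exact: compact_cdisc.
    by apply: continuous_subspaceT => z; exact: hol_cont hF I.
  by exists M => // z z1; apply: hM; exists z.
have [M1 M10 hM1] := bdd h hh; have [M2 M20 hM2] := bdd q hq.
have far z : 1 <= md (z - a) -> e <= md (f z - f a).
  move=> z1; rewrite leNgt; apply/negP => /he[y y1 /inj yz].
  by move: y1; rewrite yz /disc/=; lra.
have hz z : 1 <= md (z - a) -> md (h z) <= md (z - a) / e.
  move=> z1; have za : z != a by rewrite -subr_eq0 -md_gt0; lra.
  rewrite /h /k /quot (negPf za) invf_div md_div ler_wpM2l ?md_ge0//.
  by rewrite lef_pV2 ?posrE ?far//; have := far z z1; lra.
have bq z : md (q z) <= M2 + (e^-1 + M1).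
  have e1 : 0 < e^-1 by rewrite invr_gt0.
  have [z1|z1] := leP (md (z - a)) 1; first by have := hM2 z z1; lra.
  have za : z != a by rewrite -subr_eq0 -md_gt0; lra.
  rewrite /q /quot (negPf za) md_div ler_pdivrMr; last by lra.
  have h1 := mdB (h z) (h a); have h2 := hz z (ltW z1).
  have h3 : md (h a) <= M1 by apply: hM1; rewrite subrr md0 ler01.
  have h4 : M1 * 1 <= M1 * md (z - a) by rewrite ler_pM2l// ltW.
  have h5 : 0 <= M2 * md (z - a) by rewrite mulr_ge0 ?md_ge0// ltW.
  by rewrite mulrDl mulrDl [e^-1 * _]mulrC; lra.
have qc := liouville hq bq.
(* Otherwise [h] would be affine with nonzero slope and vanish somewhere, although it is an
   inverse. *)
have q00 : q 0 = 0.
  apply/eqP/negPn/negP => n; have := quotE h a (a - h a / q 0).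
  rewrite -/q qc => E; have : h (a - h a / q 0) = 0 by rewrite E; field.
  by move/eqP; rewrite /h invr_eq0 (negPf (k0 _)).
have hc z : h z = h a by rewrite (quotE h a z) -/q qc q00 mulr0 addr0.
have kc z : k z = k a by apply: invr_inj; exact: hc.
exists ((f a - a * k a)%:P + k a *: 'X) => z.
by rewrite (quotE f a z) -/k kc !hornerE; ring.
Qed.

(* A univalent iterate omits one of two points with the same image. *)
Lemma univ_normal f a b w r : hol setT f -> a != b -> f a = f b -> 0 < r ->
  (forall n, inj (disc w r) (iter n f)) -> iterates_normal_on f (disc w (r / 8)).
Proof.
move=> hf ab fab r0 hi.
pose M0 := md a + md b.
have om n : exists2 v, md v <= M0 & ~ (iter n f @` disc w r) v.
  have [[z zr za]|] := pselect ((iter n f @` disc w r) a); last first.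
    by exists a => //; rewrite /M0; have := md_ge0 b; lra.
  exists b; first by rewrite /M0; have := md_ge0 a; lra.
  move=> [y yr yb].
  have e : z = y by apply: (hi n.+1) => //=; rewrite za yb.
  by move/eqP: ab; apply; rewrite -za -yb e.
have [L [L0 gr]] : exists L : R, 0 < L /\ forall a r F w z, hol (disc a r) F -> inj (disc a r) F ->
    ~ (F @` disc a r) w -> disc a (r / 2) z -> md (F z - w) <= L * md (F a - w).
  by exists (2 ^+ 200); split; [rewrite exprn_gt0|exact: growth].
have hit n D : hol D (iter n f) by apply: hol_sub (hol_iter n hf) => //.
(* If the values at the centre are bounded along a subsequence, growth from the centre bounds the
   iterates on the disc and Montel applies. Otherwise they tend to infinity, and the same estimate
   on a disc centred at [z] bounds the value at [w] by the value at [z], which spreads divergence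
   over the disc. *)
move=> n; have [[M hM]|nM] := pselect (exists M, forall N, exists2 k, (N <= k)%N & md (iter (n k) f w) <= M).
  have [|s s1 s2] := @lip_choice (fun _ k => md (iter (n k) f w) <= M).
    by move=> _ N; have [k k1 k2] := hM N; exists k.
  have r2 : 0 < r / 2 by lra.
  have sub : disc w (r / 2) `<=` disc w r by apply: subset_disc; rewrite subrr md0; lra.
  have bd k z : disc w (r / 2) z -> md (iter (n (s k)) f z) <= L * (M + M0) + M0.
    move=> zr; have [v v1 v2] := om (n (s k)).
    have := gr _ _ _ _ _ (hit _ _) (hi _) v2 zr => h.
    have h1 := mdB (iter (n (s k)) f w) v.
    have h2 : L * md (iter (n (s k)) f w - v) <= L * (M + M0).
      by rewrite ler_wpM2l ?(ltW L0)//; have := s2 k; lra.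
    by have := md_subl (iter (n (s k)) f z) v; lra.
  have [t [g [t1 t2]]] := montel r2 (fun k => hit (n (s k)) _) bd.
  exists (s \o t); first by move=> i j ij /=; apply: s1; exact: t1.
  left; exists g; apply/fam_cvgE => K cK KD e e0.
  have [N hN] := t2 e e0; exists N => k /hN h z /KD/disc_sub_cdisc zr; apply: h.
  by move: zr; have -> : r / 2 / 4 = r / 8 by field.
exists id => //; right => K cK KD M.
have : exists N, forall k, (N <= k)%N -> L * (`|M| + M0) + M0 < md (iter (n k) f w).
  apply: contrapT => h; apply: nM; exists (L * (`|M| + M0) + M0) => N.
  apply: contrapT => h2; apply: h; exists N => k Nk.
  by rewrite ltNge; apply/negP => h3; apply: h2; exists k.
move=> [N hN]; exists N => // k Nk z /KD zr.
have [v v1 v2] := om (n k).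
have sub : disc z (r / 2) `<=` disc w r by apply: subset_disc; move: zr; rewrite /disc/=; lra.
have h : md (iter (n k) f w - v) <= L * md (iter (n k) f z - v).
  apply: (gr z (r / 2)) => //; first exact: inj_sub sub (hi _).
    by move=> [y /sub yr e]; apply: v2; exists y.
  by move: zr; rewrite /disc/= md_distC; lra.
have h1 := hN k Nk; have h2 := md_subl (iter (n k) f w) v.
suff : M < md (iter (n k) f z) by rewrite -ltcR.
rewrite ltNge; apply/negP => h3.
have h4 := mdB (iter (n k) f z) v; have h5 := ler_norm M.
have h6 : L * md (iter (n k) f z - v) <= L * (`|M| + M0) by rewrite ler_wpM2l ?(ltW L0)//; lra.
have : L * (`|M| + M0) + M0 < L * (`|M| + M0) + M0 by lra.
by rewrite ltxx.
Qed.

Lemma fatou_open f z : fatou_set f z -> exists2 r, 0 < r & disc z r `<=` fatou_set f.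
Proof.
move=> [D [[oD cD D0] Dz nD]].
have /open_md/(_ z Dz)[r r0 hr] := oD; exists r => // y yr; exists D; split => //; exact: hr.
Qed.

Lemma domain_disc w r : 0 < r -> domain (disc w r).
Proof. by move=> r0; split; [exact: open_disc|exact: connected_disc|exists w; exact: disc_center]. Qed.

Lemma lip_sub (s : nat -> nat) : {homo s : i j / (i < j)%N} -> forall k, (k <= s k)%N.
Proof. by move=> h; elim=> // k IH; apply: leq_ltn_trans IH _; exact: h. Qed.

(** Iterates at [z] are iterates of one order less at [f z]. Indices with [n k = 0] have no
    predecessor; if they recur infinitely often, they give a constant subsequence. *)
Lemma fatou_back f z : hol setT f -> fatou_set f (f z) -> fatou_set f z.
Proof.
move=> hf [D [[oD cD D0] Dz nD]].
have /open_md/(_ _ Dz)[t t0 ht] := oD.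
have cf y : {for y, continuous f} by exact: hol_cont hf I.
have /contP/(_ t t0)[r r0 hr] := cf z.
have sub y : disc z r y -> D (f y) by move=> yr; apply: ht; exact: hr.
exists (disc z r); split; [exact: domain_disc|exact: disc_center|] => n.
have [h|h] := pselect (forall N, exists2 k, (N <= k)%N & n k = 0%N).
  have [|s s1 s2] := @lip_choice (fun _ k => n k = 0%N).
    by move=> _ N; have [k k1 k2] := h N; exists k.
  exists s => //; left; exists id; apply/fam_cvgE => K cK KD e e0.
  by exists 0%N => k _ y Ky; rewrite s2 /= subrr md0.
have [N hN] : exists N, forall k, (N <= k)%N -> (0 < n k)%N.
  apply: contrapT => h1; apply: h => N; apply: contrapT => h2; apply: h1; exists N => k Nk.
  by rewrite lt0n; apply/eqP => h3; apply: h2; exists k.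
have [s s1 s2] := nD (fun k => (n (k + N)%N).-1).
have nE k y : iter (n (s k + N)%N) f y = iter (n (s k + N)%N).-1 f (f y).
  by rewrite -iterSr prednK//; apply: hN; exact: leq_addl.
have cfK K : compact K -> compact (f @` K).
  move=> cK; apply: continuous_compact => //.
  by apply: continuous_subspaceT; exact: cf.
exists (fun k => (s k + N)%N); first by move=> i j ij; rewrite ltn_add2r; exact: s1.
case: s2 => [[g hg]|hg].
  left; exists (g \o f); apply/fam_cvgE => K cK KD e e0.
  have [|N1 h1] := (fam_cvgE _ _ _).1 hg (f @` K) (cfK K cK) _ e e0.
    by move=> _ [y /KD yr <-]; exact: sub.
  by exists N1 => k /h1 h2 y Ky; rewrite nE; apply: h2; exists y.
right=> K cK KD M.
have := hg (f @` K) (cfK K cK) _ M; case.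
  by move=> _ [y /KD yr <-]; exact: sub.
by move=> N1 _ h1; exists N1 => // k /h1 h2 y Ky; rewrite nE; apply: h2; exists y.
Qed.

Section Comp.
Variables (f : C -> C) (U : set C).
Hypothesis fU : fatou_component f U.

Lemma comp_sub : U `<=` fatou_set f.
Proof. by case: fU => z _ ->; exact: connected_component_sub. Qed.

Lemma comp_conn : connected U.
Proof. by case: fU => z _ ->; exact: component_connected. Qed.

Lemma comp_abs z r y : disc z r `<=` fatou_set f -> disc z r y -> U y -> disc z r `<=` U.
Proof.
case: fU => x Fx -> sub yr Uy.
rewrite (same_connected_component Uy); exact: connected_component_max yr sub (@connected_disc R _ _).
Qed.

Lemma comp_open : open U.
Proof.
apply/open_md => z Uz; have [r r0 sub] := fatou_open (comp_sub Uz).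
by exists r => //; exact: comp_abs sub (disc_center z r0) Uz.
Qed.

Lemma bd_fatou z : boundary U z -> ~ fatou_set f z.
Proof.
move=> [/closure_md clz nz] Fz; apply: nz.
have [r r0 sub] := fatou_open Fz; have [y Uy yz] := clz r r0.
by apply/nbhs_md; exists r => //; exact: comp_abs sub yz Uy.
Qed.

Lemma bd_notin z : boundary U z -> ~ U z.
Proof. by move=> bz /comp_sub; exact: bd_fatou. Qed.

Lemma bdE z : closure U z -> ~ U z -> boundary U z.
Proof. by move=> cz nz; split => // /(@interior_subset _ U). Qed.

Hypothesis hf : hol setT f.
Hypothesis fUU : f @` U `<=` U.

(** [f z] cannot fall into [U]: the Fatou set is backward invariant, and [z] is not in it. *)
Lemma bd_inv z : boundary U z -> boundary U (f z).
Proof.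
move=> bz; apply: bdE; last first.
  by move=> /comp_sub /(fatou_back hf); exact: bd_fatou.
apply/closure_md => e e0.
have /contP/(_ e e0)[t t0 ht] := hol_cont hf (I : setT z).
case: bz => /closure_md/(_ t t0)[y Uy yz] _.
by exists (f y); [apply: fUU; exists y|exact: ht].
Qed.

Lemma iter_bd n z : boundary U z -> boundary U (iter n f z).
Proof. move=> bz; elim: n => [|n IH]; [exact: bz|exact: bd_inv IH]. Qed.

Lemma iter_U n z : U z -> U (iter n f z).
Proof. by move=> Uz; elim: n => [|n IH]; [exact: Uz|apply: fUU; exists (iter n f z)]. Qed.

End Comp.

Section Shrink.
Variables (f : C -> C).
Hypothesis hf : transcendental_entire f.

(* Otherwise some disc around [p] lies in the image of [G k] for infinitely many
   [k]; all iterates are then univalent on it, and [p] is in the Fatou set. *)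
Lemma shrink x r (G : nat -> C -> C) (m : nat -> nat) p :
  0 < r -> (forall k, hol (disc x r) (G k)) ->
  (forall k, inj (disc x r) (fun z => iter (m k) f (G k z))) ->
  (forall k, (k <= m k)%N) ->
  (forall e, 0 < e -> exists N, forall k, (N <= k)%N -> md (G k x - p) < e) ->
  ~ fatou_set f p ->
  forall e, 0 < e -> exists N, forall k, (N <= k)%N -> forall z, disc x (r / 2) z ->
    md (G k z - p) < e.
Proof.
move=> r0 hG Gid mk Gx np.
have hf' : hol setT f by case: hf => /holomorphic_hol.
have [a [b [ab fab]]] := noninj hf.
have iG k : inj (disc x r) (G k) by move=> z w zr wr e; apply: (Gid k) => //; rewrite e.
have omit c : 0 < c -> exists N, forall k, (N <= k)%N ->
    exists2 w, md (G k x - w) < c & ~ (G k @` disc x r) w.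
  move=> c0; apply: contrapT => H; apply: np.
  have H1 N : exists2 k, (N <= k)%N & disc (G k x) c `<=` G k @` disc x r.
    apply: contrapT => h1; apply: H; exists N => k Nk; apply: contrapT => h2; apply: h1.
    exists k => // w wc; apply: contrapT => h3; apply: h2; exists w => //.
    by rewrite md_distC.
  have c2 : 0 < c / 2 by lra.
  have [N0 hN0] := Gx _ c2.
  exists (disc p (c / 2 / 8)); split; [|by apply: disc_center; lra|].
    by apply: domain_disc; lra.
  apply: (univ_normal hf' ab fab c2) => n z w zc wc e.
  have [k] := H1 (maxn n N0); rewrite geq_max => /andP[nk Nk] sub.
  have pk := hN0 k Nk.
  have s y : disc p (c / 2) y -> (G k @` disc x r) y.
    by move=> yc; apply: sub; apply: subset_disc yc; rewrite md_distC; lra.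
  have [z' zr ez] := s z zc; have [w' wr ew] := s w wc.
  have mm : m k = (m k - n + n)%N by rewrite subnK//; exact: leq_trans (mk k).
  rewrite -ez -ew; congr (G k _).
  by apply: (Gid k) => //; rewrite ez ew mm !iterD e.
move=> e e0.
have [L [L0 gr]] : exists L : R, 0 < L /\ forall a r F w z, hol (disc a r) F -> inj (disc a r) F ->
    ~ (F @` disc a r) w -> disc a (r / 2) z -> md (F z - w) <= L * md (F a - w).
  by exists (2 ^+ 200); split; [rewrite exprn_gt0|exact: growth].
(* [L * c] comes from the growth estimate at [w], and [c] twice from the distances of the centre
   value to [w] and to [p]. *)
pose c := e / (2 * (L + 2)).
have c0 : 0 < c by rewrite divr_gt0//; lra.
have cE : (L + 2) * c = e / 2 by rewrite /c; field; lra.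
have [N1 h1] := omit c c0; have [N2 h2] := Gx c c0.
exists (maxn N1 N2) => k; rewrite geq_max => /andP[k1 k2] z zr.
have [w w1 w2] := h1 k k1.
have g := gr _ _ _ _ _ (hG k) (iG k) w2 zr.
have g2 : L * md (G k x - w) <= L * c by rewrite ler_wpM2l ?(ltW L0)// ltW.
have := md_tri (G k z) p w; have := md_tri w p (G k x); rewrite (md_distC w (G k x)).
by have := h2 k k2; lra.
Qed.

(** The points at which the branches tend to [p] form an open set by [shrink]; it is closed in [D]
    because the disc of a nearby such point reaches back to the given one. *)
Lemma shrink_conn (D : set C) x0 (G : nat -> C -> C) (m : nat -> nat) p :
  open D -> connected D -> D x0 -> (forall k, hol D (G k)) ->
  (forall k z, D z -> iter (m k) f (G k z) = z) ->
  (forall k, (k <= m k)%N) ->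
  (forall e, 0 < e -> exists N, forall k, (N <= k)%N -> md (G k x0 - p) < e) ->
  ~ fatou_set f p ->
  forall x, D x -> forall e, 0 < e -> exists N, forall k, (N <= k)%N -> md (G k x - p) < e.
Proof.
move=> oD cD Dx0 hG Gid mk Gx np.
pose P := [set x | forall e, 0 < e -> exists N, forall k, (N <= k)%N -> md (G k x - p) < e].
have S x r y : 0 < r -> disc x r `<=` D -> P x -> disc x (r / 2) y -> P y.
  move=> r0 sub Px yr e e0.
  have ig k : inj (disc x r) (fun z => iter (m k) f (G k z)).
    by move=> z w zr wr; rewrite !Gid//; exact: sub.
  have [N hN] := shrink r0 (fun k => hol_sub sub (hG k)) ig mk Px np e0.
  by exists N => k Nk; exact: hN.
move=> x Dx; apply: (@conn_clopen _ D P x0 _ cD) => // y Dy Py.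
  have /open_md/(_ y Dy)[r r0 sub] := oD.
  by apply/nbhs_md; exists (r / 2) => [|z zr _]; [lra|exact: S r0 sub Py zr].
have /open_md/(_ y Dy)[r r0 sub] := oD.
apply/nbhs_md; exists (r / 4) => [|z zr _ Pz]; first lra.
apply: Py; have r2 : 0 < r / 2 by lra.
apply: (S z (r / 2)) => //.
  by apply: subset_trans sub; apply: subset_disc; move: zr; rewrite /disc/=; lra.
by move: zr; rewrite /disc/= md_distC; lra.
Qed.

End Shrink.
End Dyn.

(** * Lifting and square roots on compact sets *)

Section Paths.
Context {R : realType}.
Local Notation C := R[i].
Implicit Types (z w a u : C) (r e s t : R) (A B D K : set C).

Lemma lipcont (k : R -> R) (L : R) : 0 < L -> (forall s t, `|k s - k t| <= L * `|s - t|) ->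
  forall t, {for t, continuous k}.
Proof.
move=> L0 h t; apply/cvgrPdist_lt => e e0.
apply/nbhs_ballP; exists (e / L); first exact: divr_gt0.
move=> s; rewrite /ball/= ltr_pdivlMr// => hs.
by apply: le_lt_trans (h t s) _; rewrite mulrC.
Qed.

Definition half1 t : R := if 2 * t <= 1 then 2 * t else 1.
Definition half2 t : R := if 2 * t <= 1 then 0 else 2 * t - 1.
Definition clamp t : R := if t <= 0 then 0 else if t <= 1 then t else 1.

Lemma cont_half1 t : {for t, continuous half1}.
Proof.
apply: (@lipcont half1 2) => // {}t s; rewrite /half1.
have h1 := ler_norm (t - s); have h2 := ler_norm (s - t); rewrite distrC in h2.
by case: (leP (2 * t) 1) => ?; case: (leP (2 * s) 1) => ?; rewrite ler_norml; lra.
Qed.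

Lemma cont_half2 t : {for t, continuous half2}.
Proof.
apply: (@lipcont half2 2) => // {}t s; rewrite /half2.
have h1 := ler_norm (t - s); have h2 := ler_norm (s - t); rewrite distrC in h2.
by case: (leP (2 * t) 1) => ?; case: (leP (2 * s) 1) => ?; rewrite ler_norml; lra.
Qed.

Lemma cont_clamp t : {for t, continuous clamp}.
Proof.
apply: (@lipcont clamp 1) => // {}t s; rewrite /clamp.
have h1 := ler_norm (t - s); have h2 := ler_norm (s - t); rewrite distrC in h2.
by case: (leP t 0) => ?; case: (leP t 1) => ?; case: (leP s 0) => ?; case: (leP s 1) => ?;
  rewrite ler_norml; lra.
Qed.

Lemma clamp01 t : 0 <= clamp t <= 1.
Proof. by rewrite /clamp; case: (leP t 0) => ?; case: (leP t 1) => ?; lra. Qed.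

Lemma clamp_id t : 0 <= t <= 1 -> clamp t = t.
Proof. by rewrite /clamp => /andP[? ?]; case: (leP t 0) => ?; case: (leP t 1) => ?; lra. Qed.

Lemma cont_rev t : {for t, continuous (fun t => 1 - t)}.
Proof.
apply: (@lipcont (fun t => 1 - t) 1) => // {}t s; rewrite mul1r distrC.
by have -> : 1 - s - (1 - t) = t - s by ring.
Qed.

Definition conc (g1 g2 : R -> C) t := g1 (half1 t) + (g2 (half2 t) - g2 0).

Lemma cont_conc g1 g2 : (forall t, {for t, continuous g1}) -> (forall t, {for t, continuous g2}) ->
  forall t, {for t, continuous (conc g1 g2)}.
Proof.
move=> c1 c2 t; apply: (@contD_T R R (g1 \o half1) (fun t => g2 (half2 t) - g2 0)).
  by apply: (@contX_T R R R half1 g1); [exact: cont_half1|exact: c1].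
apply: (@contB_T R R (g2 \o half2) (fun _ => g2 0)); last exact: contcst.
by apply: (@contX_T R R R half2 g2); [exact: cont_half2|exact: c2].
Qed.

Lemma conc1 g1 g2 t : 2 * t <= 1 -> conc g1 g2 t = g1 (2 * t).
Proof. by move=> h; rewrite /conc /half1 /half2 h subrr addr0. Qed.

Lemma conc2 g1 g2 t : 1 <= 2 * t -> conc g1 g2 t = g1 1 + (g2 (2 * t - 1) - g2 0).
Proof.
rewrite /conc /half1 /half2 => h; case: leP => // h2.
have -> : 2 * t = 1 by apply/eqP; rewrite eq_le h h2.
by rewrite !subrr.
Qed.

Lemma conc_0 g1 g2 : conc g1 g2 0 = g1 0.
Proof. by rewrite conc1 ?mulr0. Qed.

Lemma conc_1 g1 g2 : conc g1 g2 1 = g1 1 + (g2 1 - g2 0).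
Proof. by rewrite conc2 ?mulr1; [have -> : 2 - 1 = 1 :> R by ring|lra]. Qed.

Definition segp z w t : C := z + t%:C * (w - z).

Lemma cont_segp z w t : {for t, continuous (segp z w)}.
Proof.
apply: (@contD_T R R (fun _ => z) (fun t : R => t%:C * (w - z))); first exact: contcst.
by apply: (@contM_T R R (fun t : R => t%:C) (fun _ => w - z)); [exact: continuous_realC|exact: contcst].
Qed.

Lemma segp0 z w : segp z w 0 = z. Proof. by rewrite /segp mul0r addr0. Qed.
Lemma segp1 z w : segp z w 1 = w. Proof. by rewrite /segp mul1r addrC subrK. Qed.

Definition convex_set A := forall z w t, A z -> A w -> 0 <= t <= 1 -> A (segp z w t).

Lemma path_image_connected (g : R -> C) : (forall t, {for t, continuous g}) ->
  connected (g @` `[0, 1]%classic).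
Proof.
move=> cg; apply: connected_continuous_connected; first exact: segment_connected.
by apply: within_contI => t _; exact: cg.
Qed.

Lemma path_image_compact (g : R -> C) : (forall t, {for t, continuous g}) ->
  compact (g @` `[0, 1]%classic).
Proof.
move=> cg; apply: continuous_compact; last exact: segment_compact.
by apply: within_contI => t _; exact: cg.
Qed.

Lemma convex_connected A : convex_set A -> connected A.
Proof.
move=> cA; have [[a Aa]|/set0P/negP/negPn/eqP ->] := pselect (A !=set0); last exact: connected0.
rewrite (_ : A = \bigcup_(z in A) (segp a z @` `[0, 1]%classic)); last first.
  apply/seteqP; split => [z zr|z [w wr [t /=]]].
    by exists z => //; exists 1; rewrite ?segp1//= in_itv/= ler01 lexx.
  by rewrite in_itv/= => t01 <-; exact: cA.
apply: bigcup_connected => [|z _]; last by apply: path_image_connected; exact: cont_segp.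
by exists a => z _; exists 0; rewrite ?segp0//= in_itv/= ler01 lexx.
Qed.

(** Paths are continuous on the whole line, which avoids the subspace topology of the unit
    interval. *)
Definition path_in A z w := exists g : R -> C,
  [/\ forall t, {for t, continuous g}, g 0 = z, g 1 = w & forall t, 0 <= t <= 1 -> A (g t)].

Lemma path_in_seg a r z w : disc a r z -> disc a r w -> path_in (disc a r) z w.
Proof.
move=> zr wr; exists (segp z w); split; [exact: cont_segp|exact: segp0|exact: segp1|].
by move=> t t01; exact: seg_disc.
Qed.

Lemma path_in_trans A z w u : path_in A z w -> path_in A w u -> path_in A z u.
Proof.
move=> [g1 [c1 a1 b1 i1]] [g2 [c2 a2 b2 i2]]; exists (conc g1 g2).
split; [exact: cont_conc|by rewrite conc_0|by rewrite conc_1 b1 b2 a2; ring|].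
move=> t /andP[t0 t1]; have [h|h] := leP (2 * t) 1.
  by rewrite conc1//; apply: i1; lra.
rewrite conc2 ?(ltW h)// b1 a2 addrC subrK; apply: i2; lra.
Qed.

Lemma path_in_sub A B z w : A `<=` B -> path_in A z w -> path_in B z w.
Proof. by move=> s [g [h1 h2 h3 h4]]; exists g; split => // t /h4 /s. Qed.

Lemma path_in_connected D z w : open D -> connected D -> D z -> D w -> path_in D z w.
Proof.
move=> oD cD Dz Dw; have Dd y : D y -> exists2 r, 0 < r & disc y r `<=` D.
  by move: y; exact/open_md.
apply: (@conn_clopen _ D (path_in D z) z w cD) => // [y Dy Py|y Dy Py|].
- have [r r0 sub] := Dd y Dy; apply/nbhs_md; exists r => // x xr _.
  apply: path_in_trans Py (path_in_sub sub _); apply: path_in_seg => //; exact: disc_center.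
- have [r r0 sub] := Dd y Dy; apply/nbhs_md; exists r => // x xr _ Px; apply: Py.
  apply: path_in_trans Px (path_in_sub sub _); apply: path_in_seg => //; exact: disc_center.
- exists (fun _ => z); split => // t; exact: contcst.
Qed.

Lemma path_compact A z w : path_in A z w ->
  exists K, [/\ compact K, connected K, K `<=` A, K z & K w].
Proof.
move=> [g [cg g0 g1 gA]]; exists (g @` `[0, 1]%classic).
split; [exact: path_image_compact|exact: path_image_connected| |exists 0|exists 1] => //=.
- by move=> _ [t /= + <-]; rewrite in_itv/=; exact: gA.
- by rewrite in_itv/= ler01 lexx.
- by rewrite in_itv/= ler01 lexx.
Qed.

Lemma within_clamp (H : R * R -> C) : {within `[0, 1] `*` `[0, 1], continuous H} ->
  forall p, {for p, continuous (fun p : R * R => H (clamp p.1, clamp p.2))}.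
Proof.
move=> /subspace_continuousP cH p; apply/contTP => e e0.
have in01 q : (`[0, 1]%classic `*` `[0, 1]%classic) (clamp q.1, clamp q.2).
  by split; rewrite /= in_itv/= clamp01.
have /cvg_md/(_ e e0) h0 := cH _ (in01 p).
have h : nbhs (clamp p.1, clamp p.2) [set q | (`[0, 1]%classic `*` `[0, 1]%classic) q ->
    md (H q - H (clamp p.1, clamp p.2)) < e] by exact: h0.
have cc : {for p, continuous (fun p : R * R => (clamp p.1, clamp p.2))}.
  by apply: cont_pair; [apply: (@continuous_comp _ _ _ fst clamp); [exact: contfst|exact: cont_clamp]|
     apply: (@continuous_comp _ _ _ snd clamp); [exact: contsnd|exact: cont_clamp]].
have := cc _ h; rewrite nbhs_simpl/=; apply: filterS => q /= hq; exact: hq (in01 q).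
Qed.

(* Continuation of logarithms along paths; uniqueness of the result comes from
   lifting the contraction of a loop. *)
Lemma log_sc (Om : set C) (F : C -> C) : simply_connected_domain Om ->
  (forall z, Om z -> {for z, continuous F}) -> (forall z, Om z -> F z != 0) ->
  exists L : C -> C, (forall z, Om z -> {for z, continuous L}) /\
    (forall z, Om z -> cexp (L z) = F z).
Proof.
move=> [[oO cO [z0 Oz0]] sc] cF F0.
pose rel z v := exists g l : R -> C, [/\ [/\ forall t, {for t, continuous g},
   forall t, {for t, continuous l}, g 0 = z0 & l 0 = 0], g 1 = z, l 1 = v,
   forall t, 0 <= t <= 1 -> Om (g t) &
   forall t, 0 <= t <= 1 -> cexp (l t) = F (g t) / F z0].
have Fz00 := F0 _ Oz0.
have uniq z v1 v2 : rel z v1 -> rel z v2 -> v1 = v2.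
  move=> [g1 [l1 [[cg1 cl1 g10 l10] g11 l11 i1 e1]]] [g2 [l2 [[cg2 cl2 g20 l20] g21 l21 i2 e2]]].
  pose rev (g : R -> C) t := g (1 - t).
  have crev g : (forall t, {for t, continuous g}) -> forall t, {for t, continuous (rev g)}.
    by move=> cg t; apply: (@contX_T R R R (fun t => 1 - t) g); [exact: cont_rev|exact: cg].
  pose b := conc g1 (rev g2); pose l := conc l1 (rev l2).
  have cb := cont_conc cg1 (crev g2 cg2); have cl := cont_conc cl1 (crev l2 cl2).
  have bl t : 0 <= t <= 1 -> Om (b t) /\ cexp (l t) = F (b t) / F z0.
    move=> /andP[t0 t1]; rewrite /b /l; have [h|h] := leP (2 * t) 1.
      by rewrite !conc1//; split; [apply: i1|apply: e1]; lra.
    rewrite !conc2 ?(ltW h)// /rev subr0 g21 g11 l11 l21.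
    have -> : z + (g2 (1 - (2 * t - 1)) - z) = g2 (1 - (2 * t - 1)) by ring.
    have t01 : 0 <= 1 - (2 * t - 1) <= 1 by lra.
    split; first exact: i2.
    have n11 : 0 <= (1 : R) <= 1 by lra.
    have := e2 _ t01; have := e2 _ n11; have := e1 _ n11.
    rewrite l11 l21 g11 g21 => E1 E2 E3.
    have : cexp v2 * cexp (- v2) = 1 by rewrite -cexpD subrr cexp0.
    by rewrite !cexpD E3 E1 E2 => E4; rewrite mulrCA E4 mulr1.
  have b0 : b 0 = z0 by rewrite /b conc_0.
  have b1 : b 1 = z0 by rewrite /b conc_1 /rev g11 subrr subr0 g20 g21; ring.
  have wb : {within `[0, 1], continuous b} by apply: within_contI => t _; exact: cb.
  have [H [cH HO H1 H2]] := sc b wb (fun t h => (bl t h).1) (etrans b0 (esym b1)).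
  (* The contraction run backwards, from the constant loop to [b]. The base point does not move, so
     the lifted logarithm [m] vanishes at both ends; by uniqueness it equals [l], whose final value
     is [v1 - v2]. *)
  pose G (s t : R) := F (H (clamp (1 - s), clamp t)).
  have k01 : compact (`[0, 1]%classic : set R) by exact: segment_compact.
  have [||m [cm em zm]] := @log_lift R R `[0, 1]%classic G k01.
  - move=> s t s01 t01; apply: (@contC_T _ _ (fun p : R * R => H (clamp (1 - p.1), clamp p.2)) F); last first.
      by apply: cF; apply: HO; exact: clamp01.
    apply: (@contX_T _ _ _ (fun p : R * R => (1 - p.1, p.2)) (fun p : R * R => H (clamp p.1, clamp p.2))); last exact: within_clamp.
    apply: cont_pair; last exact: contsnd.
    by apply: (@continuous_comp _ _ _ fst (fun t => 1 - t)); [exact: contfst|exact: cont_rev].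
  - by move=> s t s01 t01; apply: F0; apply: HO; exact: clamp01.
  have i0 : 0 <= (0 : R) <= 1 by lra.
  have i1' : 0 <= (1 : R) <= 1 by lra.
  have m0 : m 0 = 0.
    apply: zm; first by rewrite /= in_itv.
    move=> s s01; rewrite /G; congr F.
    by rewrite (clamp_id i0) (H2 _ (clamp01 _)).1 (H2 _ (clamp01 _)).1.
  have m1 : m 1 = 0.
    apply: zm; first by rewrite /= in_itv.
    move=> s s01; rewrite /G; congr F.
    by rewrite (clamp_id i1') (H2 _ (clamp01 _)).2 (H2 _ (clamp01 _)).2.
  have G0 t : 0 <= t <= 1 -> G 0 t = F z0.
    by move=> t01; rewrite /G subr0 (clamp_id i1') (clamp_id t01) (H1 _ t01).2 b0.
  have G1 t : 0 <= t <= 1 -> G 1 t = F (b t).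
    by move=> t01; rewrite /G subrr (clamp_id i0) (clamp_id t01) (H1 _ t01).1.
  have : m 1 = l 1.
    apply: (@log_unique _ R `[0, 1]%classic m l 0 1); first exact: segment_connected.
    - exact: cm.
    - by move=> t _; exact: cl.
    - move=> t tt; rewrite em//; move: tt; rewrite /= in_itv/= => tt.
      by rewrite (G1 _ tt) (G0 _ tt) (bl t tt).2.
    - by rewrite /= in_itv.
    - by rewrite m0 /l conc_0 l10.
    - by rewrite /= in_itv.
  rewrite m1 /l conc_1 /rev subrr subr0 l20 l21 l11 sub0r => /eqP.
  by rewrite eq_sym subr_eq0 => /eqP.
(* On small discs all ratios of values of [F] lie in the right half-plane, so [plog] continues a
   logarithm along any segment. *)
have near c : Om c -> exists2 r, 0 < r & disc c r `<=` Om /\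
    forall z w, disc c r z -> disc c r w -> 0 < complex.Re (F w / F z).
  move=> Oc; have /open_md/(_ _ Oc)[r r0 sub] := oO.
  have p : 0 < md (F c) / 4 by rewrite divr_gt0// md_gt0 F0.
  have /contP/(_ _ p)[t t0 ht] := cF c Oc.
  exists (Order.min r t) => [|]; first by rewrite lt_min r0.
  split=> [w|z w]; rewrite /disc/= !lt_min => /andP[z1 z2]; first exact: sub.
  move=> /andP[_ w2].
  apply: Re_near1; have -> : F w / F z - 1 = (F w - F z) / F z by field; apply: F0; exact: sub.
  rewrite md_div ltr_pdivrMr ?md_gt0 ?mul1r; last by apply: F0; exact: sub.
  have := ht _ z2; have := ht _ w2; have := md_tri (F w) (F z) (F c).
  have := md_subl (F c) (F z); rewrite (md_distC (F c)); lra.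
have ext c z w r v : disc c r `<=` Om ->
    (forall z w, disc c r z -> disc c r w -> 0 < complex.Re (F w / F z)) ->
    disc c r z -> disc c r w -> rel z v -> rel w (v + plog (F w / F z)).
  move=> sub hre zr wr [g [l [[cg cl g0 l0] g1 l1 ig eg]]].
  have sr t : disc c r (segp z w (clamp t)) by apply: seg_disc => //; exact: clamp01.
  pose l2 t := plog (F (segp z w (clamp t)) / F z).
  have Fz := F0 z (sub z zr).
  have cseg t : {for t, continuous (fun t => segp z w (clamp t))}.
    by apply: (@contX_T R R R clamp (segp z w)); [exact: cont_clamp|exact: cont_segp].
  have cl2 t : {for t, continuous l2}.
    apply: (@contC_T _ R (fun t => F (segp z w (clamp t)) / F z) plog); last first.
      by apply: continuous_plog; exact: hre.
    apply: (@contM_T _ R (fun t => F (segp z w (clamp t))) (fun _ => (F z)^-1)); last exact: contcst.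
    by apply: (@contC_T _ R (fun t => segp z w (clamp t)) F); [exact: cseg|apply: cF; exact: sub].
  have i0 : 0 <= (0 : R) <= 1 by lra.
  have i1 : 0 <= (1 : R) <= 1 by lra.
  have l20 : l2 0 = 0 by rewrite /l2 (clamp_id i0) segp0 divff// plog1.
  exists (conc g (segp z w \o clamp)), (conc l l2); split.
  - split; [exact: (cont_conc cg cseg)|exact: (cont_conc cl cl2)|rewrite conc_0; exact: g0|rewrite conc_0; exact: l0].
  - by rewrite conc_1 /= (clamp_id i0) (clamp_id i1) segp0 segp1 g1; ring.
  - by rewrite conc_1 l20 subr0 l1 /l2 (clamp_id i1) segp1.
  - move=> t /andP[t0 t1]; have [h|h] := leP (2 * t) 1.
      by rewrite conc1//; apply: ig; lra.
    by rewrite conc2 ?(ltW h)//= (clamp_id i0) segp0 g1 addrC subrK; exact: sub.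
  move=> t /andP[t0 t1]; have [h|h] := leP (2 * t) 1.
    by rewrite !conc1//; apply: eg; lra.
  rewrite !conc2 ?(ltW h)//= (clamp_id i0) segp0 g1 (addrC z) subrK l20 subr0 cexpD eg//.
  by rewrite /l2 cexp_plog ?g1; [field; rewrite Fz Fz00|exact: hre].
have ex z : exists v, Om z -> rel z v.
  have [Oz|nO] := pselect (Om z); last by exists 0 => /nO.
  suff [v hv] : exists v, rel z v by exists v.
  apply: (@conn_clopen _ Om (fun z => exists v, rel z v) z0 z cO) => // [y Oy [v hv]|y Oy nv|].
  - have [r r0 [sub hre]] := near y Oy; apply/nbhs_md; exists r => // w wr _.
    by exists (v + plog (F w / F y)); exact: ext sub hre (disc_center y r0) wr hv.
  - have [r r0 [sub hre]] := near y Oy; apply/nbhs_md; exists r => // w wr _ [v hv].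
    by apply: nv; exists (v + plog (F y / F w)); exact: ext sub hre wr (disc_center y r0) hv.
  - exists 0, (fun _ => z0), (fun _ => 0); split => //.
    + split=> // t; exact: contcst.
    + by move=> t _; rewrite cexp0 divff.
have [L0 hL0] := choice ex.
have [c hc] := cexp_surj Fz00.
exists (fun z => L0 z + c); split => z Oz.
  apply: (@contD_T R C L0 (fun _ => c)); last exact: contcst.
  have [r r0 [sub hre]] := near z Oz.
  have zr := disc_center z r0.
  apply/contP => e e0.
  have cl : {for z, continuous (fun w => plog (F w / F z))}.
    apply: (@contC_T R C (fun w => F w / F z) plog); last by apply: continuous_plog; exact: hre.
    by apply: (@contM_T R C F (fun _ => (F z)^-1)); [exact: cF|exact: contcst].
  have /contP/(_ e e0)[t t0 ht] := cl.
  exists (Order.min r t) => [|w]; first by rewrite lt_min r0.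
  rewrite lt_min => /andP[wr wt].
  have -> : L0 w = L0 z + plog (F w / F z).
    by apply: (uniq w); [apply: hL0; exact: sub|exact: ext sub hre zr wr (hL0 z Oz)].
  by have := ht w wt; rewrite divff ?F0// plog1 subr0 addrAC subrr add0r.
have [g [l [_ g1 l1 _ hl]]] := hL0 z Oz.
have i1 : 0 <= (1 : R) <= 1 by lra.
by have := hl 1 i1; rewrite g1 l1 cexpD hc => ->; rewrite divfK.
Qed.

End Paths.

(** * Relative continuity and roots of [z - e] *)

Section Con.
Context {R : realType}.
Local Notation C := R[i].
Implicit Types (z w a u : C) (r e t : R) (A B D K : set C) (s : C -> C).

(** Epsilon-delta form of continuity relative to [K], which restricts to subsets and glues along
    closed sets directly. *)
Definition con K s := forall z, K z -> forall e, 0 < e ->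
  exists2 d, 0 < d & forall w, K w -> md (w - z) < d -> md (s w - s z) < e.

Lemma con_sub A B s : A `<=` B -> con B s -> con A s.
Proof. by move=> h c z /h Bz e /(c z Bz)[d d0 hd]; exists d => // w /h; exact: hd. Qed.

Lemma con_eq K s s' : (forall z, K z -> s z = s' z) -> con K s -> con K s'.
Proof. by move=> h c z Kz e /(c z Kz)[d d0 hd]; exists d => // w Kw; rewrite -!h//; exact: hd. Qed.

Lemma cont_con K s : (forall z, K z -> {for z, continuous s}) -> con K s.
Proof. by move=> h z /h/contP c e /c[d d0 hd]; exists d => // w _; exact: hd. Qed.

Lemma con_disc_cont a r s z : con (disc a r) s -> disc a r z -> {for z, continuous s}.
Proof.
move=> c zr; apply/contP => e /(c z zr)[d d0 hd].
have /open_md/(_ z zr)[t t0 ht] := @open_disc R a r.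
exists (Order.min d t) => [|w]; first by rewrite lt_min d0.
by rewrite lt_min => /andP[w1 w2]; apply: hd => //; exact: ht.
Qed.

Lemma closed_md A z : closed A -> ~ A z -> exists2 r, 0 < r & forall w, md (w - z) < r -> ~ A w.
Proof.
move=> cA nA; apply: contrapT => h; apply: nA; apply/cA/closure_md => r r0.
apply: contrapT => h2; apply: h; exists r => // w wr Aw; apply: h2; by exists w.
Qed.

Lemma con_glue A B s : closed A -> closed B -> con A s -> con B s -> con (A `|` B) s.
Proof.
move=> cA cB hA hB z _ e e0.
have part (K : set C) : closed K -> con K s ->
    exists2 d, 0 < d & forall w, K w -> md (w - z) < d -> md (s w - s z) < e.
  move=> cK hK; have [Kz|nK] := pselect (K z); first exact: hK.
  by have [d d0 hd] := closed_md cK nK; exists d => // w Kw /hd.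
have [d1 d10 h1] := part A cA hA; have [d2 d20 h2] := part B cB hB.
exists (Order.min d1 d2) => [|w]; first by rewrite lt_min d10.
by rewrite lt_min => -[Aw|Bw] /andP[w1 w2]; [exact: h1|exact: h2].
Qed.

Lemma conn_md A (P : set C) x y : connected A ->
  (forall x, A x -> P x -> exists2 d, 0 < d & forall y, A y -> md (y - x) < d -> P y) ->
  (forall x, A x -> ~ P x -> exists2 d, 0 < d & forall y, A y -> md (y - x) < d -> ~ P y) ->
  A x -> P x -> A y -> P y.
Proof.
move=> cA h1 h2; apply: (@conn_clopen _ A P x y cA) => z Az Pz.
  by have [d d0 hd] := h1 z Az Pz; apply/nbhs_md; exists d => // w wd Aw; exact: hd.
by have [d d0 hd] := h2 z Az Pz; apply/nbhs_md; exists d => // w wd Aw; exact: hd.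
Qed.

Lemma conn_closed2 K A B z : connected K -> K `<=` A `|` B -> closed A -> closed B ->
  A `&` B = set0 -> K z -> A z -> K `<=` A.
Proof.
move=> cK sub cA cB AB Kz Az y Ky.
have dis w : A w -> B w -> False by move=> Aw Bw; have : (A `&` B) w by []; rewrite AB.
apply: (conn_md cK _ _ Kz Az Ky) => x Kx Px.
  have [d d0 hd] := closed_md cB (dis x Px); exists d => // w Kw /hd.
  by have [] := sub w Kw.
have Bx : B x by have [] := sub x Kx.
by have [d d0 hd] := closed_md cA Px; exists d => // w Kw; exact: hd.
Qed.

Definition star a A := forall z t, A z -> 0 <= t <= 1 -> A (segp a z t).

Lemma star_connected a A : star a A -> connected A.
Proof.
move=> sA; have [[z Az]|/set0P/negP/negPn/eqP ->] := pselect (A !=set0); last exact: connected0.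
have i0 : 0 <= (0 : R) <= 1 by lra.
have Aa : A a by rewrite -(segp0 a z); exact: sA.
rewrite (_ : A = \bigcup_(z in A) (segp a z @` `[0, 1]%classic)); last first.
  apply/seteqP; split => [w wr|w [v vr [t /=]]].
    by exists w => //; exists 1; rewrite ?segp1//= in_itv/= ler01 lexx.
  by rewrite in_itv/= => t01 <-; exact: sA.
apply: bigcup_connected => [|w _]; last by apply: path_image_connected; exact: cont_segp.
by exists a => w _; exists 0; rewrite ?segp0//= in_itv/= ler01 lexx.
Qed.

Lemma Re_segp a z t : complex.Re (segp a z t) = complex.Re a + t * (complex.Re z - complex.Re a).
Proof. by case: a z => a1 a2 [z1 z2] /=; ring. Qed.
Lemma Im_segp a z t : complex.Im (segp a z t) = complex.Im a + t * (complex.Im z - complex.Im a).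
Proof. by case: a z => a1 a2 [z1 z2] /=; ring. Qed.

Definition rect (a b c d : R) := [set z : C | a <= complex.Re z <= b /\ c <= complex.Im z <= d].

Lemma rect_convex (a b c d : R) : convex_set (rect a b c d).
Proof.
move=> z w t [/andP[? ?] /andP[? ?]] [/andP[? ?] /andP[? ?]] /andP[? ?].
rewrite /rect/= Re_segp Im_segp; split; apply/andP; split; nra.
Qed.

Lemma rect_connected (a b c d : R) : connected (rect a b c d).
Proof. exact/convex_connected/rect_convex. Qed.

Lemma rect_closed (a b c d : R) : closed (rect a b c d).
Proof.
move=> z /closure_md h; have H e : 0 < e -> [/\ a - e <= complex.Re z, complex.Re z <= b + e,
    c - e <= complex.Im z & complex.Im z <= d + e].
  move=> /h[w [/andP[? ?] /andP[? ?]]] wz.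
  have := le_lt_trans (md_Re (w - z)) wz; have := le_lt_trans (md_Im (w - z)) wz.
  by rewrite !raddfB/= !ltr_norml => /andP[? ?] /andP[? ?]; split; lra.
split; apply/andP; split; apply/ler_addgt0Pl => e e0; have [] := H e e0; lra.
Qed.

Lemma rect_md (a b c d : R) z w : rect a b c d z -> rect a b c d w -> md (w - z) <= (b - a) + (d - c).
Proof.
move=> [/andP[? ?] /andP[? ?]] [/andP[? ?] /andP[? ?]]; apply: le_trans (md_le_ReIm _) _.
by rewrite !raddfB/=; apply: lerD; rewrite ler_norml; lra.
Qed.

(* [K] has even winding around [e]: all that lifting uses of the simple
   connectivity of a domain whose complement contains [e]. *)
Definition hsqrt K (e : C) := exists s, con K s /\ forall z, K z -> s z ^+ 2 = z - e.

(** The quotient [(z - e') / (z - e)] lies in the right half-plane, so its root comes from [plog]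
    and multiplies the given one. *)
Lemma hsqrt_near K (e e' : C) : (forall z, K z -> md (e' - e) < md (z - e)) -> hsqrt K e -> hsqrt K e'.
Proof.
move=> h [s [cs es]].
have p z : K z -> 0 < complex.Re ((z - e') / (z - e)).
  move=> Kz; have n : z - e != 0 by rewrite -md_gt0; apply: le_lt_trans (h z Kz); exact: md_ge0.
  apply: Re_near1; have -> : (z - e') / (z - e) - 1 = (e - e') / (z - e) by field.
  by rewrite md_div ltr_pdivrMr ?md_gt0// mul1r md_distC; exact: h.
pose q z := cexp (plog ((z - e') / (z - e)) / 2).
exists (fun z => s z * q z); split=> z Kz; last first.
  have n : z - e != 0 by rewrite -md_gt0; apply: le_lt_trans (h z Kz); exact: md_ge0.
  rewrite exprMn es// /q expr2 -cexpD.
  have -> (x : C) : x / 2 + x / 2 = x by field.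
  by rewrite cexp_plog; [rewrite mulrC divfK|exact: p].
have n : z - e != 0 by rewrite -md_gt0; apply: le_lt_trans (h z Kz); exact: md_ge0.
have cq : {for z, continuous q}.
  have c1 : {for z, continuous (fun z => (z - e') / (z - e))}.
    apply: (@contM_T R C (fun z => z - e') (fun z => (z - e)^-1)).
      by apply: (@contB_T R C (fun z => z) (fun _ => e')); [exact: contid|exact: contcst].
    apply: (@contV_T R C (fun z => z - e)) => //.
    by apply: (@contB_T R C (fun z => z) (fun _ => e)); [exact: contid|exact: contcst].
  have c2 := contC_T c1 (continuous_plog (p z Kz)).
  have c3 : {for z, continuous (fun z => plog ((z - e') / (z - e)) / 2)}.
    by apply: (@contM_T R C (fun z => plog ((z - e') / (z - e))) (fun _ => 2^-1)); [exact: c2|exact: contcst].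
  exact: (contC_T c3 (hd_continuous (hd_cexp _))).
move=> e1 e10.
pose M := md (s z) + md (q z) + 1.
have M0 : 0 < M by rewrite /M; have := md_ge0 (s z); have := md_ge0 (q z); lra.
pose d := Order.min 1 (e1 / (2 * M)).
have d0 : 0 < d by rewrite lt_min ltr01 divr_gt0// mulr_gt0.
have [d1 d10 h1] := cs z Kz d d0; have /contP/(_ d d0)[d2 d20 h2] := cq.
exists (Order.min d1 d2) => [|w Kw]; first by rewrite lt_min d10.
rewrite lt_min => /andP[/(h1 w Kw) w1 /h2 w2].
have -> : s w * q w - s z * q z = (s w - s z) * (q w - q z) + (s w - s z) * q z + s z * (q w - q z) by ring.
have dM : d * M <= e1 / 2.
  apply: le_trans (_ : e1 / (2 * M) * M <= _); first by rewrite ler_wpM2r ?(ltW M0)// ge_min lexx orbT.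
  by have -> : e1 / (2 * M) * M = e1 / 2 by field; rewrite gt_eqF.
have dd1 : d <= 1 by rewrite ge_min lexx.
apply: le_lt_trans (mdD _ _) _; apply: le_lt_trans (lerD (mdD _ _) (lexx _)) _.
rewrite (mdM (s w - s z) (q w - q z)) (mdM (s w - s z) (q z)) (mdM (s z)).
have A0 := md_ge0 (s w - s z); have B0 := md_ge0 (q w - q z).
have S0 := md_ge0 (s z); have T0 := md_ge0 (q z).
move: w1 w2 dM A0 B0 S0 T0; rewrite /M.
set a := md (s w - s z); set b := md (q w - q z); set x := md (s z); set y := md (q z).
move=> w1 w2 dM A0 B0 S0 T0.
have k1 : a * b <= d * 1 by apply: ler_pM => //; lra.
have k2 : a * y <= d * y by rewrite ler_wpM2r// ltW.
have k3 : x * b <= d * x by rewrite mulrC ler_wpM2r// ltW.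
lra.
Qed.

(** Each point of [X] has a positive distance from [K], so [hsqrt_near] in both directions makes the
    admissible points open and closed in [X]. *)
Lemma hsqrt_move K X (e e' : C) : compact K -> connected X -> X `&` K = set0 -> X e -> X e' ->
  hsqrt K e -> hsqrt K e'.
Proof.
move=> cK cX XK Xe Xe' he.
have far x : X x -> exists2 d, 0 < d & forall z, K z -> d <= md (z - x).
  move=> Xx; have nK : ~ K x by move=> Kx; have : (X `&` K) x by []; rewrite XK.
  have [d d0 hd] := closed_md (compact_closed (@norm_hausdorff _ _) cK) nK.
  by exists d => // z Kz; rewrite leNgt; apply/negP => /hd.
apply: (conn_md cX _ _ Xe he Xe') => x Xx hx; have [d d0 hd] := far x Xx.
  exists d => // y Xy yd; apply: hsqrt_near hx => z Kz; apply: lt_le_trans yd _; exact: hd.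
exists (d / 2) => [|y Xy yd hy]; first by rewrite divr_gt0.
apply: hx; apply: hsqrt_near hy => z Kz; rewrite md_distC.
have := hd z Kz; have := md_tri z x y; lra.
Qed.

(* Only the signs of the coordinates of the root are used: their sum cannot
   vanish above the height of [c], nor their difference off the ray above [c]. *)
Lemma sqrt_contra A Q s c b1 b2 : connected A -> connected Q -> con (A `|` Q) s ->
  (forall z, (A `|` Q) z -> s z ^+ 2 = z - c) ->
  (forall z, Q z -> 0 < complex.Im (z - c)) ->
  (forall z, A z -> 0 <= complex.Im (z - c) -> complex.Re (z - c) != 0) ->
  A b1 -> A b2 -> Q b1 -> Q b2 -> complex.Re (b1 - c) < 0 -> 0 < complex.Re (b2 - c) -> False.
Proof.
move=> cA cQ cs es hQ hA Ab1 Ab2 Qb1 Qb2 r1 r2.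
(* [p * m] is the real part of [z - c], of opposite signs at [b1] and [b2], while [p] keeps its sign
   on [Q] and [m] keeps its sign on [A]. *)
pose p z := complex.Re (s z) + complex.Im (s z); pose m z := complex.Re (s z) - complex.Im (s z).
have E z : (A `|` Q) z -> complex.Re (z - c) = complex.Re (s z) ^+ 2 - complex.Im (s z) ^+ 2 /\
    complex.Im (z - c) = 2 * (complex.Re (s z) * complex.Im (s z)).
  by move=> /es <-; case: (s z) => x y; rewrite expr2 /=; split; ring.
have sgn (K : set C) (k : C -> R) x y : connected K -> K `<=` A `|` Q ->
    (forall z w, `|k z - k w| <= 2 * md (s z - s w)) -> (forall z, K z -> k z != 0) ->
    K x -> K y -> 0 < k x -> 0 < k y.
  move=> cK sub lip nz Kx Ky kx.
  apply: (@conn_md K [set z | 0 < k z] x y cK) => // z Kz /= kz.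
    have kz2 : 0 < k z / 2 by rewrite divr_gt0.
    have [d d0 hd] := cs z (sub z Kz) _ kz2; exists d => // w Kw /(hd w (sub w Kw)) h.
    by have := lip w z; rewrite ler_norml => /andP[? ?]; lra.
  have kz' : k z < 0 by rewrite lt_neqAle nz//= leNgt; exact/negP.
  have kz2 : 0 < - k z / 2 by rewrite divr_gt0//; lra.
  have [d d0 hd] := cs z (sub z Kz) _ kz2; exists d => // w Kw /(hd w (sub w Kw)) h.
  by have := lip w z; rewrite ler_norml => /andP[? ?]; lra.
have lipp z w : `|p z - p w| <= 2 * md (s z - s w).
  have := md_Re (s z - s w); have := md_Im (s z - s w); rewrite !raddfB/= !ler_norml => /andP[? ?] /andP[? ?].
  by rewrite /p; lra.
have lipm z w : `|m z - m w| <= 2 * md (s z - s w).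
  have := md_Re (s z - s w); have := md_Im (s z - s w); rewrite !raddfB/= !ler_norml => /andP[? ?] /andP[? ?].
  by rewrite /m; lra.
have lipN (k : C -> R) : (forall z w, `|k z - k w| <= 2 * md (s z - s w)) ->
    forall z w, `|- k z - - k w| <= 2 * md (s z - s w).
  by move=> h z w; rewrite -opprD normrN; exact: h.
have pz z : Q z -> p z != 0.
  move=> Qz; have [_] := E z (or_intror Qz); have := hQ z Qz; rewrite /p => h1 h2.
  apply/eqP => h3; have h4 : complex.Re (s z) = - complex.Im (s z) by lra.
  by move: h1; rewrite h2 h4; have := sqr_ge0 (complex.Im (s z)); rewrite expr2; lra.
have mz z : A z -> m z != 0.
  move=> Az; have [h1 h2] := E z (or_introl Az); apply/eqP; rewrite /m => h3.
  have h4 : complex.Re (s z) = complex.Im (s z) by lra.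
  have : complex.Re (z - c) != 0.
    by apply: hA => //; rewrite h2 h4; have := sqr_ge0 (complex.Im (s z)); rewrite expr2; lra.
  by rewrite h1 h4 subrr eqxx.
have subA : A `<=` A `|` Q by left.
have subQ : Q `<=` A `|` Q by right.
have [x1 y1] := E b1 (or_introl Ab1); have [x2 y2] := E b2 (or_introl Ab2).
have q1 : p b1 * m b1 < 0 by move: x1 r1; rewrite /p /m; lra.
have q2 : 0 < p b2 * m b2 by move: x2 r2; rewrite /p /m; lra.
have [p1|p1] := ltP 0 (p b1).
  have p2 := sgn Q p b1 b2 cQ subQ lipp pz Qb1 Qb2 p1.
  have m2 : 0 < m b2 by rewrite pmulr_rgt0 in q2.
  have := sgn A m b2 b1 cA subA lipm mz Ab2 Ab1 m2.
  by rewrite pmulr_rlt0 in q1 => //; lra.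
have p1' : 0 < - p b1 by rewrite oppr_gt0 lt_neqAle pz.
have p2 : 0 < - p b2.
  by apply: (sgn Q (fun z => - p z) b1 b2) => //; [exact: lipN|move=> z Qz; rewrite oppr_eq0; exact: pz].
have m1 : 0 < m b1 by have : 0 < (- p b1) * m b1 by [rewrite mulNr; lra|]; rewrite pmulr_rgt0.
have := sgn A m b1 b2 cA subA lipm mz Ab1 Ab2 m1.
by move=> m2; have : 0 < (- p b2) * m b2 by [exact: mulr_gt0|]; rewrite mulNr; lra.
Qed.

End Con.

(** * Lifting over a domain by filling a grid *)

Section Lift.
Context {R : realType}.
Local Notation C := R[i].
Implicit Types (z w u : C) (r t : R) (A B K : set C).
Variables (D : set C) (f g : C -> C).
Hypothesis oD : open D.
Hypothesis hW : forall K e, compact K -> K `<=` D -> ~ D e -> hsqrt K e.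

Definition lift A psi := con A psi /\ forall z, A z -> f (psi z) = g z.

(** Even covering: a value prescribed over any point of the disc extends to a lift over the whole
    disc. *)
Hypothesis EC : forall z, D z -> exists2 r, 0 < r & disc z r `<=` D /\
  forall y w, disc z r y -> f w = g y -> exists2 psi, lift (disc z r) psi & psi y = w.
Hypothesis UN : forall K psi1 psi2 z, connected K -> K `<=` D -> lift K psi1 -> lift K psi2 ->
  K z -> psi1 z = psi2 z -> forall w, K w -> psi1 w = psi2 w.

Lemma lift_sub A B psi : A `<=` B -> lift B psi -> lift A psi.
Proof. by move=> s [c h]; split; [exact: con_sub s c|move=> z /s; exact: h]. Qed.

Definition good A := [/\ closed A, connected A, A `<=` D &
  forall z w, A z -> f w = g z -> exists2 psi, lift A psi & psi z = w].

(** Lifts over [A] and over [B] that agree at one common point agree on the whole intersection,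
    because it is connected. *)
Lemma good_glue A B : good A -> good B -> connected (A `&` B) -> A `&` B !=set0 -> good (A `|` B).
Proof.
move=> [clA cA AD lA] [clB cB BD lB] cAB [x [Ax Bx]].
split; [exact: closedU|by apply: connectedU => //; exists x|by move=> z [/AD|/BD]|].
have glue p1 p2 : lift A p1 -> lift B p2 -> p1 x = p2 x ->
    exists psi, [/\ lift (A `|` B) psi, forall z, A z -> psi z = p1 z & forall z, B z -> psi z = p2 z].
  move=> l1 l2 e.
  have E z : A z -> B z -> p1 z = p2 z.
    move=> Az Bz; apply: (@UN (A `&` B) p1 p2 x) => //.
    - by move=> y [/AD].
    - by apply: lift_sub l1 => y [].
    - by apply: lift_sub l2 => y [].
  pose psi z := if `[< A z >] then p1 z else p2 z.
  have eA z : A z -> psi z = p1 z by move=> Az; rewrite /psi; case: asboolP.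
  have eB z : B z -> psi z = p2 z by move=> Bz; rewrite /psi; case: asboolP => // Az; exact: E.
  exists psi; split => //; split => [|z [Az|Bz]].
  - apply: con_glue => //; first by apply: con_eq l1.1 => z Az; rewrite eA.
    by apply: con_eq l2.1 => z Bz; rewrite eB.
  - by rewrite eA//; exact: l1.2.
  - by rewrite eB//; exact: l2.2.
move=> z w [Az|Bz] e.
  have [p1 l1 e1] := lA z w Az e.
  have [p2 l2 e2] := lB x (p1 x) Bx (l1.2 x Ax).
  by have [|psi [h1 h2 h3]] := glue p1 p2 l1 l2; [by rewrite e2|exists psi => //; rewrite h2].
have [p2 l2 e2] := lB z w Bz e.
have [p1 l1 e1] := lA x (p2 x) Ax (l2.2 x Bx).
by have [|psi [h1 h2 h3]] := glue p1 p2 l1 l2; [by rewrite e1|exists psi => //; rewrite h3].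
Qed.

(** Small rectangles lie in evenly covered discs; adjacent ones meet in a segment, so the quarters
    glue. *)
Lemma good_rect (a b c d : R) : a <= b -> c <= d -> rect a b c d `<=` D -> good (rect a b c d).
Proof.
move=> ab cd sub.
refine (@rect_bisect R (fun a b c d => good (rect a b c d)) a b c d ab cd _ _).
  move=> a' b' c' d' _ ab' _ _ cd' _; move: {ab cd sub} a' b' c' d' ab' cd' => {}a {}b {}c {}d ab' cd'.
  set m := (a + b) / 2; set n := (c + d) / 2 => g1 g2 g3 g4.
  have am : a <= m by rewrite /m; lra.
  have mb : m <= b by rewrite /m; lra.
  have cn : c <= n by rewrite /n; lra.
  have nd : n <= d by rewrite /n; lra.
  have H (p q : R) : p <= q -> good (rect a m p q) -> good (rect m b p q) -> good (rect a b p q).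
    move=> pq h1 h2.
    have -> : rect a b p q = rect a m p q `|` rect m b p q.
      apply/seteqP; split => [z [/andP[? ?] ?]|z [|] [/andP[? ?] ?]].
      - by have [?|?] := leP (complex.Re z) m; [left|right]; split => //; lra.
      - by split => //; lra.
      - by split => //; lra.
    have E : rect a m p q `&` rect m b p q = rect m m p q.
      apply/seteqP; split => [z [[/andP[? ?] ?] [/andP[? ?] _]]|z [/andP[? ?] ?]].
        by split => //; lra.
      by split; split => //; lra.
    apply: good_glue => //; rewrite E; first exact: rect_connected.
    by exists (m +i* p); split => /=; lra.
  have -> : rect a b c d = rect a b c n `|` rect a b n d.
    apply/seteqP; split => [z [? /andP[? ?]]|z [|] [? /andP[? ?]]].
    - by have [?|?] := leP (complex.Im z) n; [left|right]; split => //; lra.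
    - by split => //; lra.
    - by split => //; lra.
  have E : rect a b c n `&` rect a b n d = rect a b n n.
    apply/seteqP; split => [z [[? /andP[? ?]] [_ /andP[? ?]]]|z [? /andP[? ?]]].
      by split => //; lra.
    by split; split => //; lra.
  apply: good_glue; [exact: H|exact: H|rewrite E; exact: rect_connected|rewrite E].
  by exists (a +i* n); split => /=; lra.
move=> x y xab ycd; have Dp : D (x +i* y) by exact: sub.
have [r r0 [sr hr]] := EC Dp; exists (r / 2); first by rewrite divr_gt0.
move=> a' b' c' d' ? ? ? ? ? ? ? ? h1 h2.
have pin : rect a' b' c' d' (x +i* y) by split => /=; lra.
have sd : rect a' b' c' d' `<=` disc (x +i* y) r.
  by move=> z zr; have := rect_md pin zr; rewrite /disc/=; lra.
split; [exact: rect_closed|exact: rect_connected|by move=> z /sd /sr|].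
move=> z w zr e; have [psi l e1] := hr z w (sd z zr) e.
by exists psi => //; exact: lift_sub sd l.
Qed.

(* The family of [good] sets plays the role of connected components. *)
Definition split_good S := closed S /\ forall z, S z ->
  exists A B, [/\ good A, closed B, S = A `|` B, A `&` B = set0 & A z].

Lemma split_sub S A B K z : S = A `|` B -> closed A -> closed B -> A `&` B = set0 ->
  connected K -> K `<=` S -> K z -> A z -> K `<=` A.
Proof. by move=> -> *; apply: (@conn_closed2 R K A B z). Qed.

Lemma absorb S K : split_good S -> connected K -> K `<=` S ->
  exists A B, [/\ closed A, closed B, S = A `|` B, A `&` B = set0 & K `<=` A] /\
    (K !=set0 -> good A) /\ (~ (K !=set0) -> A = set0).
Proof.
move=> [cS hS] cK KS; have [[z Kz]|nK] := pselect (K !=set0).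
  have [A [B [gA cB e AB Az]]] := hS z (KS z Kz).
  have clA : closed A by case: gA.
  exists A, B; split; last by split => // -[]; exists z.
  split => //; exact: (split_sub e clA cB AB cK KS Kz Az).
exists set0, S; split; last by split.
by split => //; [exact: closed0|rewrite set0U|rewrite set0I|move=> z Kz; case: nK; exists z].
Qed.

(** When the contact pieces [K1] and [K2] lie in different good parts [A1] and [A2], each gluing has
    a connected intersection, [K1] or [K2]. The last hypothesis excludes a common part, where [Q]
    would close a ring. *)
Lemma add_cell S Q K1 K2 : split_good S -> good Q -> Q `&` S = K1 `|` K2 ->
  connected K1 -> connected K2 ->
  (forall A, good A -> A `<=` S -> K1 !=set0 -> K2 !=set0 -> K1 `<=` A -> K2 `<=` A -> False) ->
  split_good (S `|` Q).
Proof.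
move=> spS gQ QS cK1 cK2 hno; have [cS hS] := spS.
have KS1 : K1 `<=` S by move=> z Kz; have : (Q `&` S) z by [rewrite QS; left|]; case.
have KS2 : K2 `<=` S by move=> z Kz; have : (Q `&` S) z by [rewrite QS; right|]; case.
have KQ1 : K1 `<=` Q by move=> z Kz; have : (Q `&` S) z by [rewrite QS; left|]; case.
have KQ2 : K2 `<=` Q by move=> z Kz; have : (Q `&` S) z by [rewrite QS; right|]; case.
have [A1 [B1 [[cA1 cB1 e1 d1 s1] [g1 n1]]]] := absorb spS cK1 KS1.
have [A2 [B2 [[cA2 cB2 e2 d2 s2] [g2 n2]]]] := absorb spS cK2 KS2.
have AS1 : A1 `<=` S by rewrite e1; left.
have AS2 : A2 `<=` S by rewrite e2; left.
have ne1 z : A1 z -> K1 !=set0 by move=> Az; apply: contrapT => /n1 h; rewrite h in Az.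
have ne2 z : A2 z -> K2 !=set0 by move=> Az; apply: contrapT => /n2 h; rewrite h in Az.
have conn1 z : A1 z -> connected A1 by move=> /ne1/g1 [].
have conn2 z : A2 z -> connected A2 by move=> /ne2/g2 [].
have dis : A1 `&` A2 = set0.
  apply/seteqP; split => // z [Az1 Az2].
  have sub : A1 `<=` A2 := split_sub e2 cA2 cB2 d2 (conn1 z Az1) AS1 Az1 Az2.
  apply: (hno A2 (g2 (ne2 z Az2)) AS2 (ne1 z Az1) (ne2 z Az2)) => //.
  exact: subset_trans s1 sub.
have I1 : A1 `&` Q = K1.
  apply/seteqP; split => [z [Az Qz]|z Kz]; last by split; [exact: s1|exact: KQ1].
  have : (Q `&` S) z by split => //; exact: AS1.
  rewrite QS => -[//|/s2 A2z]; have : (A1 `&` A2) z by []; by rewrite dis.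
have gQ1 : good (A1 `|` Q).
  have [h|h] := pselect (K1 !=set0); last by rewrite n1// set0U.
  by apply: good_glue; [exact: g1|exact: gQ|rewrite I1|rewrite I1].
have I2 : (A1 `|` Q) `&` A2 = K2.
  apply/seteqP; split => [z [[A1z|Qz] A2z]|z Kz]; last by split; [right; exact: KQ2|exact: s2].
    by have : (A1 `&` A2) z by []; rewrite dis.
  have : (Q `&` S) z by split => //; exact: AS2.
  rewrite QS => -[/s1 A1z|//]; have : (A1 `&` A2) z by []; by rewrite dis.
pose Q2 := A1 `|` Q `|` A2.
have gQ2 : good Q2.
  have [h|h] := pselect (K2 !=set0); last by rewrite /Q2 n2// setU0.
  by apply: good_glue; [exact: gQ1|exact: g2|rewrite I2|rewrite I2].
have [cQ _ _ _] := gQ.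
split; first exact: closedU.
move=> z Sz; have [Qz|nQz] := pselect (Q2 z).
  exists Q2, (B1 `&` B2); split => //; first exact: closedI.
    apply/seteqP; split => w.
      case=> [Sw|Qw]; last by left; left; right.
      have : (A1 `|` B1) w by rewrite -e1.
      case=> [?|Bw1]; first by left; left; left.
      have : (A2 `|` B2) w by rewrite -e2.
      by case=> [?|Bw2]; [left; right|right].
    case=> [[[/AS1|]|/AS2]|[Bw1 _]]; [by left|by right|by left|left].
    by rewrite e1; right.
  apply/seteqP; split => // w [[[Aw|Qw]|Aw] [Bw1 Bw2]].
  - by have : (A1 `&` B1) w by []; rewrite d1.
  - have : (Q `&` S) w by split => //; rewrite e1; right.
    rewrite QS => -[/s1 Aw|/s2 Aw].
      by have : (A1 `&` B1) w by []; rewrite d1.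
    by have : (A2 `&` B2) w by []; rewrite d2.
  - by have : (A2 `&` B2) w by []; rewrite d2.
have Sz' : S z by case: Sz => // Qz; case: nQz; left; right.
have [A [B [gA cB e AB Az]]] := hS z Sz'.
have [clA cA _ _] := gA; have AS : A `<=` S by rewrite e; left.
have no w : A w -> Q w -> False.
  move=> Aw Qw; apply: nQz; have : (Q `&` S) w by split => //; exact: AS.
  rewrite QS => -[/s1 Kw|/s2 Kw].
    left; left; exact: (split_sub e1 cA1 cB1 d1 cA AS Aw Kw).
  right; exact: (split_sub e2 cA2 cB2 d2 cA AS Aw Kw).
exists A, (B `|` Q); split => //; first exact: closedU.
  by rewrite e setUA.
apply/seteqP; split => // w [Aw [Bw|Qw]]; last exact: (no w).
by have : (A `&` B) w by []; rewrite AB.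
Qed.

Section Grid.
Variables (x0 y0 h : R) (N : nat).
Hypothesis h0 : 0 < h.

Definition gx (i : nat) : R := x0 + i%:R * h.
Definition gy (j : nat) : R := y0 + j%:R * h.
Definition cell i j : set C := rect (gx i) (gx i + h) (gy j) (gy j + h).

(** In row-by-row numbering a cell comes after its left neighbour and after the row below, which
    limits its contact with the cells already present. *)
Definition cells n : set C := [set z | exists i j,
  [/\ (i < N)%N, (j * N + i < n)%N, cell i j `<=` D & cell i j z]].

Lemma gxS i j : j = i.+1 -> gx j = gx i + h. Proof. by move=> ->; rewrite /gx -natr1; ring. Qed.
Lemma gyS i j : j = i.+1 -> gy j = gy i + h. Proof. by move=> ->; rewrite /gy -natr1; ring. Qed.
Lemma gx_lt i j : (i < j)%N -> gx i + h <= gx j.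
Proof. by move=> ij; rewrite -(gxS (erefl _)) /gx lerD2l ler_pM2r// ler_nat. Qed.
Lemma gy_lt i j : (i < j)%N -> gy i + h <= gy j.
Proof. by move=> ij; rewrite -(gyS (erefl _)) /gy lerD2l ler_pM2r// ler_nat. Qed.

Lemma strictx i i' z j' : cell i' j' z -> gx i < complex.Re z -> complex.Re z < gx i + h -> i' = i.
Proof.
by move=> [/andP[? ?] _] ? ?; case: (ltngtP i' i) => // [/gx_lt|/gx_lt] ?; exfalso; lra.
Qed.

Lemma stricty j i' z j' : cell i' j' z -> gy j < complex.Im z -> complex.Im z < gy j + h -> j' = j.
Proof.
by move=> [_ /andP[? ?]] ? ?; case: (ltngtP j' j) => // [/gy_lt|/gy_lt] ?; exfalso; lra.
Qed.

(* In row-by-row order, an earlier cell meets a cell only along its left side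
   or along its bottom side. *)
Lemma contact i j i' j' z : (i < N)%N -> (i' < N)%N -> (j' * N + i' < j * N + i)%N ->
  cell i j z -> cell i' j' z ->
  [/\ j' = j, i = i'.+1 & complex.Re z = gx i] \/
  [/\ j = j'.+1, complex.Im z = gy j &
     [\/ i' = i, i = i'.+1 /\ complex.Re z = gx i | i' = i.+1 /\ complex.Re z = gx i + h]].
Proof.
move=> iN iN' lt [/andP[a1 a2] /andP[b1 b2]] [/andP[a1' a2'] /andP[b1' b2']].
have hx : (i' < i)%N -> i = i'.+1 /\ complex.Re z = gx i.
  move=> l; have l1 := gx_lt l; have e : complex.Re z = gx i by lra.
  split=> //; apply/eqP; rewrite eqn_leq l andbT leqNgt; apply/negP => /gx_lt H.
  have H2 := gxS (erefl i'.+1); move: H H2; set a := gx i'.+1 => H H2.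
  by have : h <= 0 by [lra|]; rewrite leNgt h0.
have hx' : (i < i')%N -> i' = i.+1 /\ complex.Re z = gx i + h.
  move=> l; have l1 := gx_lt l; have e : complex.Re z = gx i + h by lra.
  split=> //; apply/eqP; rewrite eqn_leq l andbT leqNgt; apply/negP => /gx_lt H.
  have H2 := gxS (erefl i.+1); move: H H2; set a := gx i.+1 => H H2.
  by have : h <= 0 by [lra|]; rewrite leNgt h0.
have jj : (j' <= j)%N.
  rewrite leqNgt; apply/negP => jl; move: lt; rewrite ltnNge => /negP; apply.
  apply: leq_trans (leq_addr _ _); apply: leq_trans (leq_mul jl (leqnn N)).
  by rewrite mulSn addnC leq_add2r ltnW.
move: jj; rewrite leq_eqVlt => /orP[/eqP ej|l].
  by left; have [|? ?] := hx; [move: lt; rewrite ej ltn_add2l|split].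
right; have l1 := gy_lt l; have e : complex.Im z = gy j by lra.
split => //.
  apply/eqP; rewrite eqn_leq l andbT leqNgt; apply/negP => /gy_lt H.
  have H2 := gyS (erefl j'.+1); move: H H2; set a := gy j'.+1 => H H2.
  by have : h <= 0 by [lra|]; rewrite leNgt h0.
by case: (ltngtP i' i) => [/hx|/hx'|]; [constructor 2|constructor 3|constructor 1].
Qed.

Lemma cells_bounded n : exists M, forall z, cells n z -> md z <= M.
Proof.
exists (`|gx 0| + `|gx N| + (`|gy 0| + `|gy n|)) => z [i [j [iN jn _ [/andP[a1 a2] /andP[b1 b2]]]]].
have c1 : gx 0 <= gx i by rewrite /gx lerD2l ler_pM2r// ler_nat.
have c2 := gx_lt iN.
have c3 : gy 0 <= gy j by rewrite /gy lerD2l ler_pM2r// ler_nat.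
have jl : (j < n)%N.
  have N0 : (0 < N)%N by exact: leq_trans iN.
  by apply: leq_ltn_trans jn; apply: leq_trans (leq_addr _ _); rewrite leq_pmulr.
have c4 := gy_lt jl; apply: le_trans (md_le_ReIm z) _.
have := ler_norm (gx N); have := ler_norm (gy n); have := ler_norm (- gx 0); have := ler_norm (- gy 0).
rewrite !normrN => ? ? ? ?; have := normr_ge0 (gx 0); have := normr_ge0 (gy 0).
have := normr_ge0 (gx N); have := normr_ge0 (gy n) => ? ? ? ?.
by apply: lerD; rewrite ler_norml; lra.
Qed.

(* A good set meeting a cell at both ends of its bottom side, above a missing
   cell, would carry a root turning once around the missing cell. *)
Lemma no_handle i j j' A : j' = j.+1 -> (i < N)%N -> good A -> A `<=` cells (j' * N + i) ->
  cell i j' `<=` D -> ~ (cell i j `<=` D) ->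
  A (gx i +i* gy j') -> A ((gx i + h) +i* gy j') -> False.
Proof.
have hp := h0; move=> jj' iN [clA cA AD _] AS QD nD b1 b2.
have [e eQ nDe] : exists2 e, cell i j e & ~ D e.
  apply: contrapT => H; apply: nD => z zQ; apply: contrapT => nDz; apply: H; by exists z.
pose Q := cell i j'; pose c : C := (gx i + h / 2) +i* (gy j + h / 2).
have Sy := gyS jj'.
have [M hM] := cells_bounded (j' * N + i).
have q : Q (gx i +i* gy j') by split => /=; lra.
have q2 : Q ((gx i + h) +i* gy j') by split => /=; lra.
have cK : compact (A `|` Q).
  apply: (@compact_md R _ (Order.max M (md (gx i +i* gy j') + (h + h)))).
    apply: closedU => //; exact: rect_closed.
  move=> z [/AS/hM zM|zQ]; rewrite le_max ?zM//; apply/orP; right.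
  by have := rect_md q zQ; have := md_subl z (gx i +i* gy j'); lra.
have subD : A `|` Q `<=` D by move=> z [/AD|/QD].
have he := hW cK subD nDe.
case: (eQ) => /andP[e1 e2] /andP[e3 e4].
(* The segment from [e] to the centre [c] starts outside [D] and then stays in the interior of the
   missing cell, so it avoids [A] and [Q]. *)
have hc : hsqrt (A `|` Q) c.
  apply: (@hsqrt_move R (A `|` Q) (segp e c @` `[0, 1]%classic) e c cK) => //.
  - by apply: path_image_connected; exact: cont_segp.
  - apply/seteqP; split => // _ [[t + <-] zK]; rewrite /= in_itv/= => /andP[t0 t1].
    move: t0; rewrite le_eqVlt => /orP[/eqP t0|t0].
      by apply: nDe; move: (subD _ zK); rewrite -t0 segp0.
    have x1 : gx i < complex.Re (segp e c t) by rewrite Re_segp /=; nra.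
    have x2 : complex.Re (segp e c t) < gx i + h by rewrite Re_segp /=; nra.
    have y1 : gy j < complex.Im (segp e c t) by rewrite Im_segp /=; nra.
    have y2 : complex.Im (segp e c t) < gy j + h by rewrite Im_segp /=; nra.
    case: zK => [/AS [i' [j0 [_ _ cD cz]]]|[_ /andP[? _]]]; last by lra.
    by apply: nD; rewrite -(strictx cz x1 x2) -(stricty cz y1 y2).
  - by exists 0; rewrite ?segp0//= in_itv/= lexx ler01.
  - by exists 1; rewrite ?segp1//= in_itv/= lexx ler01.
have [s [cs es]] := hc.
apply: (@sqrt_contra R A Q s c (gx i +i* gy j') ((gx i + h) +i* gy j')) => //.
- exact: rect_connected.
- by move=> z [_ /andP[? _]]; rewrite raddfB/=; lra.
- move=> z Az; rewrite !raddfB/= => h1; apply/eqP => h2.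
  have [i' [j0 [iN' lt cD cz]]] := AS z Az.
  have ei : i' = i by apply: (strictx cz); lra.
  have jj : (j0 < j.+1)%N.
    by move: lt; rewrite ei ltn_add2r ltn_mul2r jj' => /andP[_].
  move: jj; rewrite ltnS leq_eqVlt => /orP[/eqP ej|/gy_lt jl].
    by apply: nD; rewrite -ej -ei.
  by case: cz => _ /andP[_ ?]; lra.
- by rewrite raddfB/=; lra.
- by rewrite raddfB/=; lra.
Qed.

Lemma row_lt i j i' j' : (i' < N)%N -> j = j'.+1 -> (j' * N + i' < j * N + i)%N.
Proof.
by move=> iN ->; apply: leq_trans (leq_addr _ _); rewrite mulSn addnC ltn_add2r.
Qed.

(** If the cell below is present, the contact is the bottom side, perhaps with the left side, and is
    connected. If it is missing, the contact is at most the left side or left corner on one hand,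
    the right corner on the other; [no_handle] shows that these belong to different parts. *)
Lemma cells_step i j : (i < N)%N -> split_good (cells (j * N + i)) -> cell i j `<=` D ->
  split_good (cells (j * N + i) `|` cell i j).
Proof.
have hp := h0; move=> iN sp QD; set n := (j * N + i)%N; pose Q := cell i j.
have gQ : good Q by apply: good_rect => //; lra.
have inS i' j' z : (i' < N)%N -> (j' * N + i' < n)%N -> cell i' j' `<=` D -> cell i' j' z -> cells n z.
  by move=> ? ? ? ?; exists i', j'.
pose L := exists2 i', i = i'.+1 & cell i' j `<=` D.
pose Bt := exists2 j', j = j'.+1 & cell i j' `<=` D.
have LS z : L -> Q z -> complex.Re z = gx i -> cells n z.
  move=> [i' ei cD] [/andP[a1 a2] b] e; apply: (inS i' j) => //.
  - by rewrite ei in iN; exact: ltnW.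
  - by rewrite /n ei addnS.
  - by split => //; rewrite e (gxS ei); lra.
have BS z : Bt -> Q z -> complex.Im z = gy j -> cells n z.
  move=> [j' ej cD] [a /andP[b1 b2]] e; apply: (inS i j') => //.
  - exact: row_lt.
  - by split => //; rewrite e (gyS ej); lra.
have Qin (a b : R) : gx i <= a <= gx i + h -> gy j <= b <= gy j + h -> Q (a +i* b) by [].
have [hB|nB] := pselect Bt.
  pose K : set C := [set z | Q z /\ (complex.Im z = gy j \/ (L /\ complex.Re z = gx i))].
  apply: (@add_cell _ Q K set0) => //.
  - rewrite setU0; apply/seteqP; split => [z [Qz [i' [j' [iN' lt cD cz]]]]|z [Qz [e|[l e]]]].
    + split => //; have [[ej ei e]|[ej e _]] := contact iN iN' lt Qz cz; last by left.
      by right; split => //; exists i' => //; rewrite -ej.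
    + by split => //; exact: BS.
    + by split => //; exact: LS.
  - apply: (@star_connected R (gx i +i* gy j)) => z t [Qz hz] t01; split.
      by apply: rect_convex => //; split => /=; lra.
    by case: hz => [e|[l e]]; [left; rewrite Im_segp e /=; ring|right; rewrite Re_segp e /=; split => //; ring].
  - exact: connected0.
  - by move=> A _ _ _ [z].
(* Diagonal neighbours below, which touch the new cell in a corner only. *)
pose LB := exists i' j', [/\ i = i'.+1, j = j'.+1 & cell i' j' `<=` D].
pose RB := exists i' j', [/\ i' = i.+1, (i' < N)%N, j = j'.+1 & cell i' j' `<=` D].
pose K1 : set C := [set z | Q z /\ complex.Re z = gx i /\ (L \/ (complex.Im z = gy j /\ LB))].
pose K2 : set C := [set z | Q z /\ complex.Re z = gx i + h /\ (complex.Im z = gy j /\ RB)].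
have c1 : Q (gx i +i* gy j) by split => /=; lra.
have c2 : Q ((gx i + h) +i* gy j) by split => /=; lra.
apply: (@add_cell _ Q K1 K2) => //.
- apply/seteqP; split => [z [Qz [i' [j' [iN' lt cD cz]]]]|z [[Qz [e hz]]|[Qz [e [e2 hz]]]]].
  + have [[ej ei e]|[ej e [ei|[ei e2]|[ei e2]]]] := contact iN iN' lt Qz cz.
    * by left; split => //; split => //; left; exists i' => //; rewrite -ej.
    * by case: nB; exists j' => //; rewrite -ei.
    * by left; split => //; split => //; right; split => //; exists i', j'.
    * by right; split => //; split => //; split => //; exists i', j'.
  + split => //; case: hz => [l|[e2 [i' [j' [ei ej cD]]]]]; first exact: LS.
    have iN' : (i' < N)%N by rewrite ei in iN; exact: ltnW.
    apply: (inS i' j') => //; first exact: row_lt.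
    by split; rewrite ?e ?e2 ?(gxS ei) ?(gyS ej); lra.
  + split => //; have [i' [j' [ei iN' ej cD]]] := hz.
    apply: (inS i' j') => //; first exact: row_lt.
    by split; rewrite ?e ?e2 ?(gxS ei) ?(gyS ej); lra.
- apply: (@star_connected R (gx i +i* gy j)) => z t [Qz [e hz]] t01; split.
    exact: rect_convex.
  by split; [rewrite Re_segp e /=; ring|case: hz => [?|[e2 ?]]; [left|right; rewrite Im_segp e2 /=; split => //; ring]].
- apply: (@star_connected R ((gx i + h) +i* gy j)) => z t [Qz [e [e2 hz]]] t01; split.
    exact: rect_convex.
  by split; [rewrite Re_segp e /=; ring|split => //; rewrite Im_segp e2 /=; ring].
move=> A gA AS [z1 [_ [_ h1]]] [z2 [_ [_ [_ h2]]]] s1 s2.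
have [i' [j' [ei iN' ej cD]]] := h2.
apply: (@no_handle i j' j A ej iN gA AS QD).
- by move=> cD'; apply: nB; exists j'.
- apply: s1; split => //; split => //; case: h1 => [|[_ ?]]; [by left|by right].
- by apply: s2; split.
Qed.

Lemma cells_split n : split_good (cells n).
Proof.
elim: n => [|n IH].
  have -> : cells 0 = set0 by apply/seteqP; split => // z [i [j [_]]].
  by split; [exact: closed0|].
have [N0|N0] := posnP N.
  have -> : cells n.+1 = set0 by apply/seteqP; split => // z [i [j [+ _ _]]]; rewrite N0.
  by split; [exact: closed0|].
pose i := (n %% N)%N; pose j := (n %/ N)%N.
have iN : (i < N)%N by rewrite ltn_mod.
have nE : n = (j * N + i)%N by exact: divn_eq.
have ij i' j' : (i' < N)%N -> (j' * N + i')%N = n -> i' = i /\ j' = j.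
  by move=> iN' e; rewrite /i /j -e modnMDl modn_small// divnMDl// divn_small// addn0.
have cS : cells n `<=` cells n.+1 by move=> z [i' [j' [? l ? ?]]]; exists i', j'; split => //; exact: ltnW.
have [QD|nQ] := pselect (cell i j `<=` D).
  have -> : cells n.+1 = cells n `|` cell i j.
    apply/seteqP; split => [z [i' [j' [iN' + cD cz]]]|z [/cS //|Qz]]; last by exists i, j; rewrite -nE.
    rewrite ltnS leq_eqVlt => /orP[/eqP /(ij _ _ iN')[<- <-]|l]; first by right.
    by left; exists i', j'.
  rewrite nE; apply: cells_step => //; by rewrite -nE.
have -> // : cells n.+1 = cells n.
apply/seteqP; split => // z [i' [j' [iN' + cD cz]]].
rewrite ltnS leq_eqVlt => /orP[/eqP /(ij _ _ iN')[ei ej]|l]; last by exists i', j'.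
by case: nQ; rewrite -ei -ej.
Qed.

End Grid.

Lemma lebesgue_number K : compact K -> K `<=` D -> exists2 d, 0 < d & forall z, K z -> disc z d `<=` D.
Proof.
move=> cK KD; apply: contrapT => H.
have ex n : exists z, K z /\ exists2 y, md (y - z) < n.+1%:R^-1 & ~ D y.
  apply: contrapT => h; apply: H; exists (n.+1%:R^-1); first by rewrite invr_gt0.
  move=> z Kz y yz; apply: contrapT => nD; apply: h; by exists z; split => //; exists y.
have [u hu] := choice ex.
have [c Kc hc] := compact_seq cK (fun n => (hu n).1).
have /open_md/(_ c (KD c Kc))[r r0 sr] := oD.
have r2 : 0 < r / 2 by rewrite divr_gt0.
have [N hN] := div_small (ler01 : (0 : R) <= 1) r2.
have [n Nn un] := hc _ r2 N.
have [_ [y yz nD]] := hu n.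
apply: nD; apply: sr; rewrite /disc/=; have := md_tri y c (u n).
by have := hN n Nn; rewrite mul1r => /(lt_trans yz) ? ?; lra.
Qed.

(** The grid has mesh [d / 4] for a Lebesgue number [d] of [K] in [D]: cells meeting [K] lie in [D],
    and the good part at [z0] contains [K] by connectedness. *)
Lemma lift_compact K z0 w0 : compact K -> connected K -> K `<=` D -> K z0 -> f w0 = g z0 ->
  exists2 psi, lift K psi & psi z0 = w0.
Proof.
move=> cK coK KD Kz e0.
have [d d0 hd] := lebesgue_number cK KD; have [M M0 hM] := compact_bound cK.
pose h := d / 4; have h0 : 0 < h by rewrite /h; lra.
pose N := (Num.truncn (2 * M / h)).+1.
pose S := cells (- M) (- M) h N (N * N).
have loc (x : R) : `|x| <= M -> exists2 i, (i < N)%N & - M + i%:R * h <= x <= - M + i%:R * h + h.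
  rewrite ler_norml => /andP[x1 x2].
  have q0 : 0 <= (x + M) / h by rewrite divr_ge0 ?(ltW h0)//; lra.
  have /andP[] := truncn_itv q0; set k := Num.truncn _.
  have -> : (k.+1%:R : R) = k%:R + 1 by rewrite -natr1.
  rewrite ler_pdivlMr// ltr_pdivrMr// => t1 t2.
  exists k.
    by rewrite ltnS; apply: le_truncn; rewrite ler_pM2r ?invr_gt0//; lra.
  by lra.
have KS : K `<=` S.
  move=> z Kz'; have zM := hM z Kz'.
  have [i iN hi] := loc _ (le_trans (md_Re z) zM).
  have [j jN hj] := loc _ (le_trans (md_Im z) zM).
  have cz : cell (- M) (- M) h i j z by [].
  exists i, j; split => //.
    apply: (@leq_trans (j * N + N)); first by rewrite ltn_add2l.
    by rewrite addnC -mulSn leq_mul2r jN orbT.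
  move=> w cw; apply: (hd z Kz'); have := rect_md cz cw; rewrite /disc/= /h; lra.
have [_ hS] := @cells_split (- M) (- M) h N h0 (N * N).
have [A [B [gA cB e AB Az]]] := hS z0 (KS z0 Kz).
have [clA _ _ lA] := gA.
have KA := split_sub e clA cB AB coK KS Kz Az.
have [psi l p0] := lA z0 w0 Az e0.
by exists psi => //; exact: lift_sub KA l.
Qed.

(** The value at [z] is read off a lift over a compact connected set containing [z0] and [z]; two
    such sets give the same value because their union is again of this kind. *)
Lemma lift_global z0 w0 : connected D -> D z0 -> f w0 = g z0 ->
  exists psi, [/\ forall z, D z -> {for z, continuous psi}, forall z, D z -> f (psi z) = g z & psi z0 = w0].
Proof.
move=> cD Dz0 e0.
have ex z : exists K : set C, D z -> [/\ compact K, connected K, K `<=` D, K z0 & K z].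
  have [Dz|nD] := pselect (D z); last by exists set0 => /nD.
  by have [K hK] := path_compact (path_in_connected oD cD Dz0 Dz); exists K.
have [K hK] := choice ex.
have ex2 z : exists w, D z -> exists p, [/\ lift (K z) p, p z0 = w0 & p z = w].
  have [Dz|nD] := pselect (D z); last by exists 0 => /nD.
  have [k1 k2 k3 k4 k5] := hK z Dz.
  by have [p l pe] := lift_compact k1 k2 k3 k4 e0; exists (p z) => _; exists p.
have [psi hpsi] := choice ex2.
have uni L p z : connected L -> L `<=` D -> L z0 -> L z -> compact L -> lift L p -> p z0 = w0 -> p z = psi z.
  move=> cL LD Lz0 Lz kL lp pe; have Dz := LD z Lz.
  have [k1 k2 k3 k4 k5] := hK z Dz; have [q [lq qe <-]] := hpsi z Dz.
  have cU : connected (L `|` K z) by apply: connectedU => //; exists z0.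
  have UD : L `|` K z `<=` D by move=> y [/LD|/k3].
  have [s ls se] := lift_compact (compactU kL k1) cU UD (or_introl Lz0) e0.
  have s1 : lift L s by apply: lift_sub ls; left.
  have s2 : lift (K z) s by apply: lift_sub ls; right.
  rewrite (UN cL LD lp s1 Lz0 (etrans pe (esym se)) Lz).
  by rewrite (UN k2 k3 lq s2 k4 (etrans qe (esym se)) k5).
exists psi; split => [z Dz|z Dz|].
- have [k1 k2 k3 k4 k5] := hK z Dz.
  have /open_md/(_ z Dz)[r r0 sr] := oD.
  have r2 : 0 < r / 2 by rewrite divr_gt0.
  have sub : cdisc z (r / 2) `<=` D by apply: subset_trans sr; apply: cdisc_sub_disc; lra.
  pose L := K z `|` cdisc z (r / 2).
  have cz : cdisc z (r / 2) z by rewrite /cdisc/= subrr md0 ltW.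
  have cc : connected (cdisc z (r / 2)).
    apply: (@star_connected R z) => w t wr /andP[t0 t1]; rewrite /cdisc/= /segp addrAC subrr add0r mdM mdr ger0_norm//.
    by apply: le_trans wr; rewrite ler_piMl// md_ge0.
  have cL : connected L by apply: connectedU => //; exists z.
  have kL : compact L by apply: compactU => //; exact: compact_cdisc.
  have LD : L `<=` D by move=> y [/k3|/sub].
  have [p lp pe] := lift_compact kL cL LD (or_introl k4) e0.
  have pE y : L y -> p y = psi y by move=> Ly; exact: (uni L p y cL LD (or_introl k4) Ly kL lp pe).
  apply: (@con_disc_cont R z (r / 2)); last exact: disc_center.
  apply: (@con_eq R _ p) => [y yr|]; first by apply: pE; right; exact: disc_sub_cdisc.
  by apply: con_sub lp.1 => y yr; right; exact: disc_sub_cdisc.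
- have [k1 k2 k3 k4 k5] := hK z Dz; have [q [lq qe <-]] := hpsi z Dz; exact: lq.2.
- have [k1 k2 k3 k4 k5] := hK z0 Dz0; have [q [lq qe qz]] := hpsi z0 Dz0.
  by rewrite -qz.
Qed.

End Lift.

(** * Inverse branches of the iterates *)

Section Branches.
Context {R : realType}.
Local Notation C := R[i].
Implicit Types (z w u : C) (r t : R) (A B K : set C) (F f g : C -> C).

(** Near [a] the function [F y - dv F a * y] is Lipschitz with constant half of [md (dv F a)]. *)
Lemma locinj F a r : 0 < r -> hol (disc a r) F -> dv F a != 0 ->
  exists2 t, 0 < t & t <= r /\ inj (disc a t) F.
Proof.
move=> r0 hF d0; have ra := disc_center a r0.
have hdF := hol_dv (@open_disc R a r) hF.
pose m := md (dv F a) / 2; have m0 : 0 < m by rewrite divr_gt0// md_gt0.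
have /contP/(_ m m0)[t t0 ht] := hol_cont hdF ra.
exists (Order.min r t); first by rewrite lt_min r0.
split=> [|z w zt wt e]; first by rewrite ge_min lexx.
have sub : disc a (Order.min r t) `<=` disc a r by move=> y; rewrite /disc/= lt_min => /andP[].
pose h y := F y - dv F a * y.
have hh y : disc a (Order.min r t) y -> hd h y (dv F y - dv F a).
  move=> /sub yr; have := hdB (dvP hF yr) (hdZ (dv F a) (hd_id y)).
  by rewrite mulr1.
have b : md (h z - h w) <= m * md (z - w).
  apply: (@mvi_disc R a (Order.min r t)) => //.
    by move=> y /hh; exists (dv F y - dv F a).
  move=> y yt; rewrite (hd_dv (hh y yt)); apply/ltW/ht.
  by move: yt; rewrite /disc/= lt_min => /andP[].
move: b; rewrite /h e.
have -> : F w - dv F a * z - (F w - dv F a * w) = - (dv F a * (z - w)) by ring.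
rewrite mdN mdM => b; apply/eqP; rewrite -subr_eq0 -md_eq0 eq_le md_ge0 andbT.
have : md (dv F a) = 2 * m by rewrite /m; field.
move=> E; rewrite E in b; have : m * md (z - w) <= 0 by lra.
by rewrite pmulr_rle0.
Qed.

Lemma iter_dv f n w : hol setT f -> (forall j, (j < n)%N -> dv f (iter j f w) != 0) ->
  dv (iter n f) w != 0.
Proof.
move=> hf; elim: n => [_|n IH h].
  by rewrite (hd_dv (hd_id w)) oner_eq0.
have h1 := dvP (hol_iter n hf) (I : setT w).
have h2 := dvP hf (I : setT (iter n f w)).
rewrite (hd_dv (hd_comp h1 h2)) mulf_neq0//; first exact: h.
by apply: IH => j jn; apply: h; exact: ltnW.
Qed.

Lemma regular_dv f w : hol setT f -> regular_value f (f w) -> dv f w != 0.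
Proof.
move=> hf [r r0 H]; have [|g [/holomorphic_hol hg fg gw]] := H w; first by rewrite ballE; exact: disc_center.
rewrite ballE in hg fg; have wr : disc (f w) r (f w) by exact: disc_center.
have h1 := dvP hg wr; have h2 : hd f (g (f w)) (dv f w) by rewrite gw; exact: dvP hf _.
have h3 : hd (fun u => f (g u)) (f w) 1.
  by apply: hd_eq r0 _ (hd_id _) => y; rewrite inE => /fg ->.
apply/eqP => e; have := hd_uniq h3 (hd_comp h1 h2); rewrite e ?mulr0 ?mul0r => /eqP.
by rewrite oner_eq0.
Qed.

(** A singular value along the orbit would put its later images, among them [iter n f s], into the
    postsingular set. *)
Lemma post_regular f n m s : ~ postsingular_set f (iter n f s) -> (m <= n)%N ->
  regular_value f (iter m f s).
Proof.
move=> nP mn; apply: contrapT => sv; apply: nP; apply: subset_closure.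
by exists (n - m)%N => //; exists (iter m f s) => //; rewrite -iterD subnK.
Qed.

(** Off the postsingular set the derivative of the iterate does not vanish at [a z], so the iterate
    is locally injective there and agreement is an open condition; it is closed by continuity. *)
Lemma uniq_iter f n K a b z0 : hol setT f -> connected K -> con K a -> con K b ->
  (forall z, K z -> iter n f (a z) = iter n f (b z)) ->
  (forall z, K z -> ~ postsingular_set f (iter n f (a z))) ->
  K z0 -> a z0 = b z0 -> forall z, K z -> a z = b z.
Proof.
move=> hf cK ca cb ab nP Kz0 e0 z Kz.
apply: (@conn_md R K (fun z => a z = b z) z0 z cK) => // y Ky e.
  have dn : dv (iter n f) (a y) != 0.
    apply: iter_dv => // j jn; apply: regular_dv => //.
    exact: (post_regular (m := j.+1) (nP y Ky) jn).
  have [t t0 [_ it]] := locinj ltr01 (hol_sub (fun _ _ => I) (hol_iter n hf)) dn.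
  have [d1 d10 h1] := ca y Ky t t0; have [d2 d20 h2] := cb y Ky t t0.
  exists (Order.min d1 d2) => [|w Kw]; first by rewrite lt_min d10.
  rewrite lt_min => /andP[w1 w2]; apply: it; last exact: ab.
    exact: h1.
  by rewrite /disc/= e; exact: h2.
have p : 0 < md (a y - b y) / 2 by rewrite divr_gt0// md_gt0 subr_eq0; exact/eqP.
have [d1 d10 h1] := ca y Ky _ p; have [d2 d20 h2] := cb y Ky _ p.
exists (Order.min d1 d2) => [|w Kw]; first by rewrite lt_min d10.
rewrite lt_min => /andP[/(h1 w Kw) w1 /(h2 w Kw) w2] e'.
have := md_tri (a y) (b y) (a w); rewrite (md_distC (a y) (a w)).
have w3 : md (a w - b y) < md (a y - b y) / 2 by rewrite e'.
lra.
Qed.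

Section Branch.
Variables (f : C -> C) (D : set C).
Hypothesis hf : hol setT f.
Hypothesis oD : open D.
Hypothesis cD : connected D.
Hypothesis hW : forall K e, compact K -> K `<=` D -> ~ D e -> hsqrt K e.

(** A regular value has a disc carrying all branches, which is the even covering required; the
    continuous lift is locally [g] followed by such a branch, hence holomorphic. *)
Lemma hol_lift g z0 w0 : hol D g -> (forall z, D z -> regular_value f (g z)) ->
  D z0 -> f w0 = g z0 ->
  exists psi, [/\ hol D psi, forall z, D z -> f (psi z) = g z & psi z0 = w0].
Proof.
move=> hg rg Dz0 e0.
have UN K p1 p2 z : connected K -> K `<=` D -> lift f g K p1 -> lift f g K p2 ->
    K z -> p1 z = p2 z -> forall w, K w -> p1 w = p2 w.
  move=> cK KD [c1 l1] [c2 l2] Kz e w Kw.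
  apply: (@conn_md R K (fun z => p1 z = p2 z) z w cK) => // y Ky ey.
    have dn : dv f (p1 y) != 0 by apply: regular_dv => //; rewrite l1//; exact/rg/KD.
    have [t t0 [_ it]] := locinj ltr01 (hol_sub (fun _ _ => I) hf) dn.
    have [d1 d10 h1] := c1 y Ky t t0; have [d2 d20 h2] := c2 y Ky t t0.
    exists (Order.min d1 d2) => [|v Kv]; first by rewrite lt_min d10.
    rewrite lt_min => /andP[v1 v2]; apply: it; last by rewrite l1// l2.
      exact: h1.
    by rewrite /disc/= ey; exact: h2.
  have p : 0 < md (p1 y - p2 y) / 2 by rewrite divr_gt0// md_gt0 subr_eq0; exact/eqP.
  have [d1 d10 h1] := c1 y Ky _ p; have [d2 d20 h2] := c2 y Ky _ p.
  exists (Order.min d1 d2) => [|v Kv]; first by rewrite lt_min d10.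
  rewrite lt_min => /andP[/(h1 v Kv) w1 /(h2 v Kv) w2] e'.
  have := md_tri (p1 y) (p2 y) (p1 v); rewrite (md_distC (p1 y) (p1 v)).
  have w3 : md (p1 v - p2 y) < md (p1 y - p2 y) / 2 by rewrite e'.
  lra.
have EC z : D z -> exists2 r, 0 < r & disc z r `<=` D /\
  forall y w, disc z r y -> f w = g y ->
    exists psi, [/\ hol (disc z r) psi, forall u, disc z r u -> f (psi u) = g u & psi y = w].
  move=> Dz; have [r1 r10 H] := rg z Dz.
  have /open_md/(_ z Dz)[r r0 sr] := oD.
  have /contP/(_ r1 r10)[t t0 ht] := hol_cont hg Dz.
  exists (Order.min r t); first by rewrite lt_min r0.
  split=> [y|y w]; first by rewrite /disc/= lt_min => /andP[/sr].
  have im u : disc z (Order.min r t) u -> disc (g z) r1 (g u).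
    by rewrite /disc/= lt_min => /andP[_ /ht].
  move=> yr e; have [|h [/holomorphic_hol hh fh hw]] := H w.
    by rewrite ballE e; exact: im.
  rewrite ballE in hh fh; exists (fun u => h (g u)); split.
  - apply: (hol_comp _ hh im); apply: hol_sub hg => u; rewrite /disc/= lt_min => /andP[/sr //].
  - by move=> u /im; exact: fh.
  - by rewrite -e.
have [|psi [c l e]] := @lift_global R D f g oD hW _ UN z0 w0 cD Dz0 e0.
  move=> z Dz; have [r r0 [sr h]] := EC z Dz; exists r => //; split => // y w yr e.
  have [p [hp lp pe]] := h y w yr e; exists p => //; split => //.
  by apply: cont_con => u ur; exact: hol_cont hp ur.
exists psi; split => // z Dz.
have [r r0 [sr h]] := EC z Dz; have zr := disc_center z r0.
have [p [hp lp pe]] := h z (psi z) zr (l z Dz).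
exists (dv p z); apply: hd_eq r0 _ (dvP hp zr) => y; rewrite inE => yr.
apply: (UN (disc z r) p psi z) => //; first exact: connected_disc.
- by split => //; apply: cont_con => u ur; exact: hol_cont hp ur.
- by split => [|u /sr Du]; [apply: cont_con => u /sr Du; exact: c|exact: l].
Qed.

Hypothesis DP : forall z, D z -> ~ postsingular_set f z.

(** The branch of the previous iterate is lifted through [f]; its values are regular because their
    [k]-th images are not postsingular. *)
Lemma branch k z0 w0 : D z0 -> iter k f w0 = z0 ->
  exists G, [/\ hol D G, forall z, D z -> iter k f (G z) = z & G z0 = w0].
Proof.
move=> Dz0; elim: k w0 => [|k IH] w0 e0.
  by exists id; split => // z _; exists 1; exact: hd_id.
rewrite iterSr in e0; have [G [hG lG eG]] := IH _ e0.
have [||p [hp lp pe]] := @hol_lift G z0 w0 hG _ Dz0.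
- move=> z Dz; have nP := DP Dz; rewrite -{1}(lG z Dz) in nP.
  exact: (post_regular (m := 0) nP).
- by rewrite eG.
- by exists p; split => // z Dz; rewrite iterSr lp// lG.
Qed.

End Branch.
End Branches.

(** * The neighbourhood of the boundary free of postsingular points *)

Section Geom.
Context {R : realType}.
Local Notation C := R[i].
Implicit Types (z w u : C) (r t : R) (A B K : set C) (F f g : C -> C).

Lemma infty_nbhs (M : R) : nbhs (None : sphere R) [set v | forall z : C, v = Some z -> M < md z].
Proof.
exists (cdisc 0 M); first by split; [exact: compact_cdisc|exact: closed_cdisc].
by move=> _ [[w nw <-]|->] z // [<-]; move: nw; rewrite /cdisc/= subr0 => /negP; rewrite -ltNge.
Qed.

Lemma md_connected A : (forall P x y,
    (forall x, A x -> P x -> exists2 d, 0 < d & forall y, A y -> md (y - x) < d -> P y) ->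
    (forall x, A x -> ~ P x -> exists2 d, 0 < d & forall y, A y -> md (y - x) < d -> ~ P y) ->
    A x -> P x -> A y -> P y) -> connected A.
Proof.
move=> H B [x Bx] [C1 oC e1] [C2 cC e2]; apply/seteqP; split; first by rewrite e1 => y [].
have Ax : A x by move: Bx; rewrite e1 => -[].
move=> y Ay; apply: (H B x y) => // z Az Bz.
  have Cz : C1 z by move: Bz; rewrite e1 => -[].
  have /open_md/(_ z Cz)[d d0 hd] := oC; exists d => // w Aw /hd Cw; by rewrite e1.
have Cz : ~ C2 z by move=> Cz; apply: Bz; rewrite e2.
by have [d d0 hd] := closed_md cC Cz; exists d => // w Aw /hd nC; rewrite e2 => -[].
Qed.

Lemma glue_cont A (h : C -> C) (c : C) z : {for z, continuous h} ->
  (A z -> exists2 d, 0 < d & disc z d `<=` A) ->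
  (~ A z -> h z = c \/ exists2 d, 0 < d & disc z d `<=` ~` A) ->
  {for z, continuous (fun w => if `[< A w >] then h w else c)}.
Proof.
move=> /contP ch h1 h2; apply/contP => e e0; have [t t0 ht] := ch e e0.
case: asboolP => [Az|nA].
  have [d d0 hd] := h1 Az; exists (Order.min d t) => [|w]; first by rewrite lt_min d0.
  by rewrite lt_min => /andP[/hd Aw wt]; case: asboolP => // _; exact: ht.
have [<-|[d d0 hd]] := h2 nA.
  exists t => // w /ht wt; case: asboolP => // _; by rewrite subrr md0.
by exists d => // w /hd nAw; case: asboolP => // _; rewrite subrr md0.
Qed.

Definition comp T x : set C := connected_component T x.

Lemma comp_open_set T x : open T -> open (comp T x).
Proof.
move=> oT; apply/open_md => z Dz; have Tz := connected_component_sub Dz.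
have /open_md/(_ z Tz)[r r0 sr] := oT; exists r => //.
rewrite /comp (same_connected_component Dz).
apply: connected_component_max => //; [exact: disc_center|exact: connected_disc].
Qed.

Definition dset (S : set C) z : R := inf [set md (z - s) | s in S].

Lemma dset_lip S z w : S !=set0 -> dset S z <= dset S w + md (z - w).
Proof.
move=> [s0 Ss0]; have inf_ y : has_inf [set md (y - s) | s in S].
  by split; [exists (md (y - s0)); exists s0|exists 0 => _ [s _ <-]; exact: md_ge0].
rewrite -lerBlDr; apply: lb_le_inf; first by case: (inf_ w).
move=> _ [s Ss <-]; have : dset S z <= md (z - s) by apply: (ge_inf (inf_ z).2); exists s.
have := md_tri z s w; lra.
Qed.

Lemma dset_ge0 S z : S !=set0 -> 0 <= dset S z.
Proof.
move=> [s0 Ss0]; apply: lb_le_inf; first by exists (md (z - s0)); exists s0.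
by move=> _ [s _ <-]; exact: md_ge0.
Qed.

Lemma dset_gt0 S z : S !=set0 -> closed S -> ~ S z -> 0 < dset S z.
Proof.
move=> [s0 Ss0] cS nS; have [d d0 hd] := closed_md cS nS.
apply: lt_le_trans d0 _; apply: lb_le_inf; first by exists (md (z - s0)); exists s0.
by move=> _ [s Ss <-]; rewrite leNgt; apply/negP; rewrite md_distC => /hd.
Qed.

Lemma dset_0 S z : S z -> dset S z = 0.
Proof.
move=> Sz; apply/eqP; rewrite eq_le dset_ge0 ?andbT; last by exists z.
have <- : md (z - z) = 0 by rewrite subrr md0.
apply: ge_inf; last by exists z.
by exists 0 => _ [s _ <-]; exact: md_ge0.
Qed.

Lemma dset_cont S z : S !=set0 -> {for z, continuous (dset S)}.
Proof.
move=> S0; apply/contRP => e e0; exists e => // w wz.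
have := dset_lip z w S0; have := dset_lip w z S0; rewrite (md_distC z w) => h1 h2.
by apply: le_lt_trans wz; rewrite ler_norml; lra.
Qed.

Section SC.
Variables (Om E U : set C).
Hypothesis scO : simply_connected_domain Om.
Hypothesis cE : connected E.
Hypothesis clE : closed E.
Hypothesis E0 : E !=set0.
Hypothesis unbE : forall M : R, exists2 e, E e & M < md e.
Let T := Om `\` E.

Lemma openT : open T.
Proof. by apply: openI; [case: scO => -[]|rewrite openC]. Qed.

(** A point of [E] slides along [E] beyond the reach of [K], to where a root exists on a disc
    containing [K]; for a point outside [Om] a logarithm of [z - e] exists on [Om]. *)
Lemma sqrt_outside K e : compact K -> K `<=` T -> ~ T e -> hsqrt K e.
Proof.
move=> cK KT nT.
have [Ee|nE] := pselect (E e).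
  have [M M0 hM] := compact_bound cK; have [e' Ee' Me'] := unbE M.
  apply: (@hsqrt_move R K E e' e cK cE) => //.
    by apply/seteqP; split => // z [Ez /KT[]].
  have M1 : 0 < M + (md e' - M) / 2 by lra.
  have M2 : M + (md e' - M) / 2 < md e' by lra.
  have [||s [cs es]] := @sqrt_disc R 0 (M + (md e' - M) / 2) (fun z => z - e') M1.
  - move=> z _; apply: (@contB_T R C (fun z => z) (fun _ => e')); [exact: contid|exact: contcst].
  - move=> z; rewrite /disc/= subr0 => zM; rewrite subr_eq0; apply: contraTneq zM => ->.
    by rewrite -leNgt ltW.
  have Kd z : K z -> disc 0 (M + (md e' - M) / 2) z.
    by move=> /hM zM; rewrite /disc/= subr0; lra.
  by exists s; split=> [|z /Kd]; [apply: cont_con => z /Kd; exact: cs|exact: es].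
have nO : ~ Om e by move=> Oe; apply: nT.
have ne z : Om z -> z - e != 0 by move=> Oz; rewrite subr_eq0; apply/eqP => ze; apply: nO; rewrite -ze.
have [|L [cL eL]] := @log_sc R Om (fun z => z - e) scO _ ne.
  move=> z _; apply: (@contB_T R C (fun z => z) (fun _ => e)); [exact: contid|exact: contcst].
exists (fun z => cexp (L z / 2)); split => [|z /KT[Oz _]].
  apply: cont_con => z /KT[Oz _].
  have c1 : {for z, continuous (fun z => L z / 2)}.
    by apply: (@contM_T R C L (fun _ => 2^-1)); [exact: cL|exact: contcst].
  exact: (contC_T c1 (hd_continuous (hd_cexp _))).
by rewrite expr2 -cexpD -eL//; congr cexp; field.
Qed.

(** If [e] lies in another component [D'] of [T], it moves within the closure of [D'] to a point [b]
    of its boundary, which is outside [T]. This closure misses [K], as the component of [x] is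
    open. *)
Lemma comp_hsqrt x K e : T x -> compact K -> K `<=` comp T x -> ~ comp T x e -> hsqrt K e.
Proof.
move=> Tx cK KD nD; have KT : K `<=` T by move=> z /KD /connected_component_sub.
have [Te|nT] := pselect (T e); last exact: sqrt_outside.
pose D' := comp T e; have D'e : D' e by exact: connected_component_refl.
have oD' : open D' by apply: comp_open_set; exact: openT.
have cD' : connected D' by exact: component_connected.
have dis z : D' z -> ~ comp T x z.
  move=> D'z Dz; apply: nD; rewrite /comp (same_connected_component Dz) -(same_connected_component D'z).
  exact: D'e.
have [b clb nb] : exists2 b, closure D' b & ~ D' b.
  apply: contrapT => H.
  have : D' x.
    apply: (@conn_md R setT D' e x) => //.
    - exact: convex_connected.
    - by move=> z _ /= D'z; have /open_md/(_ z D'z)[r r0 sr] := oD'; exists r => // w _ /sr.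
    - move=> z _ nz; have ncl : ~ closure D' z by move=> cz; apply: H; exists z.
      apply: contrapT => h; apply: ncl; apply/closure_md => r r0; apply: contrapT => h2; apply: h.
      by exists r => // w _ wr D'w; apply: h2; exists w.
  by move=> /dis; apply; exact: connected_component_refl.
have nTb : ~ T b.
  move=> Tb; have /open_md/(_ b Tb)[r r0 sr] := openT.
  have [y D'y yb] := (closure_md _ _).1 clb r r0.
  apply: nb; rewrite /D' /comp (same_connected_component D'y).
  have : disc b r `<=` connected_component T y.
    by apply: connected_component_max => //; exact: connected_disc.
  by apply; exact: disc_center.
have dis2 : closure D' `&` K = set0.
  apply/seteqP; split => // z [clz Kz].
  have /open_md/(_ z (KD z Kz))[r r0 sr] := comp_open_set (x := x) openT.
  by have [y D'y /sr] := (closure_md _ _).1 clz r r0; exact: dis.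
exact: (hsqrt_move cK (connected_closure cD') dis2 clb (subset_closure D'e) (sqrt_outside cK KT nTb)).
Qed.

Hypothesis oU : open U.
Hypothesis cU : connected U.
Hypothesis EU : E `<=` U.

(* A separation of [U n D] would give a map to the circle winding between its
   two parts, which cannot have a logarithm on the simply connected [Om]. *)
Lemma conn_UD x : T x -> U `<=` Om -> connected (U `&` comp T x).
Proof.
move=> Tx UO; set D := comp T x.
have oD : open D by apply: comp_open_set; exact: openT.
have cD : connected D by exact: component_connected.
have DT : D `<=` T by exact: connected_component_sub.
have oT := openT.
have [UT|nUT] := pselect (U = setT); first by rewrite UT setTI.
have nU0 : ~` U !=set0.
  by apply: contrapT => h; apply: nUT; apply/seteqP; split => // z _; apply: contrapT => nz; apply: h; exists z.
have cnU : closed (~` U) by rewrite closedC.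
pose den z := dset E z + dset (~` U) z.
have den0 z : 0 < den z.
  have [Ez|nE] := pselect (E z).
    rewrite ltr_wpDl ?dset_ge0// dset_gt0//; by move=> h; apply: h; exact: EU.
  by rewrite ltr_pwDl ?dset_ge0// dset_gt0.
pose rho z := dset E z / den z.
have crho z : {for z, continuous rho}.
  apply: (@continuousM R C (dset E) (fun z => (den z)^-1) z); first exact: dset_cont.
  apply: continuousV; first by rewrite gt_eqF.
  by apply: (@continuousD R R C (dset E) (dset (~` U)) z); exact: dset_cont.
have rho0 z : E z -> rho z = 0 by move=> Ez; rewrite /rho dset_0// mul0r.
have rho1 z : ~ U z -> rho z = 1.
  by move=> nz; rewrite /rho /den (@dset_0 (~` U))// addr0 divff// gt_eqF// dset_gt0//; move=> /EU.
apply: md_connected => P a b h1 h2 [Ua Da] Pa [Ub Db]; apply: contrapT => nPb.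
pose A := [set z | [/\ U z, D z & P z]].
have oUD z : U z -> D z -> exists2 d, 0 < d & disc z d `<=` U `&` D.
  by move=> Uz Dz; have /open_md := openI oU oD; apply.
have Ain z : A z -> exists2 d, 0 < d & disc z d `<=` A.
  move=> [Uz Dz Pz]; have [d1 d10 s1] := h1 z (conj Uz Dz) Pz; have [d2 d20 s2] := oUD z Uz Dz.
  exists (Order.min d1 d2) => [|w]; first by rewrite lt_min d10.
  by rewrite /disc/= lt_min => /andP[w1 /s2 [Uw Dw]]; split => //; exact: s1.
have Aout z : Om z -> ~ A z -> [\/ E z, ~ U z | exists2 d, 0 < d & disc z d `<=` ~` A].
  move=> Oz nA; have [Ez|nE] := pselect (E z); first by constructor 1.
  have [Uz|nU] := pselect (U z); last by constructor 2.
  have Tz : T z by [].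
  constructor 3; have [Dz|nD] := pselect (D z).
    have nP : ~ P z by move=> Pz; apply: nA.
    have [d d0 hd] := h2 z (conj Uz Dz) nP; exists d => // w wd [Uw Dw]; exact: hd.
  have /open_md/(_ z (connected_component_refl Tz))[d d0 hd] := comp_open_set (x := z) oT.
  exists d => // w /hd zw [_ Dw _]; apply: nD.
  rewrite /D /comp (same_connected_component Dw) -(same_connected_component zw).
  exact: connected_component_refl.
have Ub' z : U z -> Om z by exact: UO.
have cpt (k : C -> R) z : {for z, continuous k} -> {for z, continuous (fun z => (0 +i* k z : C))}.
  by move=> ck; apply: contReIm_T => //=; exact: contcst.
have ccis (k : C -> R) z : {for z, continuous k} -> {for z, continuous (fun z => cis (k z) : C)}.
  by move=> ck; apply: (@contX_T R C R k (@cis R)) => //; exact: continuous_cis.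
have c2 z : {for z, continuous (fun z => 2 * pi * rho z)}.
  by apply: (@continuousM R C (fun _ => 2 * pi) rho z); [exact: contcst|exact: crho].
have c2' z : {for z, continuous (fun z => 2 * pi * (rho z - 1))}.
  apply: (@continuousM R C (fun _ => 2 * pi) (fun z => rho z - 1) z); first exact: contcst.
  by apply: (@continuousD R R C rho (fun _ => - 1) z); [exact: crho|exact: contcst].
(* [rho] is [0] on [E] and [1] off [U], and within [Om] the boundary of [A] can lie only there; so
   [F] is continuous on [Om]. *)
pose F z := if `[< A z >] then cis (2 * pi * rho z) else 1 : C.
have cF z : Om z -> {for z, continuous F}.
  move=> Oz; apply: (@glue_cont A (fun z => cis (2 * pi * rho z)) 1 z) => [|/Ain //|nA]; first exact: ccis.
  have [/rho0 ->|/rho1 ->|] := Aout z Oz nA; [left|left|by right]; rewrite ?mulr0 ?mulr1 ?cis0//.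
  exact: cis2pi.
have F0 z : Om z -> F z != 0.
  by move=> _; rewrite /F; case: asboolP => _; [exact: cis_neq0|exact: oner_neq0].
have [L [cL eL]] := log_sc scO cF F0.
(* Logarithms of [F] on [U] ([u]) and on [D] ([v]). From [a] in [A] to [b] outside [A] their
   increments differ by [2 * pi] in imaginary part, although both must equal the increment of
   [L]. *)
pose u z := if `[< A z >] then 0 +i* (2 * pi * rho z) else 0 : C.
pose v z := if `[< A z >] then 0 +i* (2 * pi * (rho z - 1)) else 0 : C.
have cu z : U z -> {for z, continuous u}.
  move=> Uz; apply: (@glue_cont A (fun z => 0 +i* (2 * pi * rho z)) 0 z) => [|/Ain //|nA]; first exact: cpt.
  by have [/rho0 ->|//|] := Aout z (UO z Uz) nA; [left; rewrite mulr0|right].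
have cv z : D z -> {for z, continuous v}.
  move=> Dz; apply: (@glue_cont A (fun z => 0 +i* (2 * pi * (rho z - 1))) 0 z) => [|/Ain //|nA]; first exact: cpt.
  have [Oz nE] := DT z Dz.
  by have [//|/rho1 ->|] := Aout z Oz nA; [left; rewrite subrr mulr0|right].
have ei (t : R) : cexp (0 +i* t) = cis t :> C by rewrite /cexp/= expR0 mul1r.
have eu z : U z -> cexp (L z) = cexp (u z).
  by move=> Uz; rewrite (eL z (UO z Uz)) /F /u; case: (asboolP (A z)) => _; [rewrite ei; reflexivity|rewrite cexp0; reflexivity].
have ev z : D z -> cexp (L z) = cexp (v z).
  move=> Dz; have [Oz _] := DT z Dz; rewrite (eL z Oz) /F /v; case: (asboolP (A z)) => _; last by rewrite cexp0; reflexivity.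
  rewrite (ei (2 * pi * (rho z - 1))) -(cisD2pi (2 * pi * (rho z - 1))); congr cis; ring.
have uniqL (X : set C) (l : C -> C) : connected X -> (forall z, X z -> {for z, continuous l}) ->
    (forall z, X z -> {for z, continuous L}) -> (forall z, X z -> cexp (L z) = cexp (l z)) ->
    X a -> X b -> L b - L a = l b - l a.
  move=> cX cl cL' el Xa Xb.
  have := @log_unique R C X L (fun z => l z + (L a - l a)) a b cX cL'.
  have k1 z : X z -> {for z, continuous (fun z => l z + (L a - l a))}.
    by move=> Xz; apply: (@contD_T R C l (fun _ => L a - l a)); [exact: cl|exact: contcst].
  have k2 z : X z -> cexp (L z) = cexp (l z + (L a - l a)).
    by move=> Xz; rewrite !cexpD (el z Xz) (el a Xa) -cexpD subrr cexp0 mulr1.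
  have k3 : L a = l a + (L a - l a) by ring.
  by move=> /(_ k1 k2 Xa k3 Xb) ->; ring.
have r1 := uniqL U u cU cu (fun z Uz => cL z (UO z Uz)) eu Ua Ub.
have r2 := uniqL D v cD cv (fun z Dz => cL z (DT z Dz).1) ev Da Db.
have Aa : A a by [].
have nAb : ~ A b by case.
have : complex.Im (u b - u a) = complex.Im (v b - v a) by rewrite -r1 -r2.
rewrite /u /v; case: (asboolP (A a)) => // _; case: (asboolP (A b)) => // _.
rewrite !raddfB/= => e.
have : pi = 0 :> R by lra.
by apply/eqP; rewrite gt_eqF// pi_gt0.
Qed.

End SC.
End Geom.

Definition glue_seq {R : realType} (h : nat -> R -> R[i]) (x : R) := h (Num.truncn x) x.

Lemma glue_seq_cont {R : realType} (h : nat -> R -> R[i]) :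
  (forall k x, {for x, continuous (h k)}) -> (forall k, h k k.+1%:R = h k.+1 k.+1%:R) ->
  forall x : R, 0 <= x -> forall e : R, 0 < e ->
  exists2 d : R, 0 < d & forall y : R, 0 <= y -> `|y - x| < d -> md (glue_seq h y - glue_seq h x) < e.
Proof.
move=> ch hstep.
have etaE k (x : R) : k%:R <= x -> x <= k%:R + 1 -> glue_seq h x = h k x.
  move=> x1 x2; have x0 : 0 <= x by apply: le_trans x1.
  have /andP[] := truncn_itv x0; rewrite /glue_seq; set j := Num.truncn x => j1 j2.
  have [kj|jk|->//] := ltngtP k j.
    have kj1 : (k.+1%:R : R) <= j%:R by rewrite ler_nat.
    have e1 : (k.+1%:R : R) = k%:R + 1 by rewrite -natr1.
    have jx : x = j%:R by lra.
    have jk : j = k.+1.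
      by apply/eqP; rewrite -(eqr_nat R) e1; apply/eqP; lra.
    by rewrite jx jk hstep.
  have kj : (j.+1%:R : R) <= k%:R by rewrite ler_nat.
  by have := lt_le_trans (lt_le_trans j2 kj) x1; rewrite ltxx.
move=> x x0 e e0.
have hk k : exists2 d : R, 0 < d & forall y : R, `|y - x| < d -> md (h k y - h k x) < e.
  have /cvg_md/(_ e e0) := ch k x; move=> /nbhs_ballP[d' d'0 hd']; exists d' => // y yx.
  by apply: hd'; rewrite /ball/= distrC.
have /andP[j1 j2] := truncn_itv x0; set j := Num.truncn x in j1 j2.
have e1 : (j.+1%:R : R) = j%:R + 1 by rewrite -natr1.
rewrite e1 in j2.
have [d1 d10 hd1] := hk j; have [d2 d20 hd2] := hk j.-1.
pose d3 := if j%:R < x then x - j%:R else 1.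
have d30 : 0 < d3 by rewrite /d3; case: (ltP (j%:R : R) x) => ?; lra.
exists (Order.min (Order.min d1 d2) (Order.min d3 (j%:R + 1 - x))).
  by rewrite !lt_min d10 d20 d30; lra.
move=> y y0; rewrite !lt_min => /andP[/andP[y1 y2] /andP[y3 y4]].
move: y3 y4; rewrite !ltr_norml => /andP[y3 y3'] /andP[y4 y4'].
have ex : glue_seq h x = h j x by apply: etaE; lra.
have [jy|yj] := leP j%:R y.
  by rewrite ex (etaE j) ?hd1//; lra.
have jx : x = j%:R by move: y3; rewrite /d3; case: (ltP (j%:R : R) x) => ?; lra.
have jp : (0 < j)%N.
  by rewrite lt0n; apply/eqP => j0; have := le_lt_trans y0 yj; rewrite j0 ltxx.
have e2 : (j%:R : R) = j.-1%:R + 1 by rewrite -{1}(prednK jp) -natr1.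
have y3'' : j%:R - 1 < y by move: y3; rewrite /d3; case: (ltP (j%:R : R) x) => ?; lra.
rewrite (etaE j.-1 y) ?(etaE j.-1 x); [exact: hd2|lra|lra|lra|lra].
Qed.

(** * Accessible periodic points and escaping points *)

Section AB.
Context {R : realType}.
Local Notation C := R[i].
Implicit Types (z w u : C) (r t : R) (A B K : set C) (F g : C -> C).
Variables (f : C -> C) (U : set C).
Hypothesis tf : transcendental_entire f.
Hypothesis fcU : fatou_component f U.
Hypothesis fUU : f @` U `<=` U.

Let hf : hol setT f.
Proof. by case: tf => /holomorphic_hol. Qed.

Lemma hol_it n D : hol D (iter n f).
Proof. exact: hol_sub (fun _ _ => I) (hol_iter n hf). Qed.

Lemma con_it n K : con K (iter n f).
Proof. by apply: cont_con => z _; exact: hol_cont (hol_iter n hf) I. Qed.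

Lemma fatou_back_iter n z : fatou_set f (iter n f z) -> fatou_set f z.
Proof. by elim: n z => // n IH z; rewrite iterSr => /IH; exact: fatou_back. Qed.

Lemma comp_max S z : connected S -> S `<=` fatou_set f -> S z -> U z -> S `<=` U.
Proof.
case: fcU => x Fx -> cS sS Sz Uz.
by rewrite (same_connected_component Uz); exact: connected_component_max.
Qed.

Lemma con_connected K F : connected K -> con K F -> connected (F @` K).
Proof.
move=> cK cF; apply: connected_continuous_connected => //.
apply/subspace_continuousP => z Kz; apply/cvg_md => e /(cF z Kz)[d d0 hd].
apply/nbhs_md; exists d => // w wd Kw; exact: hd.
Qed.

Lemma bd_closed : closed (boundary U).
Proof. by apply: closedI; [exact: closed_closure|rewrite closedC; exact: open_interior]. Qed.

Lemma accessible_tail (g0 : R -> C) (M : R) : (Some (g0 t) : sphere R) @[t --> 1^'-] --> (None : sphere R) ->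
  exists2 s, s < 1 & forall t, s < t -> t < 1 -> M < md (g0 t).
Proof.
move=> /(_ _ (infty_nbhs M)); rewrite nbhs_simpl/= => -[e e0 h]; exists (1 - e); first by move: e0 => /=; lra.
by move=> t t1 t2; apply: (h t) => //=; rewrite ltr_norml; lra.
Qed.

(** [E] consists of the closure of [V], a path in [U] from [V] to the start of the access curve, and
    that curve. Tending to infinity, the curve is unbounded; it is also closed, since near any given
    point only a compact part of it matters. *)
Lemma setup : accessible U None -> SPS f U ->
  exists T : set C, [/\ open T, boundary U `<=` T, forall z, T z -> ~ postsingular_set f z &
    forall x, T x -> (forall K e, compact K -> K `<=` comp T x -> ~ comp T x e -> hsqrt K e) /\
      connected (U `&` comp T x)].
Proof.
move=> [_ [g0 [cg gU ginf]]] [Om [V [scO [oV cV [v Vv]] VU UO PV]]].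
have oU := comp_open fcU.
have UOm : U `<=` Om by move=> z Uz; apply: UO; exact: subset_closure.
have z01 : 0 <= (0 : R) < 1 by lra.
have Vu : U v by apply: VU; exact: subset_closure.
have [K [cK coK KU Kv K0]] := path_compact (path_in_connected oU (comp_conn fcU) Vu (gU 0 z01)).
pose I01 : set R := `[0, 1[%classic.
pose E := closure V `|` K `|` g0 @` I01.
have cgI : connected (g0 @` I01).
  apply: connected_continuous_connected => //; apply/connected_intervalP.
  exact: interval_is_interval.
have cE : connected E.
  apply: connectedU => //; last first.
    by apply: connectedU => //; [exists v; split => //; exact: subset_closure|exact: connected_closure].
  by exists (g0 0); split; [right|exists 0 => //; rewrite /I01/= in_itv].
have EU : E `<=` U.
  by move=> z [[/VU //|/KU //]|[t /= + <-]]; rewrite /I01/= in_itv/=; exact: gU.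
have unb (M : R) : exists2 e, E e & M < md e.
  have [s s1 hs] := accessible_tail M ginf.
  have m1 : s < Order.max ((1 + s) / 2) 0 by rewrite lt_max; apply/orP; left; lra.
  have m2 : Order.max ((1 + s) / 2) 0 < 1 by rewrite gt_max; apply/andP; split; lra.
  exists (g0 (Order.max ((1 + s) / 2) 0)); last exact: hs.
  by right; exists (Order.max ((1 + s) / 2) 0) => //; rewrite /I01/= in_itv/= m2 andbT le_max lexx orbT.
have clg : closed (g0 @` I01).
  move=> z /closure_md hz; have [s s1 hs] := accessible_tail (md z + 1) ginf.
  pose s' := Order.max s 0; have s'1 : s' < 1 by rewrite gt_max s1 ltr01.
  have cS : closed (g0 @` `[0, s']%classic).
    apply: compact_closed; first exact: norm_hausdorff.
    apply: continuous_compact; last exact: segment_compact.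
    apply: continuous_subspaceW cg => t /=; rewrite !in_itv/= => /andP[-> t2]; exact: le_lt_trans t2 s'1.
  have : (g0 @` `[0, s']%classic) z.
    apply/cS/closure_md => r r0.
    have m0 : 0 < Order.min r 1 by rewrite lt_min r0 ltr01.
    have [_ [t + <-]] := hz _ m0.
    rewrite /I01/= in_itv/= lt_min => /andP[t0 t1] /andP[tr t2].
    exists (g0 t) => //; exists t => //=; rewrite in_itv/= t0/= leNgt; apply/negP.
    rewrite gt_max => /andP[st _]; have := hs t st t1; have := md_subl (g0 t) z; lra.
  by move=> [t /=]; rewrite in_itv/= => /andP[t0 t1] <-; exists t => //; rewrite /I01/= in_itv/= t0 (le_lt_trans t1).
have clE : closed E.
  apply: closedU => //; apply: closedU; first exact: closed_closure.
  by apply: compact_closed => //; exact: norm_hausdorff.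
exists (Om `\` E); split.
- exact: openT scO clE.
- by move=> z bz; split; [apply: UO; case: bz|move=> /EU; exact: (bd_notin fcU)].
- move=> z [Oz nE] Pz; apply: nE; left; left; apply: subset_closure; exact: PV.
- move=> x Tx; split=> [L e|]; first exact: (@comp_hsqrt R Om E scO cE clE unb x L e Tx).
  apply: (@conn_UD R Om E U scO clE _ oU (comp_conn fcU) EU x Tx UOm).
  by exists v; left; left; exact: subset_closure.
Qed.

Section WithT.
Variable T : set C.
Hypothesis oT : open T.
Hypothesis bT : boundary U `<=` T.
Hypothesis PT : forall z, T z -> ~ postsingular_set f z.
Hypothesis hT : forall x, T x ->
  (forall K e, compact K -> K `<=` comp T x -> ~ comp T x e -> hsqrt K e) /\ connected (U `&` comp T x).

Lemma compT x : comp T x `<=` T. Proof. exact: connected_component_sub. Qed.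

Lemma branchT x k z0 w0 : T x -> comp T x z0 -> iter k f w0 = z0 ->
  exists G, [/\ hol (comp T x) G, forall z, comp T x z -> iter k f (G z) = z & G z0 = w0].
Proof.
move=> Tx; apply: branch => //; first exact: comp_open_set.
- exact: component_connected.
- by have [] := hT Tx.
- by move=> z /compT; exact: PT.
Qed.

(** If uniformity failed, bad points would accumulate at some [c] in [K]; there [shrink_conn] gives
    convergence, and [shrink] makes it uniform on a disc. *)
Lemma shrink_compact D x0 (G : nat -> C -> C) (m : nat -> nat) p K :
  open D -> connected D -> D x0 -> (forall k, hol D (G k)) ->
  (forall k z, D z -> iter (m k) f (G k z) = z) -> (forall k, (k <= m k)%N) ->
  G ^~ x0 = (fun _ => p) -> ~ fatou_set f p -> compact K -> K `<=` D ->
  forall e, 0 < e -> exists N, forall k, (N <= k)%N -> forall z, K z -> md (G k z - p) < e.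
Proof.
move=> oD cD Dx0 hG Gid mk Gx np cK KD e e0.
have pw := @shrink_conn R f tf D x0 G m p oD cD Dx0 hG Gid mk _ np.
apply: contrapT => H.
have ex k : exists z, K z /\ exists2 n, (k <= n)%N & e <= md (G n z - p).
  apply: contrapT => h; apply: H; exists k => n kn z Kz; rewrite ltNge; apply/negP => h2.
  by apply: h; exists z; split => //; exists n.
have [u hu] := choice ex.
have [c Kc hc] := compact_seq cK (fun n => (hu n).1).
have /open_md/(_ c (KD c Kc))[r r0 sr] := oD.
have Gc : forall e, 0 < e -> exists N, forall k, (N <= k)%N -> md (G k c - p) < e.
  apply: pw; last exact: KD.
  move=> e' e'0; exists 0%N => k _.
  by have /(congr1 (fun h => h k)) /= -> := Gx; rewrite subrr md0.
have ig k : inj (disc c r) (fun z => iter (m k) f (G k z)).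
  by move=> z w zr wr; rewrite !Gid//; exact: sr.
have [N hN] := shrink tf r0 (fun k => hol_sub sr (hG k)) ig mk Gc np e0.
have r2 : 0 < r / 2 by rewrite divr_gt0.
have [n Nn un] := hc _ r2 N; have [_ [k nk]] := hu n.
by rewrite leNgt => /negP; apply; apply: hN => //; exact: leq_trans Nn nk.
Qed.

Lemma pigeon n0 (v : nat -> nat) : (forall k, (v k < n0)%N) ->
  exists i, forall N, exists2 k, (N <= k)%N & v k = i.
Proof.
move=> hv; apply: contrapT => H.
have ex i : exists N, forall k, (N <= k)%N -> v k <> i.
  apply: contrapT => h; apply: H; exists i => N; apply: contrapT => h2; apply: h.
  by exists N => k Nk e; apply: h2; exists k.
have [N hN] := choice ex.
pose M := (\max_(i < n0) N i)%N.
have := hN (v M) M; apply => //.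
exact: (leq_bigmax (Ordinal (hv M))).
Qed.

(** The return times [m k] of [q] near [c] are taken in one residue class modulo the period, so that
    all [iter (m k) f p] are the same point [p']. The connected images of [X] lie in the component
    [D] of [c]. The branch [G k] on [D] with [G k p' = p] undoes [iter (m k) f] on [X] by
    uniqueness; so it takes the returned points to [q], while it tends to [p] uniformly near [c]. *)
Lemma part_b z p q : boundary U z -> connected_component (boundary U) z p -> periodic_point f p ->
  connected_component (boundary U) z q -> q <> p -> escaping f q.
Proof.
move=> bz Cp [n0 n00 pp] Cq qp; apply: contrapT => nesc; apply: qp.
set X := connected_component (boundary U) z in Cp Cq.
have Xb : X `<=` boundary U by exact: connected_component_sub.
have cX : connected X by exact: component_connected.
have [M hM] : exists M, forall N, exists2 n, (N <= n)%N & md (iter n f q) <= M.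
  apply: contrapT => H; apply: nesc => B [L [cL clL] sub].
  have [M _ hM] := compact_bound cL.
  have [N hN] : exists N, forall n, (N <= n)%N -> M < md (iter n f q).
    apply: contrapT => h; apply: H; exists M => N; apply: contrapT => h2; apply: h.
    by exists N => n Nn; rewrite ltNge; apply/negP => h3; apply: h2; exists n.
  exists N => // n Nn; apply: sub; left; exists (iter n f q) => // /hM.
  by rewrite leNgt hN.
have [|s s1 s2] := @lip_choice (fun _ n => md (iter n f q) <= M).
  by move=> _ N; have [n ? ?] := hM N; exists n.
have cB : compact (boundary U `&` cdisc 0 M).
  apply: (@compact_md R _ M); last by move=> y [_]; rewrite /cdisc/= subr0.
  by apply: closedI; [exact: bd_closed|exact: closed_cdisc].
have inB k : (boundary U `&` cdisc 0 M) (iter (s k) f q).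
  split; first exact/(iter_bd fcU hf fUU)/Xb.
  by rewrite /cdisc/= subr0.
have [c [bc _] [t t1 t2]] := compact_subseq cB inB.
have [i hi] := @pigeon n0 (fun k => (s (t k) %% n0)%N) (fun k => ltn_pmod _ n00).
have Tc : T c by exact: bT.
pose D := comp T c; have Dc : D c by exact: connected_component_refl.
have oD : open D by exact: comp_open_set.
have cD : connected D by exact: component_connected.
have /open_md/(_ c Dc)[r r0 sr] := oD.
have [|m m1 m2] := @lip_choice (fun k n => [/\ md (iter n f q - c) < Order.min r k.+1%:R^-1 & (n %% n0)%N = i]).
  move=> k N; have e0 : 0 < Order.min r k.+1%:R^-1 by rewrite lt_min r0 invr_gt0 ltr0n.
  have [N1 h1] := div_small (ler01 : (0 : R) <= 1) e0.
  have [j jN ji] := hi (maxn N N1); move: jN; rewrite geq_max => /andP[j1 j2].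
  exists (s (t j)); first by apply: leq_trans j1 _; apply: leq_trans (lip_sub t1 j) (lip_sub s1 _).
  by split => //; apply: lt_trans (t2 j) _; have := h1 j j2; rewrite mul1r.
have perk n k : iter (k * n0) f (iter n f p) = iter n f p.
  elim: k => // k IH; rewrite mulSn iterD IH -iterD addnC iterD pp //.
have pm k : iter (m k) f p = iter i f p.
  have [_ e] := m2 k; rewrite (divn_eq (m k) n0) e addnC iterD.
  by have := perk 0 (m k %/ n0)%N; rewrite /= => ->.
set p' := iter i f p in pm.
have sub k : iter (m k) f @` X `<=` D.
  have [h _] := m2 k.
  have Dq : D (iter (m k) f q).
    by apply: sr; apply: lt_le_trans h _; rewrite ge_min lexx.
  rewrite /D /comp (same_connected_component Dq); apply: connected_component_max.
  - by exists q.
  - by move=> _ [y /Xb Xy <-]; apply: bT; exact: (iter_bd fcU hf fUU).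
  - by apply: con_connected => //; exact: con_it.
have Dp' : D p' by rewrite -(pm 0%N); apply: (sub 0%N); exists p.
have [G hG] : exists G : nat -> C -> C, forall k, [/\ hol D (G k),
    forall z, D z -> iter (m k) f (G k z) = z & G k p' = p].
  have hb k : exists G, [/\ hol D G, forall z, D z -> iter (m k) f (G z) = z & G p' = p] by exact: branchT.
  by have [G hG] := choice hb; exists G.
have nF : ~ fatou_set f p by apply: (bd_fatou fcU); exact: Xb.
have Gq k : G k (iter (m k) f q) = q.
  have [h1 h2 h3] := hG k; apply: esym.
  apply: (@uniq_iter R f (m k) X id (fun z => G k (iter (m k) f z)) p) => //.
  - by apply: cont_con => y _; exact: contid.
  - apply: cont_con => y Xy; apply: (@contC_T R C (iter (m k) f) (G k)).
      exact: hol_cont (hol_iter _ hf) I.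
    by apply: (hol_cont h1); apply: (sub k); exists y.
  - by move=> y Xy; rewrite h2//; apply: (sub k); exists y.
  - by move=> y Xy; apply: PT; apply: (@compT c); apply: (sub k); exists y.
  - by rewrite pm h3.
have Gp : G ^~ p' = (fun _ => p) by apply: funext => k; have [_ _] := hG k.
have r2 : 0 < r / 2 by rewrite divr_gt0.
have KD : cdisc c (r / 2) `<=` D.
  by apply: subset_trans sr; apply: cdisc_sub_disc; lra.
have un := @shrink_compact D p' G m p _ oD cD Dp' (fun k => let: And3 h _ _ := hG k in h)
  (fun k => let: And3 _ h _ := hG k in h) (lip_sub m1) Gp nF (@compact_cdisc R c (r / 2)) KD.
apply/eqP; rewrite -subr_eq0 -normr_le0; apply/ler_addgt0Pl => e e0.
rewrite addr0 md_normE.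
have [e' e'0 ee] : exists2 e' : R, 0 < e' & e = e'%:C.
  by case: e e0 => x y; rewrite ltcE/= => /andP[/eqP -> x0]; exists x.
rewrite ee lecR; have [N hN] := un e' e'0.
have [N2 hN2] := div_small (ler01 : (0 : R) <= 1) r2.
have := hN (maxn N N2) (leq_maxl _ _) (iter (m (maxn N N2)) f q).
rewrite Gq => h; apply/ltW/h; have [+ _] := m2 (maxn N N2).
rewrite lt_min => /andP[_ h3]; rewrite /cdisc/=; apply/ltW/(lt_trans h3).
by have := hN2 _ (leq_maxr N N2); rewrite mul1r.
Qed.

(* Fundamental domain [sigma] from [z0] to its preimage; its images under the
   inverse branches fixing [p] fit together to a curve landing at [p]. *)
Lemma part_a p : boundary U p -> periodic_point f p -> accessible U (Some p).
Proof.
move=> bp [n0 n00 pp].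
have Tp : T p := bT bp.
pose D := comp T p; have Dp : D p by exact: connected_component_refl.
have oD : open D by exact: comp_open_set.
have cD : connected D by exact: component_connected.
have nF : ~ fatou_set f p := bd_fatou fcU bp.
have oU := comp_open fcU.
pose m k := (k * n0)%N.
have mk k : (k <= m k)%N by rewrite /m leq_pmulr.
have pm k : iter (m k) f p = p by rewrite /m; elim: k => // k IH; rewrite mulSn iterD IH.
have [G hG] : exists G : nat -> C -> C, forall k, [/\ hol D (G k),
    forall z, D z -> iter (m k) f (G k z) = z & G k p = p].
  have hb k : exists G, [/\ hol D G, forall z, D z -> iter (m k) f (G z) = z & G p = p] by exact: branchT.
  by have [G hG] := choice hb; exists G.
have hol_G k : hol D (G k) by have [] := hG k.
have Gid k z : D z -> iter (m k) f (G k z) = z by have [_ h _] := hG k; exact: h.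
have Gp k : G k p = p by have [] := hG k.
have un K : compact K -> K `<=` D -> forall e, 0 < e -> exists N, forall k, (N <= k)%N -> forall z, K z -> md (G k z - p) < e.
  by move=> cK KD; apply: (@shrink_compact D p G m p K) => //; exact/funext.
have /open_md/(_ p Dp)[r r0 sr] := oD.
have m1 : m 1%N = n0 by rewrite /m mul1n.
have dn : dv (iter n0 f) p != 0.
  apply: iter_dv => // j jn; apply: regular_dv => //.
  apply: (post_regular (n := n0) (m := j.+1)) => //; rewrite pp; exact: PT.
have hp : hol (disc p r) (iter n0 f) by exact: hol_it.
have [t t0 [tr it]] := locinj r0 hp dn.
have /contP/(_ t t0)[ro ro0 hro] := hol_cont (hol_G 1%N) Dp.
rewrite Gp in hro.
(* On this disc [G 1] is defined and takes its values where [iter n0 f] is injective. *)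
pose rho := Order.min r ro.
have rho0 : 0 < rho by rewrite lt_min r0.
have rD z : disc p rho z -> D z by rewrite /disc/= lt_min => /andP[/sr].
have G1t z : disc p rho z -> disc p t (G 1%N z) by rewrite /disc/= lt_min => /andP[_ /hro].
have tD z : disc p t z -> D z by move=> zt; apply: sr; exact: lt_le_trans zt tr.
have /contP/(_ rho rho0)[d d0 hd] := hol_cont (hol_iter n0 hf) (I : setT p).
rewrite pp in hd.
have clp : closure U p by case: bp.
have mdt : 0 < Order.min d t by rewrite lt_min d0.
have [z' Uz'] := (closure_md _ _).1 clp _ mdt; rewrite lt_min => /andP[/hd z0r z't].
(* [z'] in [U] is so near [p] that the branch [G 1] takes its image [z0] back to it; this is what
   starts the induction keeping the branches in [U]. *)
set z0 := iter n0 f z' in z0r.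
have Uz0 : U z0 by exact: iter_U.
have Dz0 : D z0 by exact: rD.
have Dz' : D z' by exact: tD.
have G1z : G 1%N z0 = z'.
  apply: it => //; first exact: G1t.
  by rewrite -{1}m1 Gid.
(* Near [p] the branches compose: [G k.+1] and [G k \o G 1] agree at [p], hence on the disc of
   radius [rho]. *)
have Gstep k : G k.+1 z0 = G k z'.
  rewrite -G1z.
  apply: (@uniq_iter R f (m k.+1) (disc p rho) (G k.+1) (fun z => G k (G 1%N z)) p) => //.
  - exact: connected_disc.
  - by apply: cont_con => z zr; apply: (hol_cont (hol_G _)); exact: rD.
  - apply: cont_con => z zr; apply: (@contC_T R C (G 1%N) (G k)).
      by apply: (hol_cont (hol_G _)); exact: rD.
    by apply: (hol_cont (hol_G _)); apply: tD; exact: G1t.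
  - move=> z zr; rewrite Gid; last exact: rD.
    rewrite /m mulSn iterD Gid; last by apply: tD; exact: G1t.
    by rewrite -m1 Gid//; exact: rD.
  - by move=> z zr; rewrite Gid; [apply: PT; apply: (@compT p); exact: rD|exact: rD].
  - exact: disc_center.
  - by rewrite !Gp.
have cUD : connected (U `&` D) by have [] := hT Tp.
(* At [z0] the value of [G k.+1] is [G k z'], in [U] by induction; connectedness of the intersection
   of [U] and [D] spreads this. *)
have GU k : forall z, (U `&` D) z -> U (G k z).
  have ext z1 : (U `&` D) z1 -> U (G k z1) -> forall z, (U `&` D) z -> U (G k z).
    move=> UD1 UG1 z UDz; have := @comp_max (G k @` (U `&` D)) (G k z1).
    apply; last by exists z.
    - apply: con_connected => //; apply: cont_con => y [_ Dy]; exact: hol_cont (hol_G k) Dy.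
    - move=> _ [y [Uy Dy] <-]; apply: (@fatou_back_iter (m k)); rewrite Gid//.
      exact: (comp_sub fcU).
    - by exists z1.
    - exact: UG1.
  elim: k ext => [|k IH] ext.
    by move=> z [Uz Dz]; have := Gid 0%N z Dz; rewrite /m mul0n /= => ->.
  apply: (ext z0); first by split.
  rewrite Gstep; apply: IH; last by split.
  move=> z1 UD1 UG1 z UDz; have := @comp_max (G k @` (U `&` D)) (G k z1).
  apply; last by exists z.
  - apply: con_connected => //; apply: cont_con => y [_ Dy]; exact: hol_cont (hol_G k) Dy.
  - move=> _ [y [Uy Dy] <-]; apply: (@fatou_back_iter (m k)); rewrite Gid//.
    exact: (comp_sub fcU).
  - by exists z1.
  - exact: UG1.
have oUD : open (U `&` D) by exact: openI.
have [sg [csg sg0 sg1 sgI]] := path_in_connected oUD cUD (conj Uz0 Dz0) (conj Uz' Dz').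
pose h k (x : R) := G k (sg (clamp (x - k%:R))).
have ch k x : {for x, continuous (h k)}.
  have c1 : {for x, continuous (fun x : R => clamp (x - k%:R))}.
    apply: (@continuous_comp _ _ _ (fun x : R => x - k%:R) clamp); last exact: cont_clamp.
    by apply: (@lipcont R (fun x => x - k%:R) 1) => // a b; rewrite mul1r (_ : _ - _ = a - b)//; ring.
  apply: (@contC_T R R (fun x => sg (clamp (x - k%:R))) (G k)).
    by apply: (@contX_T R R R (fun x : R => clamp (x - k%:R)) sg); [exact: c1|exact: csg].
  by apply: (hol_cont (hol_G k)); have [] := sgI _ (clamp01 (x - k%:R)).
pose eta := glue_seq h.
have hstep k : h k k.+1%:R = h k.+1 k.+1%:R.
  rewrite /h subrr -natr1 addrAC subrr add0r !clamp_id ?lexx ?ler01//.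
  by rewrite sg0 sg1.
have ceta := glue_seq_cont ch hstep.
have Ueta (x : R) : 0 <= x -> U (eta x).
  by move=> x0; apply: GU; exact: sgI (clamp01 _).
have unsg : forall e, 0 < e -> exists N, forall k, (N <= k)%N -> forall z, (sg @` `[0, 1]%classic) z -> md (G k z - p) < e.
  apply: un; first exact: path_image_compact.
  by move=> _ [x /= + <-]; rewrite in_itv/= => /sgI [].
(* Maps [[0, 1[] onto the half-line along which [eta] runs through the successive images of [sg]. *)
pose q (x : R) := x / (1 - x).
have q0 (x : R) : 0 <= x -> x < 1 -> 0 <= q x by move=> x0 x1; rewrite divr_ge0//; lra.
have cq (x : R) : x < 1 -> {for x, continuous q}.
  move=> x1; apply: (@continuousM R R id (fun x => (1 - x)^-1) x); first exact: contid.
  by apply: continuousV; [rewrite gt_eqF//; lra|exact: cont_rev].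
split.
  split.
    move=> B nB; have nB' : nbhs p (Some @^-1` B) by exact: nB.
    by have [y [Uy By]] := clp _ nB'; exists (Some y); split => //; exists y.
  move=> /interior_subset [y Uy [yp]]; apply: (bd_notin fcU bp); by rewrite -yp.
exists (eta \o q); split.
- apply/subspace_continuousP => x; rewrite /= in_itv/= => /andP[x0 x1].
  apply/cvg_md => e e0; have [d' d0' hd'] := ceta (q x) (q0 x x0 x1) e e0.
  have /cvgrPdist_lt/(_ d' d0') := cq x x1.
  rewrite /within/=; apply: filterS => y yq /=; rewrite in_itv/= => /andP[y0 y1].
  by apply: hd'; [exact: q0|rewrite distrC].
- by move=> x /andP[x0 x1]; apply: Ueta; exact: q0.
move=> B nB; have /nbhs_md[e e0 he] : nbhs p (Some @^-1` B) by exact: nB.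
have [N hN] := unsg e e0.
have N1 : 0 < N%:R + 1 :> R by rewrite ltr_wpDl.
rewrite nbhs_simpl/=; exists (N%:R + 1)^-1; first by rewrite /= invr_gt0.
move=> x /= xN x1; apply: he; rewrite /disc/=.
have xN' : 1 - x < (N%:R + 1)^-1 by apply: le_lt_trans xN; rewrite ler_norm.
have i1 : (N%:R + 1)^-1 <= 1 :> R by rewrite invf_le1// lerDr.
have x0 : 0 < x by lra.
have qN : N%:R <= q x.
  rewrite /q ler_pdivlMr; last by lra.
  have h1 : (1 - x) * (N%:R + 1) <= 1.
    by apply: le_trans (_ : (N%:R + 1)^-1 * (N%:R + 1) <= 1); [rewrite ler_pM2r// ltW|rewrite mulVf// gt_eqF].
  by lra.
have qx0 : 0 <= q x by apply: q0 => //; exact: ltW.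
rewrite /eta /glue_seq /h; apply: hN.
  rewrite -(@natrK R N); apply: le_truncn => //.
by exists (clamp (q x - (Num.truncn (q x))%:R)) => //=; rewrite in_itv/=; exact: clamp01.
Qed.

End WithT.
End AB.

(** * Boundary behaviour of bounded functions *)

Section Means.
Context {R : realType}.
Local Notation C := R[i].
Local Notation mu := (@lebesgue_measure R).
Implicit Types (z w u : C) (r t : R) (F f g h E : C -> C) (p q : C -> R).

Definition cmean p : R := (2 * pi)^-1 * \int[mu]_(t in `[0, 2 * pi]) p (cis t).

Definition rcont p := forall z, md z = 1 -> {for z, continuous p}.

Lemma circ1 t : circ 1 t = cis t :> C. Proof. by rewrite /circ mul1r. Qed.

Lemma rcont_within p : rcont p -> {within `[0, 2 * pi], continuous (fun t => p (cis t))}.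
Proof.
move=> cp; apply: continuous_in_subspaceT => t _.
by apply: (@contXR_T R R C (@cis R) p); [exact: continuous_cis|apply: cp; exact: md_cis].
Qed.

Lemma rcont_int p : rcont p -> mu.-integrable `[0, 2 * pi] (EFin \o (fun t => p (cis t))).
Proof. by move=> /rcont_within; exact: ri_int. Qed.

Lemma rcont_Re h : ccont h 1 -> rcont (fun z => complex.Re (h z)).
Proof. by move=> ch z z1; apply: (@contCR_T R C h); [exact: ch|exact: continuous_Re]. Qed.

Lemma rcont_Im h : ccont h 1 -> rcont (fun z => complex.Im (h z)).
Proof. by move=> ch z z1; apply: (@contCR_T R C h); [exact: ch|exact: continuous_Im]. Qed.

Lemma rcont_md h : ccont h 1 -> rcont (fun z => md (h z)).
Proof. by move=> ch z z1; apply: (@contCR_T R C h); [exact: ch|exact: continuous_md]. Qed.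

Lemma rcontD p q : rcont p -> rcont q -> rcont (fun z => p z + q z).
Proof. by move=> cp cq z z1; apply: (@continuousD R R C p q z); [exact: cp|exact: cq]. Qed.

Lemma rcontM p q : rcont p -> rcont q -> rcont (fun z => p z * q z).
Proof. by move=> cp cq z z1; apply: (@continuousM R C p q z); [exact: cp|exact: cq]. Qed.

Lemma rcont_cst r : rcont (fun _ => r).
Proof. by move=> z _; exact: contcst. Qed.

Lemma rcont_md2 h : ccont h 1 -> rcont (fun z => md (h z) ^+ 2).
Proof. by move=> ch; have := rcontM (rcont_md ch) (rcont_md ch). Qed.

Let ip : 0 <= (2 * pi)^-1 :> R.
Proof. by rewrite invr_ge0 ltW// pi2_gt0. Qed.

Lemma cmeanE h : ccont h 1 -> avg h 1 = cmean (fun z => complex.Re (h z)) +i* cmean (fun z => complex.Im (h z)).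
Proof.
move=> ch; rewrite /avg /ci mulrC -fmorphV; apply/eqP; rewrite eq_complex /= !mul0r subr0 addr0.
by rewrite /cmean; under [in X in _ && (_ == X)]eq_Rintegral do rewrite -circ1;
  under [in X in (_ == X) && _]eq_Rintegral do rewrite -circ1; rewrite !eqxx.
Qed.

Lemma eq_cmean p q : (forall z, md z = 1 -> p z = q z) -> cmean p = cmean q.
Proof. by move=> e; congr (_ * _); apply: eq_Rintegral => t _; apply: e; exact: md_cis. Qed.

Lemma cmean_le p q : rcont p -> rcont q -> (forall z, md z = 1 -> p z <= q z) -> cmean p <= cmean q.
Proof.
move=> cp cq h; rewrite /cmean ler_wpM2l//.
by apply: le_Rintegral => //; [exact: rcont_int|exact: rcont_int|move=> t _; apply: h; exact: md_cis].
Qed.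

Lemma cmeanD p q : rcont p -> rcont q -> cmean (fun z => p z + q z) = cmean p + cmean q.
Proof. by move=> cp cq; rewrite /cmean -mulrDr; congr (_ * _); apply: RintegralD => //; exact: rcont_int. Qed.

Lemma cmeanZ r p : rcont p -> cmean (fun z => r * p z) = r * cmean p.
Proof. move=> cp; rewrite /cmean mulrCA; congr (_ * _); apply: RintegralZl => //; exact: rcont_int. Qed.

Lemma cmean_cst r : cmean (fun _ => r) = r.
Proof.
by rewrite /cmean ri_cst ?(ltW pi2_gt0)// subr0 mulrCA mulVf ?mulr1// gt_eqF// pi2_gt0.
Qed.

Lemma cmean_ge0 p : (forall z, md z = 1 -> 0 <= p z) -> 0 <= cmean p.
Proof.
by move=> h; rewrite /cmean mulr_ge0//; apply: Rintegral_ge0 => t _; apply: h; exact: md_cis.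
Qed.

Lemma cmean_md h : ccont h 1 -> md (avg h 1) <= cmean (fun z => md (h z)).
Proof.
move=> ch; have ch' : {within `[0, 2 * pi], continuous (fun t => h (circ 1 t))} by exact: circ_within.
rewrite /avg md_div mdr gtr0_norm ?pi2_gt0// mulrC /cmean ler_wpM2l//.
apply: le_trans (ci_md ch') _.
by under eq_Rintegral do rewrite circ1.
Qed.

Lemma avg_scale h r : avg h r = avg (fun y => h (r%:C * y)) 1.
Proof. by rewrite /avg; congr (_ / _); apply: eq_ci => t _; rewrite circ1. Qed.

Lemma md_conjc z : md (conjc z) = md z. Proof. by case: z => a b /=; rewrite sqrrN. Qed.

Lemma hd_conj F z d : hd F (conjc z) d -> hd (fun z => conjc (F (conjc z))) z (conjc d).
Proof.
move=> h e /h[t t0 ht]; exists t => // w wt.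
have E2 : md (conjc w - conjc z) = md (w - z) by rewrite -rmorphB md_conjc.
have := ht (conjc w); rewrite E2 => /(_ wt).
have -> // : conjc (F (conjc w)) - conjc (F (conjc z)) - conjc d * (w - z) =
  conjc (F (conjc w) - F (conjc z) - d * (conjc w - conjc z)).
  by rewrite !rmorphB rmorphM rmorphB /= !conjcK.
by rewrite md_conjc.
Qed.

Lemma cont_conj z : {for z, continuous (fun w : C => conjc w)}.
Proof. by apply/contP => e e0; exists e => // w; rewrite -rmorphB md_conjc. Qed.

Lemma mul_conjc z : z * conjc z = (md z ^+ 2)%:C.
Proof. by rewrite md_sqr; case: z => a b /=; apply/eqP; rewrite eq_complex /=; apply/andP; split; apply/eqP; ring. Qed.

Lemma conjc_inv z : md z = 1 -> z^-1 = conjc z.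
Proof.
move=> z1; have z0 : z != 0 by rewrite -md_gt0 z1.
by apply: (mulfI z0); rewrite divff// mul_conjc z1 expr1n.
Qed.

Section L2.
Variables (F : C -> C) (M : R).
Hypothesis hF : hol (disc 0 1) F.
Hypothesis bF : forall z, disc 0 1 z -> md (F z) <= M.

Definition sc r F z := F (r%:C * z).

Lemma sc_in r z : 0 < r < 1 -> md z = 1 -> disc (0 : C) 1 (r%:C * z).
Proof. by move=> /andP[r0 r1] z1; rewrite /disc/= subr0 mdM mdr z1 mulr1 gtr0_norm. Qed.

Lemma sc_ccont r : 0 < r < 1 -> ccont (sc r F) 1.
Proof.
move=> r01 z z1; apply: (@contC_T R C (fun z => r%:C * z) F); first exact: continuous_mulC.
by apply: hol_cont hF _; exact: sc_in.
Qed.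

Definition N r := cmean (fun z => md (sc r F z) ^+ 2).

(* Only the product of the two radii matters: move them along the annulus. *)
Lemma inner_sc s t : 0 < s < 1 -> 0 < t < 1 ->
  avg (fun z => sc s F z * conjc (sc t F z)) 1 = (N (Num.sqrt (s * t)))%:C.
Proof.
move=> s01 t01; have [/andP[s0 s1] /andP[t0 t1]] := (s01, t01).
(* Holomorphic in an annulus, and equal to the integrand on the unit circle, where [conjc z] is
   [z^-1]. *)
pose Phi z := F (s%:C * z) * conjc (F (conjc (t%:C / z))).
have -> : avg (fun z => sc s F z * conjc (sc t F z)) 1 = avg Phi 1.
  apply: eq_avg => // z z1; rewrite /Phi /sc; congr (_ * conjc (F _)).
  rewrite conjc_inv//; case: (z) => a b; apply/eqP; rewrite eq_complex /=.
  by apply/andP; split; apply/eqP; ring.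
(* At radius [rho] both arguments of [F] have modulus [s * rho = t / rho = q]. *)
pose q := Num.sqrt (s * t); pose rho := Num.sqrt (t / s).
have st0 : 0 < s * t by exact: mulr_gt0.
have q0 : 0 < q by rewrite sqrtr_gt0.
have rho0 : 0 < rho by rewrite sqrtr_gt0 divr_gt0.
have srho : s * rho = q.
  apply: (@pexpIrn _ 2) => //; rewrite ?nnegrE ?ltW// ?mulr_gt0//.
  by rewrite exprMn !sqr_sqrtr ?(ltW st0) ?divr_ge0 ?ltW//; field; rewrite gt_eqF.
have trho : t / rho = q.
  have rr : s * (rho * rho) = t.
    by rewrite -expr2 sqr_sqrtr ?divr_ge0 ?ltW//; field; rewrite gt_eqF.
  by rewrite -srho -{1}rr; field; rewrite gt_eqF.
have q1 : q < 1 by rewrite -sqrtr1 ltr_sqrt// -[1]mulr1 ltr_pM// ltW.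
have hPhi z : 0 < md z -> s * md z < 1 -> t / md z < 1 -> exists d, hd Phi z d.
  move=> z0 zs zt; have zn : z != 0 by rewrite -md_gt0.
  have i1 : disc 0 1 (s%:C * z) by rewrite /disc/= subr0 mdM mdr gtr0_norm.
  have i2 : disc 0 1 (conjc (t%:C / z)) by rewrite /disc/= subr0 md_conjc md_div mdr gtr0_norm.
  have h1 := hd_comp (hdZ s%:C (hd_id z)) (dvP hF i1).
  have h2 := hd_comp (hdZ t%:C (hd_inv zn)) (hd_conj (dvP hF i2)).
  by eexists; exact: hdM h1 h2.
have e : avg Phi 1 = avg Phi rho.
  have [h|h] := leP 1 rho.
    apply: avg_annulus => // z /andP[z1 z2]; apply: hPhi.
    - exact: lt_le_trans z1.
    - by apply: le_lt_trans q1; rewrite -srho ler_pM2l.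
    - by apply: le_lt_trans t1; rewrite ler_pdivrMr ?(lt_le_trans _ z1)// ler_pMr.
  apply/esym; apply: avg_annulus => //; last exact: ltW.
  move=> z /andP[z1 z2]; have z0 := lt_le_trans rho0 z1; apply: hPhi => //.
  - by apply: le_lt_trans s1; rewrite ler_piMr// ltW.
  - by apply: le_lt_trans q1; rewrite -trho ler_pM2l// lef_pV2.
rewrite e avg_scale cmeanE; last first.
  move=> z z1; have [|||d /hd_continuous] := hPhi (rho%:C * z).
  - by rewrite mdM mdr z1 mulr1 gtr0_norm.
  - by rewrite mdM mdr z1 mulr1 gtr0_norm// srho.
  - by rewrite mdM mdr z1 mulr1 gtr0_norm// trho.
  move=> cP; exact: (@contC_T R C (fun z => rho%:C * z) Phi z (@continuous_mulC R rho%:C z) cP).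
have E z : md z = 1 -> Phi (rho%:C * z) = (md (sc q F z) ^+ 2)%:C.
  move=> z1; rewrite -mul_conjc /Phi /sc; congr (F _ * conjc (F _)).
    by rewrite mulrA -rmorphM srho.
  rewrite invfM (conjc_inv z1) -fmorphV mulrA -rmorphM trho.
  by case: (z) => a b; apply/eqP; rewrite eq_complex /=; apply/andP; split; apply/eqP; ring.
rewrite (eq_cmean (q := fun z => md (sc q F z) ^+ 2)); last by move=> z /E ->.
rewrite (eq_cmean (p := fun z => complex.Im _) (q := fun z => 0)); last by move=> z /E ->.
by rewrite cmean_cst.
Qed.

(** Expansion of the square; [inner_sc] evaluates the cross term. *)
Lemma diff_sc s t : 0 < s < 1 -> 0 < t < 1 ->
  cmean (fun z => md (sc s F z - sc t F z) ^+ 2) = N s + N t - 2 * N (Num.sqrt (s * t)).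
Proof.
move=> s01 t01; have cs := sc_ccont s01; have ct := sc_ccont t01.
have ci : ccont (fun z => sc s F z * conjc (sc t F z)) 1.
  move=> z z1; apply: (@contM_T R C (sc s F) (fun z => conjc (sc t F z))); first exact: cs.
  by apply: (@contC_T R C (sc t F) (@conjc R)); [exact: ct|exact: cont_conj].
have E z : md z = 1 -> md (sc s F z - sc t F z) ^+ 2 = md (sc s F z) ^+ 2 + md (sc t F z) ^+ 2 + (- 2) * complex.Re (sc s F z * conjc (sc t F z)).
  by move=> _; rewrite !md_sqr; case: (sc s F z) => a b; case: (sc t F z) => c d /=; ring.
rewrite (eq_cmean E) cmeanD; last first.
- by apply: rcontM; [exact: rcont_cst|exact: rcont_Re].
- by apply: rcontD; exact: rcont_md2.
rewrite cmeanD; [|exact: rcont_md2|exact: rcont_md2].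
rewrite cmeanZ; last exact: rcont_Re.
have := inner_sc s01 t01; rewrite cmeanE// => /(congr1 (@complex.Re R)) /= ->.
by rewrite -/(N s) -/(N t); ring.
Qed.

Lemma N_le r : 0 < r < 1 -> 0 <= N r <= M ^+ 2.
Proof.
move=> r01; apply/andP; split; first by apply: cmean_ge0 => z _; exact: sqr_ge0.
rewrite -[leRHS]cmean_cst; apply: cmean_le; [exact/rcont_md2/sc_ccont|exact: rcont_cst|].
move=> z z1; have := bF (sc_in r01 z1) => h.
by rewrite ler_pXn2r ?nnegrE ?md_ge0//; apply: le_trans h; exact: md_ge0.
Qed.

Lemma sqrt_between s t : 0 < s -> s <= t -> s <= Num.sqrt (s * t) <= t.
Proof.
move=> s0 st; have t0 : 0 < t by exact: lt_le_trans st.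
have e1 : Num.sqrt (s ^+ 2) = s by rewrite sqrtr_sqr gtr0_norm.
have e2 : Num.sqrt (t ^+ 2) = t by rewrite sqrtr_sqr gtr0_norm.
have st0 : 0 <= s * t by rewrite mulr_ge0// ltW.
apply/andP; split; first by rewrite -{1}e1 ler_sqrt// expr2 ler_pM2l.
by rewrite -[leRHS]e2 ler_sqrt ?sqr_ge0// expr2 ler_pM2r.
Qed.

(** Since [diff_sc] is nonnegative, [N x' - N t >= 2 * (N x - N t)] when [x] is the geometric mean
    of [x'] and [t]. If [N s > N t], the iteration [x' = x ^+ 2 / t] would double the excess without
    end, against the bound [M ^+ 2]. *)
Lemma N_mono s t : 0 < s -> s <= t -> t < 1 -> N s <= N t.
Proof.
move=> s0 st t1; have t0 : 0 < t by exact: lt_le_trans st.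
rewrite leNgt; apply/negP => h.
pose x k := iter k (fun y => y ^+ 2 / t) s.
have x01 k : 0 < x k /\ x k <= t.
  elim: k => [|k [IH1 IH2]]; first by [].
  split; first by rewrite /= divr_gt0// exprn_gt0.
  change (x k ^+ 2 / t <= t).
  by rewrite ler_pdivrMr// -expr2 ler_pXn2r ?nnegrE//; exact: ltW.
have grow k : 2 ^+ k * (N s - N t) <= N (x k) - N t.
  elim: k => [|k IH]; first by rewrite expr0 mul1r.
  have [p1 p2] := x01 k; have [p3 p4] := x01 k.+1.
  have xs : 0 < x k.+1 < 1 by rewrite p3 (le_lt_trans p4).
  have ts : 0 < t < 1 by rewrite t0.
  have := diff_sc xs ts.
  have -> : Num.sqrt (x k.+1 * t) = x k.
    by rewrite /= divfK ?gt_eqF// sqrtr_sqr gtr0_norm.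
  have : 0 <= cmean (fun z => md (sc (x k.+1) F z - sc t F z) ^+ 2).
    by apply: cmean_ge0 => z _; exact: sqr_ge0.
  by rewrite exprS => ? ?; lra.
have [k hk] : exists k, M ^+ 2 + 1 <= 2 ^+ k * (N s - N t).
  have d0 : 0 < N s - N t by rewrite subr_gt0.
  pose n := Num.truncn ((M ^+ 2 + 1) / (N s - N t)); exists n.+1.
  have q0 : 0 <= (M ^+ 2 + 1) / (N s - N t) by exact: divr_ge0 (addr_ge0 (sqr_ge0 _) ler01) (ltW d0).
  have /andP[_ h2] := truncn_itv q0.
  rewrite -ler_pdivrMr//; apply: ltW; apply: lt_le_trans h2 _.
  by rewrite -natrX ler_nat ltnW// ltn_expl.
have [p1 p2] := x01 k.
have xs : 0 < x k < 1 by rewrite p1 (le_lt_trans p2).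
have ts : 0 < t < 1 by rewrite t0.
have /andP[_ b1] := N_le xs; have /andP[b2 _] := N_le ts.
by have := grow k; lra.
Qed.

(** [N] is increasing and bounded. Once it is within [e / 4] of its supremum, [diff_sc] gives a
    value below [e / 2], as the geometric mean of two radii lies between them. *)
Lemma L2_cauchy e : 0 < e -> exists2 r0, 0 < r0 < 1 & forall s t, r0 <= s -> s < 1 -> r0 <= t -> t < 1 ->
  cmean (fun z => md (sc s F z - sc t F z) ^+ 2) < e.
Proof.
move=> e0; pose S := [set N r | r in [set r | 0 < r < 1]].
have h2 : 0 < (1 / 2 : R) < 1 by lra.
have hS : has_sup S.
  by split; [exists (N (1 / 2)); exists (1 / 2)|exists (M ^+ 2) => _ [r r01 <-]; have /andP[] := N_le r01].
have e4 : 0 < e / 4 by lra.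
have [_ [r0 r01 <-] hr] := sup_adherent e4 hS.
have ub r : 0 < r < 1 -> N r <= sup S by move=> r1; apply: (ub_le_sup hS.2); exists r.
exists r0 => // s t s0 s1 t0 t1; have /andP[r00 r02] := r01.
have ss : 0 < s < 1 by rewrite (lt_le_trans r00 s0).
have tt : 0 < t < 1 by rewrite (lt_le_trans r00 t0).
rewrite diff_sc//; have := ub s ss; have := ub t tt.
have : N r0 <= N (Num.sqrt (s * t)).
  have [st|ts] := leP s t.
    have /andP[a b] := sqrt_between (lt_le_trans r00 s0) st.
    by apply: N_mono => //; [exact: le_trans a|exact: le_lt_trans b t1].
  have /andP[a b] := sqrt_between (lt_le_trans r00 t0) (ltW ts).
  by rewrite mulrC; apply: N_mono => //; [exact: le_trans a|exact: le_lt_trans b s1].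
lra.
Qed.

End L2.

(** The Herglotz kernel; its real part [pois] is the Poisson kernel. *)
Definition pk w y : C := (y + w) / (y - w).

Lemma pk_ne w y : md w < 1 -> md y = 1 -> y - w != 0.
Proof. by move=> w1 y1; rewrite subr_eq0; apply: contraTneq w1 => <-; rewrite y1 ltxx. Qed.

Lemma pk_ccont w : md w < 1 -> ccont (pk w) 1.
Proof.
move=> w1 y y1; apply: (@contM_T R C (fun y => y + w) (fun y => (y - w)^-1)).
  by apply: (@contD_T R C (fun y => y) (fun _ => w)); [exact: contid|exact: contcst].
apply: (@contV_T R C (fun y => y - w)); first exact: pk_ne.
by apply: (@contB_T R C (fun y => y) (fun _ => w)); [exact: contid|exact: contcst].
Qed.

Lemma pk_md w y : md w < 1 -> md y = 1 -> md (pk w y) <= (1 + md w) / (1 - md w).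
Proof.
move=> w1 y1; rewrite /pk md_div.
have h1 := mdD y w; have h2 := md_subl y w; rewrite y1 in h1 h2.
have p : 0 < 1 - md w by rewrite subr_gt0.
apply: ler_pM; rewrite ?md_ge0 ?invr_ge0 ?md_ge0//.
by rewrite lef_pV2// posrE; lra.
Qed.

Definition pois w y : R := complex.Re (pk w y).

Lemma poisE w y : md w < 1 -> md y = 1 -> pois w y = (1 - md w ^+ 2) / md (y - w) ^+ 2.
Proof.
move=> w1 y1; have yw := pk_ne w1 y1; have p : 0 < md (y - w) by rewrite md_gt0.
have E : pk w y = (y + w) * conjc (y - w) / (md (y - w) ^+ 2)%:C.
  rewrite -mul_conjc /pk; have c0 : conjc (y - w) != 0 by rewrite -md_eq0 md_conjc md_eq0.
  by move: (conjc (y - w)) c0 => v v0; field; rewrite yw v0.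
rewrite /pois E -fmorphV.
have -> (u : C) (x : R) : complex.Re (u * x%:C) = complex.Re u * x by case: u => a b /=; rewrite mulr0 subr0.
congr (_ / _); have := md_sqr y; rewrite y1 expr1n md_sqr.
case: (y) => a b; case: (w) => c d /= e; rewrite e; ring.
Qed.

Lemma pois_ge0 w y : md w < 1 -> md y = 1 -> 0 <= pois w y.
Proof.
move=> w1 y1; rewrite poisE// divr_ge0 ?sqr_ge0// subr_ge0 expr_le1 ?md_ge0// ltW//.
Qed.

Lemma pois_le w y : md w < 1 -> md y = 1 -> pois w y <= (1 + md w) / (1 - md w).
Proof. by move=> w1 y1; apply: le_trans (Re_le_md _) (pk_md w1 y1). Qed.

Lemma rcont_pois w : md w < 1 -> rcont (pois w).
Proof. by move=> /pk_ccont; exact: rcont_Re. Qed.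

Lemma avg_conj h : ccont h 1 -> avg (fun y => conjc (h y)) 1 = conjc (avg h 1).
Proof.
move=> ch; rewrite (cmeanE ch) cmeanE; last first.
  by move=> y y1; apply: (@contC_T R C h (@conjc R)); [exact: ch|exact: cont_conj].
have -> : cmean (fun y => complex.Re (conjc (h y))) = cmean (fun y => complex.Re (h y)).
  by apply: eq_cmean => y _; case: (h y).
have -> : cmean (fun y => complex.Im (conjc (h y))) = - cmean (fun y => complex.Im (h y)).
  rewrite -[RHS]mulN1r -cmeanZ; last exact: rcont_Im.
  by apply: eq_cmean => y _; case: (h y) => a b /=; rewrite mulN1r.
by [].
Qed.

Lemma mvp1 h r : 1 < r -> hol (disc 0 r) h -> avg h 1 = h 0.
Proof.
move=> r1 hh; have z0 : disc (0 : C) r 0 by apply: disc_center; lra.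
apply: (mvp (s := r)) => //; last exact: hol_cont hh z0.
by move=> z /andP[_ zr]; apply: hh; rewrite /disc/= subr0.
Qed.

Lemma hol_ccont h r : 1 < r -> hol (disc 0 r) h -> ccont h 1.
Proof. by move=> r1 hh z z1; apply: hol_cont hh _; rewrite /disc/= subr0 z1. Qed.

(** On the unit circle the kernel is the conjugate of [(1 - conjc w * y)^-1], which is holomorphic
    in a larger disc with value [1] at [0]. *)
Lemma cauchy_kernel w : md w < 1 -> avg (fun y => y / (y - w)) 1 = 1.
Proof.
move=> w1.
have [r r1 wr] : exists2 r, 1 < r & md w * r < 1.
  have p : 0 < 1 + md w by have := md_ge0 w; lra.
  exists (2 / (1 + md w)); first by rewrite ltr_pdivlMr//; lra.
  by rewrite mulrA ltr_pdivrMr//; lra.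
pose k y := (1 - conjc w * y)^-1.
have kn y : disc 0 r y -> 1 - conjc w * y != 0.
  rewrite /disc/= subr0 => yr; rewrite subr_eq0; apply/eqP => e.
  have : md (conjc w * y) = 1 by rewrite -e md1.
  rewrite mdM md_conjc => e1; have : md w * md y <= md w * r by rewrite ler_wpM2l ?md_ge0// ltW.
  by rewrite e1; lra.
have hk : hol (disc 0 r) k.
  apply: holV => //; apply: holB; first exact: hol_cst.
  by apply: holM; [exact: hol_cst|exact: hol_id].
have := mvp1 r1 hk; rewrite /k mulr0 subr0 invr1 => /(congr1 (@conjc R)).
rewrite -avg_conj; last exact: hol_ccont hk.
have -> : conjc 1 = 1 :> C by rewrite rmorph1.
move=> <-; apply: eq_avg => // y y1.
have y0 : y != 0 by rewrite -md_gt0 y1.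
rewrite fmorphV rmorphB rmorph1 rmorphM /= conjcK.
have -> : conjc y = y^-1 by rewrite conjc_inv.
by field; rewrite y0 pk_ne.
Qed.

(** On the circle the Poisson kernel is [y / (y - w) + conjc w * y / (1 - conjc w * y)]. The first
    term reproduces [H w], as [y * quot H w y] has mean [0]; the second leads to a holomorphic
    function vanishing at [0]. *)
Lemma poisson_formula H r w : 1 < r -> hol (disc 0 r) H -> md w < 1 ->
  avg (fun y => H y * (pois w y)%:C) 1 = H w.
Proof.
move=> r1 hH w1; have cH := hol_ccont r1 hH.
have wr : disc 0 r w by rewrite /disc/= subr0; lra.
have hq := hol_quot (@open_disc R 0 r) hH wr.
have hyq : hol (disc 0 r) (fun y => y * quot H w y) by apply: holM => //; exact: hol_id.
have cyw : ccont (fun y => y / (y - w)) 1.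
  move=> y y1; apply: (@contM_T R C (fun y => y) (fun y => (y - w)^-1)); first exact: contid.
  apply: (@contV_T R C (fun y => y - w)); first exact: pk_ne.
  by apply: (@contB_T R C (fun y => y) (fun _ => w)); [exact: contid|exact: contcst].
have a1 : avg (fun y => H y * (y / (y - w))) 1 = H w.
  have -> : avg (fun y => H y * (y / (y - w))) 1 = avg (fun y => H w * (y / (y - w)) - (- (y * quot H w y))) 1.
    apply: eq_avg => // y y1; rewrite {1}(quotE H w y); field; exact: pk_ne.
  have h1 : ccont (fun y => H w * (y / (y - w))) 1.
    by move=> y y1; apply: (@contM_T R C (fun _ => H w)); [exact: contcst|exact: cyw].
  have h2 : ccont (fun y => y * quot H w y) 1 := hol_ccont r1 hyq.
  have h3 : ccont (fun y => - (y * quot H w y)) 1.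
    by move=> y y1; apply: contN_T; exact: h2.
  rewrite (@avgB R _ _ 1 ler01 h1 h3) (@avgZ R _ _ 1 ler01 cyw) cauchy_kernel// mulr1.
  have -> : avg (fun y => - (y * quot H w y)) 1 = 0; last by rewrite subr0.
  have -> : avg (fun y => - (y * quot H w y)) 1 = avg (fun y => (-1) * (y * quot H w y)) 1.
    by apply: eq_avg => // y _; rewrite mulN1r.
  by rewrite (@avgZ R _ _ 1 ler01 h2) (mvp1 r1 hyq) mul0r mulr0.
have [q [q1 qr wq]] : exists q : R, [/\ 1 < q, q <= r & md w * q < 1].
  have p : 0 < 1 + md w by have := md_ge0 w; lra.
  exists (Order.min r (2 / (1 + md w))); split.
  - by rewrite lt_min r1 ltr_pdivlMr//; lra.
  - by rewrite ge_min lexx.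
  - apply: (@le_lt_trans _ _ (md w * (2 / (1 + md w)))).
      by rewrite ler_wpM2l ?md_ge0// ge_min lexx orbT.
    by rewrite mulrA ltr_pdivrMr//; lra.
have kn y : disc 0 q y -> 1 - conjc w * y != 0.
  rewrite /disc/= subr0 => yr; rewrite subr_eq0; apply/eqP => e.
  have : md (conjc w * y) = 1 by rewrite -e md1.
  rewrite mdM md_conjc => e1; have : md w * md y <= md w * q by rewrite ler_wpM2l ?md_ge0// ltW.
  by rewrite e1; lra.
pose k y := H y * (conjc w * y / (1 - conjc w * y)).
have qsub : disc (0 : C) q `<=` disc 0 r by apply: subset_disc; rewrite subrr md0 add0r.
have hk : hol (disc 0 q) k.
  apply: holM; first exact: hol_sub hH.
  have h1 : hol (disc 0 q) (fun y => conjc w * y) by apply: holM; [exact: hol_cst|exact: hol_id].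
  by apply: holM => //; apply: holV => //; apply: holB => //; exact: hol_cst.
have a2 : avg k 1 = 0 by rewrite (mvp1 q1 hk) /k mulr0 mul0r mulr0.
have c1 : ccont (fun y => H y * (y / (y - w))) 1.
  by move=> y y1; apply: (@contM_T R C H); [exact: cH|exact: cyw].
have c2 : ccont k 1 := hol_ccont q1 hk.
have c3 : ccont (fun y => - k y) 1 by move=> y y1; apply: contN_T; exact: c2.
have E y : md y = 1 -> H y * (pois w y)%:C = H y * (y / (y - w)) - (- k y).
  move=> y1; rewrite opprK -mulrDr; congr (_ * _); rewrite poisE// rmorphM fmorphV /=.
  have e1 : ((1 - md w ^+ 2)%:C : C) = 1 - w * conjc w by rewrite mul_conjc rmorphB rmorph1.
  have e2 : ((md (y - w) ^+ 2)%:C : C) = (y - w) * (y^-1 - conjc w).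
    by rewrite -mul_conjc rmorphB (conjc_inv y1).
  rewrite e1 e2.
  have y0 : y != 0 by rewrite -md_gt0 y1.
  have n1 : y - w != 0 by exact: pk_ne.
  have n2 : 1 - conjc w * y != 0 by apply: kn; rewrite /disc/= subr0 y1.
  have n3 : y^-1 - conjc w != 0.
    have E1 : 1 - conjc w * y = (y^-1 - conjc w) * y by rewrite mulrBl mulVf.
    by apply: contraNneq n2 => e; rewrite E1 e mul0r.
  move: (conjc w) n2 n3 => v n2 n3; field; rewrite y0 n1 n2 /=; move: n3.
  by rewrite (_ : y^-1 - v = (1 - v * y) / y); [|field].
rewrite (eq_avg ler01 E) (@avgB R _ _ 1 ler01 c1 c3) a1.
have -> : avg (fun y => - k y) 1 = avg (fun y => (-1) * k y) 1.
  by apply: eq_avg => // y _; rewrite mulN1r.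
by rewrite (@avgZ R _ _ 1 ler01 c2) a2 mulr0 subr0.
Qed.

Lemma pois_mean w : md w < 1 -> cmean (pois w) = 1.
Proof.
move=> w1; have l : (1 : R) < 2 by lra.
have := @poisson_formula (fun _ => 1) 2 w l (@hol_cst R _ 1) w1.
have -> : avg (fun y => 1 * (pois w y)%:C) 1 = avg (fun y => (pois w y)%:C) 1.
  by apply: eq_avg => // y _; rewrite mul1r.
rewrite cmeanE => [/(congr1 (@complex.Re R)) //|].
by move=> y y1; apply: contRC_T; exact: rcont_pois.
Qed.

Lemma poisson_le H r w : 1 < r -> hol (disc 0 r) H -> md w < 1 ->
  md (H w) <= cmean (fun y => md (H y) * pois w y).
Proof.
move=> r1 hH w1; rewrite -(poisson_formula r1 hH w1).
have c1 : ccont (fun y => H y * (pois w y)%:C) 1.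
  move=> y y1; apply: (@contM_T R C H); first exact: hol_ccont r1 hH _ y1.
  by apply: contRC_T; exact: rcont_pois.
apply: le_trans (cmean_md c1) _; apply: cmean_le; first exact: rcont_md.
  by apply: rcontM; [exact: rcont_md (hol_ccont r1 hH)|exact: rcont_pois].
by move=> y y1; rewrite mdM mdr ger0_norm// pois_ge0.
Qed.

(** A holomorphic function whose real part is the Poisson integral of [p]; the mean value property
    of harmonic functions is thus obtained from that of holomorphic ones. *)
Definition herglotz p w : C := avg (fun y => (p y)%:C * pk w y) 1.

Lemma herglotz_ccont p w : rcont p -> md w < 1 -> ccont (fun y => (p y)%:C * pk w y) 1.
Proof.
move=> cp w1 y y1; apply: (@contM_T R C (fun y => (p y)%:C)); last exact: pk_ccont.
by apply: contRC_T; exact: cp.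
Qed.

Lemma Re_herglotz p w : rcont p -> md w < 1 -> complex.Re (herglotz p w) = cmean (fun y => p y * pois w y).
Proof.
move=> cp w1; rewrite /herglotz cmeanE; last exact: herglotz_ccont.
by apply: eq_cmean => y y1; rewrite /pois; case: (pk w y) => a b /=; rewrite mul0r subr0.
Qed.

Lemma hol_herglotz p : rcont p -> hol (disc 0 1) (herglotz p).
Proof.
move=> cp w; rewrite /disc/= subr0 => w1.
(* The derivative of [pk] in [w]. *)
pose dk y := 2 * y / (y - w) ^+ 2.
exists (avg (fun y => (p y)%:C * dk y) 1).
pose d := (1 - md w) / 2; have d0 : 0 < d by rewrite divr_gt0// subr_gt0.
pose B := cmean (fun y => `|p y|) + 1.
have cap : rcont (fun y => `|p y|).
  by move=> y y1; apply: (@continuous_comp _ _ _ p (fun x : R => `|x|)); [exact: cp|exact: norm_continuous].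
have B0 : 0 < B by rewrite /B ltr_wpDl//; apply: cmean_ge0 => y _; exact: normr_ge0.
pose K := 2 / d ^+ 3; have K0 : 0 < K by rewrite divr_gt0// exprn_gt0.
move=> e e0; exists (Order.min d (e / (K * B))) => [|v].
  by rewrite lt_min d0 divr_gt0// mulr_gt0.
rewrite lt_min => /andP[v1 v2].
have vm : md v < 1 by have := md_subl v w; move: v1; rewrite /d; lra.
have far y : md y = 1 -> d <= md (y - v) /\ d <= md (y - w).
  move=> y1; have := md_subl y v; have := md_subl y w; have := md_subl v w.
  by rewrite y1; move: v1; rewrite /d; split; lra.
have cdk : ccont (fun y => (p y)%:C * dk y) 1.
  move=> y y1; apply: (@contM_T R C (fun y => (p y)%:C)); first by apply: contRC_T; exact: cp.
  have c1 : {for y, continuous (fun y => y - w)}.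
    by apply: (@contB_T R C (fun y => y) (fun _ => w)); [exact: contid|exact: contcst].
  apply: (@contM_T R C (fun y => 2 * y)); first exact: continuous_mulC.
  apply: (@contV_T R C (fun y => (y - w) ^+ 2)); first by rewrite expf_neq0// pk_ne.
  exact: (contM_T c1 c1).
have h1 := herglotz_ccont cp vm; have h2 := herglotz_ccont cp w1.
have h3 : ccont (fun y => (v - w) * ((p y)%:C * dk y)) 1.
  by move=> y y1; apply: (@contM_T R C (fun _ => v - w)); [exact: contcst|exact: cdk].
have h4 : ccont (fun y => (p y)%:C * pk v y - (p y)%:C * pk w y) 1.
  by move=> y y1; apply: contB_T; [exact: h1|exact: h2].
have h5 : ccont (fun y => (p y)%:C * pk v y - (p y)%:C * pk w y - (v - w) * ((p y)%:C * dk y)) 1.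
  by move=> y y1; apply: (@contB_T R C (fun y => (p y)%:C * pk v y - (p y)%:C * pk w y)); [exact: h4|exact: h3].
rewrite /herglotz [X in md (_ - X)]mulrC -(@avgZ R (v - w) _ 1 ler01 cdk).
rewrite -(@avgB R _ _ 1 ler01 h1 h2) -(@avgB R _ _ 1 ler01 h4 h3).
apply: le_trans (cmean_md h5) _.
have bd : cmean (fun y => md ((p y)%:C * pk v y - (p y)%:C * pk w y - (v - w) * ((p y)%:C * dk y))) <=
    cmean (fun y => K * md (v - w) ^+ 2 * `|p y|).
  apply: cmean_le; first exact: rcont_md.
    by apply: rcontM; [exact: rcont_cst|exact: cap].
  move=> y y1; have [f1 f2] := far y y1.
  have n1 : y - v != 0 by exact: pk_ne.
  have n2 : y - w != 0 by exact: pk_ne.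
  have -> : (p y)%:C * pk v y - (p y)%:C * pk w y - (v - w) * ((p y)%:C * dk y) =
     (p y)%:C * (2 * y * (v - w) ^+ 2 / ((y - v) * (y - w) ^+ 2)).
    by rewrite /pk /dk; field; rewrite n1 n2.
  have -> : md ((p y)%:C * (2 * y * (v - w) ^+ 2 / ((y - v) * (y - w) ^+ 2))) =
      2 / (md (y - v) * md (y - w) ^+ 2) * md (v - w) ^+ 2 * `|p y|.
    rewrite (mdM (p y)%:C) mdr md_div (mdM _ ((v - w) ^+ 2)) (mdM 2 y) (mdM (y - v)) !mdX md_nat y1 mulr1.
    by rewrite mulrC [2 * _ / _]mulrAC.
  apply: ler_wpM2r; first exact: normr_ge0.
  apply: ler_wpM2r; first exact: sqr_ge0.
  rewrite /K; apply: ler_wpM2l => //.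
  have g1 : 0 < md (y - v) by rewrite md_gt0.
  have g2 : 0 < md (y - w) by rewrite md_gt0.
  rewrite lef_pV2; [|by rewrite posrE mulr_gt0// exprn_gt0|by rewrite posrE exprn_gt0].
  rewrite exprS; apply: ler_pM => //; [exact: ltW|exact: sqr_ge0|].
  by rewrite ler_pXn2r ?nnegrE ?md_ge0 ?(ltW d0).
apply: le_trans bd _; rewrite cmeanZ//.
have -> : K * md (v - w) ^+ 2 * cmean (fun y => `|p y|) = K * cmean (fun y => `|p y|) * md (v - w) * md (v - w).
  by rewrite expr2; ring.
rewrite ler_wpM2r ?md_ge0//.
apply: le_trans (_ : K * B * md (v - w) <= _).
  by rewrite ler_wpM2r ?md_ge0// ler_wpM2l ?(ltW K0)// lerDl.
have KB : 0 < K * B by exact: mulr_gt0.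
by rewrite mulrC -ler_pdivlMr//; exact: ltW.
Qed.

(* Littlewood's subordination principle: the Poisson integral of [|E|^2] is a
   harmonic majorant, and its mean along [G] is its value at [G 0]. *)
Lemma littlewood E G r s : 1 < r -> hol (disc 0 r) E -> hol (disc 0 1) G ->
  (forall z, disc 0 1 z -> md (G z) < 1) -> 0 < s < 1 ->
  cmean (fun z => md (E (G (s%:C * z))) ^+ 2) <=
    (1 + md (G 0)) / (1 - md (G 0)) * cmean (fun z => md (E z) ^+ 2).
Proof.
move=> r1 hE hG G1 s01; have /andP[s0 s1] := s01.
pose p y := md (E y) ^+ 2.
have cE := hol_ccont r1 hE.
have cp : rcont p by exact: rcont_md2.
have d0 : disc (0 : C) 1 0 by exact: disc_center.
have G0 := G1 0 d0.
have hPG : hol (disc 0 s^-1) (fun z => herglotz p (G (s%:C * z))).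
  apply: (@hol_comp R (disc 0 s^-1) (disc 0 1) (fun z => G (s%:C * z)) (herglotz p)).
  - apply: (@hol_comp R (disc 0 s^-1) (disc 0 1) (fun z => s%:C * z) G) => //.
      by apply: holM; [exact: hol_cst|exact: hol_id].
    by move=> z; rewrite /disc/= !subr0 mdM mdr gtr0_norm// -ltr_pdivlMl// mulr1.
  - exact: hol_herglotz.
  - move=> z zr; rewrite /disc/= subr0; apply: G1; move: zr.
    by rewrite /disc/= !subr0 mdM mdr gtr0_norm// -ltr_pdivlMl// mulr1.
have s1' : 1 < s^-1 by rewrite invf_gt1.
have cPG := hol_ccont s1' hPG.
have e0 := mvp1 s1' hPG; rewrite mulr0 (cmeanE cPG) in e0.
have e : cmean (fun z => complex.Re (herglotz p (G (s%:C * z)))) = complex.Re (herglotz p (G 0)).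
  exact: (congr1 (@complex.Re R) e0).
have hE2 : hol (disc 0 r) (fun z => E z ^+ 2) by exact: holX.
have in1 z : md z = 1 -> disc (0 : C) 1 (s%:C * z) by exact: sc_in.
have cEG : ccont (fun z => E (G (s%:C * z))) 1.
  move=> z z1; apply: (@contC_T R C (fun z => G (s%:C * z)) E); last first.
    by apply: hol_cont hE _; rewrite /disc/= subr0; apply: lt_trans r1; exact/G1/in1.
  apply: (@contC_T R C (fun z => s%:C * z) G); first exact: continuous_mulC.
  by apply: hol_cont hG _; exact: in1.
apply: (@le_trans _ _ (cmean (fun z => complex.Re (herglotz p (G (s%:C * z)))))).
  apply: cmean_le; [exact: rcont_md2|exact: rcont_Re|move=> z z1].
  rewrite Re_herglotz//; last exact/G1/in1.
  by rewrite -mdX; have := poisson_le r1 hE2 (G1 _ (in1 z z1)); under eq_cmean do rewrite mdX.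
rewrite e Re_herglotz// -cmeanZ//; apply: cmean_le.
- by apply: rcontM => //; exact: rcont_pois.
- by apply: rcontM => //; exact: rcont_cst.
- by move=> y y1; rewrite mulrC ler_wpM2r ?sqr_ge0//; exact: pois_le.
Qed.

End Means.

(** * Convergence almost everywhere along fast radii *)

Section AE.
Context {R : realType}.
Local Notation C := R[i].
Local Notation mu := (@lebesgue_measure R).
Implicit Types (z w u : C) (r t : R) (F f g h E : C -> C) (Q : R -> Prop).

Local Instance ae_filter_leb : Filter (nbhs (almost_everywhere mu)) := ae_filter_ringOfSetsType mu.

Definition AE Q := {ae mu, forall t : R, 0 <= t < 2 * pi -> Q t}.

Lemma AE_mono Q Q' : (forall t, Q t -> Q' t) -> AE Q -> AE Q'.
Proof. by move=> h; rewrite /AE; apply: filterS => t + t01 => /(_ t01)/h. Qed.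

Lemma AE_and Q Q' : AE Q -> AE Q' -> AE (fun t => Q t /\ Q' t).
Proof. by rewrite /AE => h1 h2; apply: filterS2 h1 h2 => t a b t01; split; [exact: a|exact: b]. Qed.

Lemma AE_all (Q : nat -> R -> Prop) : (forall n, AE (Q n)) -> AE (fun t => forall n, Q n t).
Proof. by move=> h; have := ae_foralln h; apply: filterS => t ht t01 n; exact: ht. Qed.

Lemma AE_true Q : (forall t, Q t) -> AE Q.
Proof. by move=> h; apply: aeW => t _; exact: h. Qed.

(** The functions [4 ^+ i * p i] have summable integrals, so their sum is finite almost everywhere
    and bounds each of them. *)
Lemma fast_ae (p : nat -> C -> R) (K : R) : (forall i, rcont (p i)) ->
  (forall i z, md z = 1 -> 0 <= p i z) -> (forall i, cmean (p i) <= K / 16 ^+ i) ->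
  AE (fun t => exists2 B, 0 <= B & forall i, p i (cis t) <= B / 4 ^+ i).
Proof.
move=> cp p0 hp; pose D : set R := `[0, 2 * pi]%classic.
have mD : measurable D by exact: measurable_itv.
pose f (i : nat) : measurableTypeR R -> \bar R := fun t => (4 ^+ i * p i (cis t))%:E.
have q4 i : 0 < (4 ^+ i : R) by rewrite exprn_gt0.
have cf i : rcont (fun z => 4 ^+ i * p i z) by apply: rcontM => //; exact: rcont_cst.
have intf i : mu.-integrable D (f i) by exact: (rcont_int (cf i)).
have mf i : measurable_fun D (f i) by have /integrableP[] := intf i.
have f0 i t : D t -> (0 <= f i t)%E by move=> _; rewrite lee_fin mulr_ge0 ?p0 ?md_cis// ltW.
pose K' := 4 * pi * `|K|.
have K0 : 0 <= K' by rewrite !mulr_ge0// pi_ge0.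
have bd i : (\int[mu]_(t in D) f i t <= (K' / (2 ^ i.+1)%:R)%:E)%E.
  have fin : (\int[mu]_(t in D) f i t)%E \is a fin_num by exact: integrable_fin_num.
  rewrite -(fineK fin) lee_fin.
  have : cmean (fun z => 4 ^+ i * p i z) <= 4 ^+ i * (K / 16 ^+ i).
    by rewrite cmeanZ// ler_wpM2l// ltW.
  rewrite /cmean ler_pdivrMl ?pi2_gt0// => h; apply: le_trans h _.
  have e16 : (16 ^+ i : R) = 4 ^+ i * 4 ^+ i by rewrite -exprMn; congr (_ ^+ _); ring.
  have -> : 2 * pi * (4 ^+ i * (K / 16 ^+ i)) = 2 * pi * (K / 4 ^+ i).
    by rewrite e16; field; rewrite gt_eqF.
  have -> : K' / (2 ^ i.+1)%:R = 2 * pi * (`|K| / 2 ^+ i).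
    by rewrite /K' natrX exprS; field; rewrite expf_neq0// pnatr_eq0.
  rewrite ler_wpM2l ?(ltW pi2_gt0)//; apply: (@le_trans _ _ (`|K| / 4 ^+ i)).
    by rewrite ler_pM2r ?invr_gt0// ler_norm.
  rewrite ler_wpM2l// lef_pV2 ?posrE ?exprn_gt0//.
  by apply: lerXn2r; rewrite ?nnegrE ?ler_nat.
have intS : (\int[mu]_(t in D) (\sum_(n <oo) f n t) <= K'%:E)%E.
  rewrite integral_nneseries//; apply: le_trans (epsilon_trick0 predT K0).
  apply: lee_nneseries; [by move=> i _ _; apply: integral_ge0 => t; exact: f0|by move=> i _; exact: bd].
have mS : measurable_fun D (fun t => (\sum_(n <oo) f n t)%E).
  have := @ge0_emeasurable_sum _ _ R D f predT (fun i t Dt _ => f0 i t Dt) (fun i _ => mf i); exact.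
have iS : mu.-integrable D (fun t => (\sum_(n <oo) f n t)%E).
  apply/integrableP; split => //.
  apply: le_lt_trans (_ : (K'%:E < +oo)%E); last by rewrite ltry.
  apply: le_trans intS; rewrite le_eqVlt; apply/orP; left; apply/eqP.
  by apply: eq_integral => t; rewrite inE => Dt; rewrite gee0_abs// nneseries_ge0// => n _ _; exact: f0.
have mD' : measurable (D : set (measurableTypeR R)) by exact: measurable_itv.
have := integrable_ae mD' iS; apply: filterS => t ht /andP[t0 t1].
have Dt : D t by rewrite /D/= in_itv/= t0 ltW.
have fin := ht Dt.
exists (fine (\sum_(n <oo) f n t)%E).
  by apply: fine_ge0; apply: nneseries_ge0 => n _ _; exact: f0.
move=> i; rewrite ler_pdivlMr// mulrC -lee_fin (fineK fin).
apply: le_trans (@nneseries_lim_ge _ _ predT 0%N i.+1 _); last by move=> n _ _; exact: f0.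
rewrite big_nat_recr//=; rewrite -[leLHS]add0e; apply: leeD => //.
by apply: sume_ge0 => n _; exact: f0.
Qed.

Lemma geo_lim (u : nat -> C) (B : R) : (forall i, md (u i.+1 - u i) <= B / 2 ^+ i) ->
  exists l, forall i, md (u i - l) <= 2 * B / 2 ^+ i.
Proof.
move=> h; have p2 i : 0 < (2 ^+ i : R) by rewrite exprn_gt0.
have step i k : md (u (i + k)%N - u i) <= 2 * B / 2 ^+ i - 2 * B / 2 ^+ (i + k).
  elim: k => [|k IH]; first by rewrite addn0 !subrr md0.
  rewrite addnS; apply: le_trans (md_tri _ _ (u (i + k)%N)) _.
  have e : 2 * B / 2 ^+ (i + k).+1 = B / 2 ^+ (i + k) by rewrite exprS; field; rewrite gt_eqF.
  have e2 : 2 * B / 2 ^+ (i + k) = B / 2 ^+ (i + k) + B / 2 ^+ (i + k) by ring.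
  by have := h (i + k)%N; rewrite e; rewrite e2 in IH; lra.
have B0 : 0 <= B by have := h 0%N; rewrite expr0 divr1; apply: le_trans; exact: md_ge0.
have up i k : md (u (i + k)%N - u i) <= 2 * B / 2 ^+ i.
  have := step i k; have : 0 <= 2 * B / 2 ^+ (i + k) by rewrite divr_ge0 ?mulr_ge0// ltW.
  lra.
have inK n : cdisc (u 0%N) (2 * B) (u n).
  by have := up 0%N n; rewrite add0n expr0 divr1.
have [c _ hc] := compact_seq (@compact_cdisc R (u 0%N) (2 * B)) inK.
exists c => i; apply/ler_addgt0Pl => e e0.
have [n ni un] := hc e e0 i; have := up i (n - i)%N; rewrite subnKC// => h1.
by have := md_tri (u i) c (u n); rewrite (md_distC (u i) (u n)); lra.
Qed.

(** [B + 1] stands in for the square root of [B], which it exceeds. *)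
Lemma sq_bound (x B : R) i : 0 <= x -> 0 <= B -> x ^+ 2 <= B / 4 ^+ i -> x <= (B + 1) / 2 ^+ i.
Proof.
move=> x0 B0 h; have p2 : 0 < (2 ^+ i : R) by rewrite exprn_gt0.
rewrite ler_pdivlMr//; rewrite ler_pdivlMr ?exprn_gt0// in h.
have e4 : (4 ^+ i : R) = 2 ^+ i * 2 ^+ i by rewrite -exprMn; congr (_ ^+ _); ring.
rewrite e4 in h; have h' : (x * 2 ^+ i) ^+ 2 <= B by rewrite expr2; move: h; rewrite expr2; lra.
rewrite leNgt; apply/negP => h2.
have : (B + 1) * (B + 1) <= (x * 2 ^+ i) * (x * 2 ^+ i) by apply: ler_pM; lra.
by move: h'; rewrite expr2; nra.
Qed.

Lemma pow_big (x : R) : exists n, x <= 2 ^+ n.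
Proof.
have x0 : 0 <= `|x| by [].
have /andP[_ h] := truncn_itv x0; exists (Num.truncn `|x|).+1.
apply: le_trans (ler_norm x) _; apply: ltW; apply: lt_le_trans h _.
by rewrite -natrX ler_nat ltnW// ltn_expl.
Qed.

(* Radii along which the square means of the differences are summable; this
   stands in for Fatou's theorem on radial limits. *)
Definition fast F (rho : nat -> R) := [/\ forall i, 0 < rho i < 1,
  forall i j, (i <= j)%N -> rho i <= rho j, forall i, 1 - rho i <= i.+1%:R^-1 &
  forall i s t, rho i <= s -> s < 1 -> rho i <= t -> t < 1 ->
    cmean (fun z => md (sc s F z - sc t F z) ^+ 2) <= 1 / 16 ^+ i].

Lemma fast_ex F (M : R) : hol (disc 0 1) F -> (forall z, disc 0 1 z -> md (F z) <= M) ->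
  exists rho, fast F rho.
Proof.
move=> hF bF.
have ex i : exists r0 : R, 0 < r0 < 1 /\ forall s t, r0 <= s -> s < 1 -> r0 <= t -> t < 1 ->
    cmean (fun z => md (sc s F z - sc t F z) ^+ 2) <= 1 / 16 ^+ i.
  have e0 : 0 < 1 / 16 ^+ i :> R by rewrite divr_gt0// exprn_gt0.
  have [r r01 hr] := L2_cauchy hF bF e0; exists r; split => // s t *; exact/ltW/hr.
have [r0 hr0] := choice ex.
pose q i := Order.max (r0 i) (1 - i.+2%:R^-1).
have q01 i : 0 < q i < 1.
  have [/andP[a b] _] := hr0 i; rewrite /q lt_max a/= gt_max b/=.
  by rewrite ltrBlDr ltrDl invr_gt0 ltr0n.
pose rho := fix rho i := if i is j.+1 then Order.max (rho j) (q i) else q i.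
have rq i : q i <= rho i by case: i => [|i]; [exact: lexx|rewrite /= le_max lexx orbT].
exists rho; split.
- elim=> [|i /andP[IH1 IH2]]; first exact: q01.
  by have /andP[a b] := q01 i.+1; rewrite /= lt_max IH1 gt_max IH2 b.
- move=> i j /subnKC <-; elim: (j - i)%N => [|k IH]; first by rewrite addn0.
  by rewrite addnS /= le_max IH.
- move=> i; have := rq i; rewrite /q ge_max => /andP[_ h].
  have : i.+2%:R^-1 <= i.+1%:R^-1 :> R by rewrite lef_pV2 ?posrE ?ltr0n// ler_nat.
  by move: h; set a := _^-1; set b := _^-1; lra.
- move=> i s t si s1 ti t1; have [_ h] := hr0 i; apply: h => //.
    by apply: le_trans si; have := rq i; rewrite /q ge_max => /andP[].
  by apply: le_trans ti; have := rq i; rewrite /q ge_max => /andP[].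
Qed.

(** [fast] controls all pairs of radii past [rho i], so any radii beyond those of [rho] will do:
    [rho] itself as well as radii adapted to an iterate. *)
Lemma fast_seq F (M : R) rho s : hol (disc 0 1) F -> (forall z, disc 0 1 z -> md (F z) <= M) ->
  fast F rho -> (forall i j, (i <= j)%N -> rho i <= s j) -> (forall j, s j < 1) ->
  AE (fun t => exists l B, 0 <= B /\ forall i, md (F ((s i)%:C * cis t) - l) <= B / 2 ^+ i).
Proof.
move=> hF bF [r01 rmono _ hr] rs s1.
have s01 i : 0 < s i < 1.
  by rewrite s1 andbT; have /andP[a _] := r01 i; apply: lt_le_trans a (rs i i _).
pose p i z := md (sc (s i.+1) F z - sc (s i) F z) ^+ 2.
have := @fast_ae p 1; have cp i : rcont (p i).
  apply: rcont_md2 => z z1; apply: contB_T; exact: (sc_ccont hF).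
move=> /(_ cp (fun _ _ _ => sqr_ge0 _)) H; apply: AE_mono (H _).
  move=> t [B B0 hB].
  have [|l hl] := @geo_lim (fun i => F ((s i)%:C * cis t)) (B + 1).
    by move=> i; apply: sq_bound => //; [exact: md_ge0|exact: hB].
  by exists l, (2 * (B + 1)); split => //; rewrite mulr_ge0// addr_ge0.
move=> i; apply: hr => //; exact: rs.
Qed.

End AE.

(** * Boundary values of the iterates of a self-map of the disc *)

Section Radial.
Context {R : realType}.
Local Notation C := R[i].
Implicit Types (z w u l : C) (r t : R) (F f g h E : C -> C) (n i j : nat).

Definition radial_at g z l := forall e : R, 0 < e -> exists2 d : R, d < 1 & forall r, d < r -> r < 1 -> md (g (r%:C * z) - l) < e.

Lemma radial_cvg g z l : (g (r%:C * z) @[r --> (1:R)^'-] --> l) <-> radial_at g z l.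
Proof.
rewrite cvg_md; split=> h e e0.
  have : \forall x \near (1:R), x < 1 -> md (g (x%:C * z) - l) < e by exact: (h e e0).
  move=> /nbhs_ballP[d d0 hd]; have d0' : 0 < d := d0; exists (1 - d); first by lra.
  by move=> r r1 r2; apply: hd => //; rewrite /ball/= ger0_norm; lra.
have [d d1 hd] := h e e0.
near=> r; apply: hd; near: r; [exact: nbhs_left_gt|exact: nbhs_left_lt].
Unshelve. all: by end_near.
Qed.

Lemma radialE g z l : radial_at g z l -> radial_limit g z = l.
Proof. by move=> /radial_cvg h; apply: (cvg_lim (@norm_hausdorff _ _)). Qed.

(* [0] is the junk value of [radial_limit]. *)
Lemma radial_dich g z : radial_at g z (radial_limit g z) \/ radial_limit g z = 0.
Proof.
case: (pselect (exists l, radial_at g z l)) => [[l hl]|no].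
  by left; rewrite (radialE hl).
right; rewrite /radial_limit /lim /lim_in; case: xgetP => // x _ h.
by exfalso; apply: no; exists x; apply/radial_cvg.
Qed.

Lemma lip_in F M k : hol (disc 0 1) F -> (forall z, disc 0 1 z -> md (F z) <= M) -> 0 < k < 1 ->
  exists2 L : R, 0 <= L & forall z w, md z <= k -> md w <= k -> md (F z - F w) <= L * md (z - w).
Proof.
move=> hF bF /andP[k0 k1]; pose k' := (1 + k) / 2; pose q := (1 - k) / 2.
have q0 : 0 < q by rewrite /q; lra.
have sub u : md u < k' -> disc u q `<=` disc 0 1.
  by move=> h; apply: subset_disc; rewrite subr0; move: h; rewrite /k' /q; lra.
have z1 : disc (0:C) 1 0 by exact: disc_center ltr01.
have M0 : 0 <= M by apply: le_trans (bF 0 z1); exact: md_ge0.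
exists (2 * M / q); first by apply: divr_ge0; [rewrite mulr_ge0|exact: ltW].
move=> z w zk wk; apply: (@mvi_disc R 0 k').
- by apply: hol_sub hF; apply: subset_disc; rewrite subrr md0 /k'; lra.
- move=> u; rewrite /disc/= subr0 => u1; apply: (cauchy_dv q0).
    by apply: hol_sub hF; exact: sub.
  by move=> v vq; apply: bF; exact: (sub u).
- by rewrite /disc/= subr0 /k'; lra.
- by rewrite /disc/= subr0 /k'; lra.
Qed.

Lemma hol_max_lt G s : hol (disc 0 1) G -> (forall z, disc 0 1 z -> disc 0 1 (G z)) -> 0 < s < 1 ->
  exists2 k, 0 < k < 1 & forall z, md z <= s -> md (G z) <= k.
Proof.
move=> hG dG /andP[s0 s1].
have ne : cdisc (0:C) s !=set0 by exists 0; apply: disc_sub_cdisc; exact: disc_center s0.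
have sub : cdisc (0:C) s `<=` disc 0 1 by exact: cdisc_sub_disc.
have cG : {within cdisc (0:C) s, continuous (fun z => md (G z))}.
  apply: continuous_in_subspaceT => z; rewrite inE => /sub z1.
  by apply: (@continuous_comp _ _ _ G); [exact: hol_cont hG z1|exact: continuous_md].
have [c cs hc] := compact_EVT_max ne (@compact_cdisc R 0 s) cG.
have c1 : md (G c) < 1 by have := dG c; rewrite /disc/= !subr0; apply; rewrite inE in cs; have := sub c cs; rewrite /disc/= subr0.
exists ((1 + md (G c)) / 2); first by have := md_ge0 (G c); lra.
move=> z zs; have : z \in cdisc (0:C) s by rewrite inE /cdisc/= subr0.
by move=> /hc h; lra.
Qed.

Lemma sq2 (a b d : R) : 0 <= a -> a <= b + d -> a ^+ 2 <= 2 * b ^+ 2 + 2 * d ^+ 2.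
Proof.
move=> a0 h; have h1 : a * a <= (b + d) * (b + d) by apply: ler_pM.
by have := sqr_ge0 (b - d); rewrite !expr2; lra.
Qed.

(** [littlewood] asks for holomorphy beyond the closed disc, so it is applied to the difference [E]
    of [F] at the scales [rho i] and [r < 1]. On the disc of radius [k], which contains the values
    of [G] in question, replacing [w] by [r * w] costs at most [d]. The factor [4] comes from
    [2 * K + 2 <= 4 * K]. *)
Lemma subordinate F G M rho i s : hol (disc 0 1) F -> (forall z, disc 0 1 z -> md (F z) <= M) ->
  fast F rho -> hol (disc 0 1) G -> (forall z, disc 0 1 z -> disc 0 1 (G z)) -> 0 < s < 1 ->
  cmean (fun z => md (F (G (s%:C * z)) - F ((rho i)%:C * G (s%:C * z))) ^+ 2) <=
    4 * ((1 + md (G 0)) / (1 - md (G 0))) / 16 ^+ i.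
Proof.
move=> hF bF [r01 _ _ hr] hG dG s01; have /andP[s0 s1] := s01.
have /andP[p0 p1] := r01 i.
have z1 : disc (0:C) 1 0 by exact: disc_center ltr01.
have G01 : md (G 0) < 1 by have := dG 0 z1; rewrite /disc/= subr0.
set K := (1 + _) / _; have K1 : 1 <= K.
  by rewrite /K ler_pdivlMr ?subr_gt0//; have := md_ge0 (G 0); lra.
have [k k01 hk] := hol_max_lt hG dG s01; have /andP[k0 k1] := k01.
have [L L0 hL] := lip_in hF bF k01.
pose d : R := 1 / 4 ^+ i; have d0 : 0 < d by rewrite divr_gt0// exprn_gt0.
have d2 : d ^+ 2 = 1 / 16 ^+ i.
  by rewrite /d expr_div_n expr1n -exprM mulnC exprM; congr (_ / _ ^+ _); ring.
pose r := Order.max (rho i) (1 - d / (L + 1)).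
have L1 : 0 < L + 1 by lra.
have r1 : r < 1 by rewrite gt_max p1/= ltrBlDr ltrDl divr_gt0.
have rp : rho i <= r by rewrite le_max lexx.
have r0 : 0 < r by lra.
have rd : L * (1 - r) <= d.
  have h : 1 - d / (L + 1) <= r by rewrite le_max lexx orbT.
  have {}h : 1 - r <= d / (L + 1) by lra.
  have : (L + 1) * (1 - r) <= d by rewrite -ler_pdivlMl// mulrC.
  by apply: le_trans; rewrite ler_wpM2r//; lra.
pose E z := F ((rho i)%:C * z) - F (r%:C * z).
have hE : hol (disc 0 r^-1) E.
  apply: holB.
    apply: (@hol_comp R _ (disc 0 1)); [by apply: holM; [exact: hol_cst|exact: hol_id]|exact: hF|].
    move=> z; rewrite /disc/= !subr0 mdM mdr ger0_norm ?(ltW p0)// => zr.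
    apply: (@le_lt_trans _ _ (r * md z)); first by rewrite ler_wpM2r ?md_ge0.
    by rewrite -lter_pdivlMl// mulr1.
  apply: (@hol_comp R _ (disc 0 1)); [by apply: holM; [exact: hol_cst|exact: hol_id]|exact: hF|].
  by move=> z; rewrite /disc/= !subr0 mdM mdr ger0_norm ?(ltW r0)// => zr; rewrite -lter_pdivlMl// mulr1.
have ri : 1 < r^-1 by rewrite invf_gt1.
have mG z : disc 0 1 z -> md (G z) < 1 by move=> /dG; rewrite /disc/= subr0.
have := littlewood ri hE hG mG s01; rewrite -/K => lw.
have m1 : cmean (fun z => md (E z) ^+ 2) <= 1 / 16 ^+ i by apply: hr.
have le1 : cmean (fun z => md (E (G (s%:C * z))) ^+ 2) <= K * (1 / 16 ^+ i).
  by apply: le_trans lw _; apply: ler_wpM2l m1; lra.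
have cG : ccont (sc s G) 1 by exact: (sc_ccont hG).
have cin (a : R) : 0 < a -> a <= 1 -> ccont (fun z => F (a%:C * G (s%:C * z))) 1.
  move=> a0 a1 z zz; have sz : disc (0:C) 1 (s%:C * z) by apply: sc_in.
  apply: (@contC_T R C (fun z => a%:C * G (s%:C * z)) F).
    by apply: (@contM_T R C (fun _ => a%:C)); [exact: cst_continuous|exact: cG].
  apply: (hol_cont hF); rewrite /disc/= subr0 mdM mdr ger0_norm ?(ltW a0)//.
  have := mG _ sz; have := md_ge0 (G (s%:C * z)); nra.
have e1 : (fun z => F (G (s%:C * z))) = (fun z => F (1%:C * G (s%:C * z))).
  by apply: funext => z; rewrite (_ : 1%:C = 1 :> C)// mul1r.
have cin1 : ccont (fun z => F (G (s%:C * z))) 1 by rewrite e1; exact: cin ltr01 (lexx _).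
have cE : ccont (fun z => E (G (s%:C * z))) 1.
  by move=> z zz; apply: (@contB_T R C); [exact: cin p0 (ltW p1) z zz|exact: cin r0 (ltW r1) z zz].
apply: (@le_trans _ _ (cmean (fun z => 2 * md (E (G (s%:C * z))) ^+ 2 + 2 * d ^+ 2))).
  apply: cmean_le.
  - by apply: rcont_md2 => z zz; apply: (@contB_T R C); [exact: cin1|exact: cin p0 (ltW p1) z zz].
  - by apply: rcontD; [apply: rcontM; [exact: rcont_cst|exact: rcont_md2]|exact: rcont_cst].
  move=> z zz; set w := G _.
  have wk : md w <= k by apply: hk; rewrite mdM mdr zz mulr1 ger0_norm// ltW.
  have h2 : md (F w - F (r%:C * w)) <= d.
    apply: le_trans (hL _ _ wk _) _.
      by rewrite mdM mdr ger0_norm ?(ltW r0)//; have := md_ge0 w; nra.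
    have -> : w - r%:C * w = (1 - r)%:C * w by rewrite rmorphB /= mulrBl mul1r.
    rewrite mdM mdr ger0_norm ?subr_ge0 ?(ltW r1)// mulrA; apply: le_trans rd.
    have : 0 <= L * (1 - r) by rewrite mulr_ge0// subr_ge0 ltW.
    by have := md_ge0 w; nra.
  have h3 := md_tri (F w) (F ((rho i)%:C * w)) (F (r%:C * w)).
  rewrite (md_distC (F (r%:C * w))) -/(E w) in h3.
  have a0 := md_ge0 (F w - F ((rho i)%:C * w)).
  have b0 := md_ge0 (E w).
  by apply: sq2 => //; lra.
rewrite cmeanD; last 2 first.
- by apply: rcontM; [exact: rcont_cst|exact: rcont_md2].
- exact: rcont_cst.
rewrite (cmeanZ 2 (rcont_md2 cE)).
rewrite cmean_cst d2; have q0 : 0 < 1 / 16 ^+ i :> R by rewrite divr_gt0// exprn_gt0.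
have -> : 4 * K / 16 ^+ i = 4 * K * (1 / 16 ^+ i) by rewrite div1r.
move: le1 q0 K1; set a := cmean _; set b := 1 / _; nra.
Qed.

Variables (g : C -> C).
Hypotheses (hg : hol (disc 0 1) g) (gd : forall z, disc 0 1 z -> disc 0 1 (g z)).
Let orb n t := iter n (radial_limit g) (cis t).

Lemma iter_disc n z : disc 0 1 z -> disc 0 1 (iter n g z).
Proof. by move=> z1; elim: n => //= n; exact: gd. Qed.

Lemma hol_iter_disc n : hol (disc 0 1) (iter n g).
Proof.
elim: n => [|n IH]; first exact: hol_id.
by apply: (hol_comp IH hg) => z; exact: iter_disc.
Qed.

Definition good_point t := forall n, md (orb n t) = 1 /\ radial_at g (orb n t) (orb n.+1 t).

Lemma radial_le z l : md z <= 1 -> radial_at g z l -> md l <= 1.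
Proof.
move=> z1 h; apply/ler_addgt0Pl => e e0; have [d d1 hd] := h e e0.
pose r := Order.max ((1 + d) / 2) (1 / 2).
have r1 : r < 1 by rewrite gt_max; apply/andP; split; lra.
have rd : d < r by rewrite lt_max; apply/orP; left; lra.
have r0 : 0 < r by rewrite lt_max; apply/orP; right; lra.
have := hd r rd r1; have : md (g (r%:C * z)) < 1.
  have := gd (z := r%:C * z); rewrite /disc/= !subr0; apply.
  by rewrite mdM mdr ger0_norm ?(ltW r0)//; have := md_ge0 z; nra.
by have := md_subl l (g (r%:C * z)); rewrite (md_distC l); lra.
Qed.

Lemma radial_in z : md z < 1 -> radial_at g z (g z).
Proof.
move=> z1 e e0; have z1' : disc 0 1 z by rewrite /disc/= subr0.
have /contP h := hol_cont hg z1'; have [t t0 ht] := h e e0.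
exists (1 - t); first by lra.
move=> r r1 r2; apply: ht; have -> : r%:C * z - z = (r - 1)%:C * z.
  by rewrite rmorphB /= mulrBl mul1r.
rewrite mdM mdr ler0_norm; last by lra.
by have := md_ge0 z; nra.
Qed.

(* Once in the open disc, an orbit stays there; an undefined radial limit counts
   as [0], hence is excluded as well. *)
Lemma recurrent_good t : (forall N, exists2 n, (N <= n)%N & md (orb n t) = 1) -> good_point t.
Proof.
move=> h.
have inn n : md (orb n t) < 1 -> md (orb n.+1 t) < 1.
  move=> n1; rewrite /orb /= (radialE (radial_in n1)).
  by have := gd (z := orb n t); rewrite /disc/= !subr0; apply.
have stay n k : md (orb n t) < 1 -> md (orb (n + k) t) < 1.
  by move=> n1; elim: k => [|k IH]; rewrite ?addn0// addnS; exact: inn.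
have ge1 n : 1 <= md (orb n t).
  rewrite leNgt; apply/negP => n1; have [k nk k1] := h n.
  by have := stay n (k - n)%N n1; rewrite subnKC// k1 ltxx.
have all1 n : md (orb n t) = 1 /\ radial_at g (orb n t) (orb n.+1 t).
  elim: n => [|n [IH IH2]].
    have e0 : orb 0 t = cis t by [].
    rewrite e0 md_cis; split => //.
    case: (radial_dich g (cis t)) => // h0; have := ge1 1%N.
    by rewrite /orb /= h0 md0 ler10.
  have n1 : md (orb n.+1 t) = 1.
    by apply/eqP; rewrite eq_le ge1 andbT; apply: radial_le IH2; rewrite IH.
  split => //; case: (radial_dich g (orb n.+1 t)) => // h0; have := ge1 n.+2.
  by rewrite /orb /= h0 md0 ler10.
exact: all1.
Qed.

Lemma pow_small (e : R) : 0 < e -> exists n, 1 / 2 ^+ n <= e.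
Proof.
move=> e0; have [n hn] := pow_big (1 / e); exists n.
by rewrite ler_pdivrMr ?exprn_gt0// mulrC -ler_pdivrMr.
Qed.

(** Stands in for the statement that the radial limits of [iter n g] are the [n]-th iterates of the
    boundary map: one sequence of radii serves almost every [t], and the rate is what the next
    composition consumes. *)
Definition appr n (s : nat -> R) := [/\ forall i, 0 < s i < 1, forall i, 1 - s i <= 1 / 2 ^+ i &
  AE (fun t => exists B, forall i, md (iter n g ((s i)%:C * cis t) - orb n t) <= B / 2 ^+ i)].

Lemma appr_sub n (s : nat -> R) (j : nat -> nat) : (forall i, (i <= j i)%N) -> appr n s -> appr n (s \o j).
Proof.
move=> ij [s01 s1 hs]; have p2 i : 1 / 2 ^+ j i <= 1 / 2 ^+ i :> R.
  by rewrite !div1r lef_pV2 ?posrE ?exprn_gt0// ler_eXn2l ?ltr1n.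
split; [by move=> i; exact: s01|by move=> i; apply: le_trans (p2 i); exact: s1|].
apply: AE_mono hs => t [B hB]; exists B => i; apply: le_trans (hB (j i)) _.
have B0 : 0 <= B by have := hB 0%N; rewrite expr0 divr1; apply: le_trans; exact: md_ge0.
by have := ler_wpM2l B0 (p2 i); rewrite !mulrA !mulr1.
Qed.

Lemma appr0 s : (forall i, 0 < s i < 1) -> (forall i, 1 - s i <= 1 / 2 ^+ i) -> appr 0 s.
Proof.
move=> s01 s1; split => //; apply: AE_true => t; exists 1 => i.
have -> : iter 0 g ((s i)%:C * cis t) - orb 0 t = (s i - 1)%:C * cis t.
  by rewrite rmorphB mulrBl rmorph1 mul1r.
have /andP[a b] := s01 i.
by rewrite mdM mdr md_cis mulr1 distrC ger0_norm ?subr_ge0 ?(ltW b).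
Qed.

(* Subordination controls [F o g^n - F (rho_i *: g^n)]; the rate of approach of
   [s o j] makes up for the Lipschitz constant of [F] on the disc of radius
   [rho_i]. *)
Lemma transfer F M rho n s : hol (disc 0 1) F -> (forall z, disc 0 1 z -> md (F z) <= M) ->
  fast F rho -> appr n s -> exists j0 : nat -> nat, forall j : nat -> nat, (forall i, (j0 i <= j i)%N) ->
  AE (fun t => md (orb n t) <= 1 -> exists B, forall i,
    md (F (iter n g ((s (j i))%:C * cis t)) - F ((rho i)%:C * orb n t)) <= B / 2 ^+ i).
Proof.
move=> hF bF fF [s01 s1 hs]; have [r01 _ _ _] := fF.
have /choice[L hL] : forall i, exists L : R, 0 <= L /\ forall z w, md z <= rho i -> md w <= rho i -> md (F z - F w) <= L * md (z - w).
  by move=> i; have [L L0 hL] := lip_in hF bF (r01 i); exists L.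
have /choice[j0 hj0] : forall i, exists j : nat, L i * 2 ^+ i <= 2 ^+ j by move=> i; exact: pow_big.
exists j0 => j jj.
have hG := hol_iter_disc n; have dG := iter_disc n.
pose p i z := md (F (iter n g ((s (j i))%:C * z)) - F ((rho i)%:C * iter n g ((s (j i))%:C * z))) ^+ 2.
pose K := 4 * ((1 + md (iter n g 0)) / (1 - md (iter n g 0))).
have cp i : rcont (p i).
  have /andP[p0 p1] := r01 i; apply: rcont_md2 => z zz.
  have sz : disc (0:C) 1 ((s (j i))%:C * z) by apply: sc_in.
  have Gz := dG _ sz.
  have cG : {for z, continuous (sc (s (j i)) (iter n g))} by apply: (sc_ccont hG).
  apply: (@contB_T R C).
    by apply: (@contC_T R C (sc (s (j i)) (iter n g)) F); [exact: cG|exact: hol_cont hF Gz].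
  apply: (@contC_T R C (fun z => (rho i)%:C * iter n g ((s (j i))%:C * z)) F).
    by apply: (@contM_T R C (fun _ => (rho i)%:C)); [exact: cst_continuous|exact: cG].
  apply: (hol_cont hF); move: Gz; rewrite /disc/= !subr0 mdM mdr ger0_norm ?(ltW p0)//.
  by move=> h; have := md_ge0 (iter n g ((s (j i))%:C * z)); nra.
have := fast_ae cp (fun _ _ _ => sqr_ge0 _) (fun i => subordinate i hF bF fF hG dG (s01 (j i))).
move=> /(AE_and hs); apply: AE_mono => t [[B1 hB1] [B2 B20 hB2]] yle.
have B10 : 0 <= B1 by have := hB1 0%N; rewrite expr0 divr1; apply: le_trans; exact: md_ge0.
exists (B2 + 1 + B1) => i; have /andP[p0 p1] := r01 i; have [L0 Lh] := hL i.
set w := iter n g _; have wd : md w < 1.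
  have : disc 0 1 w := dG _ (sc_in (s01 (j i)) (md_cis t)).
  by rewrite /disc/= subr0.
have a1 : md (F w - F ((rho i)%:C * w)) <= (B2 + 1) / 2 ^+ i.
  by apply: sq_bound => //; [exact: md_ge0|exact: hB2].
have a2 : md (F ((rho i)%:C * w) - F ((rho i)%:C * orb n t)) <= B1 / 2 ^+ i.
  apply: le_trans (Lh _ _ _ _) _.
  - by rewrite mdM mdr ger0_norm ?(ltW p0)//; have := md_ge0 w; nra.
  - by rewrite mdM mdr ger0_norm ?(ltW p0)//; have := md_ge0 (orb n t); nra.
  rewrite -mulrBr mdM mdr ger0_norm ?(ltW p0)//.
  have h1 : md (w - orb n t) <= B1 / 2 ^+ j i by exact: hB1.
  have h2 : rho i * md (w - orb n t) <= B1 / 2 ^+ j i.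
    by apply: le_trans h1; have := md_ge0 (w - orb n t); nra.
  apply: le_trans (ler_wpM2l L0 h2) _; rewrite ler_pdivlMr ?exprn_gt0//.
  have -> : L i * (B1 / 2 ^+ j i) * 2 ^+ i = B1 * ((L i * 2 ^+ i) / 2 ^+ j i) by ring.
  rewrite -[leRHS]mulr1 ler_wpM2l// ler_pdivrMr ?exprn_gt0// mul1r.
  apply: le_trans (hj0 i) _; by rewrite ler_eXn2l ?ltr1n.
have := md_tri (F w) (F ((rho i)%:C * orb n t)) (F ((rho i)%:C * w)).
by rewrite mulrDl; lra.
Qed.

(** In the induction step thinned radii make the next iterate converge almost everywhere by
    [fast_seq]; [transfer] for [F = g] compares it with [g] at [(rho i)%:C * orb n t], and the
    radial limit of [g] there identifies the limit [l]. *)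
Lemma appr_ex n : AE good_point -> exists s, appr n s.
Proof.
move=> hgood; have gb z : disc 0 1 z -> md (g z) <= 1.
  by move=> /gd; rewrite /disc/= subr0 => /ltW.
elim: n => [|n [s hs]].
  exists (fun i => 1 - 1 / 2 ^+ i.+1); apply: appr0 => i.
    have h : 0 < 1 / 2 ^+ i.+1 :> R by rewrite divr_gt0// exprn_gt0.
    have h2 : 1 / 2 ^+ i.+1 < 1 :> R by rewrite ltr_pdivrMr ?exprn_gt0// mul1r exprn_egt1// ltr1n.
    by apply/andP; split; lra.
  rewrite opprB addrC subrK !div1r lef_pV2 ?posrE ?exprn_gt0// ler_eXn2l ?ltr1n//.
have [rho frho] := fast_ex hg gb.
have [j0 hj0] := transfer hg gb frho hs.
have [s01 s1 _] := hs.
have hG := hol_iter_disc n.+1.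
have Gb z : disc 0 1 z -> md (iter n.+1 g z) <= 1.
  by move=> /(iter_disc n.+1); rewrite /disc/= subr0 => /ltW.
have [rho' frho'] := fast_ex hG Gb; have [r01 rmono _ _] := frho'.
have /choice[j1 hj1] : forall i, exists j, 1 / 2 ^+ j <= 1 - rho' i :> R.
  by move=> i; apply: pow_small; have /andP[_ h] := r01 i; rewrite subr_gt0.
(* [j0] serves [transfer], [j1] pushes the radii beyond [rho'], and [i] keeps the rate of [s]. *)
pose j i := maxn (maxn (j0 i) (j1 i)) i.
have jj i : (j0 i <= j i)%N by rewrite /j !leq_max leqnn.
have ij i : (i <= j i)%N by rewrite /j leq_max leqnn orbT.
have [t01 t1 _] := appr_sub ij hs.
have big i k : (i <= k)%N -> rho' i <= s (j k).
  move=> ik; apply: le_trans (rmono _ _ ik) _.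
  have h1 := s1 (j k); have h2 := hj1 k.
  have h3 : 1 / 2 ^+ j k <= 1 / 2 ^+ j1 k :> R.
    by rewrite !div1r lef_pV2 ?posrE ?exprn_gt0// ler_eXn2l ?ltr1n// /j !leq_max leqnn orbT.
  by lra.
exists (s \o j); split => //.
have lt1 i : s (j i) < 1 by have /andP[] := s01 (j i).
have hf := fast_seq hG Gb frho' big lt1.
have := AE_and (AE_and hgood (hj0 j jj)) hf; apply: AE_mono.
move=> t [[gt ht] [l [B [B0 hB]]]]; have [y1 yr] := gt n.
have [|B' hB'] := ht; first by rewrite y1.
have B'0 : 0 <= B' by have := hB' 0%N; rewrite expr0 divr1; apply: le_trans; exact: md_ge0.
suff <- : l = orb n.+1 t by exists B => i; exact: hB.
apply/eqP; rewrite -subr_eq0 -md_eq0; apply/eqP/le_anti; rewrite md_ge0 andbT.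
apply/ler_addgt0Pl => e e0; rewrite addr0.
have [d d1 hd] := yr (e / 2) ltac:(lra).
have [fr01 frm frh _] := frho.
have e4 : 0 < e / (2 * (B + B' + 1)) by apply: divr_gt0 => //; lra.
have [N1 hN1] := pow_small e4.
have d0 : 0 < 1 - d by lra.
have [N2 hN2] := div_small ler01 d0.
pose i := maxn N1 N2.
have q1 : 1 / 2 ^+ i <= e / (2 * (B + B' + 1)).
  by apply: le_trans hN1; rewrite !div1r lef_pV2 ?posrE ?exprn_gt0// ler_eXn2l ?ltr1n// leq_maxl.
have q2 : d < rho i.
  by have := hN2 i (leq_maxr _ _); have := frh i; rewrite div1r; set a := _^-1; lra.
have /andP[_ q3] := fr01 i.
have a1 := hB i; have a2 := hB' i; have a3 := hd (rho i) q2 q3.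
have a4 : (B + B') / 2 ^+ i <= e / 2.
  have bb : 0 < B + B' + 1 by lra.
  have -> : e / 2 = (B + B' + 1) * (e / (2 * (B + B' + 1))) by field; rewrite gt_eqF.
  have -> : (B + B') / 2 ^+ i = (B + B') * (1 / 2 ^+ i) by rewrite mulrA mulr1.
  have p0 : 0 < 1 / 2 ^+ i :> R by rewrite divr_gt0// exprn_gt0.
  by apply: ler_pM; lra.
rewrite mulrDl in a4.
set u := iter n.+1 g _ in a1; have e' : g (iter n g ((s (j i))%:C * cis t)) = u by [].
rewrite e' in a2.
have := md_tri l (orb n.+1 t) u; have := md_tri u (orb n.+1 t) (g ((rho i)%:C * orb n t)).
rewrite (md_distC l u); lra.
Qed.

(** The same radii serve at time [0] and at time [n], so that a single point [(s i)%:C * cis t] of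
    the disc can witness both. *)
Lemma compare F M rho n : hol (disc 0 1) F -> (forall z, disc 0 1 z -> md (F z) <= M) ->
  fast F rho -> AE good_point ->
  AE (fun t => exists (s : nat -> R) (B : R), (forall i, 0 < s i < 1) /\ forall i,
    md (F ((s i)%:C * cis t) - F ((rho i)%:C * cis t)) <= B / 2 ^+ i /\
    md (F (iter n g ((s i)%:C * cis t)) - F ((rho i)%:C * orb n t)) <= B / 2 ^+ i).
Proof.
move=> hF bF fF hgood; have [s hs] := appr_ex n hgood; have [s01 s1 _] := hs.
have [j0 hj0] := transfer hF bF fF hs.
have [j1 hj1] := transfer hF bF fF (appr0 s01 s1).
pose j i := maxn (j0 i) (j1 i).
have H0 := hj0 j (fun i => leq_maxl _ _); have H1 := hj1 j (fun i => leq_maxr _ _).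
have := AE_and hgood (AE_and H0 H1); apply: AE_mono => t [gt [h0 h1]].
have [|B0 hB0] := h0; first by have [-> _] := gt n.
have [|B1 hB1] := h1; first by have -> : orb 0 t = cis t by []; rewrite md_cis.
have p0 i : 0 <= (2 ^+ i)^-1 :> R by rewrite invr_ge0 exprn_ge0.
exists (s \o j), (Order.max B0 B1); split; first by move=> i; exact: s01.
move=> i; split.
  by apply: le_trans (hB1 i) _; apply: ler_wpM2r; rewrite ?le_max ?lexx ?orbT.
by apply: le_trans (hB0 i) _; apply: ler_wpM2r; rewrite ?le_max ?lexx ?orbT.
Qed.

End Radial.

(** * From recurrence on the circle to returns in the component *)

Section Recurrence.
Context {R : realType}.
Local Notation C := R[i].
Local Notation mu := (@lebesgue_measure R).
Implicit Types (z w u l : C) (r t : R) (F f g h E phi : C -> C) (n i j : nat) (p : C -> R).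

(* Near a critical point, the quotient of differences would be bounded below on
   a circle, hence so would be [dv F] off its zeros. *)
Lemma inj_dv a r F : 0 < r -> hol (disc a r) F -> inj (disc a r) F -> dv F a != 0.
Proof.
move=> r0 hF iF; apply/negP => /eqP da0.
pose s := r / 2; have s0 : 0 < s by rewrite /s; lra.
have sr : s < r by rewrite /s; lra.
have [e e0 he] := inj_open s0 sr hF iF.
have ra := disc_center a r0.
have far z : md (z - a) = s -> e <= md (F z - F a).
  move=> zs; rewrite leNgt; apply/negP => h; have [y ys yz] := he (F z) h.
  have : y = z by apply: iF => //; [exact: lt_trans ys sr|rewrite /disc/= zs].
  by move=> yz'; move: ys; rewrite yz' /disc/= zs ltxx.
have odr := @open_disc R a r.
have /contP cD := hol_cont (hol_dv odr hF) ra.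
have /contP cF := hol_cont hF ra.
have q0 : 0 < e / (4 * s) by rewrite divr_gt0// mulr_gt0.
have [t1 t10 h1] := cD _ q0; have e2 : 0 < e / 2 by lra.
have [t2 t20 h2] := cF _ e2.
pose t := Order.min s (Order.min t1 t2).
have t0 : 0 < t by rewrite !lt_min s0 t10 t20.
have sub : disc a t `<=` disc a r by move=> z; rewrite /disc/= lt_min => /andP[h _]; lra.
have zero b : disc a t b -> dv F b = 0.
  rewrite /disc/= !lt_min => /andP[bs /andP[b1 b2]]; apply/eqP/negPn/negP => db.
  have br : disc a r b by rewrite /disc/=; lra.
  have := h1 b b1; rewrite da0 subr0 => small.
  have hq := hol_quot odr hF br.
  have q_ne z : disc a r z -> quot F b z != 0.
    move=> zr; rewrite /quot; case: (eqVneq z b) => [zb|zb]; first exact: db.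
    rewrite mulf_neq0 ?invr_eq0 ?subr_eq0//; apply/eqP => /iF h.
    by move: zb; rewrite h// eqxx.
  have hV := holV hq q_ne.
  have csr : cdisc a s `<=` disc a r by exact: cdisc_sub_disc.
  have := @max_principle R a s (fun z => (quot F b z)^-1) (4 * s / e) s0.
  move=> /(_ (hol_sub (subset_trans (@disc_sub_cdisc R a s) csr) hV)).
  move=> /(_ (fun z hz => hol_cont hV (csr z hz))).
  have bnd z : md (z - a) = s -> md (quot F b z)^-1 <= 4 * s / e.
    move=> zs; have zb : z != b by apply/eqP => zb; move: bs; rewrite -zb zs ltxx.
    rewrite /quot (negbTE zb) invf_div md_div.
    have m1 : md (z - b) <= 2 * s by have := md_tri z b a; rewrite (md_distC a b) zs; lra.
    have m2 : e / 2 <= md (F z - F b).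
      by have := far z zs; have := md_tri (F z) (F a) (F b); have := h2 b b2; lra.
    have m0 : 0 < md (F z - F b) by lra.
    rewrite ler_pdivrMr//; apply: le_trans m1 _.
    have -> : 2 * s = 4 * s / e * (e / 2) by field; rewrite gt_eqF.
    by rewrite ler_wpM2l// divr_ge0 ?mulr_ge0 ?(ltW e0)// ltW.
  move=> /(_ bnd b (disc_sub_cdisc bs)); rewrite /quot eqxx mdV => h.
  have db0 : 0 < md (dv F b) by rewrite md_gt0.
  have : e / (4 * s) <= md (dv F b).
    rewrite -(@lef_pV2 R) ?posrE// invf_div; exact: h.
  by rewrite leNgt small.
pose b := a + (t / 2)%:C.
have bt : disc a t b by rewrite /disc/= /b addrAC subrr add0r mdr gtr0_norm; lra.
have Fb : F b = F a by apply: (hol_zero_dv t0) bt; [exact: hol_sub sub hF|exact: zero].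
have := iF _ _ (sub _ bt) ra Fb; move/(congr1 (fun z => z - a)).
rewrite /b addrAC subrr add0r => /(congr1 (fun z => md z)); rewrite md0 mdr gtr0_norm; last by lra.
by move=> /eqP; rewrite mulf_eq0 invr_eq0 pnatr_eq0 orbF gt_eqF.
Qed.

(** Differentiation of [F (g w) = h w]: a nonzero [d] upgrades continuity of [g] to a Lipschitz
    bound, after which the remainder of [F] is negligible. *)
Lemma hd_lift F g h z d e : {for z, continuous g} -> hd F (g z) d -> d != 0 -> hd h z e ->
  (exists2 r, 0 < r & forall w, disc z r w -> F (g w) = h w) -> hd g z (e / d).
Proof.
move=> /contP cg hF d0 hh [r0 r00 er] ep ep0.
have md0' : 0 < md d by rewrite md_gt0.
have c1 : 0 < md d / 2 by lra.
have [t1 t10 h1] := hF _ c1.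
have [t2 t20 h2] := cg t1 t10.
have [t3 t30 h3] := hd_lip hh.
pose L := 2 * (md e + 1) / md d.
have L0 : 0 < L by rewrite divr_gt0// mulr_gt0//; have := md_ge0 e; lra.
have c2 : 0 < ep * md d / (2 * L) by apply: divr_gt0; apply: mulr_gt0.
have [t4 t40 h4] := hF _ c2.
have [t5 t50 h5] := cg t4 t40.
have c3 : 0 < ep * md d / 2 by rewrite divr_gt0 ?mulr_gt0.
have [t6 t60 h6] := hh _ c3.
exists (Order.min r0 (Order.min t2 (Order.min t3 (Order.min t5 t6)))).
  by rewrite !lt_min r00 t20 t30 t50 t60.
move=> w; rewrite !lt_min => /and5P[w0 w2 w3 w5 w6].
have ez : F (g z) = h z by apply: er; exact: disc_center.
have ew : F (g w) = h w by exact: er.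
have k1 := h1 _ (h2 _ w2); have k3 := h3 _ w3; have k4 := h4 _ (h5 _ w5); have k6 := h6 _ w6.
rewrite ez ew in k1 k4.
have Lip : md (g w - g z) <= L * md (w - z).
  have := md_subl (d * (g w - g z)) (h w - h z); rewrite (md_distC (d * _)) mdM => k.
  rewrite /L mulrAC ler_pdivlMr// mulrC.
  by lra.
have -> : g w - g z - e / d * (w - z) = (h w - h z - e * (w - z) - (h w - h z - d * (g w - g z))) / d.
  by field.
rewrite md_div ler_pdivrMr//; apply: le_trans (mdB _ _) _.
have k4' : md (h w - h z - d * (g w - g z)) <= ep * md d / 2 * md (w - z).
  apply: le_trans k4 _; apply: le_trans (ler_wpM2l (ltW c2) Lip) _.
  by rewrite le_eqVlt; apply/orP; left; apply/eqP; field; rewrite gt_eqF.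
by move: k4' k6; set a := md _; set b := md _; lra.
Qed.

Lemma rcont_abs p : rcont p -> rcont (fun z => `|p z|).
Proof.
move=> cp z z1; apply/contRP => e e0; have /contRP/(_ e e0)[t t0 ht] := cp z z1.
by exists t => // w /ht; apply: le_lt_trans; exact: ler_dist_dist.
Qed.

Lemma borel_closed (B : set C) : closed B -> <<s @open C >> B.
Proof.
move=> cB; rewrite -(setCK B) -setTD; apply: sigma_algebraCD.
by apply: sub_sigma_algebra; rewrite openC.
Qed.

Lemma borel_bigcap (A : nat -> set C) : (forall k, <<s @open C >> (A k)) -> <<s @open C >> (\bigcap_k A k).
Proof.
move=> hA; rewrite -(setCK (\bigcap_k A k)) -setTD; apply: sigma_algebraCD.
rewrite setC_bigcap; apply: sigma_algebra_bigcup => k.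
by rewrite -setTD; exact: sigma_algebraCD.
Qed.

Lemma dominated0 (q : nat -> C -> R) (M : R) : (forall n, rcont (q n)) ->
  (forall n z, md z = 1 -> 0 <= q n z <= M) ->
  AE (fun t => forall e, 0 < e -> exists N, forall n, (N <= n)%N -> q n (cis t) < e) ->
  forall e, 0 < e -> exists n0, forall n, (n0 <= n)%N -> cmean (q n) < e.
Proof.
move=> cq qM h e e0; pose D : set (measurableTypeR R) := `[0, 2 * pi]%classic.
have mD : measurable D by exact: measurable_itv.
pose F n : measurableTypeR R -> \bar R := fun t => (q n (cis t))%:E.
have intf n : mu.-integrable D (F n) by exact: (rcont_int (cq n)).
have mF n : measurable_fun D (F n) by have /integrableP[] := intf n.
have ig : mu.-integrable D (fun _ : measurableTypeR R => M%:E) by exact: (@rcont_int R (fun _ => M) (@rcont_cst R M)).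
have lim0 : {ae mu, forall t, D t -> F ^~ t @ \oo --> 0%E}.
  (* [AE] speaks of the half-open interval, whereas the mean integrates over the closed one. *)
  have ne : {ae mu, forall t : measurableTypeR R, t != 2 * pi}.
    exists [set (2 * pi : R)]; split; [exact: measurable_set1|exact: lebesgue_measure_set1|].
    by move=> t /= /negP; rewrite negbK => /eqP.
  have := ae_filter_ringOfSetsType mu => FF.
  move: h; rewrite /AE => h; apply: filterS2 ne h => t tn ht.
  rewrite /D/= in_itv/= => /andP[t0 t1].
  have t01 : 0 <= t < 2 * pi by rewrite t0 lt_neqAle tn.
  have {}ht := ht t01; apply/fine_cvgP; split; first by apply: nearW => n.
  apply/cvgr0Pnorm_lt => ep ep0; have [N hN] := ht ep ep0.
  exists N => // n /= Nn; have := hN n Nn.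
  by have /andP[a _] := qM n (cis t) (md_cis t); rewrite ger0_norm.
have dom : {ae mu, forall t n, D t -> (`|F n t| <= M%:E)%E}.
  apply: aeW => t n _; have /andP[a b] := qM n (cis t) (md_cis t).
  by rewrite /F /= lee_fin ger0_norm.
have [_ _] := dominated_convergence mD mF (measurable_cst _) lim0 ig dom.
rewrite integral0 => /fine_cvgP[_ /cvgr0Pnorm_lt].
have e1 : 0 < 2 * pi * e :> R by rewrite mulr_gt0// pi2_gt0.
move=> /(_ _ e1)[N _ hN]; exists N => n Nn; have := hN n Nn => /= h1.
rewrite /cmean ltr_pdivrMl ?pi2_gt0//; apply: le_lt_trans h1; exact: ler_norm.
Qed.

(** If the modulus of [F] were asymptotically at most [m] almost everywhere, its positive excess
    over [m] would have mean tending to [0] by dominated convergence, and the Poisson formula would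
    bound [md (F w)] by [m]. *)
Lemma nonnull F (M m : R) rho w : hol (disc 0 1) F -> (forall z, disc 0 1 z -> md (F z) <= M) ->
  fast F rho -> md w < 1 -> 0 <= m -> m < md (F w) ->
  ~ AE (fun t => forall l : nat, exists I, forall i, (I <= i)%N ->
    md (F ((rho i)%:C * cis t)) < m + l.+1%:R^-1).
Proof.
move=> hF bF [r01 _ r1 _] w1 m0 mw h.
pose x i z := md (sc (rho i) F z) + - m.
have cx i : rcont (x i).
  by apply: rcontD; [apply: rcont_md; exact: (sc_ccont hF)|exact: rcont_cst].
(* The positive part of [x i], in a form whose continuity is immediate. *)
pose q i z := 2^-1 * (x i z + `|x i z|).
have cq i : rcont (q i).
  by apply: rcontM; [exact: rcont_cst|apply: rcontD; [exact: cx|apply: rcont_abs; exact: cx]].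
have qE i z : q i z = if 0 <= x i z then x i z else 0.
  rewrite /q; case: ifPn => h0; first by rewrite ger0_norm//; lra.
  by rewrite -ltNge in h0; rewrite ltr0_norm//; lra.
have xM i z : md z = 1 -> x i z <= M.
  by move=> z1; have := bF _ (sc_in (r01 i) z1); rewrite /x /sc; lra.
have M0 : 0 <= M.
  have z0 : disc (0:C) 1 0 by exact: disc_center ltr01.
  by apply: le_trans (bF 0 z0); exact: md_ge0.
have q0 i z : 0 <= q i z by rewrite qE; case: ifP.
have qM i z : md z = 1 -> 0 <= q i z <= M.
  by move=> z1; rewrite q0 qE; case: ifP => // _; exact: xM.
have hq : AE (fun t => forall e, 0 < e -> exists N, forall n, (N <= n)%N -> q n (cis t) < e).
  apply: AE_mono h => t ht e e0; have [l hl] := div_small ler01 e0.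
  have [I hI] := ht l; exists I => i Ii; have := hI i Ii; have := hl l (leqnn _).
  rewrite div1r qE /x /sc; set c := _^-1 => a1 a2; case: ifP => // _; lra.
pose K := (1 + md w) / (1 - md w).
have K1 : 0 < K by rewrite divr_gt0//; have := md_ge0 w; lra.
pose e := (md (F w) - m) / 2; have e0 : 0 < e by rewrite /e; lra.
have eK : 0 < e / K by rewrite divr_gt0.
have [n0 hn0] := dominated0 cq qM hq eK.
have w1' : disc 0 1 w by rewrite /disc/= subr0.
have /contP/(_ e e0)[d d0 hd] := hol_cont hF w1'.
have [n1 hn1] := div_small ler01 d0.
pose n := maxn n0 n1; have /andP[p0 p1] := r01 n.
have c1 : md (F ((rho n)%:C * w) - F w) < e.
  apply: hd; have -> : (rho n)%:C * w - w = (rho n - 1)%:C * w.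
    by rewrite rmorphB mulrBl rmorph1 mul1r.
  rewrite mdM mdr ler0_norm; last by lra.
  have := hn1 n (leq_maxr _ _); have := r1 n; rewrite div1r; set a := _^-1.
  by have := md_ge0 w; nra.
have ri : 1 < (rho n)^-1 by rewrite invf_gt1.
have hsc : hol (disc 0 (rho n)^-1) (sc (rho n) F).
  apply: (@hol_comp R _ (disc 0 1)); [by apply: holM; [exact: hol_cst|exact: hol_id]|exact: hF|].
  by move=> z; rewrite /disc/= !subr0 mdM mdr ger0_norm ?(ltW p0)// => zr; rewrite -lter_pdivlMl// mulr1.
have c2 := poisson_le ri hsc w1.
have c3 : cmean (fun y => md (sc (rho n) F y) * pois w y) <= cmean (fun y => m * pois w y + K * q n y).
  have cF : ccont (sc (rho n) F) 1 by exact: (sc_ccont hF).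
  apply: cmean_le.
  - by apply: rcontM; [exact: rcont_md|exact: rcont_pois].
  - by apply: rcontD; apply: rcontM; [exact: rcont_cst|exact: rcont_pois|exact: rcont_cst|exact: cq].
  move=> y y1; have a1 := pois_ge0 w1 y1; have a2 := pois_le w1 y1; rewrite -/K in a2.
  have a3 : md (sc (rho n) F y) <= m + q n y.
    by rewrite qE /x; case: ifPn => [|]; [lra|rewrite -ltNge; lra].
  have a4 := q0 n y.
  apply: (@le_trans _ _ ((m + q n y) * pois w y)); first by rewrite ler_wpM2r.
  rewrite mulrDl lerD2l mulrC; exact: ler_wpM2r.
rewrite cmeanD in c3; last 2 first.
- by apply: rcontM; [exact: rcont_cst|exact: rcont_pois].
- by apply: rcontM; [exact: rcont_cst|exact: cq].
rewrite (cmeanZ m (rcont_pois w1)) (cmeanZ K (cq n)) pois_mean// mulr1 in c3.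
have c4 : K * cmean (q n) < e.
  by rewrite mulrC -ltr_pdivlMr//; apply: hn0; exact: leq_maxl.
have := md_tri (F w) 0 (F ((rho n)%:C * w)); rewrite !subr0 (md_distC (F w)).
have c5 : md (F ((rho n)%:C * w)) <= m + K * cmean (q n) := le_trans c2 c3.
by move: c1 c4 c5; rewrite /e; lra.
Qed.

Section Orbits.
Variables (f phi : C -> C) (U : set C).
Hypotheses (tf : transcendental_entire f) (fcU : fatou_component f U) (fUU : f @` U `<=` U).
Hypothesis rm : riemann_map U phi.

Lemma unit_discE : @unit_disc R = disc 0 1. Proof. exact: ballE. Qed.

Let psi := pinv (@unit_disc R) phi.

Lemma riemannP : [/\ hol (disc 0 1) phi, inj (disc 0 1) phi, phi @` disc 0 1 = U,
  forall z, disc 0 1 z -> psi (phi z) = z & forall u, U u -> disc 0 1 (psi u) /\ phi (psi u) = u].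
Proof.
have [h1 h2 h3] := rm; rewrite unit_discE in h1 h3; have h2' := h2; rewrite unit_discE in h2'.
have hK : forall z, disc 0 1 z -> psi (phi z) = z.
  by move=> z z1; apply: (pinvKV _ h2); rewrite inE unit_discE.
split => //; first exact/holomorphic_hol.
- by move=> z w z1 w1; apply: h2'; rewrite inE.
- by move=> u; rewrite -h3 => -[z z1 <-]; rewrite hK.
Qed.

(** Openness of [phi] gives continuity of the inverse, and the nonvanishing derivative of an
    injective map gives differentiability. *)
Lemma hol_riemann_inv : hol U psi.
Proof.
have [hp ip pU pK Kp] := riemannP; have oU := comp_open fcU.
move=> u Uu; have [a1 ua] := Kp u Uu; set a := psi u in a1 ua.
pose r := 1 - md a; have r0 : 0 < r by move: a1; rewrite /disc/= subr0 /r; lra.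
have sub : disc a r `<=` disc 0 1 by apply: subset_disc; rewrite subr0 /r; lra.
have hr := hol_sub sub hp; have ir := inj_sub sub ip.
have d0 := inj_dv r0 hr ir.
have c : {for u, continuous psi}.
  apply/contP => e e0; pose s := Order.min (e / 2) (r / 2).
  have s0 : 0 < s by rewrite lt_min; apply/andP; split; lra.
  have sr : s < r by rewrite gt_min; apply/orP; right; lra.
  have [e' e'0 he] := inj_open s0 sr hr ir; rewrite ua in he.
  exists e' => // w /he[y ys yw].
  have y1 : disc 0 1 y by apply: sub; exact: lt_trans ys sr.
  by rewrite -yw pK//; apply: lt_le_trans ys _; rewrite /s ge_min; apply/orP; left; lra.
have ra := disc_center a r0.
exists (1 / dv phi a); apply: (@hd_lift phi psi id u (dv phi a) 1) => //.
- exact: dvP hr ra.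
- exact: hd_id.
- have /open_md/(_ u Uu)[t t0 ht] := oU; exists t => // w /ht Uw.
  by have [_] := Kp w Uw.
Qed.

Let g := inner_function f phi.

Lemma innerP : [/\ hol (disc 0 1) g, forall z, disc 0 1 z -> disc 0 1 (g z) &
  forall n z, disc 0 1 z -> phi (iter n g z) = iter n f (phi z)].
Proof.
have [hp ip pU pK Kp] := riemannP; have [/holomorphic_hol hf _] := tf.
have Up z : disc 0 1 z -> U (phi z) by move=> z1; rewrite -pU; exists z.
have Uf u : U u -> U (f u) by move=> Uu; apply: fUU; exists u.
have gd z : disc 0 1 z -> disc 0 1 (g z) by move=> z1; have [] := Kp (f (phi z)) (Uf _ (Up z z1)).
split => //.
  have h1 : hol (disc 0 1) (fun z => f (phi z)) by apply: (hol_comp hp hf).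
  by apply: (hol_comp h1 hol_riemann_inv) => z z1; exact/Uf/Up.
elim=> [//|n IH] z z1 /=; rewrite -IH//.
have z1' := iter_disc gd n z1.
by have [_] := Kp (f (phi (iter n g z))) (Uf _ (Up _ z1')).
Qed.

Lemma unit_circleP z : unit_circle z <-> md z = 1.
Proof.
rewrite /unit_circle/= md_normE; split=> [/(congr1 (@complex.Re R))//|->//].
Qed.

(* Take [s] with [s ^+ 2 = phi - q] and [J = (s + s w)^-1], with [phi w] close to
   [q]; [J] is bounded since the image of [s] is open and misses its opposite. *)
Lemma separating q (r : R) : 0 < r -> boundary U q -> exists J M m w,
  [/\ hol (disc 0 1) J, forall z, disc 0 1 z -> md (J z) <= M, disc 0 1 w, 0 <= m < md (J w) &
    forall z, disc 0 1 z -> m < md (J z) -> md (phi z - q) < r].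
Proof.
move=> r0 bq; have [hp ip pU pK Kp] := riemannP; have oU := comp_open fcU.
have Up z : disc 0 1 z -> U (phi z) by move=> z1; rewrite -pU; exists z.
have nq z : disc 0 1 z -> phi z - q != 0.
  move=> z1; rewrite subr_eq0; apply/eqP => e; apply: (bd_notin fcU bq); rewrite -e; exact: Up.
have hF : hol (disc 0 1) (fun z => phi z - q) by apply: holB => //; exact: hol_cst.
have [s [cs hs]] := @sqrt_disc R 0 1 (fun z => phi z - q) ltr01 (fun z (hz : disc 0 1 z) => hol_cont hF hz) nq.
have s_ne z : disc 0 1 z -> s z != 0.
  by move=> z1; apply/eqP => e; have := nq z z1; rewrite -hs// e expr0n eqxx.
have hol_s : hol (disc 0 1) s.
  move=> z z1; have [d hd] := hF z z1; exists (d / (2 * s z)).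
  apply: hd_sqrt; [exact: cs|exact: s_ne|].
  have z1' : md z < 1 by move: z1; rewrite /disc/= subr0.
  apply: (@hd_eq R (fun z => phi z - q) _ z d (1 - md z)) hd; first by lra.
  move=> w; rewrite inE => wz; rewrite hs//; apply: subset_disc wz; rewrite subr0; lra.
pose k := Num.sqrt r; have k0 : 0 < k by rewrite sqrtr_gt0.
have k2 : k ^+ 2 = r by rewrite sqr_sqrtr// ltW.
have e0 : 0 < r / 16 by lra.
have /closure_md/(_ _ e0)[u Uu uq] : closure U q by case: bq.
have [w1 uw] := Kp u Uu; set w := psi u in w1 uw.
pose d := md (s w); have d0 : 0 < d by rewrite md_gt0 s_ne.
have d2 : d ^+ 2 < r / 16 by rewrite /d -mdX hs// uw.
have dk : 4 * d < k.
  rewrite ltNge; apply/negP => h; have : k * k <= 4 * d * (4 * d) by apply: ler_pM; lra.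
  by move: d2; rewrite -k2 !expr2; lra.
have inj_s : inj (disc 0 1) s.
  by move=> z z' z1 z'1 e; apply: ip => //; apply: (addIr (- q)); rewrite -!hs// e.
have neg z z' : disc 0 1 z -> disc 0 1 z' -> s z + s z' != 0.
  move=> z1 z'1; rewrite addr_eq0; apply/eqP => e.
  have e' : z = z' by apply: ip => //; apply: (addIr (- q)); rewrite -!hs// e sqrrN.
  have : s z *+ 2 = 0 by rewrite mulr2n {2}e e' addrN.
  by move/eqP; rewrite mulrn_eq0 /= (negbTE (s_ne z z1)).
pose rw := 1 - md w; have rw0 : 0 < rw by move: w1; rewrite /disc/= subr0 /rw; lra.
have sub : disc w rw `<=` disc 0 1 by apply: subset_disc; rewrite subr0 /rw; lra.
have rw2 : 0 < rw / 2 by lra.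
have rwl : rw / 2 < rw by lra.
have [e1 e10 he] := inj_open rw2 rwl (hol_sub sub hol_s) (inj_sub sub inj_s).
have low z : disc 0 1 z -> e1 <= md (s z + s w).
  move=> z1; rewrite leNgt; apply/negP => h.
  have [|y ys yz] := he (- s z).
    by rewrite /disc/= (_ : - s z - s w = - (s z + s w)) ?mdN//; ring.
  have y1 : disc 0 1 y by apply: sub; exact: lt_trans ys rwl.
  by have := neg z y z1 y1; rewrite yz addrN eqxx.
(* [m] is chosen so that [md (J z) > m] forces [md (s z) < k], that is [md (phi z - q) < r]; and
   [md (J w)] is the inverse of [2 * d], which is smaller than [k - d]. *)
exists (fun z => (s z + s w)^-1), (e1^-1), (k - d)^-1, w; split => //.
- by apply: holV => [|z z1]; [apply: holD => //; exact: hol_cst|exact: neg].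
- move=> z z1; rewrite mdV lef_pV2 ?posrE ?low//.
  by apply: lt_le_trans (low z z1).
- have kd : 0 < k - d by lra.
  rewrite invr_ge0 (ltW kd)/= mdV ltf_pV2 ?posrE//; last by rewrite md_gt0 neg.
  apply: le_lt_trans (mdD _ _) _; rewrite -/d; lra.
- move=> z z1; rewrite mdV ltf_pV2 ?posrE; last 2 first.
  + by lra.
  + by rewrite md_gt0 neg.
  move=> h; have h1 : md (s z) < k by have := md_addl (s z) (s w); rewrite -/d; lra.
  by rewrite -hs// mdX -k2 ltr_pXn2r// nnegrE ?md_ge0 ?(ltW k0).
Qed.

Hypothesis recu : forall A, <<s @open C >> A -> A `<=` unit_circle ->
    {ae mu, forall t : R, 0 <= t < 2 * pi -> A (cis t) ->
       exists2 n : nat -> nat, n k @[k --> \oo] --> \oo &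
         forall k, A (iter (n k) (radial_limit g) (cis t))}.

(** Let [A] be the set of boundary points towards which the modulus of [J] exceeds [m] by a definite
    amount infinitely often. By [nonnull] its complement does not have full measure. Recurrence
    brings almost every point of [A] back to [A] at some time [n >= N], and [compare] turns both
    visits into one point [z] of the disc at which, as at [iter n g z], the modulus of [J] exceeds
    [m]. *)
Lemma return_near q (r : R) N : 0 < r -> boundary U q ->
  exists n z, [/\ (N <= n)%N, U z, md (z - q) < r & md (iter n f z - q) < r].
Proof.
move=> r0 bq; have [hp ip pU pK Kp] := riemannP; have [hg gd gn] := innerP.
have Up z : disc 0 1 z -> U (phi z) by move=> z1; rewrite -pU; exists z.
have rec A : <<s @open C >> A -> A `<=` unit_circle -> AE (fun t => A (cis t) ->
    forall N, exists2 n, (N <= n)%N & A (iter n (radial_limit g) (cis t))).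
  move=> bA sA; have := recu bA sA; rewrite -/(AE _); apply: AE_mono => t h At N'.
  have [v hv Av] := h At; have /hv[k0 _ hk] : \forall n \near \oo, (N' <= n)%N by exact: nbhs_infty_ge.
  by exists (v k0) => //; exact: (hk k0 (leqnn _)).
have bcirc : <<s @open C >> (@unit_circle R).
  apply: borel_closed => z /closure_md h; apply/unit_circleP.
  apply/eqP; rewrite -subr_eq0 -normr_le0; apply/ler_addgt0Pl => e e0; rewrite addr0.
  have [w /unit_circleP w1 wz] := h e e0; rewrite -w1.
  have := md_subl z w; have := md_subl w z; rewrite (md_distC z w) ler_norml; lra.
have AEgood : AE (good_point g).
  have hh := rec _ bcirc (@subset_refl _ _).
  apply: AE_mono hh => t h; apply: (recurrent_good hg gd) => N'.
  have /h/(_ N')[n Nn /unit_circleP h1] : unit_circle (cis t : C) by apply/unit_circleP; exact: md_cis.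
  by exists n.
have [J [M [m [w [hJ bJ w1 /andP[m0 mw] near]]]]] := separating r0 bq.
have [rho frho] := fast_ex hJ bJ; have [r01 rmono _ _] := frho.
pose B (l i : nat) : set C := [set y | md y = 1 /\ m + l.+1%:R^-1 <= md (J ((rho i)%:C * y))].
have cB (l' i : nat) : closed (B l' i).
  move=> y /closure_md h.
  have y1 : md y = 1.
    apply/eqP; rewrite -subr_eq0 -normr_le0; apply/ler_addgt0Pl => e e0; rewrite addr0.
    have [v [v1 _] vy] := h e e0; rewrite -v1.
    have := md_subl y v; have := md_subl v y; rewrite (md_distC y v) ler_norml; lra.
  split => //; rewrite leNgt; apply/negP => lt.
  have /contP c := sc_ccont hJ (r01 i) y1.
  have [|d d0 hd] := c (m + l'.+1%:R^-1 - md (J ((rho i)%:C * y))); first by rewrite subr_gt0.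
  have [v [_ v2] vy] := h d d0; have := hd v vy; rewrite /sc.
  have := md_subl (J ((rho i)%:C * v)) (J ((rho i)%:C * y)).
  by move: v2; set a := m + _; lra.
(* Infinitely often, written as a countable combination of closed sets, hence Borel. *)
pose A : set C := \bigcup_(l' in [set: nat]) \bigcap_(k in [set: nat]) \bigcup_(i in [set: nat]) B l' (k + i)%N.
have bA : <<s @open C >> A.
  apply: sigma_algebra_bigcup => l'; apply: borel_bigcap => k; apply: sigma_algebra_bigcup => i.
  by apply: borel_closed; exact: cB.
have sA : A `<=` unit_circle.
  by move=> y [l' _ h]; have [i _ [y1 _]] := h 0%N I; exact/unit_circleP.
have w1' : md w < 1 by move: w1; rewrite /disc/= subr0.
have conv : AE (fun t => exists l B, 0 <= B /\ forall i, md (J ((rho i)%:C * cis t) - l) <= B / 2 ^+ i).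
  apply: (fast_seq hJ bJ frho) => [i j ij|j]; [exact: rmono|by have /andP[] := r01 j].
have cmp : AE (fun t => forall n, exists (s : nat -> R) (B : R), (forall i, 0 < s i < 1) /\ forall i,
    md (J ((s i)%:C * cis t) - J ((rho i)%:C * cis t)) <= B / 2 ^+ i /\
    md (J (iter n g ((s i)%:C * cis t)) - J ((rho i)%:C * iter n (radial_limit g) (cis t))) <= B / 2 ^+ i).
  by apply: AE_all => n; exact: (compare hg gd n hJ bJ frho AEgood).
apply: contrapT => no; apply: (nonnull hJ bJ frho w1' m0 mw).
have := AE_and (rec A bA sA) (AE_and conv cmp); apply: AE_mono => t [rA [[L [B0 [B00 hL]]] hc]].
have AP y : md y = 1 -> ~ A y -> forall l' : nat, exists I, forall i, (I <= i)%N ->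
    md (J ((rho i)%:C * y)) < m + l'.+1%:R^-1.
  move=> y1 nA l'; apply: contrapT => h; apply: nA; exists l' => // k _.
  apply: contrapT => h2; apply: h; exists k => i ki; rewrite ltNge; apply/negP => h3.
  by apply: h2; exists (i - k)%N => //; rewrite subnKC.
apply: AP; first exact: md_cis.
move=> At; have [n Nn An] := rA At N.
have [s [B1 [s01 hs]]] := hc n.
have [l1 _ hl1] := At; have [l2 _ hl2] := An.
have p2 (B' e : R) : 0 < e -> exists k, forall i, (k <= i)%N -> B' / 2 ^+ i < e.
  move=> e0; have e1 : 0 < e / (`|B'| + 1) by rewrite divr_gt0//; have := normr_ge0 B'; lra.
  have [k hk] := pow_small e1; exists k => i ki.
  have q1 : 1 / 2 ^+ i <= 1 / 2 ^+ k :> R.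
    by rewrite !div1r lef_pV2 ?posrE ?exprn_gt0// ler_eXn2l ?ltr1n.
  have q0 : 0 < 1 / 2 ^+ i :> R by rewrite divr_gt0// exprn_gt0.
  have q2 : 1 / 2 ^+ i * (`|B'| + 1) <= e.
    by rewrite -ler_pdivlMr; [lra|have := normr_ge0 B'; lra].
  have -> : B' / 2 ^+ i = B' * (1 / 2 ^+ i) by rewrite mulrA mulr1.
  by have := ler_norm B'; nra.
have l0 (l' : nat) : 0 < l'.+1%:R^-1 :> R by rewrite invr_gt0.
have f1 : 0 < l1.+1%:R^-1 / 8 :> R by rewrite divr_gt0.
have f2 : 0 < l2.+1%:R^-1 / 8 :> R by rewrite divr_gt0.
have [k1 hk1] := p2 B0 _ f1; have [k2 hk2] := p2 B1 _ f1; have [k3 hk3] := p2 B1 _ f2.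
(* At index [i] the value of [J] is large for the returned point; for the initial point it is only
   known to be large at another index [j], and the limit [L] along [rho] carries this over to
   [i]. *)
have [i2 _ [_ h2]] := hl2 (maxn k1 (maxn k2 k3)) I.
set i := (_ + i2)%N in h2.
have ik : (maxn k1 (maxn k2 k3) <= i)%N by exact: leq_addr.
move: ik; rewrite !geq_max => /and3P[i1 ik2 i3].
have [i4 _ [_ h1]] := hl1 i I; set j := (i + i4)%N in h1.
have ij : (k1 <= j)%N by apply: leq_trans i1 (leq_addr _ _).
have c1 := hL i; have c2 := hL j; have c3 := hk1 i i1; have c4 := hk1 j ij.
have [c5 c6] := hs i; have c7 := hk2 i ik2; have c8 := hk3 i i3.
pose z := (s i)%:C * cis t; have z1 : disc (0:C) 1 z := sc_in (s01 i) (md_cis t).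
have zn := iter_disc gd n z1.
apply: no; exists n, (phi z); split => //; first exact: Up.
  apply: near => //.
  have := md_tri (J ((rho j)%:C * cis t)) (J z) L.
  rewrite (md_distC L); have := md_tri (J z) L (J ((rho i)%:C * cis t)).
  have := md_subl (J ((rho j)%:C * cis t)) (J z).
  move: h1 f1 c1 c2 c3 c4 c5 c7; rewrite -/z; set x := l1.+1%:R^-1; lra.
rewrite -gn//; apply: near => //.
have := md_subl (J ((rho i)%:C * iter n (radial_limit g) (cis t))) (J (iter n g z)).
rewrite (md_distC (J ((rho i)%:C * _))).
move: h2 f2 c6 c8; rewrite -/z; set x := l2.+1%:R^-1; lra.
Qed.

End Orbits.
End Recurrence.

(** * Density of periodic and escaping points *)

Section Contraction.
Context {R : realType}.
Local Notation C := R[i].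
Variables (f : C -> C) (U T : set C).
Hypotheses (tf : transcendental_entire f) (fcU : fatou_component f U) (fUU : f @` U `<=` U).
Hypotheses (oT : open T) (bT : boundary U `<=` T) (PT : forall z, T z -> ~ postsingular_set f z).
Hypothesis hT : forall x, T x -> (forall K e, compact K -> K `<=` comp T x -> ~ comp T x e -> hsqrt K e) /\
  connected (U `&` comp T x).

Let hf : hol setT f. Proof. by case: tf => /holomorphic_hol. Qed.

Lemma branch_invariant x k G z1 : T x -> hol (comp T x) G -> (forall z, comp T x z -> iter k f (G z) = z) ->
  (U `&` comp T x) z1 -> U (G z1) -> forall z, (U `&` comp T x) z -> U (G z).
Proof.
move=> Tx hG Gid UD1 UG1 z UDz; have [_ cUD] := hT Tx.
have := @comp_max _ f U fcU (G @` (U `&` comp T x)) (G z1).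
apply; last by exists z.
- by apply: con_connected => //; apply: cont_con => y [_ Dy]; exact: hol_cont hG Dy.
- move=> _ [y [Uy Dy] <-]; apply: (@fatou_back_iter _ f tf k); rewrite Gid//.
  exact: (comp_sub fcU).
- by exists z1.
- exact: UG1.
Qed.

(** Values within [s / 32] of [q] give, by the derivative estimate, the contraction constant
    [4 * (s / 32) / s = 1 / 8]. The fixed point is where [md (G z - z)] is least. *)
Lemma contraction_fix (G : C -> C) q (s : R) : 0 < s -> hol (disc q s) G ->
  (forall z, disc q s z -> md (G z - q) < s / 32) ->
  exists z0, [/\ md (z0 - q) < s / 32, G z0 = z0 &
    forall j w, cdisc q (s / 4) w -> cdisc q (s / 4) (iter j G w) /\ md (iter j G w - z0) <= (1 / 2) ^+ j * s].
Proof.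
move=> s0 hG Gs; pose H z := G z - q.
have hH : hol (disc q s) H by apply: holB => //; exact: hol_cst.
have dH z : disc q (s / 2) z -> md (dv G z) <= 1 / 8.
  move=> zs; have sub : disc q (s / 2) `<=` disc q s by apply: subset_disc; rewrite subrr md0; lra.
  have e : dv H z = dv G z.
    apply: hd_dv; rewrite -[dv G z]subr0; apply: hdB; [exact: dvP hG (sub z zs)|exact: hd_cst].
  rewrite -e; apply: le_trans (dv_bound s0 hH (fun z hz => ltW (Gs z hz)) zs) _.
  by rewrite le_eqVlt; apply/orP; left; apply/eqP; field; rewrite gt_eqF.
have lip z w : cdisc q (s / 4) z -> cdisc q (s / 4) w -> md (G z - G w) <= 1 / 8 * md (z - w).
  have sub : cdisc q (s / 4) `<=` disc q (s / 2) by apply: cdisc_sub_disc; lra.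
  move=> zs ws; apply: (@mvi_disc R q (s / 2)) => //; [|exact: sub|exact: sub].
  by apply: hol_sub hG; apply: subset_disc; rewrite subrr md0; lra.
have GK z : cdisc q (s / 4) z -> cdisc q (s / 4) (G z).
  move=> zs; have : disc q s z by move: zs; rewrite /cdisc /disc/=; lra.
  by move=> /Gs; rewrite /cdisc/=; lra.
have K0 : cdisc q (s / 4) !=set0 by exists q; rewrite /cdisc/= subrr md0; lra.
have cG : {within cdisc q (s / 4), continuous (fun z => md (G z - z))}.
  apply: continuous_in_subspaceT => z; rewrite inE => zs.
  apply: (@contCR_T R C (fun z => G z - z)); last exact: continuous_md.
  apply: (@contB_T R C G id); last exact: contid.
  by apply: hol_cont hG _; move: zs; rewrite /cdisc /disc/=; lra.
have [z0] := compact_EVT_min K0 (@compact_cdisc R q (s / 4)) cG.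
rewrite inE => z0s hmin.
have fz : G z0 = z0.
  have := hmin (G z0); rewrite inE => /(_ (GK z0 z0s)) h1.
  have h2 := lip (G z0) z0 (GK z0 z0s) z0s.
  have h3 := md_ge0 (G z0 - z0).
  by apply/eqP; rewrite -subr_eq0 -md_eq0; apply/eqP; lra.
exists z0; split => //.
  by rewrite -{1}fz; apply: Gs; move: z0s; rewrite /cdisc /disc/=; lra.
move=> j w ws; elim: j => [|j [IH1 IH2]].
  split => //; rewrite expr0 mul1r /=; move: ws z0s; rewrite /cdisc/=.
  by have := md_tri w z0 q; rewrite (md_distC q z0); lra.
split; first exact: GK.
have h := lip (iter j G w) z0 IH1 z0s; rewrite fz in h; rewrite /= exprS.
by move: IH2 h; have := md_ge0 (iter j G w - z0); set a := md _; set b := _ ^+ j; lra.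
Qed.

(** The fixed point [p] of the contracting branch is in the closure of [U], since the orbit of [w N]
    under the branch stays in [U] and tends to [p]. It is not in [U]: the orbit of [q] under the
    branch would then enter [U], and its forward image [q] would lie in [U]. *)
Lemma periodic_near q (r : R) :
  (forall (r : R) N, 0 < r -> exists n z, [/\ (N <= n)%N, U z, md (z - q) < r & md (iter n f z - q) < r]) ->
  0 < r -> boundary U q -> exists p, [/\ boundary U p, periodic_point f p & md (p - q) < r].
Proof.
move=> ret r0 bq; have Tq := bT bq.
pose D := comp T q; have Dq : D q by exact: connected_component_refl.
have oD : open D by exact: comp_open_set.
have /open_md/(_ q Dq)[r1 r10 sr1] := oD.
pose s := Order.min r r1; have s0 : 0 < s by rewrite lt_min r0.
have sD : disc q s `<=` D.
  by apply: subset_trans sr1; apply: subset_disc; rewrite subrr md0 add0r ge_min lexx orbT.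
have rk k : 0 < Order.min (s / 32) (k.+1%:R^-1) by rewrite lt_min invr_gt0 ltr0n andbT; lra.
have [m hm] := choice (fun k => ret _ k.+1 (rk k)).
have [v hv] := choice hm.
pose w k := iter (m k) f (v k).
have wk k : md (w k - q) < s / 32 by have [_ _ _] := hv k; rewrite lt_min => /andP[].
have Dw k : D (w k) by apply: sD; rewrite /disc/=; have := wk k; lra.
have hb k : exists G, [/\ hol D G, forall z, D z -> iter (m k) f (G z) = z & G (w k) = v k].
  by apply: (branchT tf oT PT hT) => //; exact: Dw.
have [G hG] := choice hb.
have hol_G k : hol D (G k) by have [] := hG k.
have Gid k z : D z -> iter (m k) f (G k z) = z by have [_ h _] := hG k; exact: h.
(* [shrink] wants all maps on one disc with convergent values at the centre; the translation puts
   [w k] at the common centre [q]. *)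
pose G' k z := G k (z + (w k - q)).
have shD k z : disc q (s / 2) z -> D (z + (w k - q)).
  move=> zs; apply: sD; rewrite /disc/=; have := mdD (z - q) (w k - q).
  rewrite (_ : z + (w k - q) - q = z - q + (w k - q)); last by ring.
  by move: zs; rewrite /disc/=; have := wk k; lra.
have hG' k : hol (disc q (s / 2)) (G' k).
  apply: (@hol_comp R _ D (fun z => z + (w k - q))); [|exact: hol_G|exact: shD].
  by apply: holD; [exact: hol_id|exact: hol_cst].
have iG' k : inj (disc q (s / 2)) (fun z => iter (m k) f (G' k z)).
  move=> z z' zs zs'; rewrite /G' !Gid; [exact: addIr|exact: shD|exact: shD].
have Gq k : G' k q = v k.
  by rewrite /G' addrC subrK; have [_ _] := hG k.
have s2 : 0 < s / 2 by lra.
have mk k : (k <= m k)%N by have [h _ _ _] := hv k; exact: ltnW.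
have vq e : 0 < e -> exists N, forall k, (N <= k)%N -> md (G' k q - q) < e.
  move=> e0; have [N hN] := div_small ler01 e0; exists N => k Nk; rewrite Gq.
  have := hN k Nk; have [_ _ h _] := hv k; move: h; rewrite lt_min div1r => /andP[_ h].
  exact: lt_trans.
have se : 0 < s / 8 / 32 by lra.
have [N hN] := shrink tf s2 hG' iG' mk vq (bd_fatou fcU bq) se.
have s8 : 0 < s / 8 by lra.
have Gsm z : disc q (s / 8) z -> md (G N z - q) < s / 8 / 32.
  move=> zs; have := hN N (leqnn N) (z - (w N - q)); rewrite /G' subrK; apply.
  rewrite /disc/=; have := mdB (z - q) (w N - q).
  rewrite (_ : z - (w N - q) - q = z - q - (w N - q)); last by ring.
  by move: zs; rewrite /disc/=; have := wk N; lra.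
have s8D : disc q (s / 8) `<=` D.
  by apply: subset_trans sD; apply: subset_disc; rewrite subrr md0; lra.
have [p [pq Gp it]] := contraction_fix s8 (hol_sub s8D (hol_G N)) Gsm.
have ps : disc q (s / 8) p by rewrite /disc/=; lra.
have Dp := s8D p ps.
have K4 : cdisc q (s / 8 / 4) `<=` D.
  by move=> z zs; apply: s8D; move: zs; rewrite /cdisc /disc/=; lra.
have small (e : R) : 0 < e -> exists j, (1 / 2) ^+ j * (s / 8) < e.
  move=> e0; have e1 : 0 < e / s by rewrite divr_gt0.
  have [j hj] := div_small ler01 e1; exists j.
  have : (1 / 2) ^+ j <= 1 / j.+1%:R :> R.
    rewrite expr_div_n expr1n !div1r lef_pV2 ?posrE ?exprn_gt0 ?ltr0n//.
    by rewrite -natrX ler_nat ltn_expl.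
  have := hj j (leqnn j); rewrite ltr_pdivlMr//; set a := 1 / j.+1%:R; set b := _ ^+ j => h1 h2.
  have h3 : b * s <= a * s by rewrite ler_wpM2r// ltW.
  have h4 : 0 < b by rewrite exprn_gt0.
  have h5 : 0 < b * s by rewrite mulr_gt0.
  by rewrite mulrA; lra.
have Uv k : U (v k) by have [_ h _ _] := hv k.
have Uw k : U (w k) by exact: iter_U.
have GU z : (U `&` D) z -> U (G N z).
  apply: (branch_invariant Tq (hol_G N) (Gid N) (conj (Uw N) (Dw N))).
  by have [_ _ ->] := hG N; exact: Uv.
have wK : cdisc q (s / 8 / 4) (w N) by rewrite /cdisc/=; have := wk N; lra.
have Uit j : U (iter j (G N) (w N)).
  elim: j => [|j IH]; first exact: Uw.
  by apply: GU; split => //; apply: K4; have [] := it j _ wK.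
have qK : cdisc q (s / 8 / 4) q by rewrite /cdisc/= subrr md0; lra.
exists p; split.
- apply: bdE.
    apply/closure_md => e e0; have [j hj] := small e e0.
    by exists (iter j (G N) (w N)) => //; apply: le_lt_trans hj; have [] := it j _ wK.
  move=> Up; have /open_md/(_ p Up)[e e0 se'] := comp_open fcU.
  have [j hj] := small e e0; have Uj : U (iter j (G N) q).
    by apply: se'; apply: le_lt_trans hj; have [] := it j _ qK.
  apply: (bd_notin fcU bq).
  have back i : iter (m N * i)%N f (iter i (G N) q) = q.
    elim: i => [|i IH]; first by rewrite muln0.
    by rewrite mulnS addnC iterD /= Gid ?IH//; apply: K4; have [] := it i _ qK.
  by rewrite -(back j); exact: iter_U.
- exists (m N); last by rewrite -{1}Gp Gid.
  by have [h _ _ _] := hv N; exact: leq_trans h.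
- have : s <= r by rewrite ge_min lexx.
  by lra.
Qed.

End Contraction.

(** * Small open and closed parts of the boundary *)

Section Islands.
Context {R : realType}.
Local Notation C := R[i].
Implicit Types (z w u p q : C) (r t : R) (F K : set C).

Lemma connected_plane : connected (setT : set C).
Proof. by apply: convex_connected. Qed.

Lemma sc_plane : simply_connected_domain (setT : set C).
Proof.
split; first by split; [exact: topology_structure.openT|exact: connected_plane|exists 0].
move=> ga /subspace_continuousP cga _ e01; pose gb t := ga (clamp t).
have in01 t : `[0, 1]%classic (clamp t) by rewrite /= in_itv/= clamp01.
have cgb t : {for t, continuous gb}.
  apply/contTP => e e0; have /cvg_md/(_ e e0) h0 := cga _ (in01 t).
  have h : nbhs (clamp t) [set q | `[0, 1]%classic q -> md (ga q - ga (clamp t)) < e] by exact: h0.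
  have := cont_clamp h; rewrite nbhs_simpl/=; apply: filterS => q /= hq; exact: hq (in01 q).
exists (fun s => gb s.2 + s.1%:C * (ga 0 - gb s.2)); split => //.
- apply: continuous_subspaceT => s.
  have c2 : {for s, continuous (fun s : R * R => gb s.2)}.
    by apply: (@contX_T R _ R snd gb); [exact: contsnd|exact: cgb].
  apply: (@contD_T R _ (fun s : R * R => gb s.2)); first exact: c2.
  apply: (@contM_T R _ (fun s : R * R => s.1%:C)).
    by apply: contRC_T; exact: contfst.
  by apply: (@contB_T R _ (fun _ => ga 0)); [exact: contcst|exact: c2].
- move=> t t01 /=; rewrite /gb clamp_id// mul0r addr0; split => //.
  by rewrite mul1r addrC subrK.
- have l01 : 0 <= (0 : R) <= 1 by rewrite lexx ler01.
  have l11 : 0 <= (1 : R) <= 1 by rewrite lexx ler01.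
  by move=> s _; rewrite /= /gb !clamp_id// -e01 subrr mulr0 addr0.
Qed.

(* [Q n] is the set of ends of chains from [p] with steps below [1 / (n + 1)]. *)
Lemma chain_or_clopen F p r : closed F -> F p -> 0 < r ->
  (exists2 y, connected_component F p y & r <= md (y - p)) \/
  exists A B, [/\ closed A, closed B, F = A `|` B, A `&` B = set0 & A p /\ forall z, A z -> md (z - p) < r].
Proof.
move=> cF Fp r0; pose K := F `&` cdisc p r.
have cK : closed K by apply: closedI => //; exact: closed_cdisc.
have kK : compact K.
  apply: (@compact_md R K (md p + r)) => // z [_]; rewrite /cdisc/= => h.
  by have := md_subl z p; lra.
have Kp : K p by split => //; rewrite /cdisc/= subrr md0 ltW.
pose stable n (X : set C) := X p /\ forall x y, X x -> K y -> md (x - y) < n.+1%:R^-1 -> X y.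
pose Q n := [set z | K z /\ forall X, stable n X -> X z].
have Qst n : stable n (Q n).
  split=> [|x y [Kx hx] Ky xy]; first by split => // X [].
  by split => // X sX; have [_ h] := sX; apply: h xy => //; exact: hx.
have i0 n : 0 < n.+1%:R^-1 :> R by rewrite invr_gt0.
have Qmono n m : (n <= m)%N -> Q m `<=` Q n.
  move=> nm z [Kz hz]; split => // X [Xp hX]; apply: hz; split => // x y Xx Ky xy; apply: hX Xx Ky _.
  by apply: lt_le_trans xy _; rewrite lef_pV2 ?posrE ?ltr0n// ler_nat.
have Qcl n : closed (Q n).
  move=> z /closure_md h; have Kz : K z.
    by apply: cK; apply/closure_md => e e0; have [w [Kw _] wz] := h e e0; exists w.
  by have [w Qw wz] := h _ (i0 n); have [_ hs] := Qst n; exact: hs Qw Kz wz.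
have QCcl n : closed (K `\` Q n).
  move=> z /closure_md h; have Kz : K z.
    by apply: cK; apply/closure_md => e e0; have [w [Kw _] wz] := h e e0; exists w.
  split => // Qz; have [w [Kw nQw] wz] := h _ (i0 n); apply: nQw; have [_ hs] := Qst n.
  by apply: hs Qz Kw _; rewrite md_distC.
pose S := [set z : C | r <= md (z - p)].
have clS : closed S.
  move=> z /closure_md h; rewrite /S/= leNgt; apply/negP => h2.
  have [w] := h (r - md (z - p)) ltac:(by rewrite subr_gt0); rewrite /S/= => h3 h4.
  by have := md_tri w p z; lra.
have [[n hn]|meet] := pselect (exists n, Q n `&` S = set0).
  right; exists (Q n), ((K `\` Q n) `|` (F `&` S)); split => //.
  - by apply: closedU => //; exact: closedI.
  - apply/seteqP; split=> [z Fz|z].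
      have [Qz|nQ] := pselect (Q n z); [by left|right].
      have [zr|zr] := leP (md (z - p)) r; first by left.
      by right; split => //; exact: ltW.
    by move=> [[[] //]|[[[] //]|[] //]].
  - apply/seteqP; split=> // z [Qz [[_ //]|[_ Sz]]]; rewrite -hn; by split.
  - split; first by have [] := Qst n.
    move=> z Qz; rewrite ltNge; apply/negP => Sz.
    have : (Q n `&` S) z by split.
    by rewrite hn.
left; have ex n : exists z, Q n z /\ S z.
  by apply: contrapT => h; apply: meet; exists n; apply/seteqP; split => // z [Qz Sz]; apply: h; exists z.
have [v hv] := choice ex.
pose QQ := [set z | forall n, Q n z].
have limQ (u : nat -> C) : (forall n, Q n (u n)) -> exists2 c, QQ c & forall e, 0 < e -> forall N, exists2 n, (N <= n)%N & md (u n - c) < e.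
  move=> hu; have [c Kc hc] := compact_seq kK (fun n => (hu n).1); exists c => // n.
  apply: Qcl; apply/closure_md => e e0; have [m nm um] := hc e e0 n.
  by exists (u m) => //; exact: Qmono nm _ (hu m).
have [y Qy hy] := limQ v (fun n => (hv n).1).
have Sy : S y.
  by apply: clS; apply/closure_md => e e0; have [n _ h] := hy e e0 0%N; exists (v n) => //; have [] := hv n.
have Qp : QQ p by move=> n; have [] := Qst n.
have clQQ : closed QQ.
  move=> z /closure_md h n; apply: Qcl; apply/closure_md => e e0; have [w Qw wz] := h e e0.
  by exists w => //; exact: Qw.
exists y => //; exists QQ => //; split => //.
- by move=> z /(_ 0%N)[[]].
apply: md_connected => P0 x0 y0 h10 h20 Qx0 Px0 Qy0.
have core P y1 : (forall x, QQ x -> P x -> exists2 d, 0 < d & forall y, QQ y -> md (y - x) < d -> P y) ->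
    (forall x, QQ x -> ~ P x -> exists2 d, 0 < d & forall y, QQ y -> md (y - x) < d -> ~ P y) ->
    P p -> QQ y1 -> P y1.
  move=> h1 h2 Pp Qy1; apply: contrapT => nPy.
  pose X := [set z | QQ z /\ P z]; pose Y := [set z | QQ z /\ ~ P z].
  have clX : closed X.
    move=> z /closure_md h; have Qz : QQ z.
      by apply: clQQ; apply/closure_md => e e0; have [w [Qw _] wz] := h e e0; exists w.
    split => //; apply: contrapT => nP; have [d d0 hd] := h2 z Qz nP.
    by have [w [Qw Pw] wz] := h d d0; exact: (hd w Qw wz).
  have clY : closed Y.
    move=> z /closure_md h; have Qz : QQ z.
      by apply: clQQ; apply/closure_md => e e0; have [w [Qw _] wz] := h e e0; exists w.
    split => // Pz; have [d d0 hd] := h1 z Qz Pz.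
    by have [w [Qw nPw] wz] := h d d0; apply: nPw; exact: (hd w Qw wz).
  have X0 : X !=set0 by exists p.
  have Y0 : Y !=set0 by exists y1.
  have YK : Y `<=` K by move=> z [/(_ 0%N)[]].
  have kY : compact Y by apply: subclosed_compact YK => //.
  have cd : {within Y, continuous (dset X)} by apply: continuous_subspaceT => z; exact: dset_cont.
  have [c] := compact_EVT_min Y0 kY cd; rewrite inE => Yc hmin.
  pose d := dset X c.
  have d0 : 0 < d by apply: dset_gt0 => //; move=> [_ Pc]; have [] := Yc.
  have dY z : Y z -> d <= dset X z by move=> Yz; apply: hmin; rewrite inE.
  have d3 : 0 < d / 3 by lra.
  have [N hN] := div_small ler01 d3.
  (* A chain from [X] to [Y] with steps below [d / 3] cannot jump over the band where the distance
     to [X] is between [d / 3] and [2 * d / 3]. A limit of such points lies in [QQ], yet in neither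
     [X] nor [Y]. *)
  have mid n : exists z, Q (maxn n N) z /\ d / 3 <= dset X z <= 2 * d / 3.
    apply: contrapT => no; set k := maxn n N in no.
    have : Q k y1 by exact: Qy1.
    move=> [_ /(_ [set z | Q k z /\ dset X z < d / 3])]; case.
      split=> [|a b [Qa da] Kb ab]; first by split; [exact: Qp|rewrite dset_0].
      have Qb : Q k b by have [_ hs] := Qst k; exact: hs Qa Kb ab.
      split => //; rewrite ltNge; apply/negP => db; apply: no; exists b; split => //.
      rewrite db/=; have := dset_lip b a X0; rewrite (md_distC b a) => h.
      have := hN k (leq_maxr _ _); rewrite div1r => h'.
      have : md (a - b) < d / 3 by exact: lt_trans ab h'.
      by lra.
    move=> _; have := dY y1 (conj Qy1 nPy); lra.
  have [u hu] := choice mid.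
  have Qu n : Q n (u n) by apply: Qmono (hu n).1; exact: leq_maxl.
  have [l Ql hl] := limQ u Qu.
  have dl : d / 3 <= dset X l <= 2 * d / 3.
    apply/andP; split; apply/ler_addgt0Pl => e e0; have [n _ h] := hl e e0 0%N.
      have [_ /andP[h3 _]] := hu n; have := dset_lip (u n) l X0; lra.
    have [_ /andP[_ h3]] := hu n; have := dset_lip l (u n) X0; rewrite (md_distC l); lra.
  have [Pl|nPl] := pselect (P l).
    by move: dl; rewrite (@dset_0 R X l)//; lra.
  by have := dY l (conj Ql nPl); lra.
(* [core] starts from [p], so it is applied to [P0] or to its negation, whichever holds there. *)
have [Pp|nPp] := pselect (P0 p); first exact: (core P0 y0).
exfalso; have : ~ P0 x0; last by [].
apply: (core (fun z => ~ P0 z) x0) => //.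
by move=> z Qz nn; have Pz := contrapT nn; have [d d0 hd] := h10 z Qz Pz; exists d => // w Qw wz nP; apply: nP; exact: hd.
Qed.

(** The image of a half-plane under [p + cexp w]. *)
Lemma connected_exterior p r : 0 < r -> connected [set z : C | r <= md (z - p)].
Proof.
move=> r0; pose H := [set w : C | ln r <= complex.Re w].
have cH : connected H.
  apply: convex_connected => z w t; rewrite /H/= => hz hw t01; rewrite Re_segp.
  by have := t01; move: hz hw; set a := complex.Re z; set b := complex.Re w; set c := ln r => hz hw /andP[t0 t1]; nra.
have := @con_connected R H (fun w => p + cexp w) cH.
have -> : (fun w => p + cexp w) @` H = [set z : C | r <= md (z - p)].
  apply/seteqP; split=> [_ [w Hw <-]|z].
    by rewrite /= addrAC subrr add0r md_cexp -(lnK r0) ler_expR.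
  move=> zr; have zp : z - p != 0 by rewrite -md_gt0; apply: lt_le_trans r0 zr.
  have [w ew] := cexp_surj zp; exists w; last by rewrite ew; ring.
  by rewrite /H/= -ler_expR (lnK r0) -md_cexp ew.
apply; apply: cont_con => w _; apply: (@contD_T R C (fun _ => p) (@cexp R)); first exact: contcst.
exact: hd_continuous (hd_cexp w).
Qed.

Lemma cont_near F' (h H : C -> C) z d : 0 < d -> (forall w, disc z d w -> H w = h w) ->
  {for z, continuous h} -> {for z, continuous H}.
Proof.
move=> d0 e /contP ch; apply/contP => ep ep0; have [t t0 ht] := ch ep ep0.
exists (Order.min d t) => [|w]; first by rewrite lt_min d0.
by rewrite lt_min => /andP[wd wt]; rewrite !e//; [exact: ht|exact: disc_center].
Qed.

Lemma con_fun_div (S1 S2 : set C) z : S1 !=set0 -> S2 !=set0 -> 0 < dset S1 z + dset S2 z ->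
  {for z, continuous (fun z => dset S2 z / (dset S1 z + dset S2 z))}.
Proof.
move=> S10 S20 d0.
apply: (@continuousM R C (dset S2) (fun z => (dset S1 z + dset S2 z)^-1) z); first exact: dset_cont.
apply: continuousV; first by rewrite gt_eqF.
by apply: (@continuousD R R C (dset S1) (dset S2) z); exact: dset_cont.
Qed.

Lemma clamp_hi (x : R) : 2 / 3 <= x -> 1 - clamp (3 * x - 1) = 0.
Proof.
move=> h; rewrite /clamp; have [h1|h1] := leP (3 * x - 1) 0; first by exfalso; lra.
by have [h2|h2] := leP (3 * x - 1) 1; lra.
Qed.

Lemma clamp_lo (x : R) : x <= 1 / 3 -> 1 - clamp (3 * x - 1) = 1.
Proof. by move=> h; rewrite /clamp; have [h1|h1] := leP (3 * x - 1) 0; lra. Qed.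

Section NoIsland.
Variables (U A B : set C) (p : C) (r : R) (L : C -> C).
Hypotheses (oU : open U) (cU : connected U) (unbU : forall M : R, exists2 u, U u & M < md u).
Hypotheses (cL : forall z, U z -> {for z, continuous L}) (eL : forall z, U z -> cexp (L z) = z - p).
Hypotheses (clA : closed A) (clB : closed B) (AB0 : A `&` B = set0).
Hypotheses (bdAB : boundary U = A `|` B).
Hypotheses (Ap : A p) (Ar : forall z, A z -> md (z - p) < r) (r0 : 0 < r).

Let nU z : (A `|` B) z -> ~ U z.
Proof. by rewrite -bdAB => -[_ nz] Uz; apply: nz; apply: open_nbhs_nbhs; split. Qed.

Let bd z : closure U z -> ~ U z -> A z \/ B z.
Proof.
move=> h1 h2; suff : boundary U z by rewrite bdAB.
by split => // h3; apply: h2; exact: (interior_subset h3).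
Qed.

Let ccis (k : C -> R) z : {for z, continuous k} -> {for z, continuous (fun z => cis (k z) : C)}.
Proof. by move=> ck; apply: (@contX_T R C R k (@cis R)) => //; exact: continuous_cis. Qed.

Let ei t : cexp (0 +i* t) = cis t :> C.
Proof. by rewrite /cexp/= expR0 mul1r. Qed.

Let clnU : closed (~` U). Proof. by rewrite closedC. Qed.

(* The function [cis (2 pi rho)] on [U], with [rho] equal to 1 on [A] and to 0
   on [B], extends by 1 to the plane; its logarithm tells the parts apart. *)
Lemma split_complement : exists ZA ZB : set C,
  [/\ closed ZA, closed ZB, ~` U = ZA `|` ZB, ZA `&` ZB = set0 & A `<=` ZA /\ B `<=` ZB].
Proof.
have [u0 Uu0 _] := unbU 0.
(* The added point of [U] keeps the set nonempty and makes [rho] vanish at [u0], where the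
   logarithms are compared. *)
pose B' := B `|` [set u0].
have clB' : closed B'.
  apply: closedU => //; apply: compact_closed; [exact: norm_hausdorff|exact: compact_set1].
have A0 : A !=set0 by exists p.
have B0 : B' !=set0 by exists u0; right.
have AB' z : A z -> ~ B' z.
  move=> Az [Bz|e]; first by have : (A `&` B) z := conj Az Bz; rewrite AB0.
  by apply: (nU (or_introl Az)); rewrite e.
have den0 z : 0 < dset A z + dset B' z.
  have [Az|nA] := pselect (A z); last by rewrite ltr_pwDl ?dset_ge0// dset_gt0.
  by rewrite ltr_wpDl ?dset_ge0// dset_gt0//; exact: AB'.
pose rho z := dset B' z / (dset A z + dset B' z).
have crho z : {for z, continuous rho} by exact: con_fun_div.
have rhoA z : A z -> rho z = 1.
  by move=> Az; have := den0 z; rewrite /rho (@dset_0 R A z)// add0r => h; rewrite divff// gt_eqF.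
have rhoB z : B' z -> rho z = 0 by move=> Bz; rewrite /rho dset_0// mul0r.
have c2 z : {for z, continuous (fun z => 2 * pi * rho z)}.
  by apply: (@continuousM R C (fun _ => 2 * pi) rho z); [exact: contcst|exact: crho].
pose F z := if `[< U z >] then cis (2 * pi * rho z) else 1 : C.
have near z : ~ U z -> [\/ A z, B z | exists2 d, 0 < d & disc z d `<=` ~` U].
  move=> nz; have [cz|nc] := pselect (closure U z); first by have [] := bd cz nz; [constructor 1|constructor 2].
  constructor 3; have [d d0 hd] := closed_md (@closed_closure _ U) nc.
  by exists d => // w wd Uw; apply: (hd w wd); exact: subset_closure.
have cF z : setT z -> {for z, continuous F}.
  move=> _; apply: (@glue_cont R U (fun z => cis (2 * pi * rho z)) 1 z); first exact: ccis.
    by move=> Uz; have /open_md := oU; apply.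
  move=> /near[/rhoA ->|Bz|h]; [left|left|by right].
    by rewrite mulr1; exact: cis2pi.
  by rewrite rhoB; [rewrite mulr0; exact: cis0|left].
have F0 z : setT z -> F z != 0.
  by move=> _; rewrite /F; case: asboolP => _; [exact: cis_neq0|exact: oner_neq0].
have [l [cl el]] := log_sc sc_plane cF F0.
pose c := l u0; pose l2 z := (0 +i* (2 * pi * rho z)) + c.
have ru0 : rho u0 = 0 by apply: rhoB; right.
have ec : cexp c = 1.
  by rewrite /c el// /F; case: asboolP => // _; rewrite ru0 mulr0; exact: cis0.
have cl2 z : {for z, continuous l2}.
  apply: (@contD_T R C (fun z => (0 +i* (2 * pi * rho z)))); last exact: contcst.
  by apply: contReIm_T; [exact: contcst|exact: c2].
have lU z : U z -> l z = l2 z.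
  move=> Uz.
  have h1 x : U x -> {for x, continuous l} by move=> _; exact: cl.
  have h2 x : U x -> {for x, continuous l2} by move=> _; exact: cl2.
  have h3 x : U x -> cexp (l x) = cexp (l2 x).
    by move=> Ux; rewrite el// /F /l2 cexpD ei ec mulr1; case: (asboolP (U x)).
  have h4 : l u0 = l2 u0 by rewrite /l2 ru0 mulr0 (_ : 0 +i* 0 = 0 :> C) ?add0r.
  exact: (log_unique cU h1 h2 h3 Uu0 h4 Uz).
have lcl z : closure U z -> l z = l2 z.
  move=> /closure_md cz; apply/eqP; rewrite -subr_eq0 -md_eq0; apply/eqP/le_anti; rewrite md_ge0 andbT.
  apply/ler_addgt0Pl => e e0; rewrite addr0; have e2 : 0 < e / 2 by lra.
  have /contP/(_ _ e2)[d1 d10 h1] := cl z I; have /contP/(_ _ e2)[d2 d20 h2] := cl2 z.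
  have dd : 0 < Order.min d1 d2 by rewrite lt_min d10.
  have [w Uw] := cz _ dd; rewrite lt_min => /andP[/h1 w1 /h2 w2].
  rewrite -(lU w Uw) in w2.
  by have := md_tri (l z) (l2 z) (l w); rewrite (md_distC (l z) (l w)); lra.
have cA z : (A `|` B) z -> closure U z by rewrite -bdAB => -[].
pose a := (0 +i* (2 * pi)) + c : C.
(* Off [U] the function [F] is [1], so [l] takes its values among the periods of [cexp] and is
   locally constant there; it is [a] on [A] and [c] on [B]. *)
exists [set z | ~ U z /\ l z = a], [set z | ~ U z /\ l z <> a]; split.
- move=> z /closure_md h; split.
    by apply: clnU; apply/closure_md => e e0; have [w [Uw _] wz] := h e e0; exists w.
  apply/eqP; rewrite -subr_eq0 -md_eq0; apply/eqP/le_anti; rewrite md_ge0 andbT.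
  apply/ler_addgt0Pl => e e0; rewrite addr0.
  have /contP/(_ _ e0)[d d0 hd] := cl z I; have [w [_ <-] wz] := h d d0.
  by rewrite md_distC; exact/ltW/hd.
- move=> z /closure_md h; have nUz : ~ U z.
    by apply: clnU; apply/closure_md => e e0; have [w [Uw _] wz] := h e e0; exists w.
  split => // la; have /contP/(_ _ ltr01)[d d0 hd] := cl z I; have [w [nUw lw] wz] := h d d0.
  apply: lw; apply/eqP; rewrite -subr_eq0; apply/eqP; apply: cexp_eq1; last by rewrite -la; exact: hd.
  have e1 : cexp (l w) = 1 by rewrite el// /F; case: asboolP.
  have e2 : cexp a = 1 by rewrite /a cexpD ei ec mulr1; exact: cis2pi.
  have := cexpD (l w - a) a; rewrite subrK e1 e2 mulr1 => <-; reflexivity.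
- apply/seteqP; split=> [z nz|z [[]|[]] //].
  by have [e|e] := pselect (l z = a); [left|right].
- by apply/seteqP; split=> // z [[_ e] [_ ne]].
- split=> z hz.
    have nz : ~ U z by apply: nU; left.
    by split => //; rewrite lcl; [rewrite /l2 rhoA// mulr1; reflexivity|apply: cA; left].
  have nz : ~ U z by apply: nU; right.
  split => //; rewrite lcl; last by apply: cA; right.
  rewrite /l2 rhoB; last by left.
  rewrite mulr0 /a => /addIr /(congr1 (@complex.Im R)) /= e.
  by have := @pi2_gt0 R; rewrite -e ltxx.
Qed.

(* A function equal to 1 near [ZA] and to [z - p] away from it would have a
   logarithm on the plane, while it winds once along a circle around [p]. *)
Lemma no_island : False.
Proof.
have [ZA [ZB [cZA cZB Zu Z0 [AZ BZ]]]] := split_complement.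
have disj z : ZA z -> ~ ZB z by move=> h1 h2; have : (ZA `&` ZB) z := conj h1 h2; rewrite Z0.
have ZAU z : ZA z -> ~ U z by move=> h; have : (~` U) z by rewrite Zu; left.
have ZBU z : ZB z -> ~ U z by move=> h; have : (~` U) z by rewrite Zu; right.
(* A point of [ZA] at distance at least [r] would make [ZA] open and closed in the connected
   exterior of the disc, which contains points of [U]. *)
have small z : ZA z -> md (z - p) < r.
  move=> Zz; rewrite ltNge; apply/negP => zr.
  have [u Uu hu] := unbU (r + md p).
  apply: (ZAU u); last exact: Uu.
  have ur : r <= md (u - p) by have := md_subl u p; lra.
  have key := @conn_md R [set z : C | r <= md (z - p)] ZA z u (@connected_exterior p r r0).
  apply: key => //.
  - move=> x xr Zx; have nx : ~ closure U x.
      move=> cx; have [Ax|Bx] := bd cx (ZAU x Zx).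
        by have := Ar Ax; move: xr; rewrite /= leNgt => /negP.
      by apply: (disj x Zx); exact: BZ.
    have [d1 d10 h1] := closed_md (@closed_closure _ U) nx.
    have [d2 d20 h2] := closed_md cZB (disj x Zx).
    exists (Order.min d1 d2) => [|y yr]; first by rewrite lt_min d10.
    rewrite lt_min => /andP[y1 y2]; have : (~` U) y.
      by move=> Uy; apply: (h1 y y1); exact: subset_closure.
    by rewrite Zu => -[//|Zy]; exfalso; exact: (h2 y y2 Zy).
  - move=> x xr nZ; have [d d0 hd] := closed_md cZA nZ.
    by exists d => // y _; exact: hd.
pose S := ZB `|` [set z : C | r <= md (z - p)].
have clS : closed S.
  apply: closedU => // z /closure_md h; rewrite /= leNgt; apply/negP => h2.
  have e0 : 0 < r - md (z - p) by rewrite subr_gt0.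
  have [w /= h3 h4] := h _ e0; by have := md_tri w p z; lra.
have S0 : S !=set0 by exists (p + r%:C); right; rewrite /= addrAC subrr add0r mdr ger0_norm// ltW.
have ZA0 : ZA !=set0 by exists p; exact: AZ.
have ZAS z : ZA z -> ~ S z by move=> Zz [/(disj z Zz)//|/=]; rewrite leNgt (small z Zz).
have den0 z : 0 < dset ZA z + dset S z.
  have [Az|nA] := pselect (ZA z); last by rewrite ltr_pwDl ?dset_ge0// dset_gt0.
  by rewrite ltr_wpDl ?dset_ge0// dset_gt0//; exact: ZAS.
pose rho z := dset S z / (dset ZA z + dset S z).
have crho z : {for z, continuous rho} by exact: con_fun_div.
have rhoA z : ZA z -> rho z = 1.
  by move=> Az; have := den0 z; rewrite /rho (@dset_0 R ZA z)// add0r => h; rewrite divff// gt_eqF.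
have rhoS z : S z -> rho z = 0 by move=> Sz; rewrite /rho dset_0// mul0r.
(* A cut-off: [0] where [rho] is at least [2 / 3], as near [ZA], and [1] where it is at most
   [1 / 3], as near [S]. *)
pose k z := 1 - clamp (3 * rho z - 1).
have ck z : {for z, continuous k}.
  have c1 : {for z, continuous (fun z => 3 * rho z - 1)}.
    apply: (@continuousD R R C (fun z => 3 * rho z) (fun _ => - 1) z); last exact: contcst.
    by apply: (@continuousM R C (fun _ => 3) rho z); [exact: contcst|exact: crho].
  apply: (@continuousD R R C (fun _ => 1) (fun z => - clamp (3 * rho z - 1)) z); first exact: contcst.
  apply: (@continuousN R R C (fun z => clamp (3 * rho z - 1)) z).
  by apply: (@contXR_T R C R (fun z => 3 * rho z - 1) (@clamp R)); [exact: c1|exact: cont_clamp].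
have k0 z : 2 / 3 <= rho z -> k z = 0.
  exact: clamp_hi.
have k1 z : rho z <= 1 / 3 -> k z = 1 by exact: clamp_lo.
(* On [U] this is the power of [z - p] with exponent [k z], taken through the logarithm [L]; it
   interpolates between the two outer values. *)
pose H z := if `[< U z >] then cexp ((k z)%:C * L z) else if `[< ZA z >] then 1 else z - p.
have cH z : setT z -> {for z, continuous H}.
  move=> _; have [Uz|nUz] := pselect (U z).
    have /open_md/(_ z Uz)[d d0 sd] := oU.
    apply: (@cont_near setT (fun z => cexp ((k z)%:C * L z)) H z d d0).
      by move=> w /sd Uw; rewrite /H; case: asboolP.
    apply: (@contC_T R C (fun z => (k z)%:C * L z) (@cexp R)); last exact: hd_continuous (hd_cexp _).
    by apply: (@contM_T R C (fun z => (k z)%:C) L); [apply: contRC_T; exact: ck|exact: cL].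
  have e3 : 0 < 1 / 3 :> R by lra.
  have /contRP/(_ _ e3)[d1 d10 h1] := crho z.
  have : (~` U) z by []. 
  rewrite Zu => -[Zz|Zz].
    have [d2 d20 h2] := closed_md cZB (disj z Zz).
    apply: (@cont_near setT (fun _ => 1) H z (Order.min d1 d2)); [by rewrite lt_min d10| |exact: contcst].
    move=> w; rewrite /disc/= lt_min => /andP[w1 w2]; rewrite /H.
    case: (asboolP (U w)) => [Uw|nUw].
      have := h1 w w1; rewrite (rhoA z Zz) => h; rewrite k0; first by rewrite mul0r cexp0.
      by move: h; rewrite ltr_norml; lra.
    case: (asboolP (ZA w)) => // nZ; have : (~` U) w by [].
    by rewrite Zu => -[//|Zw]; exfalso; exact: (h2 w w2 Zw).
  have nA : ~ ZA z by move=> h; exact: (disj z h Zz).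
  have [d2 d20 h2] := closed_md cZA nA.
  apply: (@cont_near setT (fun z => z - p) H z (Order.min d1 d2)); first by rewrite lt_min d10.
    move=> w; rewrite /disc/= lt_min => /andP[w1 w2]; rewrite /H.
    case: (asboolP (U w)) => [Uw|nUw].
      have := h1 w w1; rewrite (rhoS z); last by left.
      rewrite subr0 => h; rewrite k1; last by have := ler_norm (rho w); lra.
      by rewrite (_ : 1%:C = 1 :> C)// mul1r eL.
    by case: (asboolP (ZA w)) => // Zw; exfalso; exact: (h2 w w2 Zw).
  by apply: (@contB_T R C id); [exact: contid|exact: contcst].
have H0 z : setT z -> H z != 0.
  move=> _; rewrite /H; case: (asboolP (U z)) => [_|nUz]; first exact: cexp_neq0.
  case: (asboolP (ZA z)) => [_|nZ]; first exact: oner_neq0.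
  by rewrite subr_eq0; apply/eqP => e; apply: nZ; rewrite e; exact: AZ.
have [l [cl el]] := log_sc sc_plane cH H0.
(* The circle lies in [S], where [H z = z - p]; a logarithm of [H] would gain [2 * pi] in imaginary
   part along it, although it is closed. *)
pose c t : C := p + circ r t.
have cc t : {for t, continuous c}.
  by apply: (@contD_T R R (fun _ => p) (circ r)); [exact: contcst|exact: continuous_circ].
have Hc t : H (c t) = circ r t.
  have cp : c t - p = circ r t by rewrite /c addrAC subrr add0r.
  have Sc : S (c t) by right; rewrite /= cp md_circ// ltW.
  rewrite /H; case: (asboolP (U (c t))) => [Uc|nUc].
    have rc : rho (c t) <= 1 / 3 by rewrite rhoS//; lra.
    by rewrite k1// (_ : 1%:C = 1 :> C)// mul1r eL.
  by case: (asboolP (ZA (c t))) => // /ZAS; case.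
pose l1 t := l (c t); pose l2 t : C := l1 0 + (0 +i* t).
have i0 : `[0, 2 * pi]%classic (0 : R) by rewrite /= in_itv/= lexx/= ltW// pi2_gt0.
have i1 : `[0, 2 * pi]%classic (2 * pi : R) by rewrite /= in_itv/= lexx/= andbT ltW// pi2_gt0.
have := @log_unique R R `[0, 2 * pi]%classic l1 l2 0 (2 * pi) (@segment_connected R 0 (2 * pi)).
move=> /(_ (fun t _ => @contX_T R R C c l t (cc t) (cl _ I))).
have cl2 t : `[0, 2 * pi]%classic t -> {for t, continuous l2}.
  move=> _; apply: (@contD_T R R (fun _ => l1 0) (fun t => 0 +i* t)); first exact: contcst.
  by apply: contReIm_T => /=; [exact: contcst|exact: contid].
have e12 t : `[0, 2 * pi]%classic t -> cexp (l1 t) = cexp (l2 t).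
  move=> _; rewrite /l2 cexpD ei /l1 !el// !Hc /circ cis0 mulr1; reflexivity.
have e0 : l1 0 = l2 0 by rewrite /l2 (_ : 0 +i* 0 = 0 :> C) ?addr0.
move=> /(_ cl2 e12 i0 e0 i1).
have -> : l1 (2 * pi) = l1 0 by rewrite /l1 /c /circ cis2pi cis0.
rewrite /l2 -[LHS]addr0 => /addrI /(congr1 (@complex.Im R)) /= e.
by have := @pi2_gt0 R; rewrite -e ltxx.
Qed.

End NoIsland.
End Islands.

(** * Nontrivial boundary components and the conclusion *)

Section Density.
Context {R : realType}.
Local Notation C := R[i].
Variables (f : C -> C) (U : set C).
Hypotheses (fcU : fatou_component f U) (acc : accessible U None).

Lemma accessible_unbounded (M : R) : exists2 u, U u & M < md u.
Proof.
have [_ [ga [_ gU lim]]] := acc; have [s s1 hs] := accessible_tail M lim.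
pose t := (Order.max s 0 + 1) / 2.
have m0 : 0 <= Order.max s 0 by rewrite le_max lexx orbT.
have ms : s <= Order.max s 0 by rewrite le_max lexx.
have m1 : Order.max s 0 < 1 by rewrite gt_max s1 ltr01.
have [t0 st t1] : [/\ 0 <= t, s < t & t < 1] by split; rewrite /t; lra.
by exists (ga t); [apply: gU; rewrite t0|exact: hs].
Qed.

(** Simple connectivity of [U] enters through the Riemann map: a logarithm of [phi - p] on the disc
    becomes one of [z - p] on [U], as [no_island] requires. The curve to infinity makes [U]
    unbounded. *)
Lemma component_nontrivial phi p (r : R) : riemann_map U phi -> boundary U p -> 0 < r ->
  exists y, [/\ connected_component (boundary U) p y, y <> p & md (y - p) < r].
Proof.
move=> rm bp r0; have [hp ip pU pK Kp] := riemannP rm.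
have [[y1 cy1 y1r]|[A [B [clA clB AB AB0 [Ap Ar]]]]] := chain_or_clopen (@bd_closed R U) bp r0.
  (* If [p] were the only point of its component within distance [r], it would be isolated, hence
     open and closed in the component, which also contains [y1]. *)
  apply: contrapT => no; pose D := connected_component (boundary U) p.
  have Dp : D p by exact: connected_component_refl.
  have : y1 = p.
    apply: (@conn_md R D (fun z => z = p) p y1) => //; first exact: component_connected.
      move=> x Dx ->; exists r => // y Dy yr; apply: contrapT => yp; apply: no.
      by exists y.
    move=> x Dx /eqP xp; exists (md (x - p)); first by rewrite md_gt0 subr_eq0.
    by move=> y Dy yx e; move: yx; rewrite e md_distC ltxx.
  by move=> e; move: y1r; rewrite e subrr md0 leNgt r0.
exfalso; pose psi := pinv (@unit_disc R) phi.
have hF : hol (disc 0 1) (fun z => phi z - p) by apply: holB => //; exact: hol_cst.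
have F0 z : disc 0 1 z -> phi z - p != 0.
  move=> z1; rewrite subr_eq0; apply/eqP => e; apply: (bd_notin fcU bp).
  by rewrite -e -pU; exists z.
have [l [cl el]] := @log_disc R 0 1 (fun z => phi z - p) ltr01 (fun z (hz : disc 0 1 z) => hol_cont hF hz) F0.
have cL z : U z -> {for z, continuous (fun z => l (psi z))}.
  move=> Uz; apply: (@contC_T R C psi l); first exact: hol_cont (hol_riemann_inv fcU rm) Uz.
  by apply: cl; have [] := Kp z Uz.
have eL z : U z -> cexp (l (psi z)) = z - p.
  by move=> Uz; have [h1 h2] := Kp z Uz; rewrite el// h2.
exact: (no_island (comp_open fcU) (comp_conn fcU) accessible_unbounded cL eL clA clB AB0 AB Ap Ar r0).
Qed.

End Density.

Theorem theoremD (R : realType) (f : R[i] -> R[i]) (U : set R[i]) :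
  transcendental_entire f ->
  fatou_component f U ->
  f @` U `<=` U ->
  accessible U None ->
  SPS f U ->
  [/\ (forall p, boundary U p -> periodic_point f p -> accessible U (Some p)),
      (forall z p, boundary U z ->
         connected_component (boundary U) z p -> periodic_point f p ->
         forall q, connected_component (boundary U) z q -> q <> p ->
         escaping f q) &
      (recurrent f U ->
         boundary U `<=` closure (boundary U `&` periodic_point f) /\
         boundary U `<=` closure (boundary U `&` escaping f))].
Proof.
move=> tf fcU fUU acc sps; have [T [oT bT PT hT]] := setup fcU acc sps.
have pb := part_b tf fcU fUU oT bT PT hT.
split; [by move=> p; exact: (part_a tf fcU fUU oT bT PT hT)|by move=> z p *; exact: (pb z p)|].
move=> [phi rm recu].
have per q (r : R) : 0 < r -> boundary U q ->
    exists p, [/\ boundary U p, periodic_point f p & md (p - q) < r].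
  move=> r0 bq; apply: (periodic_near tf fcU fUU oT bT PT hT _ r0 bq) => r' N r'0.
  exact: (return_near tf fcU fUU rm recu N r'0 bq).
split=> q bq; apply/closure_md => r r0.
  by have [p [bp pp pq]] := per q r r0 bq; exists p.
have r2 : 0 < r / 2 by rewrite divr_gt0.
have [p [bp pp pq]] := per q _ r2 bq.
have [y [cy yp yr]] := component_nontrivial fcU acc rm bp r2.
exists y; last by have := md_tri y q p; lra.
split; first exact: (@connected_component_sub _ (boundary U) p y cy).
exact: (pb p p y bp (connected_component_refl bp) pp cy yp).
Qed.
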